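(* Let $M$ be an $n$-dimensional Frobenius manifold of charge $d$ as in the context, with discriminant $\Sigma$. Let $(x^1(t),\dots,x^n(t))$ be a system of independent flat coordinates of the intersection form on $M$ defined locally on $M\setminus\Sigma$ (normalized by $E\,x^a=\frac{1-d}2x^a$), $G^{ab}=(dx^a,dx^b)$, $(G_{ab})=(G^{ab})^{-1}$. Then there exists a basis of odd periods on $M\otimes QH^*(\mathbb{CP}^1)$ of the form $$(X^1(t,Q),\dots,X^n(t,Q),Y_1(t,Q),\dots,Y_n(t,Q)),\qquad Q=e^s,$$ where, at the points of the coordinate cross, $$X^a=x^a(t)+O(Q),\qquad Y_a=x_a(t)\log Q-2\frac{\partial F_*(x)}{\partial x^a}+o(1),\qquad Q\to0,\quad x_a(t)=G_{ab}x^b(t),\quad a=1,\dots,n .$$ Here $F_*(x)$ is the potential of the dual almost Frobenius manifold $M_*$. The functions $X^a,Y_b$ are canonically conjugated with respect to the symplectic structure on $M\otimes QH^*(\mathbb{CP}^1)$: $$\{X^a,Y_b\}=\delta^a_b,\qquad\{X^a,X^b\}=\{Y_a,Y_b\}=0 .$$ The coordinates $X^a$ are determined uniquely; the coordinates $Y_a$ are determined with an ambiguity that can be absorbed by a redefinition of the dual potential $F_*(x)\mapsto F_*(x)+\text{quadratic}$.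
   Context: A Frobenius manifold of charge $d$: complex manifold $M$ with a commutative associative product with unity $e$ and an invariant nondegenerate symmetric form $\langle\ ,\ \rangle$ on each $T_tM$, such that $\langle\ ,\ \rangle$ is flat with Levi-Civita connection $\nabla$, $\nabla e=0$; $(\nabla_wc)(x,y,z)$ is totally symmetric for $c(x,y,z)=\langle x\cdot y,z\rangle$; and an Euler field $E$ is given with $\nabla\nabla E=0$, $[E,x\cdot y]-[E,x]\cdot y-x\cdot[E,y]=x\cdot y$, $E\langle x,y\rangle-\langle[E,x],y\rangle-\langle x,[E,y]\rangle=(2-d)\langle x,y\rangle$. In flat coordinates $t^\alpha$ with $e=\partial_1$: $\partial_\alpha\cdot\partial_\beta=c_{\alpha\beta}^\gamma\partial_\gamma$; matrices acting on row vectors from the right: $(C_\alpha)^\beta_\gamma=c^\beta_{\alpha\gamma}$, $\mathcal U^\alpha_\beta=E^\epsilon c^\alpha_{\epsilon\beta}$, $\mathcal V=\frac{2-d}2-\nabla E$. The product on $T^*M$ is transported from $TM$ by $\langle\ ,\ \rangle$; the intersection form on $T^*M$ is $(\omega_1,\omega_2)=i_E(\omega_1\cdot\omega_2)$; the discriminant $\Sigma$ is the locus where it degenerates, and off $\Sigma$ its inverse is a flat metric. The dual almost Frobenius manifold is $M_*=M\setminus\Sigma$ with product $u*v=E^{-1}\cdot u\cdot v$; its potential $F_*$ is defined, up to quadratic polynomials, by $\frac{\partial}{\partial x^a}*\frac{\partial}{\partial x^b}=G^{cd}\frac{\partial^3F_*}{\partial x^d\partial x^a\partial x^b}\frac{\partial}{\partial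 x^c}$ in flat coordinates $x^a$ of the intersection form. An odd period is a function $\varpi$ on an open subset of the complement of the discriminant whose gradient row vector $\xi$ satisfies $\partial_\alpha\xi\cdot\mathcal U=\xi\cdot\mathcal V\,C_\alpha$ for all $\alpha$. The Poisson bracket on a Frobenius manifold is $\{f,g\}=\langle df,\mathcal V\,dg\rangle$, i.e. $\{t^\alpha,t^\beta\}=\eta^{\alpha\gamma}\mathcal V^\beta_\gamma$. Here $M$ is assumed to have $\mathcal V=\mathrm{diag}(\mu_1,\dots,\mu_n)$ diagonalizable with eigenvalues different from $\frac12$ (in particular $d\ne1$, as $\mu_1=-\frac d2$ and the spectrum is symmetric), and flat coordinates with $\eta_{\alpha\beta}=\langle\partial_\alpha,\partial_\beta\rangle=\delta_{\alpha+\beta,n+1}$, $\mu_\alpha+\mu_{n+1-\alpha}=0$. $QH^*(\mathbb{CP}^1)$ is the Frobenius manifold of charge $1$ with flat coordinates $(t^1,s)$, potential $\frac12(t^1)^2s+e^s$ and Euler field $t^1\partial_1+2\partial_s$. The tensor product $M\otimes QH^*(\mathbb{CP}^1)$ is the $2n$-dimensional Frobenius manifold of charge $d+1$ with flat coordinates $t^{\alpha'\alpha''}$, $\alpha'=1,\dots,n$, $\alpha''=1,2$, with $t^{\alpha'1''}=t^\alpha$, $t^{1'2''}=s$, defined near the coordinate cross $\{t^{\alpha'2''}=0,\ \alpha'\ge2\}$ (coordinatized by $(t,s)$, $t\in M$), uniquely determined by the condition that on the cross $\frac{\partial}{\partial t^{\alpha'\alpha''}}\mapsto e_\alpha\otimes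 e_{\alpha''}$ ($e_1=\partial_1,e_2=\partial_s$ on the second factor) is an isomorphism of Frobenius algebras of the tangent space with $T_tM\otimes T_sQH^*(\mathbb{CP}^1)$; its Euler field on the cross is $E+2\partial_s$ and its operator $\mathcal V$ acts by $e_\alpha\otimes e_1\mapsto(\mu_\alpha-\frac12)e_\alpha\otimes e_1$, $e_\alpha\otimes e_2\mapsto(\mu_\alpha+\frac12)e_\alpha\otimes e_2$. Its (nondegenerate) Poisson bracket is $\{t^{\alpha'1''},t^{\beta'2''}\}=\eta^{\alpha\beta}(\mu_\beta+\frac12)$, $\{t^{\alpha'2''},t^{\beta'1''}\}=\eta^{\alpha\beta}(\mu_\beta-\frac12)$, other brackets zero. *)

(* Defs.v *)
From mathcomp Require Import all_boot all_order all_algebra.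
From mathcomp Require Import complex mxtens.
From mathcomp Require Import all_classical all_reals all_analysis.
Set Implicit Arguments.
Unset Strict Implicit.
Unset Printing Implicit Defensive.
Import Order.TTheory GRing.Theory Num.Theory numFieldNormedType.Exports.
Local Open Scope classical_set_scope.
Local Open Scope ring_scope.

(* Points and tangent vectors are columns, covectors are rows, so that an
   endomorphism A of the tangent space acts on v by A *m v and on a covector
   xi, from the right, by xi *m A.  All components refer to flat coordinates
   of the metric <,>; covariant derivatives are therefore plain directional
   derivatives.  The definitions below are used for K = C only. *)
Section FrobeniusManifolds.
Variable K : numFieldType.

(* For K = C and D open: complex differentiable at every point of D, together
   with all iterated directional derivatives. *)
Fixpoint holomorphic_upto (k : nat) (V W : normedModType K) (D : set V)
    (f : V -> W) : Prop :=
  (forall p, D p -> differentiable f p) /\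
  (if k is k'.+1 then forall v, holomorphic_upto k' D (fun p => 'D_v f p)
   else True).

Definition holomorphic (V W : normedModType K) (D : set V) (f : V -> W) :=
  forall k, holomorphic_upto k D f.

Definition del {n : nat} (i : 'I_n) : 'cV[K]_n := delta_mx i 0.

Definition grad {n : nat} (f : 'cV[K]_n -> K) (t : 'cV[K]_n) : 'rV[K]_n :=
  \row_a 'D_(del a) f t.

Definition lie_bracket {n : nat} (X Y : 'cV[K]_n -> 'cV[K]_n) (t : 'cV[K]_n) :=
  'D_(X t) Y t - 'D_(Y t) X t.

(* fm_c t a b g is the structure constant c_{a g}^b(t), i.e. fm_c t a is the
   matrix C_a of multiplication by the a-th coordinate vector field. *)
Record frob_data (n : nat) := FrobData {
  fm_dom : set 'cV[K]_n;
  fm_eta : 'M[K]_n;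
  fm_c : 'cV[K]_n -> 'I_n -> 'M[K]_n;
  fm_e : 'cV[K]_n;
  fm_E : 'cV[K]_n -> 'cV[K]_n;
  fm_d : K }.

Section Operations.
Variables (n : nat) (M : frob_data n).

Definition fm_mul (t u v : 'cV[K]_n) : 'cV[K]_n :=
  \sum_a u a 0 *: (fm_c M t a *m v).

Definition fm_form (u v : 'cV[K]_n) : K := (u^T *m fm_eta M *m v) 0 0.

Record is_frobenius : Prop := IsFrobenius {
  frob_open : open (fm_dom M);
  frob_eta_sym : (fm_eta M)^T = fm_eta M;
  frob_eta_unit : fm_eta M \in unitmx;
  frob_c_holo : forall a, holomorphic (fm_dom M) (fun t => fm_c M t a);
  frob_mulC : forall t u v, fm_dom M t -> fm_mul t u v = fm_mul t v u;
  frob_mulA : forall t u v w, fm_dom M t ->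
    fm_mul t u (fm_mul t v w) = fm_mul t (fm_mul t u v) w;
  frob_mul1 : forall t v, fm_dom M t -> fm_mul t (fm_e M) v = v;
  frob_inv : forall t u v w, fm_dom M t ->
    fm_form (fm_mul t u v) w = fm_form u (fm_mul t v w);
  frob_dc_sym : forall t, fm_dom M t ->
    let dc w x y z := 'D_w (fun p => fm_form (fm_mul p x y) z) t in
    forall w x y z,
      [/\ dc w x y z = dc x w y z, dc w x y z = dc w y x z
        & dc w x y z = dc w x z y];
  frob_E_holo : holomorphic (fm_dom M) (fm_E M);
  frob_E_affine : forall t u v, fm_dom M t ->
    'D_u (fun p => 'D_v (fm_E M) p) t = 0;
  frob_E_mul : forall X Y : 'cV[K]_n -> 'cV[K]_n,
    holomorphic (fm_dom M) X -> holomorphic (fm_dom M) Y ->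
    forall t, fm_dom M t ->
      lie_bracket (fm_E M) (fun p => fm_mul p (X p) (Y p)) t
      - fm_mul t (lie_bracket (fm_E M) X t) (Y t)
      - fm_mul t (X t) (lie_bracket (fm_E M) Y t) = fm_mul t (X t) (Y t);
  frob_E_form : forall X Y : 'cV[K]_n -> 'cV[K]_n,
    holomorphic (fm_dom M) X -> holomorphic (fm_dom M) Y ->
    forall t, fm_dom M t ->
      'D_(fm_E M t) (fun p => fm_form (X p) (Y p)) t
      - fm_form (lie_bracket (fm_E M) X t) (Y t)
      - fm_form (X t) (lie_bracket (fm_E M) Y t)
      = (2 - fm_d M) * fm_form (X t) (Y t) }.

Definition fm_U (t : 'cV[K]_n) : 'M[K]_n := \sum_a fm_E M t a 0 *: fm_c M t a.

Definition fm_V (t : 'cV[K]_n) : 'M[K]_n :=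
  ((2 - fm_d M) / 2)%:M - \matrix_(a, b) 'D_(del b) (fm_E M) t a 0.

Definition fm_sharp (w : 'rV[K]_n) : 'cV[K]_n := invmx (fm_eta M) *m w^T.

Definition fm_comul (t : 'cV[K]_n) (w1 w2 : 'rV[K]_n) : 'rV[K]_n :=
  (fm_mul t (fm_sharp w1) (fm_sharp w2))^T *m fm_eta M.

Definition fm_int (t : 'cV[K]_n) (w1 w2 : 'rV[K]_n) : K :=
  (fm_comul t w1 w2 *m fm_E M t) 0 0.

Definition fm_disc : set 'cV[K]_n := [set t | fm_dom M t /\
  \matrix_(a, b) fm_int t (delta_mx 0 a) (delta_mx 0 b) \notin unitmx].

Definition fm_star : set 'cV[K]_n := fm_dom M `\` fm_disc.

Definition fm_Einv (t : 'cV[K]_n) : 'cV[K]_n := invmx (fm_U t) *m fm_e M.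

Definition fm_dualmul (t u v : 'cV[K]_n) : 'cV[K]_n :=
  fm_mul t (fm_mul t (fm_Einv t) u) v.

Definition odd_period (D : set 'cV[K]_n) (w : 'cV[K]_n -> K) : Prop :=
  [/\ open D, D `<=` fm_star, holomorphic D w
    & forall t, D t -> forall a,
        'D_(del a) (grad w) t *m fm_U t = grad w t *m fm_V t *m fm_c M t a].

(* The defining equation only involves the gradient, so odd periods are
   considered modulo additive constants. *)
Definition odd_period_basis (D : set 'cV[K]_n) (I : finType)
    (f : I -> 'cV[K]_n -> K) : Prop :=
  (forall i, odd_period D (f i)) /\
  (forall w, odd_period D w -> exists! k : {ffun I -> K} * K,
     forall p, D p -> w p = \sum_i k.1 i * f i p + k.2).

(* {t^a, t^b} = eta^{a g} V^b_g *)
Definition poisson (f g : 'cV[K]_n -> K) (t : 'cV[K]_n) : K :=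
  (grad f t *m invmx (fm_eta M) *m (fm_V t)^T *m (grad g t)^T) 0 0.

Definition jac (x : 'cV[K]_n -> 'cV[K]_n) (t : 'cV[K]_n) : 'M[K]_n :=
  \matrix_(a, b) grad (fun p => x p a 0) t 0 b.

(* The vector field d/dx^a. *)
Definition dual_del (x : 'cV[K]_n -> 'cV[K]_n) (t : 'cV[K]_n) (a : 'I_n) :
  'cV[K]_n := col a (invmx (jac x t)).

(* x is a system of coordinates on the domain W in which the intersection form
   has the constant Gram matrix G = (G^{ab}). *)
Record flat_coordinates (W : set 'cV[K]_n) (x : 'cV[K]_n -> 'cV[K]_n)
    (G : 'M[K]_n) : Prop := FlatCoordinates {
  flat_open : open W;
  flat_nonempty : W !=set0;
  flat_connected : connected W;
  flat_star : W `<=` fm_star;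
  flat_holo : holomorphic W x;
  flat_inj : set_inj W x;
  flat_indep : forall t, W t -> jac x t \in unitmx;
  flat_gram : forall t a b, W t ->
    fm_int t (grad (fun p => x p a 0) t) (grad (fun p => x p b 0) t) = G a b;
  flat_E : forall t a, W t ->
    'D_(fm_E M t) (fun p => x p a 0) t = (1 - fm_d M) / 2 * x t a 0 }.

(* F is a function of the flat coordinates x. *)
Definition dual_potential (W : set 'cV[K]_n) (x : 'cV[K]_n -> 'cV[K]_n)
    (G : 'M[K]_n) (F : 'cV[K]_n -> K) : Prop :=
  holomorphic (x @` W) F /\
  forall t a b, W t ->
    fm_dualmul t (dual_del x t a) (dual_del x t b) =
    \sum_c (\sum_d G c d *
       'D_(del d) (fun z => 'D_(del a) (fun y => 'D_(del b) F y) z) (x t))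
      *: dual_del x t c.

End Operations.

Definition antidiag (n : nat) : 'M[K]_n := \matrix_(a, b) (b == rev_ord a)%:R.

Record normalized_diag (n : nat) (M : frob_data n.+1) (mu : 'I_n.+1 -> K) :
    Prop := NormalizedDiag {
  norm_e : fm_e M = del 0;
  norm_eta : fm_eta M = antidiag n.+1;
  norm_V : forall t, fm_dom M t -> fm_V M t = diag_mx (\row_a mu a);
  norm_mu : forall a, mu a != 1 / 2;
  norm_mu_sym : forall a, mu a + mu (rev_ord a) = 0 }.

Definition is_quadratic (n : nat) (q : 'cV[K]_n -> K) : Prop :=
  exists (A : 'M[K]_n) (l : 'rV[K]_n) (c : K),
    q = fun y => (y^T *m A *m y) 0 0 + (l *m y) 0 0 + c.

(* c_{a g}^b = eta^{b d} F_{d a g} *)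
Definition potential_c (n : nat) (eta : 'M[K]_n) (F : 'cV[K]_n -> K)
    (t : 'cV[K]_n) (a : 'I_n) : 'M[K]_n :=
  \matrix_(b, g) \sum_d invmx eta b d *
    'D_(del d) (fun z => 'D_(del a) (fun y => 'D_(del g) F y) z) t.

(* Kronecker product of columns; the coordinate t^{a i} of the tensor product
   is the one of index mxtens_index (a, i). *)
Definition tens (m n : nat) (u : 'cV[K]_m) (v : 'cV[K]_n) : 'cV[K]_(m * n) :=
  u *t v.

(* The point of the coordinate cross with coordinates (t, s). *)
Definition cross (n : nat) (t : 'cV[K]_n.+1) (s : K) : 'cV[K]_(n.+1 * 2) :=
  tens t (del 0) + s *: tens (del 0) (del 1).

End FrobeniusManifolds.

Section TensorWithQH.
Variable R : realType.

(* R[i] presented as an abstract numFieldType, so that it carries the topology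
   and norm which the library puts on every numFieldType. *)
Definition Cplx : numFieldType := R[i]%C.

Definition cRe (z : Cplx) : R := complex.Re z.
Definition cIm (z : Cplx) : R := complex.Im z.
Definition creal (r : R) : Cplx := (r%:C)%C.

Definition cexp (z : Cplx) : Cplx :=
  creal (expR (cRe z)) * (cos (cIm z) +i* sin (cIm z))%C.

Definition qh_potential (p : 'cV[Cplx]_2) : Cplx :=
  p 0 0 ^+ 2 * p 1 0 / 2 + cexp (p 1 0).

Definition qh_cp1 : frob_data Cplx 2 := {|
  fm_dom := setT;
  fm_eta := antidiag Cplx 2;
  fm_c := potential_c (antidiag Cplx 2) qh_potential;
  fm_e := del Cplx 0;
  fm_E := fun p => p 0 0 *: del Cplx 0 + 2 *: del Cplx 1;
  fm_d := 1 |}.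

(* The algebra at a point of QH^*(CP^1) depends on s only; the flat coordinate
   along the unit vector field is carried by M. *)
Definition qh_pt (s : Cplx) : 'cV[Cplx]_2 := s *: del Cplx 1.

Record tensor_qh (n : nat) (M : frob_data Cplx n.+1) (mu : 'I_n.+1 -> Cplx)
    (N : frob_data Cplx (n.+1 * 2)) : Prop := TensorQH {
  tensor_frob : is_frobenius N;
  tensor_d : fm_d N = fm_d M + 1;
  tensor_dom : forall t s, fm_dom M t -> fm_dom N (cross t s);
  tensor_eta : fm_eta N = fm_eta M *t fm_eta qh_cp1;
  tensor_e : fm_e N = tens (fm_e M) (fm_e qh_cp1);
  tensor_c : forall t s a i, fm_dom M t ->
    fm_c N (cross t s) (mxtens_index (a, i)) =
    fm_c M t a *t fm_c qh_cp1 (qh_pt s) i;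
  tensor_E : forall t s, fm_dom M t ->
    fm_E N (cross t s) =
    tens (fm_E M t) (del Cplx 0) + 2 *: tens (del Cplx 0) (del Cplx 1);
  tensor_V : forall p a, fm_dom N p ->
    fm_V N p *m tens (del Cplx a) (del Cplx 0) =
      (mu a - 1 / 2) *: tens (del Cplx a) (del Cplx 0) /\
    fm_V N p *m tens (del Cplx a) (del Cplx 1) =
      (mu a + 1 / 2) *: tens (del Cplx a) (del Cplx 1) }.

(* P holds on the cross for Q = exp s small, locally uniformly in t in W.
   The coordinate s parametrizes the universal cover of Q <> 0. *)
Definition near_Q0 (n : nat) (W : set 'cV[Cplx]_n) (P : 'cV[Cplx]_n -> Cplx -> Prop) :=
  forall t0, W t0 -> exists rho : R,
    \forall t \near t0, forall s, cRe s < rho -> P t s.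

(* f = g + O(Q) *)
Definition cross_bigO (n : nat) (W : set 'cV[Cplx]_n.+1)
    (f : 'cV[Cplx]_(n.+1 * 2) -> Cplx) (g : 'cV[Cplx]_n.+1 -> Cplx) : Prop :=
  forall t0, W t0 -> exists (k : Cplx) (rho : R),
    \forall t \near t0, forall s, cRe s < rho ->
      `|f (cross t s) - g t| <= k * `|cexp s|.

(* f = g + o(1) as Q -> 0.  Since log Q = s is multivalued, Q tends to 0 inside
   a sector |arg Q| <= b, with b arbitrary (Q log Q is not o(1) uniformly over
   all branches of the logarithm). *)
Definition cross_littleo1 (n : nat) (W : set 'cV[Cplx]_n.+1)
    (f : 'cV[Cplx]_(n.+1 * 2) -> Cplx) (g : 'cV[Cplx]_n.+1 -> Cplx -> Cplx) :
    Prop :=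
  forall t0, W t0 -> forall b eps : R, 0 < eps -> exists rho : R,
    \forall t \near t0, forall s, cRe s < rho -> `|cIm s| <= b ->
      `|f (cross t s) - g t s| <= creal eps.

Definition XY_family (n m : nat) (X Y : 'I_n -> 'cV[Cplx]_m -> Cplx)
    (i : 'I_n + 'I_n) : 'cV[Cplx]_m -> Cplx :=
  match i with inl a => X a | inr a => Y a end.

(* (X, Y) is a basis of odd periods on D with the prescribed behaviour on the
   cross; D contains the points of the cross over W with Q small. *)
Record period_system (n : nat) (N : frob_data Cplx (n.+1 * 2))
    (W : set 'cV[Cplx]_n.+1) (x : 'cV[Cplx]_n.+1 -> 'cV[Cplx]_n.+1)
    (G : 'M[Cplx]_n.+1) (F : 'cV[Cplx]_n.+1 -> Cplx)
    (D : set 'cV[Cplx]_(n.+1 * 2))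
    (X Y : 'I_n.+1 -> 'cV[Cplx]_(n.+1 * 2) -> Cplx) : Prop := PeriodSystem {
  ps_dom : near_Q0 W (fun t s => D (cross t s));
  ps_basis : odd_period_basis N D (XY_family X Y);
  ps_X : forall a, cross_bigO W (X a) (fun t => x t a 0);
  ps_Y : forall a, cross_littleo1 W (Y a)
    (fun t s => (invmx G *m x t) a 0 * s - 2 * 'D_(del Cplx a) F (x t)) }.

Definition canonically_conjugate (n : nat) (N : frob_data Cplx (n.+1 * 2))
    (D : set 'cV[Cplx]_(n.+1 * 2))
    (X Y : 'I_n.+1 -> 'cV[Cplx]_(n.+1 * 2) -> Cplx) : Prop :=
  forall p a b, D p ->
    [/\ poisson N (X a) (Y b) p = (a == b)%:R,
        poisson N (X a) (X b) p = 0
      & poisson N (Y a) (Y b) p = 0].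

(* Equality of multivalued functions near the cross, for Q small. *)
Definition eq_near_cross (n : nat) (W : set 'cV[Cplx]_n.+1)
    (f g : 'cV[Cplx]_(n.+1 * 2) -> Cplx) : Prop :=
  near_Q0 W (fun t s => \forall p \near cross t s, f p = g p).

End TensorWithQH.

(* Main.v *)
Require Import Defs.
From HB Require Import structures.
From mathcomp Require Import all_boot all_order all_algebra.
From mathcomp Require Import complex mxtens ring lra zify.
From mathcomp Require Import all_classical all_reals all_analysis.
Import Order.TTheory GRing.Theory Num.Theory numFieldNormedType.Exports.
Set Implicit Arguments.
Unset Strict Implicit.
Unset Printing Implicit Defensive.
Local Open Scope classical_set_scope.
Local Open Scope ring_scope.

(** Write xi for the gradient row of an odd period w of the tensor product N.
    Augmented by w it satisfies a flat linear system d(xi, w) = (xi, w) A, whose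
    restriction to the coordinate cross is a Fuchsian system in Q = exp s with
    parameters t.  Frobenius' method solves it there explicitly: from a flat
    gradient p of the intersection form (P_1 = p, P_(m+1) = the derivative of P_m
    along the unit field) and an inhomogeneous companion G one gets
    w = s x_a + phi + sum_(k >= 1) Q^k / k!^2 ((s - 2 H_k) P_(2k-1) + G_(2k-1)) e.
    Choosing p = 0, G_1 = grad x^a gives X^a, and p = grad x_a,
    G_1 = -2 grad (dF_* / dx^a) gives Y_a.  Flatness extends these solutions to a
    neighbourhood of the cross.

    The Poisson bracket of two odd periods is locally constant, so it can be read
    off from the limit Q -> 0, where it reduces to the Gram matrix of the flat
    coordinates and to the symmetry of the Hessian of F_*.  Nondegeneracy of the
    bracket makes (X, Y) a basis; it also replaces uniqueness theorems for the
    linear system, since the coefficients of any odd period in this basis are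
    brackets.

    For uniqueness, an odd period that tends to 0 along the cross has an expansion
    A(t) + B(t) s + o(1) with A = B = 0, and differentiating in t kills all its
    coefficients.  Two dual potentials have the same third derivatives, hence
    differ by a quadratic polynomial q, and Y' - Y + 2 grad q (X) is such a period. *)

(** * Norms and complex differentials *)

(** One equation dictates the series. The gradient of an odd period satisfies [d_u xi = chi C_u],
    where [chi] is its derivative along the unit, so every relation of the product becomes a
    differential equation. On the cross the relation [e_2 . e_2 = Q e_1] reads
    [(d/ds)^2 w = Q (d/dt^1)^2 w]: the coefficient of [Q^k] is the [2k]-th unit derivative of the
    leading one divided by [k!^2], and the logarithmic branch picks up harmonic numbers. Unit
    derivatives grow like factorials, which [k!^2] compensates only up to a geometric factor; hence
    the restriction to small [Q]. The condition on the spectrum enters through [V + 1/2]: its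
    inverse produces the antiderivative [P_0] of a flat gradient, whose pairing with the unit is
    [x_a]. The analysis rests on the mean value inequality alone. Flat systems are integrated by
    Euler polygons along segments issuing from a point of the cross; two such local extensions are
    compared at a common point [q] through its projection to the cross, where both take the
    prescribed value. *)

Section RealNorm.
Variable R : realType.
Local Notation C := (Cplx R).

(* The order on C is partial, so estimates use the norm as a real number. *)
Definition nm (V : normedModType C) (v : V) : R := cRe `|v|.

Lemma crealE (z : C) : z \is Num.real -> z = creal (cRe z).
Proof. by move=> zr; rewrite /creal /cRe RRe_real. Qed.

Lemma creal_le (a b : R) : (creal a <= creal b) = (a <= b).
Proof. exact: lecR. Qed.

Lemma creal_lt (a b : R) : (creal a < creal b) = (a < b).
Proof. exact: ltcR. Qed.

Lemma crealD (a b : R) : creal (a + b) = creal a + creal b.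
Proof. by rewrite /creal -rmorphD. Qed.

Lemma crealM (a b : R) : creal (a * b) = creal a * creal b.
Proof. by rewrite /creal -rmorphM. Qed.

Lemma crealN (a : R) : creal (- a) = - creal a.
Proof. by rewrite /creal -rmorphN. Qed.

Lemma creal0 : creal 0 = 0 :> C. Proof. by []. Qed.
Lemma creal1 : creal 1 = 1 :> C. Proof. by []. Qed.

Lemma creal_nat k : creal k%:R = k%:R :> C.
Proof. by rewrite /creal rmorph_nat. Qed.

Lemma crealV (a : R) : creal a^-1 = (creal a)^-1.
Proof. by rewrite /creal fmorphV. Qed.

Lemma creal_inj : injective (@creal R).
Proof. by move=> a b []. Qed.

Section NormFacts.
Variable V : normedModType C.
Implicit Types u v : V.

Lemma nmE v : `|v| = creal (nm v).
Proof. by rewrite /nm -crealE // normr_real. Qed.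

Lemma nm_ge0 v : 0 <= nm v.
Proof. by rewrite -creal_le creal0 -nmE. Qed.

Lemma nm0 : nm (0 : V) = 0.
Proof. by apply: creal_inj; rewrite -nmE normr0. Qed.

Lemma nm_eq0 v : nm v = 0 -> v = 0.
Proof. by move=> h; apply/eqP; rewrite -normr_eq0 nmE h creal0. Qed.

Lemma nmN v : nm (- v) = nm v.
Proof. by rewrite /nm normrN. Qed.

Lemma nmD u v : nm (u + v) <= nm u + nm v.
Proof. by rewrite -creal_le crealD -!nmE ler_normD. Qed.

Lemma nmB u v : nm (u - v) <= nm u + nm v.
Proof. by rewrite -(nmN v) nmD. Qed.

Lemma nm_distC u v : nm (u - v) = nm (v - u).
Proof. by rewrite -nmN opprB. Qed.

Lemma nmZ (a : C) v : nm (a *: v) = nm a * nm v.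
Proof. by apply: creal_inj; rewrite crealM -!nmE normrZ. Qed.

Lemma nm_trans w u v : nm (u - v) <= nm (u - w) + nm (w - v).
Proof. by rewrite -[u - v](subrKA w) nmD. Qed.

Lemma nm_sum (I : Type) (s : seq I) (P : pred I) (F : I -> V) :
  nm (\sum_(i <- s | P i) F i) <= \sum_(i <- s | P i) nm (F i).
Proof.
elim/big_ind2 : _ => [|a b c d h1 h2|//]; first by rewrite nm0.
exact: le_trans (nmD _ _) (lerD h1 h2).
Qed.

(** Filters are turned once and for all into balls of real radius, where the order is total. *)
Lemma nbhs_nmP (p : V) (P : set V) :
  nbhs p P <-> exists2 r : R, 0 < r & forall q, nm (q - p) < r -> P q.
Proof.
split.
  move=> /nbhs_normP [e /= e0 h].
  exists (cRe e).
    by rewrite -creal_lt -crealE ?creal0 // gtr0_real.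
  move=> q hq; apply: h => /=.
  by rewrite -normrN opprB nmE (crealE (gtr0_real e0)) creal_lt.
move=> [r r0 h]; apply/nbhs_normP; exists (creal r) => /=.
  by rewrite -creal0 creal_lt.
move=> q /=; rewrite -normrN opprB nmE creal_lt; exact: h.
Qed.

End NormFacts.

Lemma nmM (a b : C) : nm (a * b) = nm a * nm b.
Proof. by apply: creal_inj; rewrite crealM -!nmE normrM. Qed.

Lemma nm_creal (a : R) : nm (creal a) = `|a|.
Proof.
rewrite /nm /cRe.
have -> : `|creal a : C| = creal `|a|; last by [].
by rewrite /creal normc_def /= expr0n addr0 sqrtr_sqr.
Qed.

Lemma nm1 : nm (1 : C) = 1.
Proof. by rewrite -creal1 nm_creal normr1. Qed.

Lemma nm_nat k : nm (k%:R : C) = k%:R.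
Proof. by rewrite -creal_nat nm_creal ger0_norm. Qed.

Lemma nmV (a : C) : nm a^-1 = (nm a)^-1.
Proof. by apply: creal_inj; rewrite crealV -!nmE normfV. Qed.

Lemma cRe_le_nm (z : C) : `|cRe z| <= nm z.
Proof.
rewrite /nm /cRe normc_def /= -sqrtr_sqr ler_sqrt ?lerDl ?sqr_ge0 //.
by rewrite addr_ge0 ?sqr_ge0.
Qed.

Lemma cIm_le_nm (z : C) : `|cIm z| <= nm z.
Proof.
rewrite /nm /cIm /cRe normc_def /= -sqrtr_sqr ler_sqrt ?lerDr ?sqr_ge0 //.
by rewrite addr_ge0 ?sqr_ge0.
Qed.

Lemma nm_le_ReIm (z : C) : nm z <= `|cRe z| + `|cIm z|.
Proof.
have -> : z = creal (cRe z) + 'i%C * creal (cIm z) by exact: complexE.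
rewrite (le_trans (nmD _ _)) // nmM !nm_creal.
have -> : nm ('i%C : C) = 1.
  by rewrite /nm /cRe normc_def /= expr0n expr1n add0r sqrtr1.
rewrite mul1r.
have -> : cRe (creal (cRe z) + 'i%C * creal (cIm z)) = cRe z.
  by case: z => a b; rewrite /cRe /cIm /creal /=; ring.
have -> // : cIm (creal (cRe z) + 'i%C * creal (cIm z)) = cIm z.
by case: z => a b; rewrite /cRe /cIm /creal /=; ring.
Qed.

Lemma nm_entry m n (A : 'M[C]_(m, n)) i j : nm (A i j) <= nm A.
Proof.
rewrite -creal_le -!nmE [leRHS]/Num.norm /= mx_normE.
rewrite -[leLHS]nngE num_le.
exact: (@le_bigmax _ _ _ _ (fun k : 'I_m * 'I_n => `|A k.1 k.2|%:nng) (i, j)).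
Qed.

Lemma nm_mxle m n (A : 'M[C]_(m, n)) c :
  0 <= c -> (forall i j, nm (A i j) <= c) -> nm A <= c.
Proof.
move=> c0 h; rewrite -creal_le -nmE [leLHS]/Num.norm /= mx_normE.
have c0' : (0 : C) <= creal c by rewrite -creal0 creal_le.
rewrite -[creal c]/((NngNum c0')%:num) num_le; apply/bigmax_leP; split => //.
by move=> [i j] _ /=; rewrite -num_le /= nmE creal_le.
Qed.

Lemma nm_mulmx m n k (A : 'M[C]_(m, n)) (B : 'M[C]_(n, k)) :
  nm (A *m B) <= n%:R * (nm A * nm B).
Proof.
apply: nm_mxle => [|i j]; first by rewrite !mulr_ge0 ?nm_ge0.
rewrite mxE (le_trans (nm_sum _ _ _)) //.
apply: (@le_trans _ _ (\sum_(l < n) nm A * nm B)).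
  by apply: ler_sum => l _; rewrite nmM ler_pM ?nm_ge0 ?nm_entry.
by rewrite sumr_const card_ord mulr_natl.
Qed.

Lemma nm_scalar_mx n (a : C) : nm (a%:M : 'M[C]_n) <= nm a.
Proof.
apply: nm_mxle => [|i j]; first exact: nm_ge0.
by rewrite mxE; case: eqP => _; rewrite ?mulr1n ?mulr0n ?nm0 ?nm_ge0.
Qed.

Lemma nm_trmx m n (A : 'M[C]_(m, n)) : nm A^T = nm A.
Proof.
suff h k l (B : 'M[C]_(k, l)) : nm B^T <= nm B.
  by apply/eqP; rewrite eq_le h -{1}[A]trmxK h.
by apply: nm_mxle => [|i j]; rewrite ?nm_ge0 // mxE nm_entry.
Qed.

End RealNorm.

(** * Real derivatives by increments, and geometric limits *)

Section RealDerivative.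
Variable R : realType.

(** Gives access to the real mean value theorem; the converse below serves to read off increments of
    [expR], [cos] and [sin]. *)
Lemma is_derive_eps (f : R -> R) (x l : R) :
  (forall eps : R, 0 < eps -> exists2 d : R, 0 < d & forall h, `|h| < d ->
     `|f (x + h) - f x - l * h| <= eps * `|h|) ->
  is_derive x 1 f l.
Proof.
move=> H.
have cv : (fun h : R => h^-1 *: ((f \o shift x) (h *: 1) - f x)) @ 0^' --> l.
  apply/cvgrPdist_le => eps eps0.
  have [d d0 hd] := H eps eps0.
  near=> h.
  have h0 : h != 0 by near: h; exact: nbhs_dnbhs_neq.
  have hd' : `|h| < d.
    near: h; apply: nbhs_dnbhs; apply/nbhs_normP; exists d => //= y.
    by rewrite /ball_ /= sub0r normrN.
  rewrite /= [h *: 1]mulr1 addrC [h + x]addrC.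
  have -> : - (h^-1 *: (f (x + h) - f x)) + l =
     - (h^-1 * (f (x + h) - f x - l * h)).
    by rewrite /GRing.scale /=; field.
  rewrite normrN normrM normfV ler_pdivrMl ?normr_gt0 // [_ * eps]mulrC.
  exact: hd.
split; first by apply/cvg_ex; exists l.
exact: cvg_lim cv.
Unshelve. all: by end_near. Qed.

Lemma is_derive_epsE (f : R -> R) (x l : R) : is_derive x 1 f l ->
  forall eps : R, 0 < eps -> exists2 d : R, 0 < d & forall h, `|h| < d ->
     `|f (x + h) - f x - l * h| <= eps * `|h|.
Proof.
move=> [dv <-] eps eps0.
have /derivable_nbhs/eqaddoP/(_ eps eps0) := dv.
move=> /nbhs_normP[d /= d0 hd]; exists d => // h hh.
have := hd h; rewrite /= sub0r normrN => /(_ hh).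
rewrite /= opprD -![(_ + _ : _ -> _) _]/(_ + _) -![(- _ : _ -> _) _]/(- _) /cst /=.
rewrite [h *: 1]mulr1 [h + x]addrC addrA.
by rewrite [_ *: _]mulrC.
Qed.

(** The intervals with centre [v k] and radius the geometric tail [e k] are nested, so the supremum
    of their left ends lies in all of them. This yields the limit together with its rate. *)
Lemma geometric_limit_real (v : nat -> R) (c q : R) : 0 <= q < 1 ->
  (forall k, `|v k.+1 - v k| <= c * q ^+ k) ->
  exists l, forall k, `|v k - l| <= c * q ^+ k / (1 - q).
Proof.
move=> /andP[q0 q1] hv.
have q1' : 0 < 1 - q by rewrite subr_gt0.
pose e k := c * q ^+ k / (1 - q).
have eS k : e k = c * q ^+ k + e k.+1.
  by rewrite /e exprS; field; rewrite gt_eqF.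
have e0 k : 0 <= e k.
  by rewrite /e divr_ge0 ?(ltW q1') // (le_trans _ (hv k)).
have lo : {homo (fun k => v k - e k) : i j / (i <= j)%N >-> i <= j}.
  apply: homo_leq => [x|y x z|k] //; first exact: le_trans.
  by rewrite (eS k); have := hv k; rewrite ler_norml => /andP[]; lra.
have hi : {homo (fun k => v k + e k) : i j / (i <= j)%N >-> j <= i}.
  apply: homo_leq => [x|y x z|k] //; first by move=> h1 h2; exact: le_trans h2 h1.
  by rewrite (eS k); have := hv k; rewrite ler_norml => /andP[]; lra.
have lohi i j : v i - e i <= v j + e j.
  apply: (@le_trans _ _ (v (maxn i j) - e (maxn i j))); first exact/lo/leq_maxl.
  apply: (@le_trans _ _ (v (maxn i j) + e (maxn i j))); last exact/hi/leq_maxr.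
  by have := e0 (maxn i j); lra.
pose A := range (fun k => v k - e k).
have A0 : A !=set0 by exists (v 0%N - e 0%N), 0%N.
exists (sup A) => k.
have h1 : v k - e k <= sup A.
  apply: ub_le_sup; last by exists k.
  by exists (v 0%N + e 0%N) => _ [j _ <-].
have h2 : sup A <= v k + e k.
  by apply: ge_sup => // _ [j _ <-].
by rewrite -/(e k) ler_norml; apply/andP; split; lra.
Qed.

End RealDerivative.

(** The local hypothesis makes both [P] and its negation relatively open in [A]. [O b] collects the
    points near which [P] has the truth value [b]; its complement serves as the closed set required
    by connectedness. *)
Lemma connected_ind (T : topologicalType) (A : set T) (P : T -> Prop) x0 :
  connected A -> A x0 -> P x0 ->
  (forall x, A x -> \forall y \near x, A y -> (P y <-> P x)) ->
  forall x, A x -> P x.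
Proof.
move=> cA Ax0 Px0 loc.
pose O b := [set x | exists2 U, open_nbhs x U & forall y, U y -> A y -> P y = b].
have oO b : open (O b).
  rewrite openE => x [U [oU Ux] hU].
  rewrite /interior nbhsE; exists U => // y Uy.
  by exists U.
have loc' x b : A x -> P x = b -> O b x.
  move=> Ax Pxb; have : nbhs x [set y | A y -> (P y <-> P x)] := loc x Ax.
  rewrite nbhsE => -[U oU hU].
  by exists U => // y Uy Ay; rewrite -Pxb; apply/propext; exact: hU.
have disj b x : A x -> O b x -> P x = b.
  by move=> Ax [U [_ Ux] hU]; exact: hU.
suff -> : A = A `&` O True by move=> x [Ax /(disj _ _ Ax) ->].
apply/esym; apply: cA.
- by exists x0; split => //; apply: loc' => //; apply/propext.
- by exists (O True).
- exists (~` O False); first exact: open_closedC.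
  apply/seteqP; split=> x [Ax h]; split=> //.
    by move=> /(disj _ _ Ax); rewrite (disj _ _ Ax h) => <-.
  apply: (loc' _ _) => //; apply/propext; split=> // _.
  by apply: contrapT => nP; apply: h; apply: loc' => //; apply/propext.
Qed.

(** * Differentials with an explicit linear part *)

Section HasD.
Variable R : realType.
Local Notation C := (Cplx R).

Section Def.
Variables V W : normedModType C.

(** Linear maps are plain functions with a property rather than bundled objects, so that a
    differential can be written down as an explicit lambda term. *)
Definition blinear (L : V -> W) :=
  linear L /\ exists2 c : R, 0 <= c & forall v, nm (L v) <= c * nm v.

(** Frechet differentiability with a named differential. Real [eps] and a non-strict inequality make
    the case [w = 0] harmless and keep the partial order of [C] out of the estimates. *)
Definition hasD (f : V -> W) (p : V) (L : V -> W) :=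
  blinear L /\ forall eps : R, 0 < eps -> exists2 r : R, 0 < r & forall w, nm w < r ->
    nm (f (p + w) - f p - L w) <= eps * nm w.

Lemma hasD_diff f p L : hasD f p L ->
  differentiable f p /\ forall v, 'D_v f p = L v.
Proof.
move=> [[lL [c c0 hc]] h].
pose L' : {linear V -> W} := HB.pack L (GRing.isLinear.Build _ _ _ _ L lL).
have cL : continuous L'.
  move=> x; apply/cvgrPdist_lt => eps eps0.
  apply/nbhs_nmP; exists (cRe eps / (c + 1)) => [|q hq].
    by rewrite divr_gt0 ?ltr_wpDl // -creal_lt -crealE ?gtr0_real.
  rewrite -raddfB nmE [eps]crealE ?gtr0_real // creal_lt.
  apply: (le_lt_trans (hc _)); rewrite nm_distC.
  move: hq; rewrite ltr_pdivlMr ?ltr_wpDl // => hq.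
  apply: le_lt_trans hq; rewrite mulrC ler_wpM2l ?nm_ge0 //; lra.
have oL : f \o shift p = cst (f p) + L' +o_ 0 id.
  apply/eqaddoP => eps eps0.
  have [|r r0 hr] := h (cRe eps).
    by rewrite -creal_lt -crealE ?gtr0_real.
  apply/nbhs_nmP; exists r => // w; rewrite subr0 => hw.
  rewrite /= opprD -![(_ + _ : _ -> _) _]/(_ + _) -![(- _ : _ -> _) _]/(- _) /cst /=.
  rewrite addrA !nmE [eps]crealE ?gtr0_real // -crealM creal_le [w + p]addrC.
  exact: hr.
have dL := diff_unique cL oL.
have df : differentiable f p by apply/diff_locallyP; rewrite dL.
by split => // v; rewrite deriveE // dL.
Qed.

Lemma diff_hasD f p : differentiable f p -> hasD f p (fun v => 'D_v f p).
Proof.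
move=> df; have e : (fun v => 'D_v f p) = 'd f p.
  by apply/funext => v; rewrite deriveE.
rewrite e; split.
  split; first by move=> a u v; rewrite linearP.
  have [k k0 hk] := linear_lipschitz (diff_continuous df).
  exists (cRe k); first by rewrite -creal_le -crealE ?gtr0_real // ltW.
  by move=> v; rewrite -creal_le crealM -!nmE -crealE ?gtr0_real.
move=> eps eps0.
have /diff_locally/eqaddoP := df.
move=> /(_ (creal eps)); rewrite -creal0 creal_lt => /(_ eps0).
move=> /nbhs_nmP[r r0 hr]; exists r => // w hw.
have := hr w; rewrite subr0 => /(_ hw).
rewrite /= opprD -![(_ + _ : _ -> _) _]/(_ + _) -![(- _ : _ -> _) _]/(- _) /cst /=.
by rewrite addrA !nmE -crealM creal_le [w + p]addrC.
Qed.

End Def.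
End HasD.

Section Calculus.
Variable R : realType.
Local Notation C := (Cplx R).

Section Blinear.
Variables V W : normedModType C.

Lemma blinear0 : blinear (fun _ : V => 0 : W).
Proof.
split; first by move=> a u v; rewrite scaler0 addr0.
by exists 0 => // v; rewrite nm0 mul0r.
Qed.

Lemma blinearD (L L' : V -> W) : blinear L -> blinear L' ->
  blinear (fun v => L v + L' v).
Proof.
move=> [l [c c0 h]] [l' [c' c0' h']]; split.
  by move=> a u v; rewrite l l' scalerDr addrACA.
exists (c + c'); first exact: addr_ge0.
by move=> v; rewrite mulrDl (le_trans (nmD _ _)) // lerD.
Qed.

Lemma blinearZ (a : C) (L : V -> W) : blinear L -> blinear (fun v => a *: L v).
Proof.
move=> [l [c c0 h]]; split.
  by move=> b u v; rewrite l scalerDr !scalerA mulrC.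
exists (nm a * c); first by rewrite mulr_ge0 ?nm_ge0.
by move=> v; rewrite nmZ -mulrA ler_wpM2l ?nm_ge0.
Qed.

Lemma blinearN (L : V -> W) : blinear L -> blinear (fun v => - L v).
Proof.
move=> h; have -> : (fun v => - L v) = (fun v => -1 *: L v).
  by apply/funext => v; rewrite scaleN1r.
exact: blinearZ.
Qed.

Lemma linear_add (L : V -> W) : linear L -> forall u v, L (u + v) = L u + L v.
Proof. by move=> l u v; have := l 1 u v; rewrite !scale1r. Qed.

Lemma linear_zero (L : V -> W) : linear L -> L 0 = 0.
Proof.
move=> l; have := l (-1) 0 0; rewrite scaler0 addr0 scaleN1r addNr //.
Qed.

Lemma linear_scale (L : V -> W) : linear L -> forall a v, L (a *: v) = a *: L v.
Proof. by move=> l a v; have := l a v 0; rewrite !addr0 (linear_zero l) addr0. Qed.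

Lemma blinear_comp (U : normedModType C) (L : V -> W) (L' : U -> V) :
  blinear L -> blinear L' -> blinear (fun u => L (L' u)).
Proof.
move=> [l [c c0 h]] [l' [c' c0' h']]; split; first by move=> a u v; rewrite l' l.
exists (c * c'); first exact: mulr_ge0.
by move=> v; rewrite (le_trans (h _)) // -mulrA ler_wpM2l.
Qed.

Lemma blinear_id : blinear (fun v : V => v).
Proof. by split => //; exists 1 => // v; rewrite mul1r. Qed.

End Blinear.

Section BlinearMx.
Variable V : normedModType C.

Lemma blinear_mulmxl m n k (A : 'M[C]_(m, n)) (L : V -> 'M[C]_(n, k)) :
  blinear L -> blinear (fun v => A *m L v).
Proof.
move=> [l [c c0 h]]; split.
  by move=> a u v; rewrite l mulmxDr scalemxAr.
exists (n%:R * nm A * c); first by rewrite !mulr_ge0 ?nm_ge0.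
move=> v; rewrite (le_trans (nm_mulmx _ _)) // mulrA -!mulrA.
by rewrite ler_wpM2l // ler_wpM2l // nm_ge0.
Qed.

Lemma blinear_mulmxr m n k (L : V -> 'M[C]_(m, n)) (A : 'M[C]_(n, k)) :
  blinear L -> blinear (fun v => L v *m A).
Proof.
move=> [l [c c0 h]]; split.
  by move=> a u v; rewrite l mulmxDl scalemxAl.
exists (n%:R * nm A * c); first by rewrite !mulr_ge0 ?nm_ge0.
move=> v; rewrite (le_trans (nm_mulmx _ _)) // -!mulrA ler_wpM2l // mulrC.
by rewrite ler_wpM2l // nm_ge0.
Qed.

Lemma blinear_scalel (W : normedModType C) (L : V -> C) (w : W) :
  blinear L -> blinear (fun v => L v *: w).
Proof.
move=> [l [c c0 h]]; split.
  by move=> a u v; rewrite l scalerDl scalerA.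
exists (nm w * c); first by rewrite !mulr_ge0 ?nm_ge0.
by move=> v; rewrite nmZ mulrC -mulrA ler_wpM2l ?nm_ge0.
Qed.

Lemma blinear_trmx m n (L : V -> 'M[C]_(m, n)) :
  blinear L -> blinear (fun v => (L v)^T).
Proof.
move=> [l [c c0 h]]; split; first by move=> a u v; rewrite l linearP.
by exists c => // v; rewrite nm_trmx.
Qed.

Lemma blinear_entry m n (L : V -> 'M[C]_(m, n)) i j :
  blinear L -> blinear (fun v => L v i j : C).
Proof.
move=> [l [c c0 h]]; split; first by move=> a u v; rewrite l !mxE.
by exists c => // v; rewrite (le_trans (nm_entry _ _ _)).
Qed.

Lemma blinear_mx m n (L : V -> 'M[C]_(m, n)) :
  (forall i j, blinear (fun v => L v i j : C)) -> blinear L.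
Proof.
move=> h; split.
  by move=> a u v; apply/matrixP => i j; rewrite (h i j).1 !mxE.
have h' i j : {c : R | 0 <= c & forall v, nm (L v i j) <= c * nm v}.
  by have [_ /cid2[c]] := h i j; exists c.
pose s := \sum_i \sum_j projT1 (sig_of_sig2 (h' i j)).
have s0 i j : 0 <= projT1 (sig_of_sig2 (h' i j)) by case: (h' i j).
exists s; first by rewrite sumr_ge0 // => i _; rewrite sumr_ge0.
move=> v; apply: nm_mxle => [|i j].
  by rewrite mulr_ge0 ?nm_ge0 // sumr_ge0 // => i _; rewrite sumr_ge0.
apply: (@le_trans _ _ (projT1 (sig_of_sig2 (h' i j)) * nm v)).
  by case: (h' i j).
rewrite ler_wpM2r ?nm_ge0 // /s (bigD1 i) //= (bigD1 j) //= -addrA lerDl.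
by rewrite addr_ge0 ?sumr_ge0 // => k _; rewrite ?s0 ?sumr_ge0 // => k' _; apply: s0.
Qed.

End BlinearMx.

Lemma blinear_cV m (W : normedModType C) (L : 'cV[C]_m -> W) : linear L -> blinear L.
Proof.
move=> l; split => //.
exists (\sum_i nm (L (delta_mx i 0))); first by rewrite sumr_ge0 // => i _; rewrite nm_ge0.
move=> v.
have -> : v = \sum_i v i 0 *: delta_mx i 0.
  apply/matrixP => i j; rewrite ord1 summxE (bigD1 i) //= !mxE !eqxx mulr1.
  by rewrite big1 ?addr0 // => k ki; rewrite !mxE eq_sym (negPf ki) mulr0.
have Ls : forall (s : seq 'I_m) (F : 'I_m -> 'cV[C]_m),
   L (\sum_(i <- s) F i) = \sum_(i <- s) L (F i).
  by move=> s F; elim/big_rec2 : _ => [|i a b _ <-]; rewrite ?(linear_zero l) ?(linear_add l).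
rewrite {1}Ls (le_trans (nm_sum _ _ _)) // mulr_suml ler_sum // => i _.
rewrite (linear_scale l) nmZ mulrC ler_wpM2l ?nm_ge0 //.
apply: le_trans (nm_entry _ i 0).
rewrite summxE (bigD1 i) //= !mxE !eqxx mulr1.
by rewrite big1 ?addr0 // => k ki; rewrite !mxE eq_sym (negPf ki) mulr0.
Qed.

Section Rules.
Variables V W : normedModType C.
Implicit Types (f g : V -> W) (p : V).

Lemma hasD_ext f g p L : (\forall q \near p, f q = g q) -> hasD f p L -> hasD g p L.
Proof.
move=> /nbhs_nmP[r r0 hr] [bL h]; split=> // eps eps0.
have [d d0 hd] := h _ eps0; exists (Num.min r d); first by rewrite lt_min r0.
move=> w; rewrite lt_min => /andP[wr wd].
by rewrite -!hr ?hd // ?subrr ?nm0 // addrC addKr.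
Qed.

Lemma hasD_eqD f p L L' : hasD f p L -> (forall v, L v = L' v) -> hasD f p L'.
Proof. by move=> h e; have <- : L = L' by apply/funext. Qed.

Lemma hasD_cst (a : W) p : hasD (fun=> a) p (fun=> 0).
Proof.
split; first exact: blinear0.
move=> eps eps0; exists 1 => // w _; rewrite subrr subr0 nm0 mulr_ge0 ?nm_ge0 //.
exact: ltW.
Qed.

Lemma hasD_lin (L : V -> W) p : blinear L -> hasD L p L.
Proof.
move=> bL; split => // eps eps0; exists 1 => // w _.
rewrite (linear_add bL.1) [L p + _]addrC addrK subrr nm0 mulr_ge0 ?nm_ge0 //.
exact: ltW.
Qed.

Lemma hasDD f g p L L' : hasD f p L -> hasD g p L' ->
  hasD (fun q => f q + g q) p (fun v => L v + L' v).
Proof.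
move=> [b h] [b' h']; split; first exact: blinearD.
move=> eps eps0; have e2 : 0 < eps / 2 by rewrite divr_gt0.
have [r r0 hr] := h _ e2; have [r' r0' hr'] := h' _ e2.
exists (Num.min r r'); first by rewrite lt_min r0.
move=> w; rewrite lt_min => /andP[wr wr'].
have -> : f (p + w) + g (p + w) - (f p + g p) - (L w + L' w) =
  (f (p + w) - f p - L w) + (g (p + w) - g p - L' w).
  by rewrite !opprD (addrACA (f (p + w))) [LHS]addrACA.
rewrite (le_trans (nmD _ _)) // [eps]splitr mulrDl lerD ?hr ?hr' //.
Qed.

Lemma hasDZ (a : C) f p L : hasD f p L -> hasD (fun q => a *: f q) p (fun v => a *: L v).
Proof.
move=> [b h]; split; first exact: blinearZ.
move=> eps eps0.
have e2 : 0 < eps / (nm a + 1) by rewrite divr_gt0 ?ltr_wpDl ?nm_ge0.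
have [r r0 hr] := h _ e2; exists r => // w wr.
rewrite -!scalerBr nmZ.
apply: (@le_trans _ _ ((nm a + 1) * nm (f (p + w) - f p - L w))).
  by rewrite ler_wpM2r ?nm_ge0 // lerDl.
by rewrite -ler_pdivlMl ?ltr_wpDl ?nm_ge0 // mulrA [_^-1 * _]mulrC hr.
Qed.

Lemma hasDN f p L : hasD f p L -> hasD (fun q => - f q) p (fun v => - L v).
Proof.
move=> /(hasDZ (-1)) h; apply: (@hasD_ext (fun q => -1 *: f q)).
  by near=> q; rewrite scaleN1r.
by apply: hasD_eqD h _ => v; rewrite scaleN1r.
Unshelve. all: by end_near. Qed.

Lemma hasDB f g p L L' : hasD f p L -> hasD g p L' ->
  hasD (fun q => f q - g q) p (fun v => L v - L' v).
Proof. by move=> h h'; apply: hasDD => //; apply: hasDN. Qed.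

Lemma hasD_sum (I : Type) (s : seq I) (F : I -> V -> W) (L : I -> V -> W) p :
  (forall i, hasD (F i) p (L i)) ->
  hasD (fun q => \sum_(i <- s) F i q) p (fun v => \sum_(i <- s) L i v).
Proof.
move=> h; elim: s => [|i s IH].
  under eq_fun do rewrite big_nil.
  by apply: hasD_eqD (hasD_cst _ _) _ => v; rewrite big_nil.
under eq_fun do rewrite big_cons.
by apply: hasD_eqD (hasDD (h i) IH) _ => v; rewrite big_cons.
Qed.

Lemma hasD_unique f p L L' : hasD f p L -> hasD f p L' -> forall v, L v = L' v.
Proof. by move=> /hasD_diff[_ h] /hasD_diff[_ h'] v; rewrite -h -h'. Qed.

Lemma hasD_lipschitz f p L : hasD f p L -> exists2 c : R, 0 <= c &
  exists2 r : R, 0 < r & forall w, nm w < r -> nm (f (p + w) - f p) <= c * nm w.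
Proof.
move=> [[l [c c0 hc]] h]; have [r r0 hr] := h 1 ltr01.
exists (c + 1); first by rewrite addr_ge0.
exists r => // w wr; rewrite -[f _ - _](subrK (L w)) (le_trans (nmD _ _)) //.
by rewrite mulrDl addrC lerD ?hc ?hr.
Qed.

Lemma hasD_cont f p L : hasD f p L -> forall eps : R, 0 < eps ->
  exists2 r : R, 0 < r & forall q, nm (q - p) < r -> nm (f q - f p) < eps.
Proof.
move=> /hasD_lipschitz[c c0 [r r0 h]] eps eps0.
exists (Num.min r (eps / (c + 1))).
  by rewrite lt_min r0 divr_gt0 // ltr_wpDl.
move=> q; rewrite lt_min => /andP[q1 q2].
have -> : q = p + (q - p) by rewrite addrC subrK.
apply: (le_lt_trans (h _ q1)); move: q2; rewrite ltr_pdivlMr ?ltr_wpDl // => q2.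
by apply: le_lt_trans q2; rewrite mulrC ler_wpM2l ?nm_ge0 // lerDl.
Qed.

(* A quadratic remainder is the form in which differentials of limits are obtained. *)
Lemma hasD_quadratic f p L (c r : R) : blinear L -> 0 < r ->
  (forall w, nm w < r -> nm (f (p + w) - f p - L w) <= c * nm w ^+ 2) ->
  hasD f p L.
Proof.
move=> bL r0 h; split => // eps eps0.
exists (Num.min r (eps / (`|c| + 1))).
  by rewrite lt_min r0 divr_gt0 // ltr_wpDl.
move=> w; rewrite lt_min => /andP[w1 w2]; apply: (le_trans (h _ w1)).
rewrite expr2 mulrA ler_wpM2r ?nm_ge0 //.
move: w2; rewrite ltr_pdivlMr ?ltr_wpDl // => /ltW; apply: le_trans.
by rewrite mulrC ler_wpM2l ?nm_ge0 // (le_trans (ler_norm _)) // lerDl.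
Qed.

End Rules.

Lemma hasD_comp (U V W : normedModType C) (f : U -> V) (g : V -> W) p L L' :
  hasD f p L -> hasD g (f p) L' -> hasD (fun q => g (f q)) p (fun v => L' (L v)).
Proof.
move=> hf; have [c c0 [r r0 hr]] := hasD_lipschitz hf.
case: hf => [bL hL] [bL' hL']; split; first exact: blinear_comp.
move=> eps eps0; have [l' [c' c0' hc']] := bL'.
have e1 : 0 < eps / 2 / (c + 1) by rewrite !divr_gt0 // ltr_wpDl.
have e2 : 0 < eps / 2 / (c' + 1) by rewrite !divr_gt0 // ltr_wpDl.
have [d d0 hd] := hL' _ e1; have [s s0 hs] := hL _ e2.
exists (Num.min r (Num.min s (d / (c + 1)))).
  by rewrite !lt_min r0 s0 divr_gt0 // ltr_wpDl.
move=> w; rewrite !lt_min => /and3P[w1 w2 w3].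
have a1 : nm (f (p + w) - f p) <= c * nm w by exact: hr.
have a2 : nm (f (p + w) - f p) < d.
  apply: (le_lt_trans a1); move: w3; rewrite ltr_pdivlMr ?ltr_wpDl //.
  by apply: le_lt_trans; rewrite mulrC ler_wpM2l ?nm_ge0 // lerDl.
have := hd _ a2; rewrite [f p + _]addrC subrK => b1.
have -> : g (f (p + w)) - g (f p) - L' (L w) =
  (g (f (p + w)) - g (f p) - L' (f (p + w) - f p)) + L' (f (p + w) - f p - L w).
  by rewrite [L' (_ - L w)](linear_add l') -[- L w]scaleN1r (linear_scale l') scaleN1r addrA subrK.
rewrite (le_trans (nmD _ _)) // [eps]splitr mulrDl lerD //.
  apply: (le_trans b1); rewrite -mulrA; apply: ler_wpM2l; first by rewrite divr_ge0 // ltW.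
  rewrite ler_pdivrMl ?ltr_wpDl //.
  by rewrite (le_trans a1) // ler_wpM2r ?nm_ge0 // lerDl.
apply: (le_trans (hc' _)).
apply: (@le_trans _ _ ((c' + 1) * nm (f (p + w) - f p - L w))).
  by rewrite ler_wpM2r ?nm_ge0 // lerDl.
by rewrite -ler_pdivlMl ?ltr_wpDl // mulrA [_^-1 * _]mulrC; apply: hs.
Qed.

Lemma hasD_mulmx (V : normedModType C) m n k (f : V -> 'M[C]_(m, n))
    (g : V -> 'M[C]_(n, k)) p L L' :
  hasD f p L -> hasD g p L' ->
  hasD (fun q => f q *m g q) p (fun v => L v *m g p + f p *m L' v).
Proof.
move=> hf hg; have [c c0 [r r0 hr]] := hasD_lipschitz hg.
have [c1 c10 [r1 r10 hr1]] := hasD_lipschitz hf.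
case: hf hg => [bL hL] [bL' hL'].
split; first by apply: blinearD; [apply: blinear_mulmxr|apply: blinear_mulmxl].
move=> eps eps0.
pose K : R := n%:R + 1; have K0 : 0 < K by rewrite ltr_wpDl.
have nK : n%:R <= K by rewrite lerDl.
have e3 : 0 < eps / 3 by rewrite divr_gt0.
have e1 : 0 < eps / 3 / (K * (nm (g p) + 1)).
  by rewrite divr_gt0 // mulr_gt0 // ltr_wpDl ?nm_ge0.
have e2 : 0 < eps / 3 / (K * (nm (f p) + 1)).
  by rewrite divr_gt0 // mulr_gt0 // ltr_wpDl ?nm_ge0.
have e4 : 0 < eps / 3 / (K * (c1 * c + 1)).
  by rewrite divr_gt0 // mulr_gt0 // ltr_wpDl // mulr_ge0.
have [d d0 hd] := hL _ e1; have [s s0 hs] := hL' _ e2.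
exists (Num.min r (Num.min r1 (Num.min d (Num.min s (eps / 3 / (K * (c1 * c + 1))))))).
  by rewrite !lt_min r0 r10 s0 d0.
move=> w; rewrite !lt_min => /and5P[w1 w2 w3 w4 w5].
have -> : f (p + w) *m g (p + w) - f p *m g p - (L w *m g p + f p *m L' w) =
  (f (p + w) - f p - L w) *m g p + f p *m (g (p + w) - g p - L' w)
   + (f (p + w) - f p) *m (g (p + w) - g p).
  rewrite !(mulmxBl, mulmxBr).
  move: (f (p + w) *m g (p + w)) (f (p + w) *m g p) (f p *m g (p + w)).
  move: (f p *m g p) (L w *m g p) (f p *m L' w) => x1 x2 x3 x4 x5 x6.
  by apply/matrixP => i j; rewrite !mxE; ring.
have -> : eps * nm w = (eps / 3 + eps / 3 + eps / 3) * nm w by congr (_ * _); field.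
rewrite !mulrDl (le_trans (nmD _ _)) // lerD ?(le_trans (nmD _ _)) ?lerD //.
- apply: (le_trans (nm_mulmx _ _)).
  apply: (@le_trans _ _ (K * (nm (g p) + 1) * nm (f (p + w) - f p - L w))).
    rewrite -mulrA ler_pM ?mulr_ge0 ?nm_ge0 // mulrC ler_wpM2r ?nm_ge0 //.
    by rewrite lerDl.
  rewrite -ler_pdivlMl ?mulr_gt0 ?ltr_wpDl ?nm_ge0 // mulrA [_^-1 * _]mulrC.
  exact: hd.
- apply: (le_trans (nm_mulmx _ _)).
  apply: (@le_trans _ _ (K * (nm (f p) + 1) * nm (g (p + w) - g p - L' w))).
    rewrite -mulrA ler_pM ?mulr_ge0 ?nm_ge0 // ler_wpM2r ?nm_ge0 //.
    by rewrite lerDl.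
  rewrite -ler_pdivlMl ?mulr_gt0 ?ltr_wpDl ?nm_ge0 // mulrA [_^-1 * _]mulrC.
  exact: hs.
- apply: (le_trans (nm_mulmx _ _)).
  apply: (@le_trans _ _ (K * (c1 * c + 1) * nm w * nm w)).
    rewrite -!mulrA ler_pM ?mulr_ge0 ?nm_ge0 //.
    apply: (@le_trans _ _ ((c1 * nm w) * (c * nm w))).
      by rewrite ler_pM ?nm_ge0 ?hr ?hr1.
    rewrite mulrACA [in leRHS]mulrA -[nm w * nm w]mulr1 -[in leRHS]mulrA.
    by rewrite mulr1 ler_wpM2r ?mulr_ge0 ?nm_ge0 // lerDl.
  rewrite ler_wpM2r ?nm_ge0 // -ler_pdivlMl ?mulr_gt0 ?ltr_wpDl ?mulr_ge0 //.
  by rewrite mulrC ltW.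
Qed.

End Calculus.

(** * The mean value inequality *)

Section MeanValue.
Variable R : realType.
Local Notation C := (Cplx R).

Section Segment.
Variable V : normedModType C.

(** [g] stands for the real or the imaginary part: a real-linear functional bounded by the norm. The
    real mean value theorem is applied to [r |-> g (f (p + r v))]. *)
Lemma mvt_real (f : V -> C) (g : C -> R) p v (L : R -> V -> C) c :
  (forall a b, g (a + b) = g a + g b) -> (forall a, g (- a) = - g a) ->
  (forall (r : R) a, g (creal r * a) = r * g a) ->
  (forall a, `|g a| <= nm a) ->
  (forall r : R, 0 <= r <= 1 -> hasD f (p + creal r *: v) (L r)) ->
  (forall r : R, 0 <= r <= 1 -> nm (L r v) <= c) ->
  `|g (f (p + v) - f p)| <= c.
Proof.
move=> gD gN gZ gle hf hL.
pose phi (r : R) := g (f (p + creal r *: v)).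
have dphi (r : R) : 0 <= r <= 1 -> is_derive r 1 phi (g (L r v)).
  move=> r01; have [bL h] := hf r r01.
  apply: is_derive_eps => eps eps0.
  have e0 : 0 < eps / (nm v + 1) by rewrite divr_gt0 // ltr_wpDl ?nm_ge0.
  have [d d0 hd] := h _ e0.
  exists (d / (nm v + 1)) => [|k hk]; first by rewrite divr_gt0 // ltr_wpDl ?nm_ge0.
  have e : `|k| * nm v <= `|k| * (nm v + 1) by rewrite ler_wpM2l // lerDl.
  have hw : nm (creal k *: v) < d.
    rewrite nmZ nm_creal (le_lt_trans e) //.
    by rewrite -ltr_pdivlMr // ltr_wpDl ?nm_ge0.
  have := hd _ hw; rewrite -[X in f X - _]addrA -scalerDl -(crealD r k) => hd'.
  have -> : phi (r + k) - phi r - g (L r v) * k =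
     g (f (p + creal (r + k) *: v) - f (p + creal r *: v) - L r (creal k *: v)).
    rewrite !gD !gN (linear_scale bL.1) /phi; congr (_ - _).
    by rewrite mulrC -gZ.
  apply: (le_trans (gle _)); apply: (le_trans hd').
  rewrite nmZ nm_creal -mulrA ler_wpM2l ?(ltW eps0) //.
  by rewrite mulrC ler_pdivrMr ?ltr_wpDl ?nm_ge0.
have cphi : {within `[0, 1], continuous phi}.
  apply: derivable_within_continuous => x; rewrite in_itv /= => x01.
  by have [] := dphi x x01.
have dphi' (x : R) : x \in `]0, 1[%R -> is_derive x 1 phi (g (L x v)).
  by rewrite in_itv /= => /andP[x0 x1]; apply: dphi; rewrite !ltW.
have [x x01] := MVT_segment ler01 dphi' cphi.
rewrite /phi scale1r scale0r addr0 subr0 mulr1 gD gN => ->.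
by apply: (le_trans (gle _)); apply: hL; move: x01; rewrite in_itv.
Qed.

Lemma cRe_creal (r : R) (a : C) : cRe (creal r * a) = r * cRe a.
Proof. by case: a => x y; rewrite /cRe /creal /=; ring. Qed.

Lemma cIm_creal (r : R) (a : C) : cIm (creal r * a) = r * cIm a.
Proof. by case: a => x y; rewrite /cIm /creal /=; ring. Qed.

Lemma cReD (a b : C) : cRe (a + b) = cRe a + cRe b.
Proof. by case: a => x y; case: b. Qed.
Lemma cImD (a b : C) : cIm (a + b) = cIm a + cIm b.
Proof. by case: a => x y; case: b. Qed.
Lemma cReN (a : C) : cRe (- a) = - cRe a. Proof. by case: a. Qed.
Lemma cImN (a : C) : cIm (- a) = - cIm a. Proof. by case: a. Qed.

(** Real and imaginary parts attain their mean values at different points, so they are bounded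
    separately; this is the source of the factor 2 in all later constants. *)
Lemma mvt_scalar (f : V -> C) p v (L : R -> V -> C) c :
  (forall r : R, 0 <= r <= 1 -> hasD f (p + creal r *: v) (L r)) ->
  (forall r : R, 0 <= r <= 1 -> nm (L r v) <= c) ->
  nm (f (p + v) - f p) <= 2 * c.
Proof.
move=> h1 h2; apply: (le_trans (nm_le_ReIm _)); rewrite mulr_natl mulr2n lerD //.
  exact: (mvt_real cReD cReN cRe_creal (@cRe_le_nm R) h1 h2).
exact: (mvt_real cImD cImN cIm_creal (@cIm_le_nm R) h1 h2).
Qed.

Lemma hasD_entry m n (f : V -> 'M[C]_(m, n)) p L i j : hasD f p L ->
  hasD (fun q => f q i j : C) p (fun v => L v i j).
Proof.
move=> [bL h]; split; first exact: blinear_entry.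
move=> eps eps0; have [r r0 hr] := h _ eps0; exists r => // w wr.
by apply: le_trans (hr w wr); have := nm_entry (f (p + w) - f p - L w) i j; rewrite !mxE.
Qed.

Lemma mvt m n (f : V -> 'M[C]_(m, n)) p v (L : R -> V -> 'M[C]_(m, n)) c :
  (forall r : R, 0 <= r <= 1 -> hasD f (p + creal r *: v) (L r)) ->
  (forall r : R, 0 <= r <= 1 -> nm (L r v) <= c) ->
  nm (f (p + v) - f p) <= 2 * c.
Proof.
move=> h1 h2; apply: nm_mxle => [|i j].
  by rewrite mulr_ge0 // (le_trans (nm_ge0 _) (h2 0 _)) // lexx ler01.
have := @mvt_scalar (fun q => f q i j) p v (fun r w => L r w i j) c.
rewrite !mxE; apply => r r01; first exact/hasD_entry/h1.
exact: le_trans (nm_entry _ _ _) (h2 r r01).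
Qed.

(** The uniqueness principle behind everything that follows: solutions are compared by finding a
    combination whose differential vanishes along a segment. *)
Lemma hasD0_segment m n (f : V -> 'M[C]_(m, n)) p q :
  (forall r : R, 0 <= r <= 1 -> hasD f (p + creal r *: (q - p)) (fun=> 0)) -> f q = f p.
Proof.
move=> h; have H := mvt h (c := 0); rewrite mulr0 in H.
apply/subr0_eq/nm_eq0/eqP; rewrite eq_le nm_ge0 andbT.
move: H; rewrite [p + _]addrC subrK; apply => r _.
by rewrite nm0.
Qed.

Lemma segment_ball (p q p0 : V) (d r : R) : 0 <= r <= 1 ->
  nm (p - p0) < d -> nm (q - p0) < d -> nm (p + creal r *: (q - p) - p0) < d.
Proof.
move=> /andP[r0 r1] hp hq.
have -> : p + creal r *: (q - p) - p0 =
  creal (1 - r) *: (p - p0) + creal r *: (q - p0).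
  rewrite crealD crealN creal1 scalerDl scale1r scaleNr !scalerDr !scalerN.
  set a := creal r *: p; set b := creal r *: q; set e := creal r *: p0.
  rewrite -[RHS]addrA opprB.
  have -> : e - a + (b - e) = b - a by rewrite addrC addrA subrK.
  by rewrite addrAC.
apply: (le_lt_trans (nmD _ _)).
rewrite !nmZ !nm_creal !ger0_norm ?subr_ge0 //.
move: r0; rewrite le0r => /orP[/eqP ->|r0].
  by rewrite subr0 mul1r mul0r addr0.
apply: (@lt_le_trans _ _ ((1 - r) * d + r * d)); last by rewrite -mulrDl subrK mul1r.
rewrite ler_ltD ?ltr_pM2l // ler_wpM2l ?subr_ge0 //; exact: ltW.
Qed.

End Segment.

Lemma geometric_limit m n (u : nat -> 'M[C]_(m, n)) (c q : R) : 0 <= q < 1 ->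
  (forall k, nm (u k.+1 - u k) <= c * q ^+ k) ->
  exists l, forall k, nm (u k - l) <= 2 * (c * q ^+ k / (1 - q)).
Proof.
move=> q01 h.
have hr i j : {l : R | forall k, `|cRe (u k i j) - l| <= c * q ^+ k / (1 - q)}.
  apply: cid; apply: geometric_limit_real => // k.
  rewrite -cReN -cReD; apply: le_trans (cRe_le_nm _) _; apply: le_trans (h k).
  by have := nm_entry (u k.+1 - u k) i j; rewrite !mxE.
have hi i j : {l : R | forall k, `|cIm (u k i j) - l| <= c * q ^+ k / (1 - q)}.
  apply: cid; apply: geometric_limit_real => // k.
  rewrite -cImN -cImD; apply: le_trans (cIm_le_nm _) _; apply: le_trans (h k).
  by have := nm_entry (u k.+1 - u k) i j; rewrite !mxE.
exists (\matrix_(i, j) Complex (projT1 (hr i j)) (projT1 (hi i j)) : 'M[C]_(m, n)) => k.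
apply: nm_mxle => [|i j].
  have /andP[q0 q1] := q01.
  rewrite mulr_ge0 // divr_ge0 ?subr_ge0 ?(ltW q1) //.
  exact: le_trans (nm_ge0 _) (h k).
rewrite !mxE (le_trans (nm_le_ReIm _)) // mulr_natl mulr2n lerD //.
  by rewrite cReD cReN; case: (hr i j) => /= l hl.
by rewrite cImD cImN; case: (hi i j) => /= l hl.
Qed.

End MeanValue.

(** * Differential of the inverse matrix *)

Section Inverse.
Variable R : realType.
Local Notation C := (Cplx R).

Lemma eq_ler (x y : R) : x = y -> x <= y.
Proof. by move=> ->. Qed.

(** If [X B = 0] then [X = - X (B - A) A^-1] has at most half its own norm, so [X = 0]. The same
    estimate applied to [X = B^-1] bounds the inverse. The factors [m] appear because the entrywise
    maximum norm is only submultiplicative up to the size. *)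
Lemma unitmx_near m (A B : 'M[C]_m) : A \in unitmx ->
  m%:R * (m%:R * (nm (invmx A) * nm (B - A))) <= 1 / 2 ->
  B \in unitmx /\ nm (invmx B) <= 2 * nm (invmx A).
Proof.
move=> uA hB.
have key k (X : 'M[C]_(k, m)) : nm (X *m ((B - A) *m invmx A)) <= 1 / 2 * nm X.
  apply: (le_trans (nm_mulmx _ _)); rewrite mulrCA mulrC ler_wpM2r ?nm_ge0 //.
  apply: le_trans hB; rewrite ler_wpM2l // [nm (invmx A) * _]mulrC.
  exact: nm_mulmx.
have uB : B \in unitmx.
  rewrite -row_free_unit -kermx_eq0; apply/eqP/nm_eq0.
  have := key _ (kermx B); rewrite mulmxA mulmxBr mulmx_ker sub0r mulNmx mulmxK //.
  by rewrite nmN; have := nm_ge0 (kermx B); lra.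
split => //.
have e : invmx B = invmx A - invmx B *m ((B - A) *m invmx A).
  by rewrite mulmxA mulmxBr mulVmx // mulmxBl mul1mx mulmxK // opprB addrC subrK.
have := key _ (invmx B); have := nmB (invmx A) (invmx B *m ((B - A) *m invmx A)).
by rewrite -e; lra.
Qed.

Lemma hasD_unit_near (V : normedModType C) m (f : V -> 'M[C]_m) p L :
  hasD f p L -> f p \in unitmx ->
  exists2 r : R, 0 < r & forall q, nm (q - p) < r ->
    f q \in unitmx /\ nm (invmx (f q)) <= 2 * nm (invmx (f p)).
Proof.
move=> hf up; set K : R := m%:R * m%:R * nm (invmx (f p)).
have K0 : 0 <= K by rewrite !mulr_ge0 ?nm_ge0.
have e0 : 0 < 1 / 2 / (K + 1) by rewrite !divr_gt0 // ltr_wpDl.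
have [r r0 hr] := hasD_cont hf e0; exists r => // q qr.
apply: unitmx_near => //; have := hr q qr; rewrite ltr_pdivlMr ?ltr_wpDl //.
move=> /ltW; apply: le_trans; rewrite !mulrA -/K mulrC ler_wpM2l ?nm_ge0 //.
by rewrite lerDl.
Qed.

(** Splits the remainder of the inverse into a product of two increments, which is quadratically
    small, and the conjugate of the remainder [E - L] of the matrix itself. *)
Lemma inverse_remainder m (A B E L : 'M[C]_m) : B - A = - (B *m E *m A) ->
  B - A - - (A *m L *m A) = - ((B - A) *m E *m A) - A *m (E - L) *m A.
Proof.
move=> BA; rewrite {1}BA !(mulmxBl, mulmxBr) opprK.
move: (B *m E *m A) (A *m E *m A) (A *m L *m A) => x y z.
by apply/matrixP => i j; rewrite !mxE; ring.
Qed.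

Lemma hasD_invmx (V : normedModType C) m (f : V -> 'M[C]_m) p L :
  hasD f p L -> f p \in unitmx ->
  hasD (fun q => invmx (f q)) p (fun v => - (invmx (f p) *m L v *m invmx (f p))).
Proof.
move=> hf up; have [r r0 hr] := hasD_unit_near hf up.
have [c c0 [s s0 hs]] := hasD_lipschitz hf.
case: hf => [bL h]; split.
  by apply/blinearN/blinear_mulmxr/blinear_mulmxl.
set A := invmx (f p); set N := nm A; have N0 : 0 <= N by exact: nm_ge0.
pose M : R := m%:R; have M0 : 0 <= M by [].
move=> eps eps0.
(* [K] controls the conjugated remainder, [c1] is a Lipschitz constant of the inverse and [K2]
   controls the quadratic part. Each part is allowed [eps / 2]; adding 1 keeps the divisors
   positive. *)
pose K := M * (M * N * N) + 1; have K0 : 0 < K by rewrite ltr_wpDl // !mulr_ge0.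
pose c1 := M * (M * (2 * N) * c) * N; have c10 : 0 <= c1 by rewrite !mulr_ge0.
pose K2 := M * (M * c1 * c) * N + 1; have K20 : 0 < K2 by rewrite ltr_wpDl // !mulr_ge0.
have e1 : 0 < eps / 2 / K by rewrite !divr_gt0.
have [d d0 hd] := h _ e1.
exists (Num.min r (Num.min s (Num.min d (eps / 2 / K2)))).
  by rewrite !lt_min r0 s0 d0 !divr_gt0.
move=> w; rewrite !lt_min => /and4P[w1 w2 w3 w4].
have [uB nB] : f (p + w) \in unitmx /\ nm (invmx (f (p + w))) <= 2 * N.
  by apply: hr; rewrite addrC addKr.
set B := invmx (f (p + w)) in nB *.
set E := f (p + w) - f p.
have BA : B - A = - (B *m E *m A).
  by rewrite /E mulmxBr mulVmx // mulmxBl mul1mx -mulmxA mulmxV // mulmx1 opprB.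
have -> : B - A - - (A *m L w *m A) = - ((B - A) *m E *m A) - A *m (E - L w) *m A.
  exact: inverse_remainder.
have nE : nm E <= c * nm w by exact: hs.
have mm a b (X : 'M[C]_(a, m)) (Y : 'M[C]_(m, b)) (x y : R) :
    nm X <= x -> nm Y <= y -> nm (X *m Y) <= M * x * y.
  move=> hx hy; apply: (le_trans (nm_mulmx _ _)); rewrite -mulrA ler_wpM2l //.
  by rewrite ler_pM ?nm_ge0.
have nX : nm (B - A) <= c1 * nm w.
  rewrite BA nmN; apply: (le_trans (mm _ _ _ _ _ _ (mm _ _ _ _ _ _ nB nE) (lexx _))).
  by apply: eq_ler; rewrite /c1 /N; ring.
have -> : eps = eps / 2 + eps / 2 by rewrite -splitr.
rewrite (le_trans (nmB _ _)) // nmN mulrDl lerD //.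
  apply: (le_trans (mm _ _ _ _ _ _ (mm _ _ _ _ _ _ nX nE) (lexx _))).
  apply: (@le_trans _ _ (K2 * nm w * nm w)).
    have -> : M * (M * (c1 * nm w) * (c * nm w)) * nm A = (K2 - 1) * nm w * nm w.
      by rewrite /K2 /N; ring.
    by rewrite -!mulrA ler_wpM2r ?mulr_ge0 ?nm_ge0 // gerDl lerN10.
  by rewrite ler_wpM2r ?nm_ge0 // mulrC -ler_pdivlMr // ltW.
apply: (le_trans (mm _ _ _ _ _ _ (mm _ _ _ _ _ _ (lexx _) (lexx _)) (lexx _))).
apply: (@le_trans _ _ (K * nm (E - L w))).
  have -> : M * (M * nm A * nm (E - L w)) * nm A = (K - 1) * nm (E - L w).
    by rewrite /K /N; ring.
  by rewrite ler_wpM2r ?nm_ge0 // gerDl lerN10.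
rewrite -ler_pdivlMl // mulrA [_^-1 * _]mulrC; exact: hd.
Qed.

End Inverse.

(** * Closure properties of holomorphic maps *)

Section Holomorphic.
Variable R : realType.
Local Notation C := (Cplx R).
Local Notation hol := holomorphic_upto.

Lemma open_near (V : normedModType C) (D : set V) p : open D -> D p -> \forall q \near p, D q.
Proof. by move=> oD Dp; apply: open_nbhs_nbhs. Qed.

Lemma hol_hasD (V W : normedModType C) k (D : set V) (f : V -> W) p :
  hol k D f -> D p -> hasD f p (fun v => 'D_v f p).
Proof. by case: k => [|k] [h _] Dp; apply/diff_hasD/h. Qed.

Lemma hasD_derive (V W : normedModType C) (f : V -> W) p L :
  hasD f p L -> forall v, 'D_v f p = L v.
Proof. by move=> /hasD_diff[_]. Qed.

Lemma hol_pred (V W : normedModType C) k (D : set V) (f : V -> W) :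
  hol k.+1 D f -> hol k D f.
Proof.
elim: k f => [|k IH] f [h1 h2]; split=> // v; apply: IH; exact: h2.
Qed.

Lemma hol_D (V W : normedModType C) k (D : set V) (f : V -> W) v :
  hol k.+1 D f -> hol k D (fun p => 'D_v f p).
Proof. by move=> [_]; apply. Qed.

(** Openness of [D] turns agreement on [D] into agreement near each of its points, which is what
    derivatives see. *)
Lemma hol_ext (V W : normedModType C) k (D : set V) (f g : V -> W) : open D ->
  (forall p, D p -> f p = g p) -> hol k D f -> hol k D g.
Proof.
move=> oD; elim: k f g => [|k IH] f g e hf.
  have hD p : D p -> hasD g p (fun v => 'D_v f p).
    move=> Dp; apply: hasD_ext (hol_hasD hf Dp).
    by have := open_near oD Dp; apply: filterS => q; apply: e.
  by split => // p /hD/hasD_diff[].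
have hD p : D p -> hasD g p (fun v => 'D_v f p).
  move=> Dp; apply: hasD_ext (hol_hasD hf Dp).
  by have := open_near oD Dp; apply: filterS => q; apply: e.
split => [p /hD/hasD_diff[]//|v].
apply: IH (hol_D v hf) => p Dp.
by have [_ ->] := hasD_diff (hD p Dp).
Qed.

Lemma hol_S (V W : normedModType C) k (D : set V) (f : V -> W) (L : V -> V -> W) :
  open D -> (forall p, D p -> hasD f p (L p)) ->
  (forall v, hol k D (fun p => L p v)) -> hol k.+1 D f.
Proof.
move=> oD h h'; split => [p /h/hasD_diff[]//|v].
apply: hol_ext (h' v) => // p Dp.
by have [_ ->] := hasD_diff (h p Dp).
Qed.

Lemma hol_0 (V W : normedModType C) (D : set V) (f : V -> W) (L : V -> V -> W) :
  (forall p, D p -> hasD f p (L p)) -> hol 0 D f.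
Proof. by move=> h; split => // p /h/hasD_diff[]. Qed.

Lemma hol_cst (V W : normedModType C) k (D : set V) (a : W) : open D -> hol k D (fun=> a).
Proof.
move=> oD; elim: k a => [|k IH] a; first by apply: hol_0 => p _; apply: hasD_cst.
by apply: (hol_S (L := fun _ _ => 0)) => // p _; apply: hasD_cst.
Qed.

Lemma hol_blinear (V W W' : normedModType C) k (D : set V) (f : V -> W) (L : W -> W') :
  open D -> blinear L -> hol k D f -> hol k D (fun p => L (f p)).
Proof.
move=> oD bL; elim: k f => [|k IH] f hf.
  apply: (hol_0 (L := fun p v => L ('D_v f p))) => p Dp.
  by apply: (hasD_comp (hol_hasD hf Dp)); apply: hasD_lin.
apply: (hol_S (L := fun p v => L ('D_v f p))) => // [p Dp|v].
  by apply: (hasD_comp (hol_hasD hf Dp)); apply: hasD_lin.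
by apply: IH; apply: hol_D.
Qed.

Lemma holD (V W : normedModType C) k (D : set V) (f g : V -> W) :
  open D -> hol k D f -> hol k D g -> hol k D (fun p => f p + g p).
Proof.
move=> oD; elim: k f g => [|k IH] f g hf hg.
  by apply: hol_0 => p Dp; apply: hasDD; [apply: hol_hasD hf Dp|apply: hol_hasD hg Dp].
apply: (hol_S (L := fun p v => 'D_v f p + 'D_v g p)) => // [p Dp|v].
  by apply: hasDD; [apply: hol_hasD hf Dp|apply: hol_hasD hg Dp].
by apply: IH; apply: hol_D.
Qed.

Lemma hol_sum (V W : normedModType C) k (D : set V) (I : Type) (s : seq I) (F : I -> V -> W) :
  open D -> (forall i, hol k D (F i)) -> hol k D (fun p => \sum_(i <- s) F i p).
Proof.
move=> oD h; elim: s => [|i s IH].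
  by apply: hol_ext (hol_cst k 0 oD) => // p _; rewrite big_nil.
by apply: hol_ext (holD oD (h i) IH) => // p _; rewrite big_cons.
Qed.

Lemma holN (V W : normedModType C) k (D : set V) (f : V -> W) :
  open D -> hol k D f -> hol k D (fun p => - f p).
Proof. by move=> oD; apply: hol_blinear => //; apply/blinearN/blinear_id. Qed.

Lemma hol_mulmx (V : normedModType C) k (D : set V) m n l (f : V -> 'M[C]_(m, n))
   (g : V -> 'M[C]_(n, l)) :
  open D -> hol k D f -> hol k D g -> hol k D (fun p => f p *m g p).
Proof.
move=> oD; elim: k f g => [|k IH] f g hf hg.
  by apply: hol_0 => p Dp; apply: hasD_mulmx; [apply: hol_hasD hf Dp|apply: hol_hasD hg Dp].
apply: (hol_S (L := fun p v => 'D_v f p *m g p + f p *m 'D_v g p)) => // [p Dp|v].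
  by apply: hasD_mulmx; [apply: hol_hasD hf Dp|apply: hol_hasD hg Dp].
by apply: holD => //; apply: IH; do ?[exact: hol_D | exact: hol_pred].
Qed.

Lemma hol_invmx (V : normedModType C) k (D : set V) m (f : V -> 'M[C]_m) :
  open D -> (forall p, D p -> f p \in unitmx) -> hol k D f -> hol k D (fun p => invmx (f p)).
Proof.
move=> oD uf; elim: k => [|k IH] hf.
  by apply: hol_0 => p Dp; apply: hasD_invmx; [apply: hol_hasD hf Dp|apply: uf].
apply: (hol_S (L := fun p v => - (invmx (f p) *m 'D_v f p *m invmx (f p)))) => // [p Dp|v].
  by apply: hasD_invmx; [apply: hol_hasD hf Dp|apply: uf].
apply: holN => //; apply: hol_mulmx => //; last exact/IH/hol_pred.
by apply: hol_mulmx => //; [exact/IH/hol_pred|exact: hol_D].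
Qed.

Lemma hol_entry (V : normedModType C) k (D : set V) m n (f : V -> 'M[C]_(m, n)) i j :
  open D -> hol k D f -> hol k D (fun p => f p i j : C).
Proof.
move=> oD hf; apply: (hol_blinear (L := fun A : 'M[C]_(m, n) => A i j : C)) => //.
exact/blinear_entry/blinear_id.
Qed.

Lemma hasD_mx (V : normedModType C) m n (f : V -> 'M[C]_(m, n)) p (L : V -> 'M[C]_(m, n)) :
  (forall i j, hasD (fun q => f q i j : C) p (fun v => L v i j)) -> hasD f p L.
Proof.
move=> h.
have -> : f = fun q => \sum_i \sum_j f q i j *: delta_mx i j.
  by apply/funext => q; exact: matrix_sum_delta.
have hZ i j : hasD (fun q => f q i j *: (delta_mx i j : 'M[C]_(m, n))) p
    (fun v => L v i j *: delta_mx i j).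
  apply: (hasD_comp (h i j) (g := fun z : C => z *: (delta_mx i j : 'M[C]_(m, n)))
    (L' := fun z : C => z *: (delta_mx i j : 'M[C]_(m, n)))).
  by apply: hasD_lin; apply: blinear_scalel; apply: blinear_id.
apply: hasD_eqD (hasD_sum _ (fun i => hasD_sum _ (fun j => hZ i j))) _ => v.
by rewrite -matrix_sum_delta.
Qed.

Lemma hol_mx (V : normedModType C) k (D : set V) m n (f : V -> 'M[C]_(m, n)) :
  open D -> (forall i j, hol k D (fun p => f p i j : C)) -> hol k D f.
Proof.
move=> oD h.
apply: (hol_ext (f := fun q => \sum_i \sum_j f q i j *: delta_mx i j)) => // [p _|].
  by rewrite -matrix_sum_delta.
apply: hol_sum => // i; apply: hol_sum => // j.
apply: (hol_blinear (L := fun z : C => z *: (delta_mx i j : 'M[C]_(m, n)))) => //.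
by apply: blinear_scalel; apply: blinear_id.
Qed.

Lemma hasD_scalel (V : normedModType C) m n (a : V -> C) (f : V -> 'M[C]_(m, n)) p L L' :
  hasD a p L -> hasD f p L' ->
  hasD (fun q => a q *: f q) p (fun v => L v *: f p + a p *: L' v).
Proof.
move=> ha hf.
have bs : blinear (fun z : C => z%:M : 'M[C]_m).
  split; first by move=> b u v; rewrite /= raddfD scale_scalar_mx.
  by exists 1 => // v; rewrite mul1r nm_scalar_mx.
have -> : (fun q => a q *: f q) = (fun q => (a q)%:M *m f q).
  by apply/funext => q; rewrite mul_scalar_mx.
apply: hasD_eqD (hasD_mulmx (hasD_comp ha (hasD_lin _ bs)) hf) _ => v.
by rewrite !mul_scalar_mx.
Qed.

Lemma hol_scalel (V : normedModType C) k (D : set V) m n (a : V -> C) (f : V -> 'M[C]_(m, n)) :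
  open D -> hol k D a -> hol k D f -> hol k D (fun q => a q *: f q).
Proof.
move=> oD ha hf.
have bs : blinear (fun z : C => z%:M : 'M[C]_m).
  split; first by move=> b u v; rewrite /= raddfD scale_scalar_mx.
  by exists 1 => // v; rewrite mul1r nm_scalar_mx.
have -> : (fun q => a q *: f q) = (fun q => (a q)%:M *m f q).
  by apply/funext => q; rewrite mul_scalar_mx.
apply: hol_mulmx => //.
exact: (hol_blinear (L := fun z : C => z%:M : 'M[C]_m)).
Qed.

End Holomorphic.

(** * Uniform bounds near a point *)

Section LocalBounds.
Variable R : realType.
Local Notation C := (Cplx R).
Local Notation hol := holomorphic_upto.
Variables (m a b : nat) (D : set 'cV[C]_m) (f : 'cV[C]_m -> 'M[C]_(a, b)) (p0 : 'cV[C]_m).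
Hypotheses (oD : open D) (Dp0 : D p0).

Lemma hol_near_bound k (g : 'cV[C]_m -> 'M[C]_(a, b)) : hol k D g ->
  \forall q \near p0, nm (g q) <= nm (g p0) + 1.
Proof.
move=> /hol_hasD /(_ Dp0) h; have [r r0 hr] := hasD_cont h ltr01.
apply/nbhs_nmP; exists r => // q /hr/ltW qr.
by rewrite -[g q](subrK (g p0)) (le_trans (nmD _ _)) // addrC lerD2l.
Qed.

Lemma cV_sum (v : 'cV[C]_m) : v = \sum_i v i 0 *: delta_mx i 0.
Proof.
apply/matrixP => i j; rewrite ord1 summxE (bigD1 i) //= !mxE !eqxx mulr1.
by rewrite big1 ?addr0 // => k ki; rewrite !mxE eq_sym (negPf ki) mulr0.
Qed.

Lemma linear_cV (W : normedModType C) (L : 'cV[C]_m -> W) v : linear L ->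
  L v = \sum_i v i 0 *: L (delta_mx i 0).
Proof.
move=> l; rewrite {1}[v]cV_sum.
have Ls : forall (s : seq 'I_m) (F : 'I_m -> 'cV[C]_m),
   L (\sum_(i <- s) F i) = \sum_(i <- s) L (F i).
  by move=> s F; elim/big_rec2 : _ => [|i x y _ <-]; rewrite ?(linear_zero l) ?(linear_add l).
by rewrite Ls; apply: eq_bigr => i _; rewrite (linear_scale l).
Qed.

(** Second derivatives along basis vectors are differentiable, hence bounded near [p0]. The mean
    value inequality descends from there to Lipschitz bounds for the first derivatives and for [f],
    and to a quadratic Taylor remainder, all with one constant on one ball. *)
Lemma hol_local_bounds : hol 2 D f -> exists c r : R,
  [/\ 0 <= c, 0 < r, forall q, nm (q - p0) < r -> D q,
      (forall q v, nm (q - p0) < r -> nm (f q) <= c /\ nm ('D_v f q) <= c * nm v) &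
      forall p q, nm (p - p0) < r -> nm (q - p0) < r ->
      [/\ nm (f q - f p) <= c * nm (q - p),
        (forall v, nm ('D_v f q - 'D_v f p) <= c * nm (q - p) * nm v) &
        nm (f q - f p - 'D_(q - p) f p) <= c * nm (q - p) ^+ 2]].
Proof.
move=> hf.
pose e (i : 'I_m) : 'cV[C]_m := delta_mx i 0.
pose b1 := nm (f p0) + 1.
pose b2 i := nm ('D_(e i) f p0) + 1.
pose b3 i j := nm ('D_(e j) (fun p => 'D_(e i) f p) p0) + 1.
have nr : \forall q \near p0, [/\ D q, nm (f q) <= b1,
   forall i, nm ('D_(e i) f q) <= b2 i &
   forall i j, nm ('D_(e j) (fun p => 'D_(e i) f p) q) <= b3 i j].
  near=> q; split.
  - by near: q; exact: (open_near oD Dp0).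
  - by near: q; apply: hol_near_bound hf.
  - near: q; apply: filter_forall => i.
    by apply: (@hol_near_bound 1); apply: hol_D.
  - near: q; apply: filter_forall => i; apply: filter_forall => j.
    by apply: (@hol_near_bound 0); apply: hol_D; apply: hol_D.
have /nbhs_nmP[r r0 hr] := nr.
have b20 i : 0 <= b2 i by rewrite addr_ge0 ?nm_ge0.
have b30 i j : 0 <= b3 i j by rewrite addr_ge0 ?nm_ge0.
have b10 : 0 <= b1 by rewrite addr_ge0 ?nm_ge0.
clearbody b1 b2 b3; clear nr.
pose B2 := \sum_i b2 i; pose B3 := \sum_i \sum_j b3 i j.
have B20 : 0 <= B2 by apply: sumr_ge0 => i _; exact: b20.
have B30 : 0 <= B3 by apply: sumr_ge0 => i _; apply: sumr_ge0 => j _; exact: b30.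
have linD (k : nat) (g : 'cV[C]_m -> 'M[C]_(a, b)) q : hol k D g -> D q -> forall v,
    'D_v g q = \sum_i v i 0 *: 'D_(e i) g q.
  move=> hg Dq v; have [[l _] _] := hol_hasD hg Dq.
  exact: (@linear_cV _ (fun v => 'D_v g q) v l).
have bD1 q v : nm (q - p0) < r -> nm ('D_v f q) <= B2 * nm v.
  move=> /hr[Dq _ h2 _]; rewrite (linD _ _ _ hf Dq) (le_trans (nm_sum _ _ _)) //.
  rewrite mulr_suml ler_sum // => i _; rewrite nmZ mulrC ler_pM ?nm_ge0 //.
  exact: nm_entry.
have hD2 q v w : nm (q - p0) < r ->
    'D_w (fun p => 'D_v f p) q = \sum_i v i 0 *: 'D_w (fun p => 'D_(e i) f p) q.
  move=> /hr[Dq _ _ _].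
  have hS : hasD (fun p => \sum_i v i 0 *: 'D_(e i) f p) q
      (fun w => \sum_i v i 0 *: 'D_w (fun p => 'D_(e i) f p) q).
    by apply: hasD_sum => i; apply: hasDZ; apply: hol_hasD Dq; apply: hol_D hf.
  have H : hasD (fun p => 'D_v f p) q (fun w => \sum_i v i 0 *: 'D_w (fun p => 'D_(e i) f p) q).
    apply: hasD_ext hS.
    by have := open_near oD Dq; apply: filterS => p Dp; rewrite (linD _ _ _ hf Dp).
  exact: (hasD_derive H w).
have bD2 q v w : nm (q - p0) < r -> nm ('D_w (fun p => 'D_v f p) q) <= B3 * nm w * nm v.
  move=> qr; have [Dq _ _ h3] := hr q qr.
  rewrite hD2 // (le_trans (nm_sum _ _ _)) // -mulrA mulr_suml ler_sum // => i _.
  rewrite nmZ mulrC mulrA ler_pM ?nm_ge0 ?nm_entry //.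
  rewrite (linD 1 _ _ (hol_D _ hf) Dq) (le_trans (nm_sum _ _ _)) //.
  rewrite mulr_suml ler_sum // => j _; rewrite nmZ mulrC ler_pM ?nm_ge0 //.
  exact: nm_entry.
have seg p q (t : R) : 0 <= t <= 1 -> nm (p - p0) < r -> nm (q - p0) < r ->
   nm (p + creal t *: (q - p) - p0) < r by exact: segment_ball.
(* Each use of the mean value inequality costs a factor 2; the Taylor remainder uses it twice,
   whence the 4. *)
pose c := b1 + 2 * B2 + 4 * B3.
have cB2 : 2 * B2 <= c by rewrite /c; lra.
have cB3 : 4 * B3 <= c by rewrite /c; lra.
have L1 p q v : nm (p - p0) < r -> nm (q - p0) < r ->
    nm ('D_v f q - 'D_v f p) <= 2 * (B3 * nm (q - p) * nm v).
  move=> pr qr; have := @mvt _ _ _ _ (fun p => 'D_v f p) p (q - p)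
    (fun t w => 'D_w (fun p => 'D_v f p) (p + creal t *: (q - p))) (B3 * nm (q - p) * nm v).
  rewrite [p + (q - p)]addrC subrK; apply => t t01; last exact/bD2/seg.
  by apply: (hol_hasD (hol_D _ hf)); have [] := hr _ (seg _ _ _ t01 pr qr).
have c0 : 0 <= c by rewrite /c; lra.
exists c, r; split=> //.
- by move=> q /hr[].
- move=> q v qr; have [_ h1 _ _] := hr q qr; split; first by rewrite (le_trans h1) // /c; lra.
  by rewrite (le_trans (bD1 _ _ qr)) // ler_wpM2r ?nm_ge0 // (le_trans _ cB2) // mulr_natl mulr2n lerDl.
- move=> p q pr qr; split.
  + have := @mvt _ _ _ _ f p (q - p)
      (fun t w => 'D_w f (p + creal t *: (q - p))) (B2 * nm (q - p)).
    rewrite [p + (q - p)]addrC subrK => H.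
    apply: (@le_trans _ _ (2 * (B2 * nm (q - p)))); last by rewrite mulrA ler_wpM2r ?nm_ge0.
    apply: H => t t01; last exact/bD1/seg.
    by apply: (hol_hasD hf); have [] := hr _ (seg _ _ _ t01 pr qr).
  + move=> v; apply: (le_trans (L1 _ _ _ pr qr)); rewrite !mulrA.
    rewrite ler_wpM2r ?nm_ge0 // ler_wpM2r ?nm_ge0 // (le_trans _ cB3) //.
    by rewrite ler_wpM2r // ler_nat.
  + have [Dp _ _ _] := hr p pr.
    pose L w := 'D_w f p.
    have lin : blinear L := (hol_hasD hf Dp).1.
    have epq : p + (q - p) = q by rewrite addrC subrK.
    (* After subtracting the linear part, the derivative on the segment is a difference of first
       derivatives, already bounded by [L1]. *)
    have H := @mvt _ _ _ _ (fun x => f x - L (x - p)) p (q - p)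
      (fun t w => 'D_w f (p + creal t *: (q - p)) - L w) (2 * (B3 * nm (q - p) * nm (q - p))).
    have {}H : nm (f q - f p - L (q - p)) <= 2 * (2 * (B3 * nm (q - p) * nm (q - p))).
      have -> : f q - f p - L (q - p) = f q - L (q - p) - (f p - L (p - p)).
        have L0 : L (p - p) = 0 by have := linear_zero lin.1; rewrite -[X in L X = _ -> _](subrr p).
        by rewrite L0 [f p - 0]subr0 addrAC.
      rewrite -[X in nm (f X - L (X - p) - _)]epq; apply: H => t t01.
        apply: hasDB.
          by apply: (hol_hasD hf); have [] := hr _ (seg _ _ _ t01 pr qr).
        apply: hasD_eqD (hasD_comp (hasDB (hasD_lin _ (blinear_id _)) (hasD_cst p _)) (hasD_lin _ lin)) _.
        by move=> v; rewrite /= [v - 0]subr0.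
      apply: (le_trans (L1 _ _ _ pr (seg _ _ _ t01 pr qr))).
      have -> : p + creal t *: (q - p) - p = creal t *: (q - p) by rewrite addrC addKr.
      rewrite ler_wpM2l // ler_wpM2r ?nm_ge0 // ler_wpM2l // nmZ nm_creal.
      have /andP[t0 t1] := t01.
      by rewrite ger0_norm // ler_piMl ?nm_ge0.
    apply: (le_trans H); rewrite expr2 !mulrA ler_wpM2r ?nm_ge0 // ler_wpM2r ?nm_ge0 //.
    by rewrite (le_trans _ cB3) // -natrM.
Unshelve. all: by end_near. Qed.

End LocalBounds.

#[local] Opaque derive.

(** * Symmetry of mixed derivatives *)

Section Schwarz.
Variable R : realType.
Local Notation C := (Cplx R).
Local Notation hol := holomorphic_upto.

Lemma addDBl (V : zmodType) (p a b : V) : p + a + b - p = a + b.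
Proof. by rewrite addrC addrA addKr. Qed.

Lemma scale_telescope (W : lmodType C) (a : C) (x y z X : W) :
  a *: x - a *: y - (a * a) *: X = a *: (x - y - z + (z - a *: X)).
Proof. by rewrite addrA subrK !scalerBr scalerA. Qed.

Lemma nm_eq_small (V : normedModType C) (x y : V) (c r : R) : 0 < r ->
  (forall h : R, 0 < h -> h < r -> nm (x - y) <= c * h) -> x = y.
Proof.
move=> r0 H; apply/subr0_eq/nm_eq0/eqP; rewrite eq_le nm_ge0 andbT.
rewrite leNgt; apply/negP => xy0.
pose h := Num.min (r / 2) (nm (x - y) / (2 * (`|c| + 1))).
have h0 : 0 < h by rewrite lt_min !divr_gt0 // mulr_gt0 // ltr_wpDl.
have hr : h < r by rewrite gt_min; apply/orP; left; rewrite ltr_pdivrMr // ltr_pMr // ltrDl.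
have h2 : h * (2 * (`|c| + 1)) <= nm (x - y).
  by rewrite -ler_pdivlMr ?mulr_gt0 ?ltr_wpDl // ge_min lexx orbT.
have : c * h <= `|c| * h by rewrite ler_wpM2r ?ler_norm // ltW.
have := H h h0 hr; have := normr_ge0 c; nra.
Qed.

Lemma eq_quadratic_limit (V : normedModType C) (X Y : V) (S : R -> V) (c c' r r' : R) :
  0 < r -> 0 < r' ->
  (forall h : R, 0 < h -> h < r -> nm (S h - creal (h ^+ 2) *: X) <= c * h ^+ 3) ->
  (forall h : R, 0 < h -> h < r' -> nm (S h - creal (h ^+ 2) *: Y) <= c' * h ^+ 3) ->
  X = Y.
Proof.
move=> r0 r0' H H'.
apply: (@nm_eq_small _ _ _ (c + c') (Num.min r r')); first by rewrite lt_min r0.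
move=> h h0; rewrite lt_min => /andP[/(H _ h0) h1 /(H' _ h0) h2].
rewrite -(ler_pM2l (exprn_gt0 2 h0)).
have -> : h ^+ 2 * nm (X - Y) = nm (creal (h ^+ 2) *: X - creal (h ^+ 2) *: Y).
  by rewrite -scalerBr nmZ nm_creal ger0_norm ?sqr_ge0.
have -> : h ^+ 2 * ((c + c') * h) = c * h ^+ 3 + c' * h ^+ 3 by ring.
apply: le_trans (lerD h1 h2); rewrite (le_trans (nm_trans (S h) _ _)) //.
by rewrite nm_distC.
Qed.

(** The second difference is the increment over [[0, 1]] of [z |-> f (p + U + z V) - f (p + z V)].
    Its derivative is an increment of [g = D_v f], which the Taylor estimate replaces by [D_u g p]
    up to third order in [h]. *)
Lemma second_difference m a b (D : set 'cV[C]_m) (f : 'cV[C]_m -> 'M[C]_(a, b)) p u v :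
  open D -> D p -> hol 3 D f -> exists c r : R, 0 < r /\ forall h : R, 0 < h -> h < r ->
    nm (f (p + creal h *: u + creal h *: v) - f (p + creal h *: u)
        - f (p + creal h *: v) + f p
        - creal (h ^+ 2) *: 'D_u (fun q => 'D_v f q) p) <= c * h ^+ 3.
Proof.
move=> oD Dp hf; set g := fun q => 'D_v f q.
have hg : hol 2 D g by exact: hol_D.
have [c [r [c0 r0 inD _ H]]] := hol_local_bounds oD Dp hg.
pose nu := nm u; pose nv := nm v.
have nu0 : 0 <= nu by exact: nm_ge0. have nv0 : 0 <= nv by exact: nm_ge0.
exists (2 * (c * nu ^+ 2 + c * nv * nu)), (r / (nu + nv + 1)).
have d0 : 0 < nu + nv + 1 by rewrite ltr_wpDl // addr_ge0.
split=> [|h h0]; first exact: divr_gt0.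
rewrite ltr_pdivlMr // => hr.
set U := creal h *: u; set V := creal h *: v.
have nU : nm U = h * nu by rewrite nmZ nm_creal gtr0_norm.
have nV : nm V = h * nv by rewrite nmZ nm_creal gtr0_norm.
pose X := 'D_u g p.
(* The expected leading term is subtracted linearly in [z], so that the mean value inequality bounds
   exactly the error. *)
pose k (z : C) := f (p + U + z *: V) - f (p + z *: V) - z *: (creal (h ^+ 2) *: X).
have near (t s : R) : 0 <= t <= 1 -> 0 <= s <= 1 ->
    nm (p + creal s *: U + creal t *: V - p) < r.
  move=> /andP[t0 t1] /andP[s0 s1].
  rewrite addDBl.
  apply: (le_lt_trans (nmD _ _)); rewrite !nmZ !nm_creal -/nu -/nv !ger0_norm ?(ltW h0) //.
  have := mulr_ge0 (ltW h0) nu0; have := mulr_ge0 (ltW h0) nv0; nra.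
have h01 : 0 <= (0 : R) <= 1 by rewrite lexx ler01.
have h11 : 0 <= (1 : R) <= 1 by rewrite lexx ler01.
have bV (q : 'cV[C]_m) (z : C) : hasD (fun z : C => q + z *: V) z (fun w => w *: V).
  apply: hasD_eqD (hasDD (hasD_cst q z) (hasD_lin z (L := fun w : C => w *: V) _)) _.
    by apply: blinear_scalel; apply: blinear_id.
  by move=> w; rewrite add0r.
have bX (z : C) : hasD (fun z : C => z *: (creal (h ^+ 2) *: X)) z
     (fun w => w *: (creal (h ^+ 2) *: X)).
  by apply: hasD_lin; apply: blinear_scalel; apply: blinear_id.
have := @mvt R C a b k 0 1 (fun t w => 'D_(w *: V) f (p + U + creal t *: V)
   - 'D_(w *: V) f (p + creal t *: V) - w *: (creal (h ^+ 2) *: X))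
   (h ^+ 3 * (c * nu ^+ 2 + c * nv * nu)).
have -> : nm (k (0 + 1) - k 0) = nm (f (p + U + V) - f (p + U) - f (p + V) + f p - creal (h ^+ 2) *: X).
  congr nm; rewrite /k add0r !scale1r !scale0r !addr0 subr0.
  move: (f (p + U + V)) (f (p + U)) (f (p + V)) (f p) (creal _ *: X) => x1 x2 x3 x4 x5.
  by apply/matrixP => i j; rewrite !mxE; ring.
move=> Hm; apply: (le_trans (Hm _ _)).
- move=> t t01; rewrite add0r -[creal t *: 1]/(creal t * 1) mulr1.
  have q1 := near t 1 t01 h11; rewrite creal1 scale1r in q1.
  have q2 := near t 0 t01 h01; rewrite creal0 scale0r addr0 in q2.
  apply: hasDB; [apply: hasDB|exact: bX].
    exact: (hasD_comp (bV (p + U) _) (hol_hasD hf (inD _ q1))).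
  exact: (hasD_comp (bV p _) (hol_hasD hf (inD _ q2))).
- move=> t t01; rewrite !scale1r.
  have q1 := near t 1 t01 h11; rewrite creal1 scale1r in q1.
  have q2 := near t 0 t01 h01; rewrite creal0 scale0r addr0 in q2.
  have pp : nm (p - p) < r by rewrite subrr nm0.
  have l1 q : nm (q - p) < r -> 'D_V f q = creal h *: g q.
    by move=> /inD Dq; exact: (linear_scale (hol_hasD hf Dq).1.1).
  rewrite l1 // l1 //.
  set q := p + creal t *: V in q2 *.
  have eq : p + U + creal t *: V = q + U by rewrite /q addrAC.
  rewrite eq in q1 *.
  have [_ _ H1] := H q (q + U) q2 q1.
  have [_ H2 _] := H p q pp q2.
  have e1 : q + U - q = U by rewrite addrC addKr.
  rewrite e1 in H1.
  have e2 : 'D_U g q = creal h *: 'D_u g q by exact: (linear_scale (hol_hasD hg (inD _ q2)).1.1).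
  have e3 : 'D_U g p = creal h *: X by exact: (linear_scale (hol_hasD hg Dp).1.1).
  have := H2 U; rewrite e3 => {}H2.
  have nq : nm (q - p) <= h * nv.
    have /andP[t0 t1] := t01.
    rewrite /q addrC addKr nmZ nm_creal nV ger0_norm // ler_piMl // mulr_ge0 //; exact: ltW.
  have -> : creal h *: g (q + U) - creal h *: g q - creal (h ^+ 2) *: X =
     creal h *: ((g (q + U) - g q - 'D_U g q) + ('D_U g q - creal h *: X)).
    by rewrite (crealM h h); exact: scale_telescope.
  rewrite nmZ nm_creal gtr0_norm // exprS -mulrA ler_wpM2l ?(ltW h0) //.
  apply: (le_trans (nmD _ _)); rewrite mulrDr lerD //.
    by apply: (le_trans H1); rewrite nU exprMn mulrCA.
  apply: (le_trans H2); rewrite nU.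
  apply: (@le_trans _ _ (c * (h * nv) * (h * nu))).
    by rewrite ler_wpM2r ?mulr_ge0 ?(ltW h0) // ler_wpM2l.
  by apply: eq_ler; ring.
by apply: eq_ler; ring.
Qed.

(** The second difference is symmetric in [u] and [v], whereas its leading coefficient is one mixed
    derivative or the other depending on which direction is expanded first. *)
Lemma schwarz m a b (D : set 'cV[C]_m) (f : 'cV[C]_m -> 'M[C]_(a, b)) p u v :
  open D -> D p -> hol 3 D f ->
  'D_u (fun q => 'D_v f q) p = 'D_v (fun q => 'D_u f q) p.
Proof.
move=> oD Dp hf.
have [c [r [r0 H]]] := second_difference u v oD Dp hf.
have [c' [r' [r0' H']]] := second_difference v u oD Dp hf.
apply: (eq_quadratic_limit (c' := c') r0 r0' H) => h h0 hr.
by move: (H' h h0 hr); rewrite (addrAC p (creal h *: v)) (addrAC (f _) (- f (p + creal h *: v))).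
Qed.

End Schwarz.

(** * Flat linear systems *)

Section FlatExistence.
Variable R : realType.
Local Notation C := (Cplx R).

Lemma euler_bound (x : R) j N : 0 <= x -> (0 < N)%N -> (j <= N)%N ->
  (1 + x / N%:R) ^+ j <= expR x.
Proof.
move=> x0 N0 jN; have N0' : 0 < N%:R :> R by rewrite ltr0n.
have y0 : 0 <= x / N%:R by rewrite divr_ge0 // ltW.
apply: (@le_trans _ _ ((1 + x / N%:R) ^+ N)).
  by rewrite ler_weXn2l // lerDl.
have -> : expR x = expR (x / N%:R) ^+ N.
  by rewrite -expRM_natr divfK // gt_eqF.
by rewrite lerXn2r ?nnegrE ?expR_ge0 ?addr_ge0 ?expR_ge1Dx.
Qed.

Lemma le_small (x y c : R) : (forall l, x <= y + c * (1 / 2) ^+ l) -> x <= y.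
Proof.
move=> H; rewrite leNgt; apply/negP => xy.
pose d := x - y; have d0 : 0 < d by rewrite subr_gt0.
pose l := (Num.truncn (`|c| / d)).+1.
have l0 : `|c| / d < l%:R by exact: truncnS_gt.
have l2 : (l%:R : R) <= 2 ^+ l by rewrite -natrX ler_nat ltnW // ltn_expl.
have p0 : 0 < (1 / 2 : R) ^+ l by rewrite exprn_gt0.
have := H l; rewrite leNgt => /negP; apply.
rewrite -ltrBrDl -/d; apply: (@le_lt_trans _ _ (`|c| * (1 / 2) ^+ l)).
  by rewrite ler_wpM2r ?ler_norm // ltW.
have -> : (1 / 2 : R) ^+ l = (2 ^+ l)^-1 by rewrite expr_div_n expr1n mul1r.
rewrite ltr_pdivrMr ?exprn_gt0 // mulrC -ltr_pdivrMr //; exact: lt_le_trans l0 l2.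
Qed.

Section Gronwall.
Variables (k : nat) (N : nat) (e psi B : nat -> 'M[C]_k) (delta beta eps : R).
Hypotheses (delta0 : 0 <= delta) (eps0 : 0 <= eps) (beta0 : 0 <= beta).
Hypothesis eS : forall j, (j < N)%N -> e j.+1 = e j + creal delta *: (e j *m B j).
Hypothesis nB : forall j, (j < N)%N -> nm (B j) <= beta.

Lemma euler_step_bound j (X : 'M[C]_k) : (j < N)%N ->
  nm (X + creal delta *: (X *m B j)) <= nm X * (1 + k%:R * beta * delta).
Proof.
move=> jN; apply: (le_trans (nmD _ _)); rewrite mulrDr mulr1 lerD2l nmZ nm_creal ger0_norm //.
apply: (@le_trans _ _ (delta * (k%:R * (nm X * beta)))); last by apply: eq_ler; ring.
rewrite ler_wpM2l // (le_trans (nm_mulmx _ _)) // ler_wpM2l // ler_wpM2l ?nm_ge0 //.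
exact: nB.
Qed.

Lemma euler_growth j : (j <= N)%N -> nm (e j) <= nm (e 0%N) * (1 + k%:R * beta * delta) ^+ j.
Proof.
elim: j => [|j IH] jN; first by rewrite expr0 mulr1.
rewrite eS // (le_trans (euler_step_bound _ jN)) // exprSr mulrA ler_wpM2r ?IH //.
  by rewrite addr_ge0 // !mulr_ge0.
exact: ltnW.
Qed.

(** Every local error is carried along by the growth factor of the scheme, and at most [j] of them
    accumulate. It serves twice: to refine the polygon and to move its end point. *)
Lemma discrete_gronwall j : psi 0%N = e 0%N ->
  (forall i, (i < N)%N -> nm (psi i.+1 - (psi i + creal delta *: (psi i *m B i))) <= eps) ->
  (j <= N)%N -> nm (psi j - e j) <= j%:R * eps * (1 + k%:R * beta * delta) ^+ j.
Proof.
move=> e0 H; set X := 1 + k%:R * beta * delta.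
have X1 : 1 <= X by rewrite lerDl !mulr_ge0.
elim: j => [|j IH] jN; first by rewrite e0 subrr nm0 !mul0r.
have -> : psi j.+1 - e j.+1 = (psi j.+1 - (psi j + creal delta *: (psi j *m B j)))
   + ((psi j - e j) + creal delta *: ((psi j - e j) *m B j)).
  rewrite eS // mulmxBl scalerBr.
  move: (psi j.+1) (psi j) (e j) (creal delta *: (psi j *m B j)) (creal delta *: (e j *m B j)).
  by move=> x1 x2 x3 x4 x5; apply/matrixP => a b; rewrite !mxE; ring.
apply: (le_trans (nmD _ _)).
have h1 := H j jN.
have h2 : nm ((psi j - e j) + creal delta *: ((psi j - e j) *m B j)) <=
   j%:R * eps * X ^+ j * X.
  rewrite (le_trans (euler_step_bound _ jN)) // ler_wpM2r ?(le_trans ler01) //.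
  exact/IH/ltnW.
apply: (le_trans (lerD h1 h2)).
have e1 : 1 <= X ^+ j.+1 by exact: exprn_ege1.
have : eps <= eps * X ^+ j.+1 by rewrite ler_peMr.
rewrite -mulrA -exprSr -natr1; move: (X ^+ j.+1) => Z; lra.
Qed.

End Gronwall.

Section Euler.
Variables (m k : nat) (A : 'cV[C]_m -> 'cV[C]_m -> 'M[C]_k).
Variable (DA : 'cV[C]_m -> 'cV[C]_m -> 'cV[C]_m -> 'M[C]_k).
Variables (p0 : 'cV[C]_m) (r b : R).
Hypotheses (r0 : 0 < r) (r1 : r <= 1) (b0 : 0 <= b).
Hypothesis linA : forall p, linear (A p).
Hypothesis linDA : forall p v, linear (fun w => DA p w v).
Hypothesis H0 : forall p v, nm (p - p0) < r -> nm (A p v) <= b * nm v.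
Hypothesis H1 : forall p q v, nm (p - p0) < r -> nm (q - p0) < r ->
  nm (A q v - A p v) <= b * nm (q - p) * nm v.
Hypothesis H2 : forall p q v, nm (p - p0) < r -> nm (q - p0) < r ->
  nm (A q v - A p v - DA p (q - p) v) <= b * nm (q - p) ^+ 2 * nm v.
Hypothesis flat : forall p u v, nm (p - p0) < r ->
  DA p u v - DA p v u + A p u *m A p v - A p v *m A p u = 0.

Let K : R := k%:R.
Let c1 := expR (K * b).
(* Euler polygon for dPhi = Phi A along the segment from p0 to p0 + y. *)
Definition euler_pt (N j : nat) (y : 'cV[C]_m) := p0 + creal (j%:R / N%:R) *: y.

Fixpoint euler N j y : 'M[C]_k :=
  if j is j'.+1 then
    euler N j' y + creal N%:R^-1 *: (euler N j' y *m A (euler_pt N j' y) y)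
  else 1%:M.

Lemma eulerS N j y : euler N j.+1 y =
  euler N j y + creal N%:R^-1 *: (euler N j y *m A (euler_pt N j y) y).
Proof. by []. Qed.

Lemma euler0 N y : euler N 0 y = 1%:M. Proof. by []. Qed.
#[local] Opaque euler addn.

Lemma pt_double N i y : 0 < N%:R :> R -> euler_pt (N + N) (i + i) y = euler_pt N i y.
Proof.
rewrite /euler_pt !natrD; move: (N%:R : R) (i%:R : R) => x z x0; congr (_ + creal _ *: _).
by field; rewrite !gt_eqF ?addr_gt0.
Qed.

Lemma pt_end N y : 0 < N%:R :> R -> euler_pt N N y = p0 + y.
Proof. by move=> N0; rewrite /euler_pt divff ?gt_eqF // creal1 scale1r. Qed.

Lemma pt_step N i y : euler_pt N i.+1 y - euler_pt N i y = creal N%:R^-1 *: y.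
Proof.
rewrite /euler_pt opprD addrACA subrr add0r -scalerBl -crealN -crealD.
by congr (creal _ *: _); rewrite -mulrBl -natr1 addrC addKr mul1r.
Qed.

Lemma pt_shift N i y w : euler_pt N i (y + w) - euler_pt N i y = creal (i%:R / N%:R) *: w.
Proof. by rewrite /euler_pt opprD addrACA subrr add0r -scalerBr [y + w]addrC addrK. Qed.

Lemma nm_pt_step N i y : nm (euler_pt N i.+1 y - euler_pt N i y) = N%:R^-1 * nm y.
Proof. by rewrite pt_step nmZ nm_creal ger0_norm. Qed.

Lemma pt_ball N j y : (0 < N)%N -> (j <= N)%N -> nm y < r -> nm (euler_pt N j y - p0) < r.
Proof.
move=> N0 jN yr; rewrite /euler_pt addrC addKr nmZ nm_creal ger0_norm ?divr_ge0 //.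
apply: le_lt_trans yr; rewrite ler_piMl ?nm_ge0 // ler_pdivrMr ?ltr0n // mul1r.
by rewrite ler_nat.
Qed.

#[local] Opaque euler_pt.

Let K0 : 0 <= K. Proof. by []. Qed.
Let c10 : 0 <= c1. Proof. exact: expR_ge0. Qed.

Lemma A_ball N j y : (0 < N)%N -> (j <= N)%N -> nm y < r -> nm (A (euler_pt N j y) y) <= b.
Proof.
move=> N0 jN yr; apply: (le_trans (H0 _ (pt_ball N0 jN yr))).
by rewrite ler_piMr // (le_trans (ltW yr)).
Qed.

Lemma euler_factor N j : (0 < N)%N -> (j <= N)%N -> (1 + K * b * N%:R^-1) ^+ j <= c1.
Proof. by move=> N0 jN; apply: euler_bound => //; rewrite mulr_ge0. Qed.

Lemma euler_norm N j y : (0 < N)%N -> (j <= N)%N -> nm y < r -> nm (euler N j y) <= c1.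
Proof.
move=> N0 jN yr.
have := @euler_growth k N (fun j => euler N j y) (fun j => A (euler_pt N j y) y) N%:R^-1 b.
move=> /(_ _ b0 _ _ j jN); rewrite invr_ge0 ler0n => H.
apply: (@le_trans _ _ (1 * c1)); last by rewrite mul1r.
apply: (le_trans (H isT _ _)).
- by [].
- by move=> i iN; apply: A_ball => //; exact: ltnW.
rewrite ler_pM ?nm_ge0 ?exprn_ge0 ?addr_ge0 ?mulr_ge0 ?invr_ge0 //.
  by rewrite euler0 (le_trans (nm_scalar_mx _ _)) // nm1.
exact: euler_factor.
Qed.

Lemma nm_mulmx_le (X Y : 'M[C]_k) (x y : R) : nm X <= x -> nm Y <= y ->
  nm (X *m Y) <= K * (x * y).
Proof.
move=> hx hy; apply: (le_trans (nm_mulmx _ _)); rewrite ler_wpM2l //.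
by rewrite ler_pM ?nm_ge0.
Qed.

Lemma doubling_id (P a a' : 'M[C]_k) (h : C) :
  P + h *: (P *m a) + h *: ((P + h *: (P *m a)) *m a') - (P + (h + h) *: (P *m a)) =
  P *m (h *: (a' - a) + (h * h) *: (a *m a')).
Proof.
rewrite mulmxDr -!scalemxAr mulmxDl -scalemxAl mulmxBr mulmxA scalerDr scalerA.
rewrite scalerDl scalerBr.
move: (h *: (P *m a)) (h *: (P *m a')) ((h * h) *: (P *m a *m a')) => x1 x2 x3.
by apply/matrixP => i j; rewrite !mxE; ring.
Qed.

Lemma doubling_step (P a a' : 'M[C]_k) (h : R) : 0 <= h -> nm P <= c1 -> nm a <= b ->
  nm a' <= b -> nm (a' - a) <= b * h ->
  nm (P + creal h *: (P *m a) + creal h *: ((P + creal h *: (P *m a)) *m a')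
     - (P + (creal h + creal h) *: (P *m a))) <=
  K * (c1 * (h * (b * h) + h * h * (K * (b * b)))).
Proof.
move=> h0 nP na na' nd; rewrite doubling_id; apply: nm_mulmx_le => //.
apply: (le_trans (nmD _ _)); rewrite !nmZ nmM !nm_creal ger0_norm // lerD //.
  by rewrite ler_wpM2l.
by rewrite ler_wpM2l ?mulr_ge0 // nm_mulmx_le.
Qed.

(** One step and two half steps differ by order [N^-2]; over [N] steps this sums to order [N^-1].
    For [N = 2^l] the end points therefore form a geometric sequence. *)
Lemma euler_doubling N y : (0 < N)%N -> nm y < r ->
  nm (euler (N + N) (N + N) y - euler N N y) <= K * c1 * c1 * (b + K * (b * b)) / N%:R.
Proof.
move=> N0 yr.
have y1 : nm y <= 1 by exact: le_trans (ltW yr) r1.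
have NN0 : (0 < N + N)%N by rewrite addn_gt0 N0.
have NR0 : 0 < N%:R :> R by rewrite ltr0n.
pose h : R := (N + N)%:R^-1.
have hE : N%:R^-1 = h + h.
  rewrite /h natrD; move: NR0; move: (N%:R : R) => x x0.
  by field; rewrite !gt_eqF ?addr_gt0.
have h0 : 0 <= h by rewrite invr_ge0.
pose c := K * (c1 * (h * (b * h) + h * h * (K * (b * b)))).
have := @discrete_gronwall k N (fun j => euler N j y) (fun j => euler (N + N) (j + j) y)
  (fun j => A (euler_pt N j y) y) N%:R^-1 b c.
move=> /(_ _ _ b0 _ _ N erefl); rewrite invr_ge0 ler0n => H.
apply: (le_trans (H isT _ _ _ _ _)).
- by rewrite /c !(addr_ge0, mulr_ge0).
- by [].
- by move=> i iN; apply: A_ball => //; exact: ltnW.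
- move=> i iN; clear H; rewrite addSn addnS.
  have iN2 : (i + i < N + N)%N by rewrite -addSn leq_add // ltnW.
  have bi : nm (euler_pt N i y - p0) < r by apply: pt_ball => //; exact: ltnW.
  have bi' : nm (euler_pt (N + N) (i + i).+1 y - p0) < r by exact: pt_ball.
  rewrite 2!(eulerS (N + N)) (pt_double _ y NR0) -/h hE crealD /c.
  apply: doubling_step; first exact: h0.
  + by apply: euler_norm => //; exact: ltnW.
  + by apply: A_ball => //; exact: ltnW.
  + by apply: A_ball.
  + rewrite (le_trans (H1 _ bi bi')) // -(pt_double _ y NR0) nm_pt_step -/h.
    rewrite -[leRHS]mulr1 ler_pM ?mulr_ge0 ?nm_ge0 // ler_wpM2l //.
    by rewrite ler_piMr.
- by [].
apply: (@le_trans _ _ (N%:R * c * c1)).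
  by rewrite ler_wpM2l ?euler_factor // /c !(addr_ge0, mulr_ge0).
have hN : h <= N%:R^-1 by rewrite hE lerDl.
have -> : N%:R * c * c1 = K * c1 * c1 * (b + K * (b * b)) * (N%:R * h * h).
  by rewrite /c; ring.
rewrite ler_wpM2l ?(addr_ge0, mulr_ge0) // (le_trans _ hN) // ler_piMl //.
by rewrite /h natrD; rewrite ler_pdivrMr ?addr_gt0 // mul1r lerDl ltW.
Qed.

Lemma transport_id (Kf : fieldType) (P a al al' B : 'M[Kf]_k) (th de : Kf) :
  (P + de *: (P *m a)) + (th + de) *: ((P + de *: (P *m a)) *m al')
   - ((P + th *: (P *m al)) + de *: ((P + th *: (P *m al)) *m B)) =
  P *m (de *: a + (th + de) *: al' + (de * (th + de)) *: (a *m al')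
        - th *: al - de *: B - (th * de) *: (al *m B)).
Proof.
rewrite !(mulmxBr, mulmxDr) -!scalemxAr !mulmxDl -!scalemxAl !mulmxA.
move: (P *m a *m al') (P *m al *m B) (P *m a) (P *m al') (P *m al) (P *m B).
by move=> x1 x2 x3 x4 x5 x6; apply/matrixP => i j; rewrite !mxE; ring.
Qed.

(** Here flatness is used. Without it the terms in [D1] and [D2] would leave a contribution of first
    order in [de] and in the displacement; substituting [D1] from the vanishing curvature leaves
    only terms that are quadratic in one of them. *)
Lemma transport_remainder_id (Kf : fieldType) (a al al' B D1 D2 : 'M[Kf]_k) (th de : Kf) :
  D1 - D2 + a *m al - al *m a = 0 ->
  de *: a + (th + de) *: al' + (de * (th + de)) *: (a *m al')
        - th *: al - de *: B - (th * de) *: (al *m B) =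
  th *: (al' - al - de *: D1) + de *: (al' - al)
  + (de * (th + de)) *: (a *m (al' - al)) + (de * de) *: (a *m al)
  - de *: (B - a - al - th *: D2) - (th * de) *: (al *m (B - a)).
Proof.
move=> fl; have {fl} -> : D1 = D2 - a *m al + al *m a.
  apply/subr0_eq; rewrite -fl.
  move: (a *m al) (al *m a) => x1 x2.
  by apply/matrixP => i j; rewrite !mxE; ring.
rewrite !mulmxBr.
move: (a *m al') (a *m al) (al *m B) (al *m a) => x1 x2 x3 x4.
by apply/matrixP => i j; rewrite !mxE; ring.
Qed.

Lemma transport_step (P a al al' B D1 D2 : 'M[C]_k) (th de nw : R) :
  0 <= th -> 0 <= de -> th + de <= 1 -> 0 <= nw -> nm P <= c1 -> nm a <= b ->
  nm al <= b * nw -> nm (al' - al) <= b * de * nw ->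
  nm (al' - al - creal de *: D1) <= b * de ^+ 2 * nw ->
  nm (B - a - al - creal th *: D2) <= 2 * b * nw ^+ 2 -> nm (B - a) <= 2 * b * nw ->
  D1 - D2 + a *m al - al *m a = 0 ->
  nm ((P + creal de *: (P *m a)) + creal (th + de) *: ((P + creal de *: (P *m a)) *m al')
     - ((P + creal th *: (P *m al)) + creal de *: ((P + creal th *: (P *m al)) *m B))) <=
  K * (c1 * ((2 * b + 2 * K * (b * b)) * (de ^+ 2 * nw + de * nw ^+ 2))).
Proof.
move=> th0 de0 thde nw0 nP na nal nd ne1 ne2 nBa fl.
have th1 : th <= 1 by rewrite (le_trans _ thde) // lerDl.
rewrite crealD transport_id (@transport_remainder_id _ a al al' B D1 D2) //.
apply: nm_mulmx_le => //.
have m1 : nm (a *m (al' - al)) <= K * (b * (b * de * nw)) by exact: nm_mulmx_le.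
have m2 : nm (a *m al) <= K * (b * (b * nw)) by exact: nm_mulmx_le.
have m3 : nm (al *m (B - a)) <= K * (b * nw * (2 * b * nw)) by exact: nm_mulmx_le.
apply: (@le_trans _ _ (1 * (b * de ^+ 2 * nw) + de * (b * de * nw)
   + de * (K * (b * (b * de * nw))) + de * de * (K * (b * (b * nw)))
   + de * (2 * b * nw ^+ 2) + de * (K * (b * nw * (2 * b * nw))))); last first.
  by apply: eq_ler; ring.
apply: (le_trans (nmD _ _)); rewrite nmN; apply: lerD; last first.
  rewrite nmZ nmM !nm_creal (ger0_norm de0) (ger0_norm th0).
  by rewrite ler_pM ?nm_ge0 ?mulr_ge0 // ler_piMl.
apply: (le_trans (nmD _ _)); rewrite nmN; apply: lerD; last first.
  by rewrite nmZ nm_creal (ger0_norm de0) ler_wpM2l.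
apply: (le_trans (nmD _ _)); apply: lerD; last first.
  by rewrite nmZ nmM !nm_creal (ger0_norm de0) ler_wpM2l // mulr_ge0.
apply: (le_trans (nmD _ _)); apply: lerD; last first.
  rewrite nmZ nmM -crealD !nm_creal (ger0_norm de0) (ger0_norm (addr_ge0 th0 de0)).
  rewrite ler_pM ?nm_ge0 ?mulr_ge0 ?addr_ge0 //.
  by rewrite ler_piMr.
apply: (le_trans (nmD _ _)); apply: lerD; last first.
  by rewrite nmZ nm_creal (ger0_norm de0) ler_wpM2l.
by rewrite nmZ nm_creal (ger0_norm th0) ler_pM ?nm_ge0.
Qed.

(** Compares the polygon towards [y + w] with the one towards [y] corrected to first order by [A].
    The local error [de^2 |w| + de |w|^2] sums to [|w| / N + |w|^2]: the first part disappears in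
    the limit and the second is the remainder of a differential. *)
Lemma euler_transport N y w : (0 < N)%N -> nm y < r -> nm (y + w) < r ->
  nm (euler N N y + euler N N y *m A (p0 + y) w - euler N N (y + w)) <=
  K * c1 * c1 * (2 * b + 2 * K * (b * b)) * (nm w / N%:R + nm w ^+ 2).
Proof.
move=> N0 yr ywr.
have NR0 : 0 < N%:R :> R by rewrite ltr0n.
have y1 : nm y <= 1 by exact: le_trans (ltW yr) r1.
pose de : R := N%:R^-1; have de0 : 0 <= de by rewrite invr_ge0 ltW.
pose c2 := 2 * b + 2 * K * (b * b).
have c20 : 0 <= c2 by rewrite !(addr_ge0, mulr_ge0).
pose nw := nm w; have nw0 : 0 <= nw by exact: nm_ge0.
pose c := K * (c1 * (c2 * (de ^+ 2 * nw + de * nw ^+ 2))).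
have cc0 : 0 <= c by rewrite /c !(addr_ge0, mulr_ge0) ?exprn_ge0.
(* At parameter [j / N] the displacement of the polygon point is [(j / N) w], so this is the
   first-order guess for the polygon towards [y + w]; it is an approximate solution of that
   scheme. *)
pose psi j := euler N j y + creal (j%:R / N%:R) *: (euler N j y *m A (euler_pt N j y) w).
have := @discrete_gronwall k N (fun j => euler N j (y + w)) psi
  (fun j => A (euler_pt N j (y + w)) (y + w)) de b c de0 cc0 b0 _ _ N.
move=> H.
have -> : euler N N y + euler N N y *m A (p0 + y) w = psi N.
  by rewrite /psi pt_end // divff ?gt_eqF // creal1 scale1r.
apply: (le_trans (H _ _ _ _ _)).
- by [].
- by move=> i iN; apply: A_ball => //; exact: ltnW.
- by rewrite /psi !euler0 mul0r creal0 scale0r addr0.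
- move=> i iN; clear H; rewrite {1}/psi eulerS.
  pose th : R := i%:R / N%:R.
  have th0 : 0 <= th by rewrite divr_ge0 // ltW.
  have -> : i.+1%:R / N%:R = th + de by rewrite -natr1 mulrDl mul1r.
  have thde : th + de <= 1.
    by rewrite /th /de -[X in _ + X]mul1r -mulrDl natr1 ler_pdivrMr // mul1r ler_nat.
  have th1 : th <= 1 by rewrite (le_trans _ thde) // lerDl.
  rewrite /psi -/th -/de.
  have bi : nm (euler_pt N i y - p0) < r by apply: pt_ball => //; exact: ltnW.
  have bi' : nm (euler_pt N i.+1 y - p0) < r by exact: pt_ball.
  have bw : nm (euler_pt N i (y + w) - p0) < r by apply: pt_ball => //; exact: ltnW.
  have nw1 : nm (euler_pt N i (y + w) - euler_pt N i y) <= nw.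
    by rewrite pt_shift nmZ nm_creal ger0_norm // ler_piMl.
  apply: (@transport_step _ _ _ _ _ (DA (euler_pt N i y) y w) (DA (euler_pt N i y) w y)) => //.
  + by apply: euler_norm => //; exact: ltnW.
  + by apply: A_ball => //; exact: ltnW.
  + exact: (H0 w bi).
  + rewrite (le_trans (H1 _ bi bi')) // nm_pt_step.
    by rewrite ler_wpM2r // ler_wpM2l // ler_piMr.
  + have := H2 w bi bi'; rewrite pt_step (linear_scale (linDA _ _)) => h.
    apply: (le_trans h); rewrite nmZ nm_creal ger0_norm // ler_wpM2r //.
    rewrite ler_wpM2l // lerXn2r ?nnegrE ?mulr_ge0 ?nm_ge0 //.
    by rewrite ler_piMr.
  + rewrite (linear_add (linA _)).
    have h1 : nm (A (euler_pt N i (y + w)) y - A (euler_pt N i y) y - creal th *: DA (euler_pt N i y) w y) <= b * nw ^+ 2.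
      have := H2 y bi bw; rewrite [X in DA _ X _]pt_shift (linear_scale (linDA _ _)) => h.
      apply: (le_trans h); apply: (@le_trans _ _ (b * nw ^+ 2 * 1)); last by rewrite mulr1.
      rewrite ler_pM ?mulr_ge0 ?exprn_ge0 ?nm_ge0 // ler_wpM2l //.
      by rewrite lerXn2r ?nnegrE ?nm_ge0.
    have h2 : nm (A (euler_pt N i (y + w)) w - A (euler_pt N i y) w) <= b * nw ^+ 2.
      by rewrite (le_trans (H1 _ bi bw)) // expr2 mulrA ler_wpM2r // ler_wpM2l.
    rewrite (_ : 2 * b * nw ^+ 2 = b * nw ^+ 2 + b * nw ^+ 2); last by ring.
    apply: le_trans (le_trans (nmD _ _) (lerD h1 h2)); apply: eq_ler; congr nm.
    move: (A (euler_pt N i (y + w)) y) (A (euler_pt N i (y + w)) w) (A (euler_pt N i y) y) (A (euler_pt N i y) w) (DA _ _ _).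
    by move=> x1 x2 x3 x4 x5; apply/matrixP => i' j'; rewrite !mxE; ring.
  + rewrite (linear_add (linA _)) addrAC (le_trans (nmD _ _)) //.
    rewrite (_ : 2 * b * nw = b * nw + b * nw); last by ring.
    rewrite lerD //; last exact: (H0 w bw).
    rewrite (le_trans (H1 _ bi bw)) //; apply: (@le_trans _ _ (b * nw * 1)); last by rewrite mulr1.
    by rewrite ler_pM ?mulr_ge0 ?nm_ge0 // ler_wpM2l.
  + exact (flat y w bi).
- by [].
apply: (@le_trans _ _ (N%:R * c * c1)).
  by apply: ler_wpM2l; [rewrite mulr_ge0|exact: euler_factor].
apply: eq_ler; rewrite /c -/c2 -/nw /de; field.
by rewrite gt_eqF.
Qed.

(** [Phi p] is the limit of the polygons from [p0] to [p]. Letting [N] tend to infinity in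
    [euler_transport] gives a quadratic remainder with constant [c2], so the candidate integrated
    only radially has the right differential in every direction. *)
Lemma flat_existence_bounds : exists Phi : 'cV[C]_m -> 'M[C]_k,
  Phi p0 = 1%:M /\ forall p, nm (p - p0) < r -> hasD Phi p (fun w => Phi p *m A p w).
Proof.
pose u y l := euler (2 ^ l) (2 ^ l) y.
pose c := K * c1 * c1 * (b + K * (b * b)).
have c0 : 0 <= c by rewrite !(addr_ge0, mulr_ge0).
have half01 : 0 <= (1 / 2 : R) < 1 by lra.
have pow2 l : ((2 ^ l)%:R : R)^-1 = (1 / 2) ^+ l.
  by rewrite natrX expr_div_n expr1n mul1r.
have pow0 l : (0 < 2 ^ l)%N by rewrite expn_gt0.
have lim y : nm y < r -> exists X, forall l, nm (u y l - X) <= 4 * c * (1 / 2) ^+ l.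
  move=> yr; have [|X hX] := @geometric_limit R k k (u y) c (1 / 2) half01.
    move=> l; rewrite /u expnS mul2n -addnn -pow2; exact: euler_doubling.
  by exists X => l; apply: (le_trans (hX l)); apply: eq_ler; field.
have lim' y : exists X, nm y < r -> forall l, nm (u y l - X) <= 4 * c * (1 / 2) ^+ l.
  by have [/lim[X hX]|] := pselect (nm y < r); [exists X|exists 0].
pose F y := projT1 (cid (lim' y)).
have hF y : nm y < r -> forall l, nm (u y l - F y) <= 4 * c * (1 / 2) ^+ l.
  exact: projT2 (cid (lim' y)).
have Ez N j : euler N j 0 = 1%:M.
  by elim: j => [|j IH]; rewrite ?euler0 // eulerS IH (linear_zero (linA _)) mulmx0 scaler0 addr0.
exists (fun p => F (p - p0)); split.
  have h0 := hF 0 _; rewrite nm0 in h0; have {}h0 := h0 r0.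
  rewrite subrr; apply/esym/subr0_eq/nm_eq0/eqP; rewrite eq_le nm_ge0 andbT.
  apply: (@le_small _ _ (4 * c)) => l; rewrite add0r; apply: le_trans (h0 l).
  by rewrite /u Ez nm_distC.
move=> p pr.
pose c2 := K * c1 * c1 * (2 * b + 2 * K * (b * b)).
have rho0 : 0 < r - nm (p - p0) by rewrite subr_gt0.
apply: (@hasD_quadratic _ _ _ _ _ _ c2 (r - nm (p - p0))) => //.
  by apply: blinear_mulmxl; apply: blinear_cV; exact: linA.
move=> w wr.
have pwr : nm (p - p0 + w) < r.
  by apply: (le_lt_trans (nmD _ _)); move: wr; lra.
have -> : p + w - p0 = p - p0 + w by rewrite addrAC.
set y := p - p0 in pr pwr *.
have py : p0 + y = p by rewrite addrC subrK.
apply: (@le_small _ _ (4 * c + 4 * c + K * (4 * c * (b * nm w)) + c2 * nm w)) => l.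
have h1 := hF _ pr l; have h2 := hF _ pwr l.
have h3 := euler_transport (pow0 l) pr pwr; rewrite py pow2 -/c2 in h3.
have h4 : nm (A p w) <= b * nm w by apply: H0; rewrite -py addrC addKr.
have h5 : nm ((u y l - F y) *m A p w) <= K * (4 * c * (1 / 2) ^+ l * (b * nm w)).
  exact: nm_mulmx_le.
have -> : F (y + w) - F y - F y *m A p w =
  (u y l - F y) - (u (y + w) l - F (y + w)) + (u y l - F y) *m A p w
  - (u y l + u y l *m A p w - u (y + w) l).
  rewrite mulmxBl; move: (u y l) (F y) (u (y + w) l) (F (y + w)) (u y l *m A p w) (F y *m A p w).
  by move=> x1 x2 x3 x4 x5 x6; apply/matrixP => i j; rewrite !mxE; ring.
apply: (le_trans (nmB _ _)).
apply: (le_trans (lerD (le_trans (nmD _ _) (lerD (le_trans (nmB _ _) (lerD h1 h2)) h5)) h3)).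
by apply: eq_ler; ring.
Qed.

End Euler.

End FlatExistence.

(** * Flat systems with holomorphic coefficients *)

Section FlatHolomorphic.
Variable R : realType.
Local Notation C := (Cplx R).
Local Notation hol := holomorphic_upto.

Lemma finite_radius (I : finType) (r_ : I -> R) : (forall i, 0 < r_ i) ->
  exists r : R, [/\ 0 < r, r <= 1 & forall i, r <= r_ i].
Proof.
move=> h; exists (\big[Num.min/1]_i r_ i); split.
- by apply/bigmin_gtP; split.
- exact: bigmin_le_id.
- by move=> i; apply: bigmin_le_cond.
Qed.

Variables (m k : nat) (D : set 'cV[C]_m) (A : 'cV[C]_m -> 'cV[C]_m -> 'M[C]_k).
Hypothesis oD : open D.
Hypothesis linA : forall p, linear (A p).
Hypothesis holA : forall v, hol 2 D (fun p => A p v).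

Let e (i : 'I_m) : 'cV[C]_m := delta_mx i 0.

Lemma flat_existence_Phi p0 : D p0 ->
  (forall p u v, D p -> 'D_u (fun q => A q v) p - 'D_v (fun q => A q u) p
     + A p u *m A p v - A p v *m A p u = 0) ->
  exists (r : R) (Phi : 'cV[C]_m -> 'M[C]_k),
  [/\ 0 < r, forall p, nm (p - p0) < r -> D p, Phi p0 = 1%:M &
      forall p, nm (p - p0) < r -> hasD Phi p (fun w => Phi p *m A p w)].
Proof.
move=> Dp0 flat.
have bnd i := hol_local_bounds oD Dp0 (holA (e i)).
have /choice[c_ /choice[r_ cr]] := bnd.
have r_0 i : 0 < r_ i by have [] := cr i.
have [r1 r10 hr1] : exists2 r1 : R, 0 < r1 & forall q, nm (q - p0) < r1 -> D q.
  by apply/nbhs_nmP; exact: (open_near oD Dp0).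
have [r [r0 rle1 rle]] := finite_radius r_0.
pose s := Num.min r r1.
have s0 : 0 < s by rewrite lt_min r0.
have s1 : s <= 1 by rewrite ge_min rle1.
have sD q : nm (q - p0) < s -> D q by rewrite lt_min => /andP[_ /hr1].
have sr q i : nm (q - p0) < s -> nm (q - p0) < r_ i.
  by rewrite lt_min => /andP[h _]; exact: lt_le_trans (rle i).
pose b := \sum_i c_ i.
have c0 i : 0 <= c_ i by have [] := cr i.
have b0 : 0 <= b by apply: sumr_ge0.
have AE p v : A p v = \sum_i v i 0 *: A p (e i) by exact: (@linear_cV _ _ _ (A p)).
(* Set to 0 outside the ball, so that linearity in [w] holds at every point as the polygon
   construction requires; inside it is the derivative of [A]. *)
pose DA p w (v : 'cV[C]_m) : 'M[C]_k :=
  if nm (p - p0) < s then \sum_i v i 0 *: 'D_w (fun q => A q (e i)) p else 0.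
have DAE p w v : nm (p - p0) < s -> DA p w v = 'D_w (fun q => A q v) p.
  move=> ps; rewrite /DA ps.
  have h : hasD (fun q => \sum_i v i 0 *: A q (e i)) p
     (fun w => \sum_i v i 0 *: 'D_w (fun q => A q (e i)) p).
    by apply: hasD_sum => i; apply: hasDZ; apply: hol_hasD (sD _ ps); exact: holA.
  have -> : (fun q => A q v) = (fun q => \sum_i v i 0 *: A q (e i)).
    by apply/funext => q; exact: AE.
  by rewrite (hasD_derive h).
have sumb (F : 'I_m -> 'M[C]_k) (x : R) (v : 'cV[C]_m) : 0 <= x -> (forall i, nm (F i) <= c_ i * x) ->
    nm (\sum_i v i 0 *: F i) <= b * x * nm v.
  move=> x0 hF; rewrite (le_trans (nm_sum _ _ _)) // -mulrA mulr_suml ler_sum // => i _.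
  by rewrite nmZ mulrC mulrA ler_pM ?nm_ge0 ?nm_entry.
have [] := @flat_existence_bounds R m k A DA p0 s b s0 s1 b0 linA _ _ _ _ _.
- move=> p v a u w; rewrite /DA.
  have [ps|ps] := boolP (nm (p - p0) < s).
  2: rewrite scaler0.
  2: by rewrite addr0.
  rewrite scaler_sumr -big_split /=; apply: eq_bigr => i _.
  have [[l _] _] := hol_hasD (holA (e i)) (sD _ ps).
  by rewrite l scalerDr !scalerA mulrC.
- move=> p v ps; rewrite AE -[b]mulr1; apply: sumb => // i.
  have [_ _ _ h _] := cr i; rewrite mulr1.
  by have [] := h p 0 (sr _ i ps).
- move=> p q v ps qs; rewrite (AE q) (AE p) -sumrB.
  under eq_bigr do rewrite -scalerBr.
  apply: sumb => [|i]; first exact: nm_ge0.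
  have [_ _ _ _ h] := cr i.
  by have [] := h p q (sr _ i ps) (sr _ i qs).
- move=> p q v ps qs; rewrite (AE q) (AE p) /DA ps.
  rewrite -!sumrB; under eq_bigr do rewrite -!scalerBr.
  apply: sumb => [|i]; first by rewrite exprn_ge0 ?nm_ge0.
  have [_ _ _ _ h] := cr i.
  by have [] := h p q (sr _ i ps) (sr _ i qs).
- by move=> p u v ps; rewrite !DAE //; exact (flat p u v (sD _ ps)).
by move=> Phi [h1 h2]; exists s, Phi; split.
Qed.

End FlatHolomorphic.

(** * Fundamental matrices *)

Section Fundamental.
Variable R : realType.
Local Notation C := (Cplx R).
Local Notation hol := holomorphic_upto.
Variables (m k : nat) (D : set 'cV[C]_m) (A : 'cV[C]_m -> 'cV[C]_m -> 'M[C]_k).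
Hypothesis oD : open D.
Hypothesis linA : forall p, linear (A p).
Hypothesis holA : forall v, hol 2 D (fun p => A p v).
Hypothesis flat : forall p u v, D p -> 'D_u (fun q => A q v) p - 'D_v (fun q => A q u) p
     + A p u *m A p v - A p v *m A p u = 0.

Lemma transpose_curvature (Kf : fieldType) (X Y P Q : 'M[Kf]_k) : X - Y + P *m Q - Q *m P = 0 ->
  - X^T - - Y^T + - P^T *m - Q^T - - Q^T *m - P^T = 0.
Proof.
move=> h; rewrite (mulNmx P^T) mulmxN opprK (mulNmx Q^T) mulmxN !opprK -!trmx_mul.
have <- : - (X - Y + P *m Q - Q *m P)^T = - X^T + Y^T + (Q *m P)^T - (P *m Q)^T.
  rewrite !linearD !linearN /=; move: (X^T) (Y^T) ((P *m Q)^T) ((Q *m P)^T) => x1 x2 x3 x4.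
  by apply/matrixP => i j; rewrite !mxE; ring.
by rewrite h trmx0 oppr0.
Qed.

(** The inverse [Psi] is carried along with its own differential, because solutions [z] are compared
    through the constancy of [z Psi]. *)
Definition fundamental p0 (r : R) (Phi Psi : 'cV[C]_m -> 'M[C]_k) :=
  [/\ 0 < r, forall p, nm (p - p0) < r -> D p, Phi p0 = 1%:M,
      forall p, nm (p - p0) < r -> Phi p *m Psi p = 1%:M /\ Psi p *m Phi p = 1%:M &
      forall p, nm (p - p0) < r -> hasD Phi p (fun w => Phi p *m A p w) /\
         hasD Psi p (fun w => - (A p w *m Psi p))].

(** The system with [- A^T] is flat as well; the transpose of its solution is a right inverse, since
    [Phi Psi] has zero differential and value 1 at [p0]. A one-sided inverse of a square matrix is
    two-sided. *)
Lemma flat_existence p0 : D p0 -> exists r Phi Psi, fundamental p0 r Phi Psi.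
Proof.
move=> Dp0.
have [r [Phi [r0 rD P0 hP]]] := flat_existence_Phi oD linA holA Dp0 flat.
pose A' p v := - (A p v)^T.
have [|||r' [Phi' [r0' _ P0' hP']]] := @flat_existence_Phi R m k D A' oD _ _ p0 Dp0.
- by move=> p a u v; rewrite /A' linA linearP scalerN opprD.
- move=> v; apply: holN => //.
  apply: (hol_blinear (L := fun X : 'M[C]_k => X^T)) => //.
  exact/blinear_trmx/blinear_id.
- move=> p u v Dp.
  have dT w x : 'D_w (fun q => A' q x) p = - ('D_w (fun q => A q x) p)^T.
    apply: (hasD_derive (L := fun w => - ('D_w (fun q => A q x) p)^T)).
    apply: hasDN; apply: (hasD_comp (hol_hasD (holA x) Dp)) => //.
    by apply: hasD_lin; apply/blinear_trmx/blinear_id.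
  by rewrite !dT; exact (transpose_curvature (flat u v Dp)).
pose Psi p := (Phi' p)^T.
pose s := Num.min r r'.
have s0 : 0 < s by rewrite lt_min r0.
have hPsi p : nm (p - p0) < s -> hasD Psi p (fun w => - (A p w *m Psi p)).
  rewrite lt_min => /andP[_ pr].
  apply: hasD_eqD (hasD_comp (hP' p pr) (hasD_lin _ (blinear_trmx (blinear_id _)))) _.
  by move=> v; rewrite trmx_mul /A' linearN /= trmxK mulNmx.
have hPhi p : nm (p - p0) < s -> hasD Phi p (fun w => Phi p *m A p w).
  by rewrite lt_min => /andP[/hP].
have one p : nm (p - p0) < s -> Phi p *m Psi p = 1%:M.
  move=> ps; have -> : 1%:M = Phi p0 *m Psi p0 by rewrite P0 /Psi P0' trmx1 mulmx1.
  apply: (@hasD0_segment _ _ _ _ (fun p => Phi p *m Psi p)) => t t01.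
  have ts : nm (p0 + creal t *: (p - p0) - p0) < s.
    by apply: segment_ball => //; rewrite subrr nm0.
  apply: hasD_eqD (hasD_mulmx (hPhi _ ts) (hPsi _ ts)) _ => v.
  by rewrite mulmxN mulmxA subrr.
exists s, Phi, Psi; split => //.
- by move=> p; rewrite lt_min => /andP[/rD].
- by move=> p ps; split; [exact (one p ps)|apply: mulmx1C; exact (one p ps)].
- by move=> p ps; split; [exact: hPhi|exact: hPsi].
Qed.

Variable pi : 'cV[C]_m -> 'cV[C]_m.
Hypothesis bpi : blinear pi.

(** The system pulled back along a linear map. With [pi] the projection onto the cross this
    expresses that [z] solves the system along the cross, as a statement about functions on an open
    set of the ambient space. *)
Definition restricted_solution (z : 'cV[C]_m -> 'rV[C]_k) p :=
  hasD z p (fun w => z p *m A (pi p) (pi w)).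

Lemma restricted_constant p0 r Phi Psi z p q : fundamental p0 r Phi Psi ->
  (forall t : R, 0 <= t <= 1 -> nm (pi (p + creal t *: (q - p)) - p0) < r /\
     restricted_solution z (p + creal t *: (q - p))) ->
  z q *m Psi (pi q) = z p *m Psi (pi p).
Proof.
move=> [_ _ _ _ hD] h.
apply: (@hasD0_segment _ _ _ _ (fun x => z x *m Psi (pi x))) => t t01.
have [ht hz] := h t t01; have [_ hP] := hD _ ht.
apply: hasD_eqD (hasD_mulmx hz (hasD_comp (hasD_lin _ bpi) hP)) _ => v.
by rewrite mulmxN mulmxA subrr.
Qed.

End Fundamental.

(** * Frobenius algebras and the connection of odd periods *)

Section MatrixFacts.
Variable R : realType.
Local Notation C := (Cplx R).

Lemma mulmx_del m n (A : 'M[C]_(m, n)) j : A *m del C j = col j A.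
Proof. by rewrite colE. Qed.

Lemma eq_mulmx_cV m n (A B : 'M[C]_(m, n)) :
  (forall w : 'cV[C]_n, A *m w = B *m w) -> A = B.
Proof.
move=> h; apply/matrixP => i j; have := h (del C j).
by rewrite !mulmx_del => /matrixP/(_ i 0); rewrite !mxE.
Qed.

Lemma form_nondeg n (eta : 'M[C]_n) (u : 'cV[C]_n) : eta \in unitmx ->
  (forall z : 'cV[C]_n, (u^T *m eta *m z) 0 0 = 0) -> u = 0.
Proof.
move=> ueta h; have h' : u^T *m eta = 0.
  apply/matrixP => i j; rewrite ord1; have := h (del C j).
  by rewrite mulmx_del !mxE => ->.
by rewrite -[u]trmxK -[u^T](mulmxK ueta) h' mul0mx trmx0.
Qed.

(** In use [A] is [C_u], [T] its derivative along the Euler field, [P] is [C_(V u)] and [k] is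
    [(2 - d) / 2]: the product axiom for [E], solved for the derivative of [U] along [u]. *)
Lemma euler_identity n (T A V P : 'M[C]_n) (k : C) (g : 'cV[C]_n) :
  T *m g - (k *: (A *m g) - V *m (A *m g)) - (- (k *: A - P)) *m g
    - A *m (- (k *: g - V *m g)) = A *m g ->
  (T + (k *: A - P)) *m g = (A + A *m V - V *m A) *m g.
Proof.
rewrite mulNmx mulmxN !(mulmxBl, mulmxDl, mulmxBr) -scalemxAl -scalemxAr !mulmxA.
move: (T *m g) (A *m g) (V *m A *m g) (P *m g) (A *m V *m g) => x1 x2 x3 x4 x5 h.
apply/matrixP => i j; move/matrixP: h => /(_ i j); rewrite !mxE => h.
have -> : x1 i j = x1 i j - (k * x2 i j - x3 i j) - - (k * x2 i j - x4 i j)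
   - - (k * x2 i j - x5 i j) - k * x2 i j - x3 i j + x4 i j + x5 i j by ring.
by rewrite h; ring.
Qed.

Lemma form_diff0 n (eta : 'M[C]_n) (a b z : 'cV[C]_n) :
  (a^T *m eta *m z) 0 0 = (b^T *m eta *m z) 0 0 -> ((a - b)^T *m eta *m z) 0 0 = 0.
Proof.
rewrite linearB /= !mulmxBl; move: (a^T *m eta *m z) (b^T *m eta *m z) => x y h.
by rewrite !mxE h subrr.
Qed.

Lemma euler_form_identity n (eta V : 'M[C]_n) (d y : 'cV[C]_n) (k : C) :
  0 - ((- (k *: d - V *m d))^T *m eta *m y) 0 0 - (d^T *m eta *m - (k *: y - V *m y)) 0 0
    = (k + k) * (d^T *m eta *m y) 0 0 ->
  (d^T *m (V^T *m eta *m y)) 0 0 = (d^T *m (- (eta *m V) *m y)) 0 0.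
Proof.
have -> : (- (k *: d - V *m d))^T = d^T *m V^T - k *: d^T.
  by rewrite opprB linearB /= linearZ /= trmx_mul.
rewrite mulmxN mulmxBr mulNmx mulmxN !mulmxBl -!scalemxAl -!scalemxAr !mulmxA.
move: (d^T *m V^T *m eta *m y) (d^T *m eta *m y) (d^T *m eta *m V *m y) => x1 x2 x3.
rewrite !mxE => h.
have -> : x1 0 0 = - (0 - (x1 0 0 - k * x2 0 0) - - (k * x2 0 0 - x3 0 0)) + (k + k) * x2 0 0 - x3 0 0.
  by ring.
by rewrite h; ring.
Qed.

End MatrixFacts.

Section Frobenius.
Variable R : realType.
Local Notation C := (Cplx R).
Local Notation hol := holomorphic_upto.
Variables (n : nat) (M : frob_data C n).
Hypothesis hM : is_frobenius M.
Local Notation dom := (fm_dom M).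
Local Notation eta := (fm_eta M).
Local Notation E := (fm_E M).

(** The multiplication operator of an arbitrary tangent vector, which allows identities to be stated
    without indices. *)
Definition Cm (t u : 'cV[C]_n) : 'M[C]_n := \sum_a u a 0 *: fm_c M t a.

Lemma Cm_mulE t u v : fm_mul M t u v = Cm t u *m v.
Proof. by rewrite /fm_mul /Cm mulmx_suml; apply: eq_bigr => a _; rewrite scalemxAl. Qed.

Lemma Cm_linear t : linear (Cm t).
Proof.
move=> a u v; rewrite /Cm scaler_sumr -big_split /=; apply: eq_bigr => i _.
by rewrite !mxE scalerDl scalerA.
Qed.

Lemma Cm_del t a : Cm t (del C a) = fm_c M t a.
Proof.
rewrite /Cm (bigD1 a) //= mxE !eqxx scale1r big1 ?addr0 // => b ba.
by rewrite mxE (negPf ba) scale0r.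
Qed.

Lemma fm_UE t : fm_U M t = Cm t (E t).
Proof. by []. Qed.

Lemma fm_VE t : fm_V M t = ((2 - fm_d M) / 2)%:M - \matrix_(a, b) 'D_(del C b) E t a 0.
Proof. by []. Qed.

#[local] Opaque Cm fm_U fm_V.

Lemma Cm_sym t u v : dom t -> Cm t u *m v = Cm t v *m u.
Proof. by move=> Dt; rewrite -!Cm_mulE (frob_mulC hM). Qed.

Lemma Cm_mul t u v : dom t -> Cm t (Cm t u *m v) = Cm t u *m Cm t v.
Proof.
move=> Dt; apply: eq_mulmx_cV => w; rewrite -mulmxA -!Cm_mulE.
by rewrite (frob_mulA hM).
Qed.

Lemma Cm_comm t u v : dom t -> Cm t u *m Cm t v = Cm t v *m Cm t u.
Proof. by move=> Dt; rewrite -!Cm_mul // Cm_sym. Qed.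

Lemma Cm_unit t : dom t -> Cm t (fm_e M) = 1%:M.
Proof.
move=> Dt; apply: eq_mulmx_cV => w; rewrite -Cm_mulE mul1mx.
by rewrite (frob_mul1 hM).
Qed.

Lemma Cm_tr t u : dom t -> (Cm t u)^T *m eta = eta *m Cm t u.
Proof.
move=> Dt; apply: eq_mulmx_cV => w; apply/matrixP => i j; rewrite !ord1.
have := frob_inv hM (del C i) u w Dt.
rewrite /fm_form (frob_mulC hM _ _ Dt) !Cm_mulE trmx_mul.
have e (X : 'cV[C]_n) : ((del C i)^T *m X) 0 0 = X i 0.
  by rewrite trmx_delta -rowE mxE.
by rewrite -!mulmxA !e.
Qed.

Lemma Cm_hol k u : hol k dom (fun t => Cm t u).
Proof.
have oD := frob_open hM.
apply: hol_sum => // a; apply: (hol_blinear (L := fun X : 'M[C]_n => u a 0 *: X)) => //.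
  exact/blinearZ/blinear_id.
exact: (frob_c_holo hM).
Qed.

Lemma Cm_hasD t u : dom t -> hasD (fun t => Cm t u) t (fun v => 'D_v (fun t => Cm t u) t).
Proof. by move=> Dt; apply: hol_hasD Dt; exact: (Cm_hol 0). Qed.

Lemma form_hasD t w x y z : dom t ->
  'D_w (fun p => fm_form M (fm_mul M p x y) z) t =
  (('D_w (fun t => Cm t x) t *m y)^T *m eta *m z) 0 0.
Proof.
move=> Dt; have hC := Cm_hasD x Dt.
have bl : blinear (fun X : 'M[C]_n => ((X *m y)^T *m eta *m z) 0 0 : C).
  by apply: blinear_entry; do 2!apply: blinear_mulmxr; apply: blinear_trmx;
     apply: blinear_mulmxr; apply: blinear_id.
have := hasD_comp hC (hasD_lin _ bl) => h.
rewrite -(hasD_derive h w); congr ('D_w _ t); apply/funext => p.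
by rewrite /fm_form Cm_mulE.
Qed.

Lemma Cm_dsym t u v : dom t -> 'D_u (fun t => Cm t v) t = 'D_v (fun t => Cm t u) t.
Proof.
move=> Dt; apply: eq_mulmx_cV => y; apply/subr0_eq.
apply: (form_nondeg (frob_eta_unit hM)) => z.
have [h _ _] := frob_dc_sym hM Dt u v y z.
rewrite (form_hasD u v y z Dt) (form_hasD v u y z Dt) in h.
exact: form_diff0 h.
Qed.

Lemma E_hasD t : dom t -> hasD E t (fun v => 'D_v E t).
Proof. by move=> Dt; exact: (hol_hasD (frob_E_holo hM 0) Dt). Qed.

Let kappa : C := (2 - fm_d M) / 2.

Lemma dE t v : dom t -> 'D_v E t = kappa *: v - fm_V M t *m v.
Proof.
move=> Dt; rewrite fm_VE mulmxBl mul_scalar_mx opprB addrC subrK.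
have [[l _] _] := E_hasD Dt.
rewrite (@linear_cV _ _ _ (fun v => 'D_v E t) v l).
apply/matrixP => i j; rewrite ord1 summxE mxE; apply: eq_bigr => a _.
by rewrite !mxE mulrC.
Qed.

Lemma lie_cst t v : dom t -> lie_bracket E (fun _ => v) t = - 'D_v E t.
Proof.
by move=> Dt; rewrite /lie_bracket (hasD_derive (hasD_cst v t)) sub0r.
Qed.

Lemma hol_constant (v : 'cV[C]_n) : holomorphic dom (fun _ : 'cV[C]_n => v).
Proof. by move=> k; apply: hol_cst; exact: (frob_open hM). Qed.

(** The product axiom for [E], applied to constant fields, knows the derivative of [C_u] along [E];
    the symmetry of the covariant derivative of [c] exchanges it with the derivative of [C_E] along
    [u] at frozen [E]. *)
Lemma U_hasD t : dom t -> hasD (fm_U M) t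
  (fun u => Cm t u + Cm t u *m fm_V M t - fm_V M t *m Cm t u).
Proof.
move=> Dt.
have hU : hasD (fm_U M) t (fun u => 'D_u (fun p => Cm p (E t)) t + Cm t ('D_u E t)).
  have h : hasD (fun p => \sum_a E p a 0 *: fm_c M p a) t (fun u =>
     \sum_a (('D_u E t) a 0 *: fm_c M t a + E t a 0 *: 'D_u (fun p => fm_c M p a) t)).
    apply: hasD_sum => a; apply: hasD_scalel; first exact/hasD_entry/E_hasD.
    exact: (hol_hasD (frob_c_holo hM _ 0) Dt).
  apply: hasD_eqD h _ => u; rewrite big_split /= addrC; congr (_ + _).
  have h : hasD (fun p => Cm p (E t)) t (fun u => \sum_a E t a 0 *: 'D_u (fun p => fm_c M p a) t).
    by apply: hasD_sum => a; apply: hasDZ; exact: (hol_hasD (frob_c_holo hM _ 0) Dt).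
  by rewrite (hasD_derive h).
apply: hasD_eqD hU _ => u; apply: eq_mulmx_cV => g.
have := frob_E_mul hM (hol_constant u) (hol_constant g) Dt.
rewrite !lie_cst // {1}/lie_bracket.
have -> : (fun p => fm_mul M p u g) = (fun p => Cm p u *m g).
  by apply/funext => p; exact: Cm_mulE.
have hg := hasD_mulmx (Cm_hasD u Dt) (hasD_cst g t).
rewrite (hasD_derive hg) mulmx0 addr0 (Cm_dsym _ u Dt) !Cm_mulE !dE //.
rewrite -[- (kappa *: u - _)]scaleN1r (linear_scale (Cm_linear t)) scaleN1r.
have -> : Cm t (kappa *: u - fm_V M t *m u) = kappa *: Cm t u - Cm t (fm_V M t *m u).
  by rewrite (linear_add (Cm_linear t)) (linear_scale (Cm_linear t)) -[- (_ *m u)]scaleN1r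
    (linear_scale (Cm_linear t)) scaleN1r.
exact: euler_identity.
Qed.

Lemma V_tr t : dom t -> (fm_V M t)^T *m eta = - (eta *m fm_V M t).
Proof.
move=> Dt; apply: eq_mulmx_cV => y; apply/matrixP => i j; rewrite !ord1.
have := frob_E_form hM (hol_constant (del C i)) (hol_constant y) Dt.
rewrite !lie_cst // (hasD_derive (hasD_cst (fm_form M (del C i) y) t)).
rewrite /fm_form !dE // => h.
have e (X : 'cV[C]_n) : ((del C i)^T *m X) 0 0 = X i 0.
  by rewrite trmx_delta -rowE mxE.
rewrite -[LHS]e -[RHS]e; apply: (@euler_form_identity _ _ _ _ _ _ kappa).
by rewrite h; congr (_ * _); rewrite /kappa; field.
Qed.

Lemma U_comm t u : dom t -> Cm t u *m fm_U M t = fm_U M t *m Cm t u.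
Proof. by move=> Dt; rewrite fm_UE Cm_comm. Qed.

Lemma U_tr t : dom t -> (fm_U M t)^T *m eta = eta *m fm_U M t.
Proof. by move=> Dt; rewrite fm_UE Cm_tr. Qed.

Lemma fm_intE t w1 w2 : dom t ->
  fm_int M t w1 w2 = (w1 *m fm_U M t *m invmx eta *m w2^T) 0 0.
Proof.
move=> Dt; have ue := frob_eta_unit hM.
have se := frob_eta_sym hM.
rewrite /fm_int /fm_comul /fm_sharp Cm_mulE.
set s1 := invmx eta *m w1^T; set s2 := invmx eta *m w2^T.
rewrite (Cm_sym _ _ Dt) trmx_mul -(mulmxA _ (Cm t s2)^T) (Cm_tr _ Dt) -!mulmxA (Cm_sym _ _ Dt).
by rewrite -fm_UE /s1 trmx_mul trmxK trmx_inv se !mulmxA mulmxKV.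
Qed.

(** The Gram matrix of the intersection form is [U eta^-1], so the discriminant is the degeneracy
    locus of [U]. *)
Lemma starP t : fm_star M t <-> dom t /\ fm_U M t \in unitmx.
Proof.
have e : dom t -> \matrix_(a, b) fm_int M t (delta_mx 0 a) (delta_mx 0 b) =
    fm_U M t *m invmx eta.
  move=> Dt; apply/matrixP => a b; rewrite mxE fm_intE //.
  by rewrite trmx_delta -mulmxA -rowE !mxE -colE; apply: eq_bigr => k _; rewrite !mxE.
have ue := frob_eta_unit hM.
have u2 : dom t -> (fm_U M t *m invmx eta \in unitmx) = (fm_U M t \in unitmx).
  by move=> _; rewrite unitmx_mul unitmx_inv ue andbT.
split=> [[Dt nd]|[Dt ut]]; split => //.
  by apply: contrapT => /negP nu; apply: nd; split => //; rewrite e // u2.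
by move=> [_]; rewrite e // u2 // ut.
Qed.

Lemma star_open : open (fm_star M).
Proof.
rewrite openE => t /starP[Dt ut]; rewrite /interior.
have [r r0 hr] := hasD_unit_near (U_hasD Dt) ut.
have nD := open_near (frob_open hM) Dt.
have nU : \forall q \near t, fm_U M q \in unitmx.
  by apply/nbhs_nmP; exists r; [exact: r0|move=> q /hr[]].
near=> q; apply/starP; split; first by near: q; exact: nD.
by near: q; exact: nU.
Unshelve. all: by end_near. Qed.

End Frobenius.

Section ConnectionAlgebra.
Variable R : realType.
Local Notation C := (Cplx R).

(** [W] is [U^-1] and [S] the symmetric derivative of [C]. After antisymmetrization in [a] and [b]
    the derivative of [W] contributes only the terms coming from [- V a] and [- V b], and these
    cancel the commutator of the connection matrices. *)
Lemma curvature_identity (Kf : fieldType) n (V a b W S : 'M[Kf]_n) : b *m W *m a = a *m W *m b ->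
  (V *m S *m W + V *m b *m - (W *m (a + a *m V - V *m a) *m W))
  - (V *m S *m W + V *m a *m - (W *m (b + b *m V - V *m b) *m W))
  + (V *m a *m W) *m (V *m b *m W) - (V *m b *m W) *m (V *m a *m W) = 0.
Proof.
move=> e; have e' : V *m b *m W *m a = V *m a *m W *m b.
  by rewrite -!mulmxA (mulmxA b) e !mulmxA.
rewrite !(mulmxDr, mulmxBr, mulmxDl, mulmxBl, mulmxN, mulNmx) !mulmxA e'.
move: (V *m S *m W) (V *m a *m W *m b *m W) (V *m a *m W *m b *m V *m W) => x1 x2 x3.
move: (V *m b *m W *m V *m a *m W) (V *m a *m W *m V *m b *m W) => x4 x5.
by apply/matrixP => i j; rewrite !mxE; ring.
Qed.

Lemma skew_identity n (x z : 'rV[C]_n) (X H V : 'M[C]_n) :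
  X *m (H *m V) + (H *m V) *m X^T = 0 ->
  ((x *m X *m H + x *m 0) *m V + x *m H *m 0) *m z^T + x *m H *m V *m (z *m X)^T = 0.
Proof.
move=> e; rewrite !mulmx0 !addr0 trmx_mul.
have -> : x *m X *m H *m V *m z^T + x *m H *m V *m (X^T *m z^T) =
  x *m (X *m (H *m V) + (H *m V) *m X^T) *m z^T.
  by rewrite mulmxDr mulmxDl !mulmxA.
by rewrite e mulmx0 mul0mx.
Qed.

(** Adjoining the function to its gradient adds to the curvature only the torsion term
    [Xu v - Xv u]. *)
Lemma block_flat n (X Y Xu Xv : 'M[C]_n) (u v : 'cV[C]_n) :
  X - Y + Xu *m Xv - Xv *m Xu = 0 -> Xu *m v = Xv *m u ->
  block_mx X 0 0 (0 : 'M[C]_1) - block_mx Y 0 0 0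
    + block_mx Xu u 0 0 *m block_mx Xv v 0 (0 : 'M[C]_1)
    - block_mx Xv v 0 0 *m block_mx Xu u 0 0 = 0.
Proof.
move=> e1 e2; rewrite !mulmx_block !(mulmx0, mul0mx, addr0) e2.
rewrite !opp_block_mx !add_block_mx !(oppr0, addr0, add0r) subrr e1.
exact: block_mx0.
Qed.

Section Blocks.
Variable V : normedModType C.

Lemma blinear_block n (L : V -> 'M[C]_n) : blinear L ->
  blinear (fun v => block_mx (L v) 0 0 (0 : 'M[C]_1)).
Proof.
move=> [l [c c0 h]]; split.
  by move=> a u v; rewrite l scale_block_mx add_block_mx !scaler0 !addr0.
exists c => // v; apply: nm_mxle => [|i j]; first by rewrite mulr_ge0 ?nm_ge0.
rewrite -(splitK i) -(splitK j).
have e0 : 0 <= c * nm v by rewrite mulr_ge0 ?nm_ge0.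
case: (fintype.split i) => i'; case: (fintype.split j) => j' /=;
  rewrite ?block_mxEul ?block_mxEur ?block_mxEdl ?block_mxEdr ?mxE ?nm0 //.
exact: le_trans (nm_entry _ _ _) (h v).
Qed.

Lemma blinear_row_l n (L : V -> 'rV[C]_n) : blinear L ->
  blinear (fun v => row_mx (L v) (0 : 'M[C]_1)).
Proof.
move=> [l [c c0 h]]; split.
  by move=> a u v; rewrite l scale_row_mx add_row_mx scaler0 addr0.
exists c => // v; apply: nm_mxle => [|i j]; first by rewrite mulr_ge0 ?nm_ge0.
rewrite -(splitK j); have e0 : 0 <= c * nm v by rewrite mulr_ge0 ?nm_ge0.
case: (fintype.split j) => j' /=; rewrite ?row_mxEl ?row_mxEr ?mxE ?nm0 //.
exact: le_trans (nm_entry _ _ _) (h v).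
Qed.

Lemma blinear_row_r n (L : V -> 'M[C]_1) : blinear L ->
  blinear (fun v => row_mx (0 : 'rV[C]_n) (L v)).
Proof.
move=> [l [c c0 h]]; split.
  by move=> a u v; rewrite l scale_row_mx add_row_mx scaler0 addr0.
exists c => // v; apply: nm_mxle => [|i j]; first by rewrite mulr_ge0 ?nm_ge0.
rewrite -(splitK j); have e0 : 0 <= c * nm v by rewrite mulr_ge0 ?nm_ge0.
case: (fintype.split j) => j' /=; rewrite ?row_mxEl ?row_mxEr ?mxE ?nm0 //.
exact: le_trans (nm_entry _ _ _) (h v).
Qed.

Lemma blinear_lsub n (L : V -> 'rV[C]_(n + 1)) : blinear L ->
  blinear (fun v => lsubmx (L v)).
Proof.
move=> [l [c c0 h]]; split.
  by move=> a u v; rewrite l; apply/matrixP => i j; rewrite !mxE.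
exists c => // v; apply: nm_mxle => [|i j]; first by rewrite mulr_ge0 ?nm_ge0.
by rewrite mxE (le_trans (nm_entry _ _ _)).
Qed.

Lemma blinear_rsub n (L : V -> 'rV[C]_(n + 1)) : blinear L ->
  blinear (fun v => rsubmx (L v)).
Proof.
move=> [l [c c0 h]]; split.
  by move=> a u v; rewrite l; apply/matrixP => i j; rewrite !mxE.
exists c => // v; apply: nm_mxle => [|i j]; first by rewrite mulr_ge0 ?nm_ge0.
by rewrite mxE (le_trans (nm_entry _ _ _)).
Qed.

End Blocks.

Lemma hasD_row_mx (V : normedModType C) n (f : V -> 'rV[C]_n) (g : V -> 'M[C]_1) p L L' :
  hasD f p L -> hasD g p L' ->
  hasD (fun q => row_mx (f q) (g q)) p (fun v => row_mx (L v) (L' v)).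
Proof.
move=> hf hg.
have h1 := hasD_comp hf (hasD_lin _ (blinear_row_l (blinear_id _))).
have h2 := hasD_comp hg (hasD_lin _ (@blinear_row_r _ n _ (blinear_id _))).
have e (a : 'rV[C]_n) (b : 'M[C]_1) : row_mx a b = row_mx a 0 + row_mx 0 b.
  by rewrite add_row_mx addr0 add0r.
apply: (hasD_ext (f := fun q => row_mx (f q) 0 + row_mx 0 (g q))).
  by near=> q; rewrite -e.
by apply: hasD_eqD (hasDD h1 h2) _ => v; rewrite -e.
Unshelve. all: by end_near. Qed.

Lemma hol_sub (V W : normedModType C) k (D D' : set V) (f : V -> W) :
  D' `<=` D -> holomorphic_upto k D f -> holomorphic_upto k D' f.
Proof.
move=> s; elim: k f => [|k IH] f [h h']; split => //.
- by move=> p /s/h.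
- by move=> p /s/h.
- by move=> v; apply: IH; exact: h'.
Qed.

End ConnectionAlgebra.

(** * The connection of odd periods and its invariant bracket *)

Section Connection.
Variable R : realType.
Local Notation C := (Cplx R).
Local Notation hol := holomorphic_upto.
Variables (n : nat) (M : frob_data C n) (V : 'M[C]_n).
Hypothesis hM : is_frobenius M.
Hypothesis hV : forall t, fm_dom M t -> fm_V M t = V.
Local Notation dom := (fm_dom M).
Local Notation eta := (fm_eta M).
Local Notation U := (fm_U M).
Local Notation star := (fm_star M).

(** [A = V] gives the connection of odd periods; [A = V - 1/2] gives the one whose flat rows are the
    gradients of flat coordinates of the intersection form. *)
Definition conn (A : 'M[C]_n) t u := A *m Cm M t u *m invmx (U t).

(* Acts on the row (grad w, w), for w an odd period. *)
Definition aconn t u : 'M[C]_(n + 1) := block_mx (conn V t u) u 0 0.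

#[local] Opaque Cm fm_U fm_V.

Lemma star_dom t : star t -> dom t. Proof. by case/(starP hM). Qed.
Lemma star_unit t : star t -> U t \in unitmx. Proof. by case/(starP hM). Qed.

Lemma conn_linear A t : linear (conn A t).
Proof.
move=> a u v; rewrite /conn (Cm_linear M t) mulmxDr mulmxDl -scalemxAr -scalemxAl.
by [].
Qed.

Lemma aconn_linear t : linear (aconn t).
Proof.
move=> a u v; rewrite /aconn (conn_linear V t) scale_block_mx add_block_mx !scaler0 !addr0.
by [].
Qed.

Lemma Cm_invU t u : star t -> Cm M t u *m invmx (U t) = invmx (U t) *m Cm M t u.
Proof.
move=> st; have ut := star_unit st.
apply: (can_inj (mulKmx ut)); rewrite mulKVmx // !mulmxA -(U_comm hM _ (star_dom st)).
by rewrite mulmxK.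
Qed.

Lemma conn_sym A t u v : star t -> conn A t u *m v = conn A t v *m u.
Proof.
move=> st; have e x y : conn A t x *m y = A *m (invmx (U t) *m (Cm M t x *m y)).
  by rewrite /conn -(mulmxA A) (Cm_invU x st) !mulmxA.
by rewrite !e (Cm_sym hM u v (star_dom st)).
Qed.

Lemma U_hasD' t : dom t -> hasD U t (fun u => Cm M t u + Cm M t u *m V - V *m Cm M t u).
Proof. by move=> Dt; have := U_hasD hM Dt; rewrite hV. Qed.

Lemma conn_hasD A t v : star t -> hasD (fun t => conn A t v) t (fun u =>
  A *m 'D_u (fun t => Cm M t v) t *m invmx (U t) +
  A *m Cm M t v *m - (invmx (U t) *m (Cm M t u + Cm M t u *m V - V *m Cm M t u) *m invmx (U t))).
Proof.
move=> st; have Dt := star_dom st.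
have h1 := hasD_mulmx (hasD_cst A t) (Cm_hasD hM v Dt).
apply: hasD_eqD (hasD_mulmx h1 (hasD_invmx (U_hasD' Dt) (star_unit st))) _ => u.
by rewrite mul0mx add0r.
Qed.

Lemma U_hol k : hol k dom U.
Proof.
have oD := frob_open hM.
apply: hol_sum => // a; apply: hol_scalel => //; last exact: (frob_c_holo hM).
by apply: hol_entry => //; exact: (frob_E_holo hM).
Qed.

Lemma conn_hol A k u : hol k star (fun t => conn A t u).
Proof.
have oS := star_open hM; have sub : star `<=` dom by move=> t /star_dom.
apply: hol_mulmx => //.
  apply: hol_mulmx => //; first exact: hol_cst.
  by apply: hol_sub sub _; exact: Cm_hol.
apply: hol_invmx => //; first by move=> p /star_unit.
by apply: hol_sub sub _; exact: U_hol.
Qed.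

Lemma aconn_split t u : aconn t u = block_mx (conn V t u) 0 0 0 + block_mx 0 u 0 0.
Proof. by rewrite /aconn add_block_mx !addr0 add0r. Qed.

Lemma aconn_hol k u : hol k star (fun t => aconn t u).
Proof.
have oS := star_open hM.
apply: (hol_ext (f := fun t => block_mx (conn V t u) 0 0 0 + block_mx 0 u 0 0)) => //.
  by move=> p _; rewrite aconn_split.
apply: holD => //; last exact: hol_cst.
apply: (hol_blinear (L := fun X => block_mx X 0 0 (0 : 'M[C]_1))) => //.
  exact/blinear_block/blinear_id.
exact: conn_hol.
Qed.

Lemma conn_flat t u v : star t ->
  'D_u (fun t => conn V t v) t - 'D_v (fun t => conn V t u) t
   + conn V t u *m conn V t v - conn V t v *m conn V t u = 0.
Proof.
move=> st; have Dt := star_dom st.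
rewrite (hasD_derive (conn_hasD V v st)) (hasD_derive (conn_hasD V u st)).
rewrite (Cm_dsym hM u v Dt) /conn; apply: curvature_identity.
by rewrite (Cm_invU v st) -(mulmxA _ (Cm M t v)) (Cm_comm hM v u Dt) mulmxA -(Cm_invU u st).
Qed.

Lemma aconn_flat t u v : star t ->
  'D_u (fun t => aconn t v) t - 'D_v (fun t => aconn t u) t
   + aconn t u *m aconn t v - aconn t v *m aconn t u = 0.
Proof.
move=> st.
have hD w x : 'D_w (fun t => aconn t x) t = block_mx ('D_w (fun t => conn V t x) t) 0 0 0.
  have h : hasD (fun t => conn V t x) t (fun w => 'D_w (fun t => conn V t x) t).
    exact: (hol_hasD (conn_hol V 0 x) st).
  have h' := hasDD (hasD_comp h (hasD_lin _ (blinear_block (blinear_id _))))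
    (hasD_cst (block_mx (0 : 'M[C]_n) x 0 (0 : 'M[C]_1)) t).
  have -> : (fun t => aconn t x) = (fun t => block_mx (conn V t x) 0 0 0 + block_mx 0 x 0 0).
    by apply/funext => q; exact: aconn_split.
  by rewrite (hasD_derive h') addr0.
rewrite !hD; apply: block_flat; first exact: conn_flat.
exact: conn_sym.
Qed.

Definition arow (xi : 'rV[C]_n) (w : C) : 'rV[C]_(n + 1) := row_mx xi w%:M.

Lemma arow_aconn xi w t u : arow xi w *m aconn t u = row_mx (xi *m conn V t u) (xi *m u).
Proof. by rewrite /arow /aconn mul_row_block !mulmx0 !addr0. Qed.

Lemma mul_aconn (z : 'rV[C]_(n + 1)) t u :
  z *m aconn t u = row_mx (lsubmx z *m conn V t u) (lsubmx z *m u).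
Proof. by rewrite -{1}[z]hsubmxK /aconn mul_row_block !mulmx0 !addr0. Qed.

Lemma grad_hasD (w : 'cV[C]_n -> C) t : differentiable w t ->
  hasD w t (fun u => (grad w t *m u) 0 0).
Proof.
move=> dw; apply: hasD_eqD (diff_hasD dw) _ => u.
have [[l _] _] := diff_hasD dw.
rewrite (@linear_cV _ _ _ (fun v => 'D_v w t) u l) mxE; apply: eq_bigr => a _.
by rewrite !mxE mulrC.
Qed.

Lemma odd_period_solution D w p : odd_period M D w -> D p ->
  hasD (fun q => arow (grad w q) (w q)) p (fun u => arow (grad w p) (w p) *m aconn p u).
Proof.
move=> [oD sD hw eq] Dp; have st := sD p Dp; have Dt := star_dom st.
have hg : hasD (grad w) p (fun u => 'D_u (grad w) p).
  have h : hol 0 D (grad w).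
    apply: hol_mx => // i j; apply: (hol_ext (f := fun q => 'D_(del C j) w q)) => //.
      by move=> q _; rewrite mxE.
    exact: (hol_D _ (hw 1)).
  exact: (hol_hasD h Dp).
have hg' : hasD (grad w) p (fun u => grad w p *m conn V p u).
  have [[l _] _] := hg; apply: hasD_eqD hg _ => u.
  rewrite (@linear_cV _ _ _ (fun v => 'D_v (grad w) p) u l).
  have l' : linear (fun v => grad w p *m conn V p v).
    by move=> a x y; rewrite (conn_linear V p) mulmxDr -scalemxAr.
  rewrite [RHS](@linear_cV _ _ _ (fun v => grad w p *m conn V p v) u l').
  apply: eq_bigr => a _; congr (_ *: _).
  rewrite -[LHS](mulmxK (star_unit st)) eq // hV // /conn Cm_del !mulmxA.
  by [].
have hw' : hasD w p (fun u => (grad w p *m u) 0 0).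
  by apply: grad_hasD; have [h _] := hw 0; exact: h.
have bs : blinear (fun z : C => z%:M : 'M[C]_1).
  split; first by move=> b u v; rewrite /= raddfD scale_scalar_mx.
  by exists 1 => // v; rewrite mul1r nm_scalar_mx.
apply: hasD_eqD (hasD_row_mx hg' (hasD_comp hw' (hasD_lin _ bs))) _ => u.
rewrite arow_aconn; congr row_mx; apply/matrixP => i j.
by rewrite !ord1 [LHS]mxE eqxx mulr1n.
Qed.

Lemma solution_grad (z : 'cV[C]_n -> 'rV[C]_(n + 1)) p : hasD z p (fun u => z p *m aconn p u) ->
  grad (fun q => rsubmx (z q) 0 0) p = lsubmx (z p).
Proof.
move=> hz; apply/matrixP => i j; rewrite ord1 mxE.
have h := hasD_comp hz (hasD_lin _ (blinear_entry 0 0 (blinear_rsub (blinear_id _)))).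
rewrite (hasD_derive h) mul_aconn row_mxKr mulmx_del mxE.
by [].
Qed.

Lemma solution_hol k D (z : 'cV[C]_n -> 'rV[C]_(n + 1)) : open D -> D `<=` star ->
  (forall p, D p -> hasD z p (fun u => z p *m aconn p u)) -> hol k D z.
Proof.
move=> oD sD h; elim: k => [|k IH]; first exact: hol_0 h.
apply: (hol_S oD h) => v; apply: hol_mulmx => //.
by apply: hol_sub sD _; exact: aconn_hol.
Qed.

Lemma solution_odd_period D (z : 'cV[C]_n -> 'rV[C]_(n + 1)) : open D -> D `<=` star ->
  (forall p, D p -> hasD z p (fun u => z p *m aconn p u)) ->
  odd_period M D (fun q => rsubmx (z q) 0 0).
Proof.
move=> oD sD h; split => //.
  move=> k; apply: hol_entry => //.
  apply: (hol_blinear (L := fun X : 'rV[C]_(n + 1) => rsubmx X)) => //.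
    exact/blinear_rsub/blinear_id.
  exact: solution_hol.
move=> p Dp a; have st := sD p Dp.
have h' : hasD (grad (fun q => rsubmx (z q) 0 0)) p (fun u => lsubmx (z p) *m conn V p u).
  apply: (hasD_ext (f := fun q => lsubmx (z q))).
    by have := open_near oD Dp; apply: filterS => q Dq; rewrite solution_grad //; exact: h.
  apply: hasD_eqD (hasD_comp (h p Dp) (hasD_lin _ (blinear_lsub (blinear_id _)))) _ => u.
  by rewrite mul_aconn row_mxKl.
rewrite (hasD_derive h') solution_grad; last exact: h.
rewrite (hV (star_dom st)) -(Cm_del M p a) /conn !mulmxA mulmxKV; last exact: star_unit.
by [].
Qed.

Definition bracket (xi zeta : 'rV[C]_n) : 'M[C]_1 := xi *m invmx eta *m V^T *m zeta^T.

Lemma poissonE f g t : dom t -> poisson M f g t = bracket (grad f t) (grad g t) 0 0.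
Proof. by move=> Dt; rewrite /poisson hV. Qed.

(** For [eta] the operators [C_u] and [U] are self-adjoint and [V] is skew. Hence the connection
    preserves the bivector [eta^-1 V^T], and brackets of odd periods are locally constant. *)
Lemma conn_skew t u : star t ->
  conn V t u *m (invmx eta *m V^T) + (invmx eta *m V^T) *m (conn V t u)^T = 0.
Proof.
move=> st; have Dt := star_dom st; have ue := frob_eta_unit hM; have ut := star_unit st.
have se := frob_eta_sym hM.
have eV : invmx eta *m V^T = - (V *m invmx eta).
  have := V_tr hM Dt; rewrite hV // => e.
  by rewrite -[V^T](mulmxK ue) e mulNmx mulmxN !mulmxA mulVmx // mul1mx.
have eC : invmx eta *m (Cm M t u)^T = Cm M t u *m invmx eta.
  by rewrite -[(Cm _ _ _)^T](mulmxK ue) (Cm_tr hM _ Dt) !mulmxA mulVmx // mul1mx.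
have eU : invmx eta *m (U t)^T = U t *m invmx eta.
  by rewrite -[(U t)^T](mulmxK ue) (U_tr hM Dt) !mulmxA mulVmx // mul1mx.
have eW : invmx eta *m (invmx (U t))^T = invmx (U t) *m invmx eta.
  apply: (can_inj (mulKmx ut)); rewrite mulKVmx // mulmxA -eU -mulmxA.
  by rewrite -trmx_mul mulVmx // trmx1 mulmx1.
rewrite /conn !trmx_mul eV mulNmx -!mulmxA (mulmxA (invmx eta)) eW.
rewrite -(mulmxA (invmx (U t))) (mulmxA (invmx eta)) eC -eV.
by rewrite (mulmxA (Cm _ _ _)) Cm_invU // !mulmxA subrr.
Qed.

Lemma bracket_hasD0 (xi zeta : 'cV[C]_n -> 'rV[C]_n) t : star t ->
  hasD xi t (fun u => xi t *m conn V t u) -> hasD zeta t (fun u => zeta t *m conn V t u) ->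
  hasD (fun q => bracket (xi q) (zeta q)) t (fun _ => 0).
Proof.
move=> st h1 h2.
have hT := hasD_comp h2 (hasD_lin _ (blinear_trmx (blinear_id _))).
have hl := hasD_mulmx (hasD_mulmx h1 (hasD_cst (invmx eta) t)) (hasD_cst V^T t).
apply: hasD_eqD (hasD_mulmx hl hT) _ => u.
exact: skew_identity (conn_skew u st).
Qed.

End Connection.

(** * Explicit solutions on the cross *)

Section ComplexExp.
Variable R : realType.
Local Notation C := (Cplx R).

Lemma cexpD (s h : C) : cexp (s + h) = cexp s * cexp h.
Proof.
case: s => a b; case: h => c d; rewrite /cexp /cRe /cIm /creal /=.
rewrite expRD cosD sinD; simpc; congr Complex; ring.
Qed.

Lemma cexp0 : cexp (0 : C) = 1.
Proof. by rewrite /cexp /cRe /cIm /creal /= expR0 cos0 sin0; simpc. Qed.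

Lemma nm_cexp (s : C) : nm (cexp s) = expR (cRe s).
Proof.
rewrite /cexp nmM nm_creal ger0_norm ?expR_ge0 // -[RHS]mulr1; congr (_ * _).
by rewrite /nm /cRe normc_def /= cos2Dsin2 sqrtr1.
Qed.

Lemma cexpX (s : C) k : cexp s ^+ k = cexp (s *+ k).
Proof. by elim: k => [|k IH]; rewrite ?expr0 ?mulr0n ?cexp0 // exprS IH mulrS cexpD. Qed.

Lemma cexp_remainder (eps : R) : 0 < eps -> exists2 d : R, 0 < d & forall h : C, nm h < d ->
  nm (cexp h - 1 - h) <= eps * nm h.
Proof.
(* The five error terms below add up to at most [7 e x], within the allowed [10 e x]; the cap
   [1 / 10] keeps the modulus of [1 + a + z1] below 2. *)
move=> eps0; pose e := Num.min (eps / 10) (1 / 10).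
have e0 : 0 < e by rewrite lt_min !divr_gt0.
have e1 : e <= 1 / 10 by rewrite ge_min lexx orbT.
have e2 : 10 * e <= eps by rewrite mulrC -ler_pdivlMr // ge_min lexx.
clearbody e.
have [d1 d10 h1] := is_derive_epsE (is_derive_expR (0 : R)) e0.
have [d2 d20 h2] := is_derive_epsE (is_derive_cos (0 : R)) e0.
have [d3 d30 h3] := is_derive_epsE (is_derive_sin (0 : R)) e0.
exists (Num.min e (Num.min d1 (Num.min d2 d3))).
  by rewrite !lt_min e0 d10 d20 d30.
move=> h; rewrite !lt_min => /and4P[hh hd1 hd2 hd3].
have ha := cRe_le_nm h; have hb := cIm_le_nm h.
have := h1 _ (le_lt_trans ha hd1); have := h2 _ (le_lt_trans hb hd2).
have := h3 _ (le_lt_trans hb hd3).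
rewrite !add0r expR0 cos0 sin0 mul1r subr0 oppr0 mul0r subr0 mul1r.
rewrite /cexp; case: h hh hd1 hd2 hd3 ha hb => a b hh _ _ _; rewrite {1 3 5}/cRe {1 3 5}/cIm /=.
set x := nm _ in hh *; move=> ha hb k3 k2 k1.
pose z1 := expR a - 1 - a; pose z2 := cos b - 1; pose z3 := sin b - b.
have a1 : `|z1| <= e * x by apply: (le_trans k1); rewrite ler_wpM2l // ltW.
have a2 : `|z2| <= e * x by apply: (le_trans k2); rewrite ler_wpM2l // ltW.
have a3 : `|z3| <= e * x by apply: (le_trans k3); rewrite ler_wpM2l // ltW.
have x0 : 0 <= x by exact: nm_ge0.
have ex : e * x <= 1 / 10 * x by rewrite ler_wpM2r.
have x1 : x <= 1 / 10 by apply: (le_trans (ltW hh)).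
apply: (le_trans (nm_le_ReIm _)).
have -> : cRe (creal (expR a) * (cos b +i* sin b)%C - 1 - (a +i* b)%C) = z1 + z2 * (1 + a + z1).
  by rewrite /cRe /creal /= /z1 /z2; ring.
have -> : cIm (creal (expR a) * (cos b +i* sin b)%C - 1 - (a +i* b)%C) = a * b + z1 * b + z3 * (1 + a + z1).
  by rewrite /cIm /creal /= /z1 /z3; ring.
have n1 : `|1 + a + z1| <= 2.
  by rewrite (le_trans (ler_normD _ _)) // (le_trans (lerD (ler_normD _ _) (lexx _))) // normr1; lra.
have n2 : `|z2 * (1 + a + z1)| <= e * x * 2 by rewrite normrM ler_pM.
have n3 : `|z3 * (1 + a + z1)| <= e * x * 2 by rewrite normrM ler_pM.
have n4 : `|a * b| <= e * x by rewrite normrM ler_pM // (le_trans ha) // ltW.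
have n5 : `|z1 * b| <= e * x * 1.
  by rewrite normrM ler_pM // (le_trans hb) // (le_trans x1) //; lra.
have m1 := ler_normD z1 (z2 * (1 + a + z1)).
have m2 := ler_normD (a * b + z1 * b) (z3 * (1 + a + z1)).
have m3 := ler_normD (a * b) (z1 * b).
have : 10 * e * x <= eps * x by rewrite ler_wpM2r.
have : 0 <= e * x by rewrite mulr_ge0 // ltW.
lra.
Qed.

Lemma cexp_hasD (s : C) : hasD (@cexp R) s (fun h => h * cexp s).
Proof.
split; first by apply: (blinear_scalel (L := fun h : C => h)); apply: blinear_id.
move=> eps eps0; have E0 : 0 < expR (cRe s) by exact: expR_gt0.
have [|d d0 hd] := @cexp_remainder (eps / expR (cRe s)); first by rewrite divr_gt0.
exists d => // h /hd hh.
have -> : cexp (s + h) - cexp s - h * cexp s = cexp s * (cexp h - 1 - h).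
  by rewrite cexpD; ring.
by rewrite nmM nm_cexp -ler_pdivlMl // mulrA [_^-1 * _]mulrC.
Qed.

End ComplexExp.

(** * Series converging at a geometric rate *)

Section MatrixSeries.
Variable R : realType.
Local Notation C := (Cplx R).
Implicit Types (a b : nat).

(** The rate [2^-K] is part of the definition, with default 0 when there is no such limit. The ratio
    [1/2] is achieved later by taking [Q] small, and a fixed ratio gives every tail estimate a
    closed form. *)
Definition gsum a b (u : nat -> 'M[C]_(a, b)) : 'M[C]_(a, b) :=
  xget 0 [set l | exists c : R, forall K, nm (\sum_(k < K) u k - l) <= c * (1 / 2) ^+ K].

Lemma gsumE a b (u : nat -> 'M[C]_(a, b)) l c :
  (forall K, nm (\sum_(k < K) u k - l) <= c * (1 / 2) ^+ K) -> gsum u = l.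
Proof.
move=> hl; rewrite /gsum.
have [c' hc'] : exists c' : R, forall K, nm (\sum_(k < K) u k - gsum u) <= c' * (1 / 2) ^+ K.
  by apply: (@xgetPex _ 0 [set l | exists c : R, forall K, nm (\sum_(k < K) u k - l) <= c * (1 / 2) ^+ K]); exists l, c.
apply/subr0_eq/nm_eq0/eqP; rewrite eq_le nm_ge0 andbT.
apply: (@le_small _ _ _ (c + c')) => K; rewrite add0r mulrDl.
rewrite (le_trans (nm_trans (\sum_(k < K) u k) _ _)) // addrC lerD //.
by rewrite nm_distC.
Qed.

Lemma gsumP a b (u : nat -> 'M[C]_(a, b)) (c : R) : (forall k, nm (u k) <= c * (1 / 2) ^+ k) ->
  forall K, nm (\sum_(k < K) u k - gsum u) <= 4 * c * (1 / 2) ^+ K.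
Proof.
move=> hu.
have half01 : 0 <= (1 / 2 : R) < 1 by lra.
have [|l hl] := @geometric_limit R a b (fun K => \sum_(k < K) u k) c (1 / 2) half01.
  by move=> k; rewrite big_ord_recr /= [X in nm X]addrC addKr.
have hl' K : nm (\sum_(k < K) u k - l) <= 4 * c * (1 / 2) ^+ K.
  by apply: (le_trans (hl K)); apply: eq_ler; field.
by rewrite (gsumE hl').
Qed.

Lemma nm_gsum a b (u : nat -> 'M[C]_(a, b)) (c : R) : (forall k, nm (u k) <= c * (1 / 2) ^+ k) ->
  nm (gsum u) <= 4 * c.
Proof.
by move=> /gsumP/(_ 0%N); rewrite big_ord0 expr0 mulr1 sub0r nmN.
Qed.

Lemma gsum_blinear a b a' b' (L : 'M[C]_(a, b) -> 'M[C]_(a', b')) (u : nat -> 'M[C]_(a, b)) (c : R) :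
  blinear L -> (forall k, nm (u k) <= c * (1 / 2) ^+ k) ->
  gsum (fun k => L (u k)) = L (gsum u).
Proof.
move=> [l [d d0 hd]] hu; apply: (@gsumE _ _ _ _ (d * (4 * c))) => K.
have -> : \sum_(k < K) L (u k) = L (\sum_(k < K) u k).
  by elim/big_rec2 : _ => [|i x y _ ->]; rewrite ?(linear_zero l) ?(linear_add l).
rewrite -[- L _]scaleN1r -(linear_scale l) -(linear_add l) scaleN1r.
by rewrite (le_trans (hd _)) // -mulrA ler_wpM2l // gsumP.
Qed.

Lemma gsumD a b (u v : nat -> 'M[C]_(a, b)) (c d : R) :
  (forall k, nm (u k) <= c * (1 / 2) ^+ k) -> (forall k, nm (v k) <= d * (1 / 2) ^+ k) ->
  gsum (fun k => u k + v k) = gsum u + gsum v.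
Proof.
move=> hu hv; apply: (@gsumE _ _ _ _ (4 * c + 4 * d)) => K.
rewrite big_split /= opprD addrACA (le_trans (nmD _ _)) // mulrDl lerD //; exact: gsumP.
Qed.

Lemma gsum_recl a b (u : nat -> 'M[C]_(a, b)) (c : R) :
  (forall k, nm (u k) <= c * (1 / 2) ^+ k) -> gsum u = u 0%N + gsum (fun k => u k.+1).
Proof.
move=> hu.
have hu' k : nm (u k.+1) <= (c / 2) * (1 / 2) ^+ k.
  by apply: (le_trans (hu _)); apply: eq_ler; rewrite exprS; field.
apply: (@gsumE _ _ _ _ (4 * c + nm (u 0%N) + nm (gsum (fun k => u k.+1)))) => -[|K].
  rewrite big_ord0 sub0r nmN expr0 mulr1 (le_trans (nmD _ _)) // -addrA lerDr.
  by rewrite mulr_ge0 // (le_trans (nm_ge0 _) (le_trans (hu 0%N) _)) // expr0 mulr1.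
rewrite big_ord_recl opprD addrACA subrr add0r.
apply: (le_trans (gsumP hu' K)).
have c0 : 0 <= c by rewrite (le_trans (nm_ge0 _) (le_trans (hu 0%N) _)) // expr0 mulr1.
rewrite exprS !mulrA ler_wpM2r ?exprn_ge0 //.
have := nm_ge0 (u 0%N); have := nm_ge0 (gsum (fun k => u k.+1)); lra.
Qed.

Lemma eq_gsum a b (u v : nat -> 'M[C]_(a, b)) : (forall k, u k = v k) -> gsum u = gsum v.
Proof. by move=> h; congr gsum; apply/funext. Qed.

(** The head is differentiated term by term. The tails need bounds on a whole ball: the mean value
    inequality then makes their increments, and not merely their values, small. *)
Lemma hasD_gsum (V : normedModType C) a b (T : nat -> V -> 'M[C]_(a, b))
    (T' : nat -> V -> V -> 'M[C]_(a, b)) p (d c : R) : 0 < d ->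
  (forall k q, nm (q - p) < d -> hasD (T k) q (T' k q)) ->
  (forall k q, nm (q - p) < d -> nm (T k q) <= c * (1 / 2) ^+ k) ->
  (forall k q v, nm (q - p) < d -> nm (T' k q v) <= c * (1 / 2) ^+ k * nm v) ->
  hasD (fun q => gsum (fun k => T k q)) p (fun v => gsum (fun k => T' k p v)).
Proof.
move=> d0 hD hT hT'.
have pp : nm (p - p) < d by rewrite subrr nm0.
have c0 : 0 <= c by rewrite (le_trans (nm_ge0 (T 0%N p))) // (le_trans (hT 0%N p pp)) // expr0 mulr1.
have hT'p v k : nm (T' k p v) <= c * nm v * (1 / 2) ^+ k by rewrite mulrAC; exact: hT'.
have linT' k : linear (T' k p) by have [[l _] _] := hD k p pp.
split.
  split; last first.
    exists (4 * c); first by rewrite mulr_ge0.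
    by move=> v; rewrite -mulrA; apply: nm_gsum; exact: hT'p.
  move=> x u v.
  rewrite -(gsum_blinear (blinearZ x (blinear_id _)) (hT'p u)).
  rewrite -(gsumD (c := nm x * (c * nm u)) _ (hT'p v)); last first.
    by move=> k; rewrite nmZ -mulrA ler_wpM2l ?nm_ge0.
  by apply: eq_gsum => k; rewrite linT'.
move=> eps eps0.
(* the tail beyond K is Lipschitz with constant 16 c / 2^K *)
have [K hK] : exists K, 16 * c * (1 / 2) ^+ K <= eps / 2.
  apply: contrapT => /forallNP h.
  have : eps / 2 <= 0.
    apply: (@le_small _ _ _ (16 * c)) => l; rewrite add0r; have := h l.
    by move/negP; rewrite -ltNge => /ltW.
  by rewrite leNgt divr_gt0.
have hS : hasD (fun q => \sum_(k < K) T k q) p (fun v => \sum_(k < K) T' k p v).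
  by apply: hasD_sum => k; exact: hD.
have [_ /(_ (eps / 2))] := hS; rewrite divr_gt0 // => /(_ isT)[r r0 hr].
exists (Num.min r d); first by rewrite lt_min r0.
move=> w; rewrite lt_min => /andP[wr wd].
have pw : nm (p + w - p) < d by rewrite addrC addKr.
have tail k : nm (T k (p + w) - T k p) <= 2 * (c * (1 / 2) ^+ k * nm w).
  apply: (mvt (L := fun t => T' k (p + creal t *: w))) => t t01.
    apply: hD; have := segment_ball t01 pp pw.
    by rewrite [X in creal t *: X](_ : _ = w) // addrC addKr.
  apply: hT'; have := segment_ball t01 pp pw.
  by rewrite [X in creal t *: X](_ : _ = w) // addrC addKr.
have half0 : 0 <= (1 / 2 : R) ^+ K by rewrite exprn_ge0.
pose S q := gsum (fun k => T k q).
have key q : nm (q - p) < d -> S q = \sum_(k < K) T k q + gsum (fun k => T (K + k)%N q).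
  move=> qd; have := hT^~ q; move=> /(_ _ qd) h.
  have : forall j, S q = \sum_(k < j) T k q + gsum (fun k => T (j + k)%N q).
    elim=> [|j IH]; first by rewrite big_ord0 add0r.
    rewrite IH big_ord_recr /= -addrA; congr (_ + _).
    rewrite (@gsum_recl _ _ _ c).
      rewrite addn0; congr (_ + _); apply: eq_gsum => k; by rewrite addnS.
    move=> k; apply: (le_trans (h _)); rewrite exprD mulrA ler_wpM2r ?exprn_ge0 //.
    by rewrite ler_piMr // exprn_ile1 //; lra.
  exact.
have key' : gsum (fun k => T' k p w) = \sum_(k < K) T' k p w + gsum (fun k => T' (K + k)%N p w).
  have h := hT'p w.
  have : forall j, gsum (fun k => T' k p w) = \sum_(k < j) T' k p w + gsum (fun k => T' (j + k)%N p w).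
    elim=> [|j IH]; first by rewrite big_ord0 add0r.
    rewrite IH big_ord_recr /= -addrA; congr (_ + _).
    rewrite (@gsum_recl _ _ _ (c * nm w)).
      rewrite addn0; congr (_ + _); apply: eq_gsum => k; by rewrite addnS.
    move=> k; apply: (le_trans (h _)); rewrite exprD mulrA ler_wpM2r ?exprn_ge0 //.
    by rewrite ler_piMr ?mulr_ge0 ?nm_ge0 // exprn_ile1 //; lra.
  exact.
rewrite -/(S (p + w)) -/(S p) (key _ pw) (key _ pp) key'.
set X := \sum_(k < K) T k (p + w); set Y := \sum_(k < K) T k p; set Z := \sum_(k < K) T' k p w.
have b1 k q : nm (q - p) < d -> nm (T (K + k)%N q) <= c * (1 / 2) ^+ K * (1 / 2) ^+ k.
  by move=> qd; rewrite -mulrA -exprD; exact: hT.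
have b2 k : nm (T' (K + k)%N p w) <= c * nm w * (1 / 2) ^+ K * (1 / 2) ^+ k.
  by rewrite -mulrA -exprD; exact: hT'p.
have tl : nm (gsum (fun k => T (K + k)%N (p + w)) - gsum (fun k => T (K + k)%N p)) <=
   4 * (2 * c * nm w * (1 / 2) ^+ K).
  rewrite -(gsum_blinear (blinearN (blinear_id _)) (fun k => b1 k p pp)).
  rewrite -(gsumD (fun k => b1 k _ pw) (v := fun k => - T (K + k)%N p) (d := c * (1 / 2) ^+ K)); last first.
    by move=> k; rewrite nmN; exact: b1.
  apply: nm_gsum => k; apply: (le_trans (tail _)).
  by rewrite exprD; apply: eq_ler; ring.
have tl' := nm_gsum b2.
have fin := hr w wr; rewrite -/X -/Y -/Z in fin.
set m1 := gsum _ in tl *; set m2 := gsum _ in tl *; set m3 := gsum _ in tl' *.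
have -> : X + m1 - (Y + m2) - (Z + m3) = (X - Y - Z) + (m1 - m2) - m3.
  clearbody X Y Z m1 m2 m3.
  by apply/matrixP => i j; rewrite !mxE; ring.
apply: (le_trans (nmB _ _)); apply: (le_trans (lerD (le_trans (nmD _ _) (lerD fin tl)) tl')).
have : 16 * c * (1 / 2) ^+ K * nm w <= eps / 2 * nm w by rewrite ler_wpM2r ?nm_ge0.
have : 0 <= c * nm w * (1 / 2) ^+ K by rewrite !mulr_ge0 ?nm_ge0.
move: ((1 / 2) ^+ K) => h; lra.
Qed.

End MatrixSeries.

(** * Iterated derivatives along the unit field *)

Section JetDef.
Variable R : realType.
Local Notation C := (Cplx R).
Variables (n : nat) (V : 'M[C]_n) (U : 'cV[C]_n -> 'M[C]_n) (r g : 'cV[C]_n -> 'rV[C]_n).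

(* [Pjet m] is the (m-1)-st derivative of a flat gradient along the unit field,
   [Gjet m] that of the inhomogeneous solution g. *)
Fixpoint Pjet m t : 'rV[C]_n :=
  if m is m'.+1 then Pjet m' t *m (V + (1 / 2 - m'%:R)%:M) *m invmx (U t) else r t.

Fixpoint Gjet0 m t : 'rV[C]_n :=
  if m is m'.+1 then
    (Gjet0 m' t *m (V + (- (1 / 2) - m'%:R)%:M) - 2 *: Pjet m t) *m invmx (U t)
  else g t.

Definition Gjet m t : 'rV[C]_n := if m is m'.+1 then Gjet0 m' t else 0.

Lemma PjetS m t : Pjet m.+1 t = Pjet m t *m (V + (1 / 2 - m%:R)%:M) *m invmx (U t).
Proof. by []. Qed.

Lemma GjetSS m t : Gjet m.+2 t =
  (Gjet m.+1 t *m (V + (- (1 / 2) - m%:R)%:M) - 2 *: Pjet m.+1 t) *m invmx (U t).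
Proof. by []. Qed.

Lemma Gjet_0 t : Gjet 0 t = 0. Proof. by []. Qed.
Lemma Gjet_1 t : Gjet 1 t = g t. Proof. by []. Qed.
Lemma Pjet_0 t : Pjet 0 t = r t. Proof. by []. Qed.

Lemma Pjet_eq0 m t : r t = 0 -> Pjet m t = 0.
Proof. by move=> r0; elim: m => [//|m IH]; rewrite PjetS IH !mul0mx. Qed.

End JetDef.

#[local] Opaque Pjet Gjet0 Gjet Cm fm_U.

(** The summand [c] in the differential [c + c V - V c] of [U] lowers the constant [x] by one. This
    is why differentiating one step of the recursion reproduces the next one. *)
Lemma jet_identity (R : realType) n (X1 X2 : 'rV[Cplx R]_n) (V c W : 'M[Cplx R]_n)
    (x y : Cplx R) : c *m W = W *m c -> y = x - 1 -> X2 = X1 *m (V + y%:M) *m W ->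
  X1 *m c *m (V + x%:M) *m W - X1 *m (c + c *m V - V *m c) *m W = X2 *m c.
Proof.
move=> e -> ->; rewrite -(mulmxA _ W c) -e !mulmxA.
rewrite !(mulmxDr, mulmxDl, mulmxN, mulNmx, mul_mx_scalar) !mulmxA -!scalemxAl.
move: (X1 *m c *m V *m W) (X1 *m c *m W) (X1 *m V *m c *m W) => x1 x2 x3.
by apply/matrixP => i j; rewrite !mxE; ring.
Qed.

Lemma jet_step (R : realType) n (X X1 X2 Z1 Z2 : 'rV[Cplx R]_n) (V c W : 'M[Cplx R]_n)
    (x y : Cplx R) : c *m W = W *m c -> X1 = (X *m (V + x%:M) - Z1) *m W -> y = x - 1 ->
  X2 = (X1 *m (V + y%:M) - Z2) *m W ->
  (X1 *m c *m (V + x%:M) + X *m 0 - Z2 *m c) *m W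
  + (X *m (V + x%:M) - Z1) *m - (W *m (c + c *m V - V *m c) *m W) = X2 *m c.
Proof.
move=> e e1 -> ->; rewrite mulmx0 addr0 mulmxN !mulmxA -e1 mulmxBl addrAC.
rewrite (jet_identity e (erefl (x - 1)) (erefl _)).
by rewrite -(mulmxA _ c W) e mulmxA -mulmxBl -mulmxBl.
Qed.

Lemma jet_step0 (R : realType) n (X X1 X2 : 'rV[Cplx R]_n) (V c W : 'M[Cplx R]_n)
    (x y : Cplx R) : c *m W = W *m c -> X1 = X *m (V + x%:M) *m W -> y = x - 1 ->
  X2 = X1 *m (V + y%:M) *m W ->
  (X1 *m c *m (V + x%:M) + X *m 0) *m W
  + X *m (V + x%:M) *m - (W *m (c + c *m V - V *m c) *m W) = X2 *m c.
Proof.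
move=> e e1 ey e2; rewrite mulmx0 addr0 mulmxN !mulmxA -e1.
exact (jet_identity e ey e2).
Qed.

Lemma half_sub (R : realType) (x : Cplx R) m : x - m.+1%:R = x - m%:R - 1.
Proof. by rewrite -natr1 opprD addrA. Qed.

Lemma nm_half (R : realType) : nm (1 / 2 : Cplx R) = 1 / 2.
Proof. by rewrite nmM nmV nm1 nm_nat. Qed.

Section Jets.
Variable R : realType.
Local Notation C := (Cplx R).
Local Notation hol := holomorphic_upto.
Variables (n : nat) (M : frob_data C n) (V : 'M[C]_n).
Hypothesis hM : is_frobenius M.
Hypothesis hV : forall t, fm_dom M t -> fm_V M t = V.
Local Notation U := (fm_U M).
Local Notation star := (fm_star M).
Variables (r g : 'cV[C]_n -> 'rV[C]_n).
Local Notation Pjet := (Pjet V U r).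
Local Notation Gjet := (Gjet V U r g).

Lemma invU_hasD t : star t -> hasD (fun t => invmx (U t)) t (fun v =>
  - (invmx (U t) *m (Cm M t v + Cm M t v *m V - V *m Cm M t v) *m invmx (U t))).
Proof.
by move=> st; exact: hasD_invmx (U_hasD' hM hV (star_dom hM st)) (star_unit hM st).
Qed.

Lemma Pjet_hasD m t : star t -> hasD r t (fun v => Pjet 1 t *m Cm M t v) ->
  hasD (Pjet m) t (fun v => Pjet m.+1 t *m Cm M t v).
Proof.
move=> st hr; elim: m => [|m IH].
  apply: hasD_ext hr; near=> q; by rewrite Pjet_0.
apply: (hasD_ext (f := fun t => Pjet m t *m (V + (1 / 2 - m%:R)%:M) *m invmx (U t))).
  by near=> q; rewrite PjetS.
apply: hasD_eqD (hasD_mulmx (hasD_mulmx IH (hasD_cst _ t)) (invU_hasD st)) _ => v.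
exact (jet_step0 (Cm_invU hM v st) (PjetS V U r m t) (half_sub _ m) (PjetS V U r m.+1 t)).
Unshelve. all: by end_near. Qed.

Lemma Gjet_hasD m t : star t -> hasD r t (fun v => Pjet 1 t *m Cm M t v) ->
  hasD g t (fun v => Gjet 2 t *m Cm M t v) ->
  hasD (Gjet m.+1) t (fun v => Gjet m.+2 t *m Cm M t v).
Proof.
move=> st hr hg; elim: m => [|m IH].
  by apply: hasD_ext hg; near=> q; rewrite Gjet_1.
apply: (hasD_ext (f := fun t => (Gjet m.+1 t *m (V + (- (1 / 2) - m%:R)%:M)
    - 2 *: Pjet m.+1 t) *m invmx (U t))).
  by near=> q; rewrite GjetSS.
have h1 := hasDB (hasD_mulmx IH (hasD_cst (V + (- (1 / 2) - m%:R)%:M) t))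
  (hasDZ 2 (Pjet_hasD m.+1 st hr)).
apply: hasD_eqD (hasD_mulmx h1 (invU_hasD st)) _ => v.
rewrite scalemxAl.
exact (jet_step (Cm_invU hM v st) (GjetSS V U r g m t) (half_sub _ m) (GjetSS V U r g m.+1 t)).
Unshelve. all: by end_near. Qed.

Section JetBounds.
Variables (t : 'cV[C]_n) (w a b : R).
Hypotheses (hw : nm (invmx (U t)) <= w) (w0 : 0 <= w).

Let N : R := n%:R.
Definition jet_const : R := 1 + N * N * (nm V + 1) * w + 2 * N * w.
Let K := jet_const.
Let N0 : 0 <= N. Proof. by []. Qed.
Let K1 : 1 <= K.
Proof. by rewrite /K /jet_const -addrA lerDl !(addr_ge0, mulr_ge0) ?nm_ge0. Qed.

Lemma nm_jet_factor (X : 'rV[C]_n) (x : C) m : nm x <= 1 / 2 + m%:R ->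
  nm (X *m (V + x%:M) *m invmx (U t)) <= K * m.+1%:R * nm X.
Proof.
move=> hx.
have h1 : nm (V + x%:M) <= (nm V + 1) * m.+1%:R.
  apply: (le_trans (nmD _ _)); have := nm_scalar_mx n x; have := nm_ge0 V.
  have : 0 <= m%:R :> R by []. rewrite -natr1; nra.
have h2 : nm (X *m (V + x%:M)) <= N * (nm X * ((nm V + 1) * m.+1%:R)).
  by apply: (le_trans (nm_mulmx _ _)); rewrite ler_wpM2l // ler_wpM2l ?nm_ge0.
apply: (le_trans (nm_mulmx _ _)).
apply: (@le_trans _ _ (N * (N * (nm X * ((nm V + 1) * m.+1%:R)) * w))).
  by rewrite ler_wpM2l // ler_pM ?nm_ge0.
have -> : K * m.+1%:R * nm X = 1 * m.+1%:R * nm X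
    + N * N * (nm V + 1) * w * m.+1%:R * nm X + 2 * N * w * m.+1%:R * nm X.
  by rewrite /K /jet_const; ring.
have := nm_ge0 X; have := nm_ge0 V => v0 x0.
have : 0 <= 1 * m.+1%:R * nm X by rewrite !mulr_ge0.
have : 0 <= 2 * N * w * m.+1%:R * nm X by rewrite !mulr_ge0.
have -> : N * (N * (nm X * ((nm V + 1) * m.+1%:R)) * w) =
   N * N * (nm V + 1) * w * m.+1%:R * nm X by ring.
lra.
Qed.

Lemma nm_jet_two (X : 'rV[C]_n) : nm (2 *: X *m invmx (U t)) <= K * nm X.
Proof.
apply: (le_trans (nm_mulmx _ _)); rewrite nmZ nm_nat.
apply: (@le_trans _ _ (N * (2 * nm X * w))).
  by rewrite ler_wpM2l // ler_wpM2l // mulr_ge0 ?nm_ge0.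
have -> : K * nm X = nm X + N * N * (nm V + 1) * w * nm X + 2 * N * w * nm X.
  by rewrite /K /jet_const; ring.
have := nm_ge0 X; have := nm_ge0 V => v0 x0.
have : 0 <= N * N * (nm V + 1) * w * nm X by rewrite !mulr_ge0 // addr_ge0.
have -> : N * (2 * nm X * w) = 2 * N * w * nm X by ring.
lra.
Qed.

Hypotheses (hr0 : nm (r t) <= a) (hr1 : nm (Pjet 1 t) <= a) (hg : nm (g t) <= b) (hab : a * K <= b).

Let a0 : 0 <= a. Proof. exact: le_trans (nm_ge0 _) hr0. Qed.

Lemma Pjet_bound0 m : nm (Pjet m t) <= a * K ^+ m * m`!%:R.
Proof.
have KX j : 1 <= K ^+ j by exact: exprn_ege1.
have a1 : nm (Pjet 1 t) <= a * K ^+ 1 * 1`!%:R.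
  by rewrite expr1 mulr1 (le_trans hr1) // ler_peMr.
elim: m => [|[|m] IH]; first by rewrite Pjet_0 expr0 !mulr1.
  exact: a1.
rewrite PjetS (le_trans (nm_jet_factor (m := m.+1) _ _)) //.
  apply: (le_trans (nmB _ _)); rewrite nm_nat lerD2r.
  by rewrite ?nmN nm_half.
have -> : a * K ^+ m.+2 * (m.+2)`!%:R = K * m.+2%:R * (a * K ^+ m.+1 * (m.+1)`!%:R).
  by rewrite (factS m.+1) natrM exprS; ring.
by rewrite ler_wpM2l // mulr_ge0 // (le_trans ler01).
Qed.

(** The base is [2 K] because the recursion has two terms, each bounded by [K (m+1)] times the
    previous bound; the hypothesis [a K <= b] lets the term in [P] be absorbed in this way. *)
Lemma Gjet_bound0 m : nm (Gjet m.+1 t) <= b * (2 * K) ^+ m * m`!%:R.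
Proof.
have K0 : 0 <= K by exact: le_trans ler01 K1.
have b0 : 0 <= b by exact: le_trans (nm_ge0 _) hg.
elim: m => [|m IH]; first by rewrite Gjet_1 expr0 !mulr1.
rewrite GjetSS mulmxBl (le_trans (nmB _ _)) //.
have h1 : nm (Gjet m.+1 t *m (V + (- (1 / 2) - m%:R)%:M) *m invmx (U t)) <=
    K * m.+1%:R * (b * (2 * K) ^+ m * m`!%:R).
  apply: (le_trans (nm_jet_factor (m := m) _ _)).
    apply: (le_trans (nmB _ _)); rewrite nm_nat lerD2r nmN.
    by rewrite ?nmN nm_half.
  by rewrite ler_wpM2l // mulr_ge0.
have h2 : nm (2 *: Pjet m.+1 t *m invmx (U t)) <= K * m.+1%:R * (b * (2 * K) ^+ m * m`!%:R).
  apply: (le_trans (nm_jet_two _)).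
  have -> : K * m.+1%:R * (b * (2 * K) ^+ m * m`!%:R) = K * (b * (2 * K) ^+ m * (m.+1)`!%:R).
    by rewrite factS natrM; ring.
  rewrite ler_wpM2l // (le_trans (Pjet_bound0 _)) // ler_wpM2r //.
  rewrite exprS mulrA ler_pM ?mulr_ge0 ?exprn_ge0 //.
  by rewrite lerXn2r ?nnegrE ?mulr_ge0 // ler_peMl // ler1n.
apply: (le_trans (lerD h1 h2)); apply: eq_ler.
by rewrite factS natrM exprS; ring.
Qed.

Lemma Pjet_bound m : nm (Pjet m t) <= a * (2 * K) ^+ m * m`!%:R.
Proof.
apply: (le_trans (Pjet_bound0 m)); rewrite ler_wpM2r // ler_wpM2l //.
have K0 : 0 <= K by exact: le_trans ler01 K1.
by rewrite lerXn2r ?nnegrE ?mulr_ge0 // ler_peMl // ler1n.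
Qed.

Lemma Gjet_bound m : nm (Gjet m t) <= b * (2 * K) ^+ m * m`!%:R.
Proof.
have K0 : 0 <= K by exact: le_trans ler01 K1.
have b0 : 0 <= b by exact: le_trans (nm_ge0 _) hg.
case: m => [|m]; first by rewrite Gjet_0 nm0 expr0 !mulr1.
apply: (le_trans (Gjet_bound0 m)).
rewrite ler_pM ?mulr_ge0 ?exprn_ge0 ?mulr_ge0 //.
  rewrite ler_wpM2l // exprS ler_peMl ?exprn_ge0 ?mulr_ge0 //.
  by have := K1; lra.
by rewrite ler_nat factS leq_pmull.
Qed.

End JetBounds.

(** The induction step is [(2k+4)(2k+3) <= 12 (k+1)^2], an equality at [k = 0]. Thus [k!^2]
    outweighs the factorial growth of the jets up to a geometric factor. *)
Lemma fact_ratio k m : (m <= k.*2.+2)%N -> (m`!%:R : R) <= 2 * 12 ^+ k * (k`!%:R ^+ 2).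
Proof.
move=> mk; apply: (@le_trans _ _ ((k.*2.+2)`!%:R)).
  rewrite ler_nat; elim: {k}(k.*2.+2) mk => [|j IH]; first by rewrite leqn0 => /eqP ->.
  rewrite leq_eqVlt => /orP[/eqP -> //|]; rewrite ltnS => /IH h.
  by rewrite factS (leq_trans h) // leq_pmull.
elim: k {mk} => [|k IH]; first by rewrite /= expr0 expr1n !mulr1.
have -> : ((k.+1).*2.+2)`!%:R = (k.*2.+2)`!%:R * (k.*2.+4%:R * k.*2.+3%:R) :> R.
  by rewrite doubleS factS (factS k.*2.+2) !natrM; ring.
have -> : 2 * 12 ^+ k.+1 * (k.+1)`!%:R ^+ 2 =
   2 * 12 ^+ k * k`!%:R ^+ 2 * (12 * k.+1%:R ^+ 2) :> R.
  by rewrite factS natrM exprS; ring.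
rewrite ler_pM ?mulr_ge0 // -natrX -!natrM ler_nat -mul2n.
rewrite -mulnn; nia.
Qed.

End Jets.

(** * The terms of the series in Q *)

Section CrossTermAlgebra.
Variable R : realType.
Local Notation C := (Cplx R).

Lemma two_half_sub k : 1 / 2 - (k.*2.+1)%:R = - (1 / 2) - k%:R * 2 :> C.
Proof.
rewrite -[k.*2.+1]addn1 natrD -muln2 natrM.
by field.
Qed.

Lemma half_double_sub k : - (1 / 2) - (k.*2)%:R = - (1 / 2) - k%:R * 2 :> C.
Proof. by rewrite -muln2 natrM. Qed.

Lemma half_double_sub2 k : - (1 / 2) - (k.*2.+1)%:R = 1 / 2 - k.+1%:R * 2 :> C.
Proof.
rewrite -natr1 -[k.*2.+1]addn1 natrD -muln2 natrM.
by field.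
Qed.

Lemma half_sub_double k : 1 / 2 - (k.*2)%:R = 1 / 2 - k%:R * 2 :> C.
Proof. by rewrite -muln2 natrM. Qed.

(** Quasi-homogeneity of a single term: the part [2 d/ds] of the Euler field hits [h = s - 2 H_k]
    and cancels the inhomogeneity [- 2 P] in the recursion for [G]. *)
Lemma cross_identity1 (Kf : fieldType) n (P1 P2 G1 G2 : 'rV[Kf]_n) (V U : 'M[Kf]_n) (c h k f : Kf) :
  P2 *m U = P1 *m (V + (- f - k * 2)%:M) ->
  G2 *m U = G1 *m (V + (- f - k * 2)%:M) - 2 *: P1 ->
  (c *: (1 *: (h *: P2 + G2) + 0 *: P2)) *m U
   + 2 *: (c *: (k *: (h *: P1 + G1) + 1 *: P1))
  = (c *: (1 *: (h *: P1 + G1) + 0 *: P1)) *m (V - f%:M).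
Proof.
move=> e1 e2; rewrite !scale0r !addr0 !scale1r -!scalemxAl !mulmxDl -!scalemxAl e1 e2.
rewrite !(mulmxDr, mul_mx_scalar, mulmxN).
move: (P1 *m V) (G1 *m V) => p q.
apply/matrixP => i j; rewrite !mxE; move: (P1 i j) (G1 i j) (p i j) (q i j) => *; ring.
Qed.

Lemma cross_identity2 (Kf : fieldType) n (P0 P1 G0 G1 : 'rV[Kf]_n) (V U : 'M[Kf]_n) (c h k f : Kf) :
  P1 *m U = P0 *m (V + (f - k * 2)%:M) ->
  k *: (G1 *m U) = k *: (G0 *m (V + (f - k * 2)%:M) - 2 *: P0) ->
  (c *: (k *: (h *: P1 + G1) + 1 *: P1)) *m U
   + 2 *: (c *: ((k * k) *: (h *: P0 + G0) + (k * 1 + k) *: P0))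
  = (c *: (k *: (h *: P0 + G0) + 1 *: P0)) *m (V + f%:M).
Proof.
move=> e1 e2; rewrite !scale1r -!scalemxAl !mulmxDl -!scalemxAl !mulmxDl -!scalemxAl e1.
rewrite (scalerDr k _ (G1 *m U)) e2.
rewrite !(mulmxDr, mul_mx_scalar, mulmxN).
move: (P0 *m V) (G0 *m V) => p q.
apply/matrixP => i j; rewrite !mxE; move: (P0 i j) (G0 i j) (p i j) (q i j) => x1 x2 x3 x4.
ring.
Qed.

(** Since [k^2 * (- 2 / k) + 2 k = 0], the increment [k^-1] of the harmonic number absorbs exactly
    the extra multiple of [P] created by differentiating [s] twice. *)
Lemma term_shift n (P G : 'rV[C]_n) (c c' s H Q k : C) : k != 0 ->
  c' * k * k = Q * c ->
  c' *: ((k * k) *: ((s - 2 * (H + k^-1)) *: P + G) + (k * 1 + k) *: P)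
  = Q *: (c *: (1 *: ((s - 2 * H) *: P + G) + 0 *: P)).
Proof.
move=> k0 e; rewrite (scalerA Q c) -e.
by apply/matrixP => i j; rewrite !mxE; move: (P i j) (G i j) => *; field.
Qed.

End CrossTermAlgebra.

Section CrossTerms.
Variable R : realType.
Local Notation C := (Cplx R).
Local Notation hol := holomorphic_upto.
Variables (n : nat) (M : frob_data C n) (V : 'M[C]_n).
Hypothesis hM : is_frobenius M.
Hypothesis hV : forall t, fm_dom M t -> fm_V M t = V.
Local Notation U := (fm_U M).
Local Notation star := (fm_star M).
Variables (r g : 'cV[C]_n -> 'rV[C]_n) (phi : 'cV[C]_n -> 'M[C]_1).
Variables (T : normedModType C) (tau : T -> 'cV[C]_n) (sigma : T -> C).
Hypotheses (btau : blinear tau) (bsigma : blinear sigma).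
Local Notation Pj := (Pjet V U r).
Local Notation Gj := (Gjet V U r g).

Definition harm k : C := \sum_(i < k) (i.+1%:R)^-1.
Definition qcoef k (p : T) : C := (k`!%:R^-1) ^+ 2 * cexp (sigma p) ^+ k.
(* Frobenius' method in Q = exp s: the terms
   Q^k / k!^2 * ((s - 2 H_k) P_(2k+i) + G_(2k+i)), H_k the harmonic number.
   xi1, xi2 are the components of the gradient along the two factors, chi1, chi2
   those of the row chi with chi *m fm_U = xi *m fm_V, and ww is the period. *)
Definition cterm (al be : C) i k (p : T) : 'rV[C]_n :=
  qcoef k p *: (al *: ((sigma p - 2 * harm k) *: Pj (k.*2 + i)%N (tau p)
      + Gj (k.*2 + i)%N (tau p)) + be *: Pj (k.*2 + i)%N (tau p)).

Definition xi1 p := gsum (fun k => cterm 1 0 1 k p).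
Definition xi2 p := gsum (fun k => cterm k%:R 1 0 k p).
Definition chi1 p := gsum (fun k => cterm 1 0 2 k p).
Definition chi2 p := gsum (fun k => cterm k%:R 1 1 k p).
Definition wterm k p : 'M[C]_1 :=
  cterm 1 0 0 k p *m fm_e M + (if k is 0%N then phi (tau p) else 0).
Definition ww p := gsum (fun k => wterm k p).

Lemma qcoef_hasD k p : hasD (qcoef k) p (fun v => k%:R * sigma v * qcoef k p).
Proof.
have h1 : hasD (fun q => cexp (sigma q *+ k)) p (fun v => sigma v *+ k * cexp (sigma p *+ k)).
  apply: (hasD_comp (f := fun q => sigma q *+ k)) (cexp_hasD _).
  apply: (hasD_ext (f := fun q => k%:R *: sigma q)).
    by near=> q; rewrite scaler_nat.
  apply: hasD_eqD (hasDZ _ (hasD_lin p bsigma)) _ => v; by rewrite scaler_nat.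
apply: (hasD_ext (f := fun q => (k`!%:R^-1) ^+ 2 *: cexp (sigma q *+ k))).
  by near=> q; rewrite /qcoef cexpX.
apply: hasD_eqD (hasDZ _ h1) _ => v; rewrite /qcoef cexpX -mulr_natl -[LHS]/(_ * _); ring.
Unshelve. all: by end_near. Qed.

Lemma cterm_derivative_algebra (P G P' G' : 'rV[C]_n) (A : 'M[C]_n) (al be c k et h : C) :
  (k * et * c) *: (al *: (h *: P + G) + be *: P)
  + c *: (al *: ((et *: P + h *: (P' *m A)) + G' *m A) + be *: (P' *m A))
  = c *: (al *: (h *: P' + G') + be *: P') *m A
    + et *: (c *: ((k * al) *: (h *: P + G) + (k * be + al) *: P)).
Proof.
rewrite -scalemxAl !mulmxDl -!scalemxAl !mulmxDl -!scalemxAl.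
move: (P' *m A) (G' *m A) => p q.
by apply/matrixP => i j; rewrite !mxE; ring.
Qed.

(** Differentiation along [s] acts on the parameters by [(al, be) |-> (k al, k be + al)], and
    differentiation along the first factor raises [i]. So [(1, 0)], [(k, 1)] and [(k^2, 2k)] encode
    the series and its first two derivatives in [s]. *)
Lemma cterm_hasD al be i k p : star (tau p) -> (0 < k + i)%N ->
  hasD r (tau p) (fun v => Pj 1 (tau p) *m Cm M (tau p) v) ->
  hasD g (tau p) (fun v => Gj 2 (tau p) *m Cm M (tau p) v) ->
  hasD (cterm al be i k) p (fun v => cterm al be i.+1 k p *m Cm M (tau p) (tau v)
     + sigma v *: cterm (k%:R * al) (k%:R * be + al) i k p).
Proof.
move=> st ki hr hg.
have [m em] : exists m, (k.*2 + i)%N = m.+1.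
  by exists (k.*2 + i).-1; rewrite prednK //; move: ki; case: (k) => //= j; rewrite doubleS.
have hP := hasD_comp (hasD_lin p btau) (Pjet_hasD hM hV m.+1 st hr).
have hG := hasD_comp (hasD_lin p btau) (Gjet_hasD hM hV m st hr hg).
have hs : hasD (fun q => sigma q - 2 * harm k) p sigma.
  by apply: hasD_eqD (hasDB (hasD_lin p bsigma) (hasD_cst _ p)) _ => v; rewrite subr0.
have h1 := hasD_scalel (qcoef_hasD k p)
  (hasDD (hasDZ al (hasDD (hasD_scalel hs hP) hG)) (hasDZ be hP)).
rewrite /cterm addnS em; apply: hasD_eqD h1 _ => v.
exact (cterm_derivative_algebra _ _ _ _ _ _ _ _ _ _ _).
Qed.

(** At index 0 the default [Gjet 0 = 0] does not differentiate to [Gjet 1]; the missing piece is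
    supplied by the differential of [phi] in [wterm0_algebra]. *)
Lemma cterm00_hasD p : star (tau p) ->
  hasD r (tau p) (fun v => Pj 1 (tau p) *m Cm M (tau p) v) ->
  hasD (cterm 1 0 0 0) p (fun v => sigma p *: (Pj 1 (tau p) *m Cm M (tau p) (tau v))
     + sigma v *: cterm 0 1 0 0 p).
Proof.
move=> st hr.
have hP := hasD_comp (hasD_lin p btau) hr.
apply: (hasD_ext (f := fun q => sigma q *: r (tau q))).
  near=> q; rewrite /cterm /qcoef /harm big_ord0 expr0 invr1 expr1n Gjet_0 Pjet_0.
  by rewrite mulr0 subr0 scale0r !addr0 mul1r !scale1r.
apply: hasD_eqD (hasD_scalel (hasD_lin p bsigma) hP) _ => v.
rewrite addrC /cterm /qcoef expr0 invr1 expr1n Pjet_0 mul1r !scale1r.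
by rewrite scale0r add0r.
Unshelve. all: by end_near. Qed.

Lemma wterm0_algebra (P g0 X Y Z : 'rV[C]_n) (A : 'M[C]_n) (e v : 'cV[C]_n) (s et : C) :
  X = s *: P + g0 -> A *m e = v ->
  (s *: (P *m A) + et *: Y) *m e + Z *m 0 + g0 *m v = X *m v + et *: (Y *m e).
Proof.
move=> -> <-; rewrite mulmx0 addr0 !mulmxDl -!scalemxAl !mulmxA.
by rewrite addrAC.
Qed.

Lemma wtermS_algebra (X Y Z : 'rV[C]_n) (A : 'M[C]_n) (e v : 'cV[C]_n) (et : C) :
  A *m e = v -> (X *m A + et *: Y) *m e + Z *m 0 + 0 = X *m v + et *: (Y *m e).
Proof. by move=> <-; rewrite mulmx0 !addr0 mulmxDl -scalemxAl mulmxA. Qed.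

Lemma Gjet_odd k t : U t \in unitmx -> Gj (k.+1.*2 + 1)%N t *m U t =
  Gj (k.+1.*2 + 0)%N t *m (V + (1 / 2 - k.+1%:R * 2)%:M) - 2 *: Pj (k.+1.*2 + 0)%N t.
Proof.
move=> uU; have e1 : (k.+1.*2 + 1)%N = k.*2.+3 by rewrite addn1 doubleS.
have e0 : (k.+1.*2 + 0)%N = k.*2.+2 by rewrite addn0 doubleS.
rewrite e1 e0 -half_double_sub2.
have := GjetSS V U r g k.*2.+1 t; move=> ->.
exact (mulmxKV uU _).
Qed.

Lemma cterm_0 i p : cterm 1 0 i 0 p = sigma p *: Pj i (tau p) + Gj i (tau p).
Proof.
rewrite /cterm /qcoef /harm big_ord0 expr0 invr1 expr1n !mulr1 mulr0 subr0 !scale1r.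
by rewrite scale0r addr0.
Qed.

Lemma wterm_hasD k p : star (tau p) ->
  hasD r (tau p) (fun v => Pj 1 (tau p) *m Cm M (tau p) v) ->
  hasD g (tau p) (fun v => Gj 2 (tau p) *m Cm M (tau p) v) ->
  hasD phi (tau p) (fun v => g (tau p) *m v) ->
  hasD (wterm k) p (fun v => cterm 1 0 1 k p *m tau v
     + sigma v *: (cterm k%:R 1 0 k p *m fm_e M)).
Proof.
move=> st hr hg hphi; have dt := star_dom hM st.
have Ce v : Cm M (tau p) v *m fm_e M = v by rewrite Cm_sym // Cm_unit // mul1mx.
case: k => [|k].
  have h1 := hasD_mulmx (cterm00_hasD st hr) (hasD_cst (fm_e M) p).
  have h2 := hasD_comp (hasD_lin p btau) hphi.
  apply: hasD_eqD (hasDD h1 h2) _ => v.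
  exact (wterm0_algebra _ _ _ (cterm_0 1 p) (Ce _)).
rewrite /wterm.
have h1 := hasDD (hasD_mulmx (cterm_hasD 1 0 st (isT : 0 < k.+1 + 0)%N hr hg)
   (hasD_cst (fm_e M) p)) (hasD_cst 0 p).
apply: hasD_eqD h1 _ => v.
rewrite mulr1 mulr0 add0r; exact (wtermS_algebra _ _ _ _ (Ce _)).
Qed.

Lemma term_identity1 k p : star (tau p) ->
  cterm 1 0 2 k p *m U (tau p) + 2 *: cterm k%:R 1 1 k p
   = cterm 1 0 1 k p *m (V - (1 / 2)%:M).
Proof.
move=> st; have uU := star_unit hM st.
apply: cross_identity1.
  by rewrite addn2 PjetS mulmxKV // addn1 two_half_sub.
by rewrite addn2 GjetSS mulmxKV // addn1 half_double_sub.
Qed.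

Lemma term_identity2 k p : star (tau p) ->
  cterm k%:R 1 1 k p *m U (tau p) + 2 *: cterm (k%:R * k%:R) (k%:R * 1 + k%:R) 0 k p
   = cterm k%:R 1 0 k p *m (V + (1 / 2)%:M).
Proof.
move=> st; have uU := star_unit hM st.
apply: cross_identity2.
  by rewrite addn1 addn0 PjetS mulmxKV // half_sub_double.
case: k => [|k]; first by rewrite !scale0r.
exact (congr1 (fun A => k.+1%:R *: A) (Gjet_odd k uU)).
Qed.

(** The equation [(d/ds)^2 w = Q (d/dt^1)^2 w] read off coefficientwise. *)
Lemma term_identity3 k p :
  cterm (k.+1%:R * k.+1%:R) (k.+1%:R * 1 + k.+1%:R) 0 k.+1 p
  = cexp (sigma p) *: cterm 1 0 2 k p.
Proof.
have k0 : k.+1%:R != 0 :> C by rewrite pnatr_eq0.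
rewrite /cterm /harm big_ord_recr /= addn0 doubleS addn2.
apply: term_shift => //.
rewrite /qcoef factS natrM !expr2 (exprS (cexp _)) invfM.
have f0 : k`!%:R != 0 :> C by rewrite pnatr_eq0 -lt0n fact_gt0.
move: (k.+1%:R) (k`!%:R) k0 f0 (cexp (sigma p) ^+ k) (cexp (sigma p)) => a b a0 b0 c d.
by field; rewrite b0.
Qed.

Lemma term_identity30 p : cterm (0%:R * 0%:R) (0%:R * 1 + 0%:R) 0 0 p = 0.
Proof.
have -> : 0%:R * 0%:R = 0 :> C by rewrite mul0r.
have -> : 0%:R * 1 + 0%:R = 0 :> C by rewrite mul0r addr0.
by rewrite /cterm !scale0r addr0 scaler0.
Qed.

End CrossTerms.

Section CrossDependence.
Variable R : realType.
Local Notation C := (Cplx R).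
Variables (n : nat) (M : frob_data C n) (V : 'M[C]_n).
Variables (r g : 'cV[C]_n -> 'rV[C]_n) (phi : 'cV[C]_n -> 'M[C]_1).
Variables (T : normedModType C) (tau : T -> 'cV[C]_n) (sigma : T -> C) (p q : T).
Hypotheses (et : tau p = tau q) (es : sigma p = sigma q).

Lemma cterm_eq al be i k : cterm M V r g tau sigma al be i k p = cterm M V r g tau sigma al be i k q.
Proof. by rewrite /cterm /qcoef et es. Qed.

Lemma xi1_eq : xi1 M V r g tau sigma p = xi1 M V r g tau sigma q.
Proof. by apply: eq_gsum => k; exact: cterm_eq. Qed.

Lemma xi2_eq : xi2 M V r g tau sigma p = xi2 M V r g tau sigma q.
Proof. by apply: eq_gsum => k; exact: cterm_eq. Qed.

Lemma ww_eq : ww M V r g phi tau sigma p = ww M V r g phi tau sigma q.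
Proof. by apply: eq_gsum => k; rewrite /wterm cterm_eq et. Qed.

End CrossDependence.

#[local] Opaque cterm.

Section TermBounds.
Variable R : realType.
Local Notation C := (Cplx R).

Lemma nm_harm k : nm (harm R k) <= k%:R.
Proof.
apply: (le_trans (nm_sum _ _ _)); rewrite -[X in _ <= X%:R]card_ord -sumr_const.
apply: ler_sum => i _.
by rewrite nmV nm_nat invf_le1 // ler1n.
Qed.

Lemma le_eq2 (x y x' y' : R) : x' = x -> y' = y -> x <= y -> x' <= y'.
Proof. by move=> -> ->. Qed.

Lemma succ_le_pow2 k : (k.+1 <= 2 ^ k)%N.
Proof. exact: ltn_expl. Qed.

Lemma cube_le_pow8 k : (k.+1%:R ^+ 3 : R) <= 8 ^+ k.
Proof.
have -> : (8 : R) ^+ k = (2 ^+ k) ^+ 3.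
  by rewrite -exprM mulnC exprM -[X in _ = X ^+ k]natrX.
rewrite lerXn2r ?nnegrE ?exprn_ge0 // -natrX ler_nat; exact: succ_le_pow2.
Qed.

(** The three pairs are the parameters of the series and of its first two derivatives in [s]. The
    factor [2 k + 1] comes from the crude bound [H_k <= k] in [s - 2 H_k]. *)
Lemma exponential_pairs (k : nat) : let x := k%:R : R in
  [/\ 1 * (x *+ 2 + 1) + 0 <= 2 * 8 ^+ k /\ 1 <= 8 ^+ k :> R,
      x * (x *+ 2 + 1) + 1 <= 2 * 8 ^+ k /\ x <= 8 ^+ k &
      x * x * (x *+ 2 + 1) + (x * 1 + x) <= 2 * 8 ^+ k /\ x * x <= 8 ^+ k].
Proof.
move=> x; have := cube_le_pow8 k; rewrite -natr1 -/x; have : 0 <= x by [].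
move: (8 ^+ k) => y x0 h; rewrite mulr2n.
by split; split; nra.
Qed.

Lemma nm_mulmx_bound m n p (A : 'M[C]_(m, n)) (B : 'M[C]_(n, p)) x y :
  nm A <= x -> nm B <= y -> nm (A *m B) <= n%:R * (x * y).
Proof.
move=> hA hB; apply: (le_trans (nm_mulmx _ _)).
by apply: ler_wpM2l => //; apply: ler_pM => //; exact: nm_ge0.
Qed.

End TermBounds.

(** * Convergence and differential equations of the series *)

Section CrossSeries.
Variable R : realType.
Local Notation C := (Cplx R).
Local Notation hol := holomorphic_upto.
Variables (n : nat) (M : frob_data C n) (V : 'M[C]_n).
Hypothesis hM : is_frobenius M.
Hypothesis hV : forall t, fm_dom M t -> fm_V M t = V.
Local Notation U := (fm_U M).
Local Notation star := (fm_star M).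
Variables (r g : 'cV[C]_n -> 'rV[C]_n).
Local Notation Pj := (Pjet V U r).
Local Notation Gj := (Gjet V U r g).

(** Jet bounds uniform on a ball. The constant [a] for the logarithmic part is kept apart from [b],
    because [a = 0] is what distinguishes an [O(Q)] error from an [O(Q log Q)] error. *)
Definition jet_region (W : set 'cV[C]_n) t0 (d a b be c : R) :=
  [/\ 0 <= a, 0 <= b, 1 <= be, 0 <= c & 0 < d] /\
  forall t, nm (t - t0) < d ->
   [/\ W t, forall m, nm (Pj m t) <= a * be ^+ m * m`!%:R,
     forall m, nm (Gj m t) <= b * be ^+ m * m`!%:R &
     forall u, nm (Cm M t u) <= c * nm u].

Lemma Cm_local_bound t0 : fm_dom M t0 -> exists c d : R, [/\ 0 <= c, 0 < d &
  forall t, nm (t - t0) < d -> forall u, nm (Cm M t u) <= c * nm u].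
Proof.
move=> dt.
have h i : {e : R | 0 < e & forall q, nm (q - t0) < e ->
    nm (Cm M q (del C i) - Cm M t0 (del C i)) < 1}.
  apply: cid2; have [e e0 he] := hasD_cont (Cm_hasD hM (del C i) dt) ltr01.
  by exists e.
have [d [d0 _ hd]] := finite_radius (fun i => s2valP (h i)).
exists (\sum_i (nm (Cm M t0 (del C i)) + 1)), d; split => //.
  by apply: sumr_ge0 => i _; rewrite addr_ge0 ?nm_ge0.
move=> t ht u; rewrite (linear_cV u (Cm_linear M t)) mulr_suml.
apply: (le_trans (nm_sum _ _ _)); apply: ler_sum => i _.
rewrite nmZ mulrC ler_pM ?nm_ge0 ?nm_entry //.
have := s2valP' (h i) t (lt_le_trans ht (hd i)) => h1.
rewrite -[Cm M t _](subrK (Cm M t0 (del C i))) (le_trans (nmD _ _)) // addrC lerD2l.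
exact: ltW.
Qed.

Lemma jet_region_exists (W : set 'cV[C]_n) t0 : open W -> W `<=` star ->
  (forall t, W t -> hasD r t (fun v => Pj 1 t *m Cm M t v)) ->
  (forall t, W t -> hasD g t (fun v => Gj 2 t *m Cm M t v)) ->
  W t0 -> exists d a b be c : R, jet_region W t0 d a b be c /\
    ((forall t, W t -> r t = 0) -> a = 0).
Proof.
move=> oW Ws hr hg Wt0; have st := Ws _ Wt0; have dt := star_dom hM st.
have /nbhs_nmP[d1 d10 hd1] := open_near oW Wt0.
have [d2 d20 hd2] := hasD_unit_near (U_hasD' hM hV dt) (star_unit hM st).
have [d3 d30 hd3] := hasD_cont (hr _ Wt0) ltr01.
have [d4 d40 hd4] := hasD_cont (Pjet_hasD hM hV 1 st (hr _ Wt0)) ltr01.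
have [d5 d50 hd5] := hasD_cont (hg _ Wt0) ltr01.
have [c [d6 [c0 d60 hc]]] := Cm_local_bound dt.
have near1 (X Y : 'rV[C]_n) : nm (X - Y) < 1 -> nm X <= nm Y + 1.
  by move=> h; rewrite -[X](subrK Y) (le_trans (nmD _ _)) // addrC lerD2l ltW.
pose w : R := 2 * nm (invmx (U t0)); have w0 : 0 <= w by rewrite mulr_ge0 ?nm_ge0.
(* When [r] vanishes on [W] the bound must be exactly 0, so this case is separated instead of using
   the value at [t0] plus 1. *)
have [a [a0 ha ha0]] : exists a, [/\ 0 <= a,
    forall t, W t -> nm (t - t0) < d3 -> nm (t - t0) < d4 -> nm (r t) <= a /\ nm (Pj 1 t) <= a &
    (forall t, W t -> r t = 0) -> a = 0].
  have [r0|r0] := pselect (forall t, W t -> r t = 0).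
    exists 0; split=> // t Wt _ _; rewrite Pjet_eq0 ?r0 // nm0 //.
  exists (nm (r t0) + 1 + (nm (Pj 1 t0) + 1)); split.
  - by rewrite !addr_ge0 ?nm_ge0.
  - move=> t _ /hd3/near1 h1 /hd4/near1 h2; split.
      by rewrite (le_trans h1) // lerDl addr_ge0 ?nm_ge0.
    by rewrite (le_trans h2) // lerDr addr_ge0 ?nm_ge0.
  - by move=> /r0.
pose K := jet_const V w.
have K1 : 1 <= K.
  by rewrite /K /jet_const -addrA lerDl !(addr_ge0, mulr_ge0) ?nm_ge0.
pose d := Num.min d1 (Num.min d2 (Num.min d3 (Num.min d4 (Num.min d5 d6)))).
(* The summand [a * K] secures the condition relating the two initial bounds in [Gjet_bound]. *)
exists d, a, (nm (g t0) + 1 + a * K), (2 * K), c; split; last exact: ha0.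
split.
  split => //.
  - by rewrite !addr_ge0 ?nm_ge0 // mulr_ge0 // (le_trans ler01).
  - by lra.
  - by rewrite /d !lt_min d10 d20 d30 d40 d50.
move=> t; rewrite /d !lt_min => /and5P[/hd1 Wt /hd2[_ t2] t3 t4 /andP[/hd5/near1 t5 t6]].
have [h1 h2] := ha _ Wt t3 t4.
split => //.
- exact: Pjet_bound t2 w0 h1 h2.
- apply: (Gjet_bound t2 w0 h1 h2); last by rewrite lerDr addr_ge0 ?nm_ge0.
  by rewrite (le_trans t5) // lerDl mulr_ge0 // (le_trans ler01).
- exact: hc.
Qed.

Variable phi : 'cV[C]_n -> 'M[C]_1.
Variables (T : normedModType C) (tau : T -> 'cV[C]_n) (sigma : T -> C).
Hypotheses (btau : blinear tau) (bsigma : blinear sigma).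
Local Notation cterm := (cterm M V r g tau sigma).

Lemma nm_qcoef_fact k m p : (m <= k.*2.+2)%N ->
  nm (qcoef sigma k p) * m`!%:R <= 2 * (12 * nm (cexp (sigma p))) ^+ k.
Proof.
move=> mk.
have nX (z : C) j : nm (z ^+ j) = nm z ^+ j.
  by elim: j => [|j IH]; rewrite ?expr0 ?nm1 // !exprS nmM IH.
have -> : nm (qcoef sigma k p) = k`!%:R^-1 / k`!%:R * nm (cexp (sigma p)) ^+ k.
  by rewrite /qcoef expr2 nmM nX nmM nmV nm_nat.
rewrite exprMn.
have f0 : 0 < k`!%:R :> R by rewrite ltr0n fact_gt0.
have e0 : 0 <= nm (cexp (sigma p)) ^+ k by rewrite exprn_ge0 ?nm_ge0.
have := fact_ratio R mk; rewrite expr2.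
move: (m`!%:R : R) (nm (cexp (sigma p)) ^+ k) e0 (k`!%:R : R) f0 (12 ^+ k : R) => x y y0 f f0 z h.
rewrite [leRHS]mulrA.
have -> : f^-1 / f * y * x = x / (f * f) * y by field; rewrite gt_eqF.
by rewrite ler_wpM2r // ler_pdivrMr ?mulr_gt0.
Qed.

Lemma cterm_00 al i p : cterm 0 al i 0 p = al *: Pj i (tau p).
Proof.
have -> : cterm 0 al i 0 p = qcoef sigma 0 p *:
  (0 *: ((sigma p - 2 * harm R 0) *: Pj (0.*2 + i)%N (tau p) + Gj (0.*2 + i)%N (tau p))
    + al *: Pj (0.*2 + i)%N (tau p)) by [].
by rewrite /qcoef expr0 invr1 expr1n mul1r scale1r scale0r add0r.
Qed.

Section RegionBounds.
Variables (W : set 'cV[C]_n) (t0 : 'cV[C]_n) (d a b be c : R).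
Hypothesis reg : jet_region W t0 d a b be c.

(** The ratio is [96 = 12 * 8]: 12 from the factorials, 8 from the polynomial coefficients in [k].
    The power [be^2] per step reflects the jet index [2k + i], and [i <= 2] leaves the prefactor
    [be^2]. *)
Lemma cterm_bound p al bt i k : (i <= 2)%N -> nm (tau p - t0) < d ->
  nm al * (k%:R *+ 2 + 1) + nm bt <= 2 * 8 ^+ k -> nm al <= 8 ^+ k ->
  nm (cterm al bt i k p) <=
   2 * be ^+ 2 * (2 * a * (nm (sigma p) + 1) + b) * (96 * be ^+ 2 * nm (cexp (sigma p))) ^+ k.
Proof.
move=> i2 hp hab hal.
have [[a0 b0 be1 c0 d0] hreg] := reg; have [_ hP hG _] := hreg _ hp.
have be0 : 0 <= be by exact: le_trans ler01 be1.
set m := (k.*2 + i)%N.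
set S := nm (sigma p) + 1; have S1 : 1 <= S by rewrite /S lerDr nm_ge0.
have hh : nm (sigma p - 2 * harm R k) <= S * (k%:R *+ 2 + 1).
  apply: (le_trans (nmB _ _)); rewrite nmM nm_nat.
  have := nm_harm R k; have : 0 <= k%:R :> R by [].
  have := nm_ge0 (sigma p); rewrite /S mulr2n.
  move: (nm (sigma p)) (k%:R : R) (nm (harm R k)) => x y z; nra.
pose B := be ^+ m * m`!%:R; have B0 : 0 <= B by rewrite mulr_ge0 ?exprn_ge0.
have hbr : nm (al *: ((sigma p - 2 * harm R k) *: Pj m (tau p) + Gj m (tau p))
     + bt *: Pj m (tau p)) <= (2 * a * S + b) * 8 ^+ k * B.
  apply: (le_trans (nmD _ _)); rewrite !nmZ.
  have h1 : nm ((sigma p - 2 * harm R k) *: Pj m (tau p) + Gj m (tau p)) <=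
      S * (k%:R *+ 2 + 1) * (a * B) + b * B.
    apply: (le_trans (nmD _ _)); rewrite nmZ lerD ?ler_pM ?nm_ge0 //.
      by rewrite /B mulrA.
    by rewrite /B mulrA.
  have h2 : nm (Pj m (tau p)) <= a * B by rewrite /B mulrA.
  have := nm_ge0 al; have := nm_ge0 bt => bt0 al0.
  apply: (@le_trans _ _ (nm al * (S * (k%:R *+ 2 + 1) * (a * B) + b * B) + nm bt * (a * B))).
    by rewrite lerD // ler_wpM2l.
  have aS : a <= a * S by rewrite ler_peMr.
  have e1 : nm bt * (a * B) <= nm bt * (a * S * B).
    by rewrite ler_wpM2l // ler_wpM2r.
  have e2 : (nm al * (k%:R *+ 2 + 1) + nm bt) * (a * S * B) <= 2 * 8 ^+ k * (a * S * B).
    by rewrite ler_wpM2r // mulr_ge0 // mulr_ge0 // (le_trans ler01 S1).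
  have e3 : nm al * (b * B) <= 8 ^+ k * (b * B) by rewrite ler_wpM2r // mulr_ge0.
  move: e1 e2 e3; move: (nm al) (nm bt) (8 ^+ k) (k%:R *+ 2 + 1) => x y z u.
  nra.
have -> : cterm al bt i k p = qcoef sigma k p *:
  (al *: ((sigma p - 2 * harm R k) *: Pj m (tau p) + Gj m (tau p)) + bt *: Pj m (tau p)).
  by [].
rewrite nmZ.
apply: (le_trans (ler_wpM2l (nm_ge0 _) hbr)).
have mk : (m <= k.*2.+2)%N by rewrite /m -addn2 leq_add2l.
have q1 := nm_qcoef_fact p mk.
have bm : be ^+ m <= be ^+ 2 * (be ^+ 2) ^+ k.
  by rewrite -exprM -exprD; apply: ler_weXn2l => //; rewrite mul2n addnC addn2.
have c1 : 0 <= 2 * a * S + b by rewrite addr_ge0 // !mulr_ge0 // (le_trans ler01).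
have e8 : (96 * be ^+ 2 * nm (cexp (sigma p))) ^+ k =
   8 ^+ k * (be ^+ 2) ^+ k * (12 * nm (cexp (sigma p))) ^+ k.
  by rewrite -!exprMn; congr (_ ^+ k); ring.
rewrite e8 /B.
have q0 : 0 <= nm (qcoef sigma k p) * m`!%:R by rewrite mulr_ge0 ?nm_ge0.
have := ler_pM q0 (exprn_ge0 m be0) q1 bm.
have : 0 <= (2 * a * S + b) * 8 ^+ k by rewrite mulr_ge0 ?exprn_ge0.
move: (nm (qcoef sigma k p)) (m`!%:R : R) (be ^+ m) (be ^+ 2) ((12 * nm (cexp (sigma p))) ^+ k)
  (2 * a * S + b) => x1 x2 x3 x4 x5 x6 h1 h2.
have := ler_wpM2l h1 h2; apply: le_eq2; ring.
Qed.

Hypotheses (oW : open W) (Ws : W `<=` star).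
Hypothesis hr : forall t, W t -> hasD r t (fun v => Pj 1 t *m Cm M t v).
Hypothesis hg : forall t, W t -> hasD g t (fun v => Gj 2 t *m Cm M t v).
Hypothesis hphi : forall t, W t -> hasD phi t (fun v => g t *m v).
Variable rho : R.
Hypothesis hrho : 96 * be ^+ 2 * expR rho <= 1 / 2.

Definition in_region p := nm (tau p - t0) < d /\ cRe (sigma p) < rho.

(** Affine in the modulus of [s], with slope proportional to [a]: without a logarithmic part the
    bound does not depend on [s]. *)
Definition growth (s : R) : R := 2 * be ^+ 2 * (2 * a * (s + 1) + b).

Lemma growth_ge0 s : 0 <= s -> 0 <= growth s.
Proof.
have [[a0 b0 be1 c0 d0] _] := reg => s0.
by rewrite /growth !(mulr_ge0, addr_ge0, exprn_ge0) // (le_trans ler01).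
Qed.

Lemma growth_le s s' : s <= s' -> growth s <= growth s'.
Proof.
have [[a0 b0 be1 c0 d0] _] := reg => ss.
rewrite /growth ler_wpM2l ?mulr_ge0 ?exprn_ge0 ?(le_trans ler01 be1) //.
by rewrite lerD2r ler_wpM2l ?mulr_ge0 // lerD2r.
Qed.

Lemma region_ratio p : in_region p -> 0 <= 96 * be ^+ 2 * nm (cexp (sigma p)) <= 1 / 2.
Proof.
have [[a0 b0 be1 c0 d0] _] := reg => -[_ h].
have be0 := le_trans ler01 be1.
rewrite !mulr_ge0 ?exprn_ge0 ?nm_ge0 // nm_cexp (le_trans _ hrho) //.
by rewrite ler_wpM2l ?mulr_ge0 ?exprn_ge0 // ler_expR ltW.
Qed.

Lemma region_near p : in_region p -> exists2 e : R, 0 < e & forall q, nm (q - p) < e ->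
  in_region q /\ nm (sigma q) <= nm (sigma p) + 1.
Proof.
move=> [h1 h2].
have e10 : 0 < d - nm (tau p - t0) by rewrite subr_gt0.
have [e1 e1p he1] := hasD_cont (hasD_lin p btau) e10.
have e20 : 0 < Num.min (rho - cRe (sigma p)) 1 by rewrite lt_min subr_gt0 h2 ltr01.
have [e2 e2p he2] := hasD_cont (hasD_lin p bsigma) e20.
exists (Num.min e1 e2); first by rewrite lt_min e1p.
move=> q; rewrite lt_min => /andP[/he1 q1 /he2]; rewrite lt_min => /andP[q2 q3].
split.
  split.
    apply: (le_lt_trans (nm_trans (tau p) _ _)); move: q1; lra.
  have := cRe_le_nm (sigma q - sigma p); rewrite cReD cReN ler_norml => /andP[_ h].
  by move: h q2; lra.
rewrite -[sigma q](subrK (sigma p)) (le_trans (nmD _ _)) // addrC lerD2l; exact: ltW.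
Qed.

Definition admissible (al bt : nat -> C) := forall k,
  nm (al k) * (k%:R *+ 2 + 1) + nm (bt k) <= 2 * 8 ^+ k /\ nm (al k) <= 8 ^+ k.

Lemma admissible0 : admissible (fun _ => 1) (fun _ => 0).
Proof.
by move=> k; have [[h1 h2] _ _] := exponential_pairs R k; rewrite nm1 nm0.
Qed.

Lemma admissible1 : admissible (fun k => k%:R) (fun _ => 1).
Proof.
by move=> k; have [_ [h1 h2] _] := exponential_pairs R k; rewrite nm1 nm_nat.
Qed.

Lemma admissible2 : admissible (fun k => k%:R * k%:R) (fun k => k%:R * 1 + k%:R).
Proof.
move=> k; have [_ _ [h1 h2]] := exponential_pairs R k; rewrite nmM nm_nat; split => //.
apply: le_trans h1; rewrite lerD2l (le_trans (nmD _ _)) // nmM nm_nat nm1 mulr1; exact: lexx.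
Qed.

Lemma cterm_small p al bt i k : (i <= 2)%N -> in_region p -> admissible al bt ->
  nm (cterm (al k) (bt k) i k p) <= growth (nm (sigma p)) * (1 / 2) ^+ k.
Proof.
move=> i2 rp hab; have [h1 h2] := hab k.
apply: (le_trans (cterm_bound i2 rp.1 h1 h2)).
rewrite ler_wpM2l ?growth_ge0 ?nm_ge0 //.
have /andP[x0 x1] := region_ratio rp.
by rewrite lerXn2r ?nnegrE.
Qed.

(** One factor of [Q] is kept out of the geometric ratio, so that the sum of all terms beyond the
    first is visibly of order [Q]. *)
Lemma cterm_tail p al bt i k : (i <= 2)%N -> in_region p -> admissible al bt ->
  nm (cterm (al k.+1) (bt k.+1) i k.+1 p) <=
   growth (nm (sigma p)) * (96 * be ^+ 2 * nm (cexp (sigma p))) * (1 / 2) ^+ k.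
Proof.
move=> i2 rp hab; have [h1 h2] := hab k.+1.
apply: (le_trans (cterm_bound i2 rp.1 h1 h2)).
rewrite [_ ^+ k.+1]exprS -/(growth _) mulrA.
have /andP[x0 x1] := region_ratio rp.
apply: ler_wpM2l; first by apply: mulr_ge0 => //; apply: growth_ge0; exact: nm_ge0.
by rewrite lerXn2r ?nnegrE.
Qed.

(** At [k = i = 0] the jet of [g] is a default value, so the formula requires its coefficient [al]
    to vanish there. *)
Lemma cterm_hasD' al bt i k p : W (tau p) -> (0 < k + i)%N \/ al = 0 ->
  hasD (cterm al bt i k) p (fun v => cterm al bt i.+1 k p *m Cm M (tau p) (tau v)
     + sigma v *: cterm (k%:R * al) (k%:R * bt + al) i k p).
Proof.
move=> Wp; have st := Ws Wp.
have [ki _|] := boolP (0 < k + i)%N; first exact: cterm_hasD (hr Wp) (hg Wp).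
rewrite -leqNgt leqn0 addn_eq0 => /andP[/eqP -> /eqP ->] [//|->].
have hP := hasD_comp (hasD_lin p btau) (hr Wp).
have e j q : cterm 0 bt j 0 q = bt *: Pj j (tau q) by exact: cterm_00.
apply: (hasD_ext (f := fun q => bt *: r (tau q))).
  by near=> q; rewrite e Pjet_0.
apply: hasD_eqD (hasDZ bt hP) _ => v.
rewrite e.
have -> : 0%:R * 0 = 0 :> C by rewrite mul0r.
have -> : 0%:R * bt + 0 = 0 :> C by rewrite mul0r addr0.
rewrite cterm_00 scale0r scaler0 addr0 scalemxAl; exact (erefl _).
Unshelve. all: by end_near. Qed.

Lemma nm_Cm_region p u : in_region p -> nm (Cm M (tau p) u) <= c * nm u.
Proof. by move=> [h _]; have [_ /(_ _ h)[]] := reg. Qed.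

Lemma region_W p : in_region p -> W (tau p).
Proof. by move=> [h _]; have [_ /(_ _ h)[]] := reg. Qed.

Lemma nm_term_derivative (X Y : 'rV[C]_n) q v (G h ct cs : R) : in_region q ->
  nm X <= G * h -> nm Y <= G * h -> 0 <= G * h -> 0 <= ct ->
  nm (tau v) <= ct * nm v -> nm (sigma v) <= cs * nm v ->
  nm (X *m Cm M (tau q) (tau v) + sigma v *: Y) <= G * (n%:R * (c * ct) + cs) * h * nm v.
Proof.
move=> rq hX hY G0 ct0 ht hs; have [[_ _ _ c0 _] _] := reg.
apply: (le_trans (nmD _ _)); rewrite nmZ.
have h1 : nm (X *m Cm M (tau q) (tau v)) <= n%:R * (G * h * (c * (ct * nm v))).
  apply: (le_trans (nm_mulmx _ _)); rewrite ler_wpM2l // ler_pM ?nm_ge0 //.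
  by apply: (le_trans (nm_Cm_region _ rq)); rewrite ler_wpM2l.
have h2 : nm (sigma v) * nm Y <= cs * nm v * (G * h) by rewrite ler_pM ?nm_ge0.
apply: (le_trans (lerD h1 h2)); apply: eq_ler; ring.
Qed.

Lemma cseries_hasD al bt i p : (i <= 1)%N -> in_region p -> admissible al bt ->
  admissible (fun k => k%:R * al k) (fun k => k%:R * bt k + al k) ->
  (forall k, (0 < k + i)%N \/ al k = 0) ->
  hasD (fun q => gsum (fun k => cterm (al k) (bt k) i k q)) p (fun v =>
    gsum (fun k => cterm (al k) (bt k) i.+1 k p) *m Cm M (tau p) (tau v)
    + sigma v *: gsum (fun k => cterm (k%:R * al k) (k%:R * bt k + al k) i k p)).
Proof.
move=> i1 rp h1 h2 hk; have [e e0 he] := region_near rp.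
have [_ [ct ct0 ht]] := btau; have [_ [cs cs0 hs]] := bsigma.
have [[_ _ _ c0 _] _] := reg.
have i2 : (i <= 2)%N by exact: leq_trans i1 _.
pose G := growth (nm (sigma p) + 1).
have G0 : 0 <= G by rewrite growth_ge0 // addr_ge0 ?nm_ge0.
pose K := G * (n%:R * (c * ct) + cs) + G.
have K1 : G <= K by rewrite /K lerDr mulr_ge0 // addr_ge0 // mulr_ge0 // mulr_ge0.
have p0 k : 0 <= (1 / 2 : R) ^+ k by rewrite exprn_ge0.
have big al' bt' j k q : (j <= 2)%N -> admissible al' bt' -> nm (q - p) < e ->
    nm (cterm (al' k) (bt' k) j k q) <= G * (1 / 2) ^+ k.
  move=> j2 hab /he[rq sq]; apply: (le_trans (cterm_small k j2 rq hab)).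
  by rewrite ler_wpM2r // growth_le.
have step := hasD_gsum (T := fun k q => cterm (al k) (bt k) i k q)
  (T' := fun k q v => cterm (al k) (bt k) i.+1 k q *m Cm M (tau q) (tau v)
    + sigma v *: cterm (k%:R * al k) (k%:R * bt k + al k) i k q) (p := p) (d := e) (c := K) e0.
apply: hasD_eqD (step _ _ _) _ => [k q /he[/region_W Wq _]|k q hq|k q v hq|v].
- exact: cterm_hasD'.
- by apply: (le_trans (big _ _ _ _ _ i2 h1 hq)); rewrite ler_wpM2r.
- have [rq sq] := he _ hq.
  apply: (le_trans (nm_term_derivative rq (big _ _ _ k _ (i1 : (i.+1 <= 2)%N) h1 hq)
    (big _ _ _ k _ i2 h2 hq) _ ct0 (ht v) (hs v))); first by rewrite mulr_ge0.
  by rewrite ler_wpM2r ?nm_ge0 // ler_wpM2r // /K lerDl.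
- have b1 k := cterm_small k (i1 : (i.+1 <= 2)%N) rp h1.
  have b2 k := cterm_small k i2 rp h2.
  rewrite (gsumD (c := n%:R * growth (nm (sigma p)) * nm (Cm M (tau p) (tau v)))
    (d := nm (sigma v) * growth (nm (sigma p)))).
  + rewrite (gsum_blinear (L := fun A => A *m Cm M (tau p) (tau v))
      (blinear_mulmxr _ (blinear_id _)) b1).
    by rewrite (gsum_blinear (L := fun A => sigma v *: A) (blinearZ _ (blinear_id _)) b2).
  + move=> k; apply: (le_trans (nm_mulmx _ _)).
    have -> : n%:R * growth (nm (sigma p)) * nm (Cm M (tau p) (tau v)) * (1 / 2) ^+ k =
       n%:R * (growth (nm (sigma p)) * (1 / 2) ^+ k * nm (Cm M (tau p) (tau v))) by ring.
    by rewrite ler_wpM2l // ler_wpM2r ?nm_ge0.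
  + by move=> k; rewrite nmZ -mulrA ler_wpM2l ?nm_ge0.
Qed.

Lemma cseries_tail al bt i p : (i <= 2)%N -> in_region p -> admissible al bt ->
  nm (gsum (fun k => cterm (al k) (bt k) i k p) - cterm (al 0%N) (bt 0%N) i 0 p)
   <= 4 * (growth (nm (sigma p)) * (96 * be ^+ 2 * nm (cexp (sigma p)))).
Proof.
move=> i2 rp hab; rewrite (gsum_recl (c := growth (nm (sigma p)))) => [|k].
  rewrite addrC addKr; apply: nm_gsum => k; exact: cterm_tail.
exact: cterm_small.
Qed.

Local Notation xi1 := (xi1 M V r g tau sigma).
Local Notation xi2 := (xi2 M V r g tau sigma).
Local Notation chi1 := (chi1 M V r g tau sigma).
Local Notation chi2 := (chi2 M V r g tau sigma).
Local Notation wterm := (wterm M V r g phi tau sigma).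
Local Notation ww := (ww M V r g phi tau sigma).
Let tail p := growth (nm (sigma p)) * (96 * be ^+ 2 * nm (cexp (sigma p))).

Lemma xi1_hasD p : in_region p ->
  hasD xi1 p (fun v => chi1 p *m Cm M (tau p) (tau v) + sigma v *: chi2 p).
Proof.
move=> rp; have h2 : admissible (fun k => k%:R * 1) (fun k => k%:R * 0 + 1).
  by move=> k; rewrite mulr1 mulr0 add0r; exact: admissible1.
apply: hasD_eqD (cseries_hasD (isT : 1 <= 1)%N rp admissible0 h2 _) _ => [k|v].
  by left; rewrite addn1.
have e k : cterm (k%:R * 1) (k%:R * 0 + 1) 1 k p = cterm k%:R 1 1 k p.
  by rewrite mulr1 mulr0 add0r.
exact (congr1 (fun A => _ + sigma v *: A) (eq_gsum e)).
Qed.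

Lemma xi2_hasD p : in_region p -> hasD xi2 p (fun v =>
  chi2 p *m Cm M (tau p) (tau v) + sigma v *: (cexp (sigma p) *: chi1 p)).
Proof.
move=> rp.
apply: hasD_eqD (cseries_hasD (isT : 0 <= 1)%N rp admissible1 admissible2 _) _ => [[|k]|v].
- by right.
- by left.
congr (_ + _ *: _).
have b2 k := cterm_small k (isT : 0 <= 2)%N rp admissible2.
have b0 k := cterm_small k (isT : 2 <= 2)%N rp admissible0.
(* The constant term of the second derivative in [s] is zero; the remaining terms, shifted by one,
   are [Q] times the series [chi1]. *)
rewrite (gsum_recl b2) term_identity30 add0r.
rewrite (eq_gsum (fun k => term_identity3 M V r g tau sigma k p)).
exact (gsum_blinear (L := fun A => cexp (sigma p) *: A) (blinearZ _ (blinear_id _)) b0).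
Qed.

Lemma gsum_combine (u v : nat -> 'rV[C]_n) (A : 'M[C]_n) (x : C) (G : R) :
  (forall k, nm (u k) <= G * (1 / 2) ^+ k) -> (forall k, nm (v k) <= G * (1 / 2) ^+ k) ->
  gsum (fun k => u k *m A + x *: v k) = gsum u *m A + x *: gsum v.
Proof.
move=> hu hv; rewrite (gsumD (c := n%:R * G * nm A) (d := nm x * G)).
- rewrite (gsum_blinear (L := fun B => B *m A) (blinear_mulmxr _ (blinear_id _)) hu).
  by rewrite (gsum_blinear (L := fun B => x *: B) (blinearZ _ (blinear_id _)) hv).
- move=> k; apply: (le_trans (nm_mulmx _ _)).
  have -> : n%:R * G * nm A * (1 / 2) ^+ k = n%:R * (G * (1 / 2) ^+ k * nm A) by ring.
  by rewrite ler_wpM2l // ler_wpM2r ?nm_ge0.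
- by move=> k; rewrite nmZ -mulrA ler_wpM2l ?nm_ge0.
Qed.

(** With [cross_euler2] this is the relation [chi U = xi V] of the tensor product in components; it
    identifies [chi] with [xi V U^-1] and so turns the termwise derivatives into the odd period
    equation. *)
Lemma cross_euler1 p : in_region p ->
  chi1 p *m U (tau p) + 2 *: chi2 p = xi1 p *m (V - (1 / 2)%:M).
Proof.
move=> rp; have st := Ws (region_W rp).
have b1 k := cterm_small k (isT : 2 <= 2)%N rp admissible0.
have b2 k := cterm_small k (isT : 1 <= 2)%N rp admissible1.
have b3 k := cterm_small k (isT : 1 <= 2)%N rp admissible0.
rewrite -(gsum_combine _ _ b1 b2).
rewrite (eq_gsum (fun k => term_identity1 V hM r g sigma k st)).
exact (gsum_blinear (L := fun B => B *m _) (blinear_mulmxr _ (blinear_id _)) b3).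
Qed.

Lemma cross_euler2 p : in_region p ->
  chi2 p *m U (tau p) + (2 * cexp (sigma p)) *: chi1 p = xi2 p *m (V + (1 / 2)%:M).
Proof.
move=> rp; have st := Ws (region_W rp).
have b0 k := cterm_small k (isT : 2 <= 2)%N rp admissible0.
have b1 k := cterm_small k (isT : 1 <= 2)%N rp admissible1.
have b2 k := cterm_small k (isT : 0 <= 2)%N rp admissible2.
have b3 k := cterm_small k (isT : 0 <= 2)%N rp admissible1.
have e : gsum (fun k => cterm (k%:R * k%:R) (k%:R * 1 + k%:R) 0 k p)
    = cexp (sigma p) *: chi1 p.
  rewrite (gsum_recl b2) term_identity30 add0r.
  rewrite (eq_gsum (fun k => term_identity3 M V r g tau sigma k p)).
  exact (gsum_blinear (L := fun A => cexp (sigma p) *: A) (blinearZ _ (blinear_id _)) b0).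
rewrite -scalerA -e -(gsum_combine _ _ b1 b2).
rewrite (eq_gsum (fun k => term_identity2 V hM r g sigma k st)).
exact (gsum_blinear (L := fun B => B *m _) (blinear_mulmxr _ (blinear_id _)) b3).
Qed.

Lemma ww_hasD p : in_region p ->
  hasD ww p (fun v => xi1 p *m tau v + sigma v *: (xi2 p *m fm_e M)).
Proof.
move=> rp; have [e1 e10 he1] := region_near rp; have Wp := region_W rp.
have [_ [ct ct0 ht]] := btau; have [_ [cs cs0 hs]] := bsigma.
have [e2 e20 he2] := hasD_cont (hasD_comp (hasD_lin p btau) (hphi Wp)) ltr01.
pose G := growth (nm (sigma p) + 1).
have G0 : 0 <= G by rewrite growth_ge0 // addr_ge0 ?nm_ge0.
have p0 k : 0 <= (1 / 2 : R) ^+ k by rewrite exprn_ge0.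
have big al' bt' j k q : (j <= 2)%N -> admissible al' bt' -> nm (q - p) < e1 ->
    nm (cterm (al' k) (bt' k) j k q) <= G * (1 / 2) ^+ k.
  move=> j2 hab /he1[rq sq]; apply: (le_trans (cterm_small k j2 rq hab)).
  by rewrite ler_wpM2r // growth_le.
pose f := nm (phi (tau p)) + 1; have f0 : 0 <= f by rewrite addr_ge0 ?nm_ge0.
pose K1 := n%:R * G * nm (fm_e M) + f.
pose K2 := n%:R * G * ct + cs * (n%:R * G * nm (fm_e M)).
have nG : 0 <= n%:R * G * nm (fm_e M).
  by apply: mulr_ge0 (nm_ge0 _); exact: mulr_ge0.
have K10 : 0 <= K1 by exact: addr_ge0.
have K20 : 0 <= K2 by apply: addr_ge0; apply: mulr_ge0 => //; exact: mulr_ge0.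
have e0 : 0 < Num.min e1 e2 by rewrite lt_min e10.
have step := hasD_gsum (T := wterm) (T' := fun k q v => cterm 1 0 1 k q *m tau v
     + sigma v *: (cterm k%:R 1 0 k q *m fm_e M)) (p := p) (c := K1 + K2) e0.
apply: hasD_eqD (step _ _ _) _ => [k q|k q|k q v|v].
- rewrite lt_min => /andP[/he1[rq _] _]; have Wq := region_W rq.
  refine (hasD_eqD (wterm_hasD hM hV btau bsigma k (Ws Wq) (hr Wq) (hg Wq) (hphi Wq)) _).
  by [].
- rewrite lt_min => /andP[q1 /he2 q2].
  have h1 := big _ _ _ k _ (isT : 0 <= 2)%N admissible0 q1.
  have -> : wterm k q = cterm 1 0 0 k q *m fm_e M + (if k is 0%N then phi (tau q) else 0) by [].
  apply: (le_trans (nmD _ _)).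
  have h2 : nm (cterm 1 0 0 k q *m fm_e M) <= n%:R * G * nm (fm_e M) * (1 / 2) ^+ k.
    apply: (le_trans (nm_mulmx _ _)).
    have -> : n%:R * G * nm (fm_e M) * (1 / 2) ^+ k = n%:R * (G * (1 / 2) ^+ k * nm (fm_e M)).
      by ring.
    by rewrite ler_wpM2l // ler_wpM2r ?nm_ge0.
  have h3 : nm ((if k is 0%N then phi (tau q) else 0) : 'M[C]_1) <= f * (1 / 2) ^+ k.
    case: (k) => [|j]; last by rewrite nm0 mulr_ge0.
    rewrite expr0 mulr1 /f -[phi (tau q)](subrK (phi (tau p))) (le_trans (nmD _ _)) //.
    by rewrite addrC lerD2l ltW.
  apply: (@le_trans _ _ (K1 * (1 / 2) ^+ k)).
    by rewrite (le_trans (lerD h2 h3)) // -mulrDl.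
  by rewrite ler_wpM2r // lerDl.
- rewrite lt_min => /andP[q1 _].
  have h1 := big _ _ _ k _ (isT : 1 <= 2)%N admissible0 q1.
  have h2 := big _ _ _ k _ (isT : 0 <= 2)%N admissible1 q1.
  apply: (@le_trans _ _ (K2 * (1 / 2) ^+ k * nm v)); last first.
    by rewrite ler_wpM2r ?nm_ge0 // ler_wpM2r // lerDr.
  apply: (le_trans (nmD _ _)); rewrite nmZ.
  have h3 : nm (cterm 1 0 1 k q *m tau v) <= n%:R * (G * (1 / 2) ^+ k * (ct * nm v)).
    exact: nm_mulmx_bound h1 (ht v).
  have h4 : nm (sigma v) * nm (cterm k%:R 1 0 k q *m fm_e M) <=
      cs * nm v * (n%:R * (G * (1 / 2) ^+ k * nm (fm_e M))).
    apply: ler_pM (nm_ge0 _) (nm_ge0 _) (hs v) _.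
    exact: nm_mulmx_bound h2 (lexx _).
  apply: (le_trans (lerD h3 h4)); apply: eq_ler; rewrite /K2; ring.
- have b1 k := cterm_small k (isT : 1 <= 2)%N rp admissible0.
  have b2 k := cterm_small k (isT : 0 <= 2)%N rp admissible1.
  set Gp := growth (nm (sigma p)) in b1 b2.
  rewrite (gsumD (c := n%:R * Gp * nm (tau v)) (d := nm (sigma v) * (n%:R * Gp * nm (fm_e M)))).
  + rewrite (gsum_blinear (L := fun A => A *m tau v) (blinear_mulmxr _ (blinear_id _)) b1).
    by rewrite (gsum_blinear (L := fun A => sigma v *: (A *m fm_e M))
      (blinearZ _ (blinear_mulmxr _ (blinear_id _))) b2).
  + move=> k; apply: (le_trans (nm_mulmx _ _)).
    have -> : n%:R * Gp * nm (tau v) * (1 / 2) ^+ k = n%:R * (Gp * (1 / 2) ^+ k * nm (tau v)).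
      by ring.
    by rewrite ler_wpM2l // ler_wpM2r ?nm_ge0.
  + move=> k; rewrite nmZ -mulrA ler_wpM2l ?nm_ge0 //; apply: (le_trans (nm_mulmx _ _)).
    have -> : n%:R * Gp * nm (fm_e M) * (1 / 2) ^+ k = n%:R * (Gp * (1 / 2) ^+ k * nm (fm_e M)).
      by ring.
    by rewrite ler_wpM2l // ler_wpM2r ?nm_ge0.
Qed.

Lemma xi1_asym p : in_region p ->
  nm (xi1 p - (sigma p *: Pj 1 (tau p) + g (tau p))) <= 4 * tail p.
Proof.
move=> rp; have := cseries_tail (isT : 1 <= 2)%N rp admissible0.
by rewrite cterm_0 Gjet_1.
Qed.

Lemma xi2_asym p : in_region p -> nm (xi2 p - r (tau p)) <= 4 * tail p.
Proof.
move=> rp; have := cseries_tail (isT : 0 <= 2)%N rp admissible1.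
by rewrite cterm_00 scale1r Pjet_0.
Qed.

Lemma ww_asym p : in_region p ->
  nm (ww p - (sigma p *: (r (tau p) *m fm_e M) + phi (tau p))) <=
  4 * (n%:R * tail p * nm (fm_e M)).
Proof.
move=> rp.
have tl k : nm (wterm k.+1 p) <= n%:R * tail p * nm (fm_e M) * (1 / 2) ^+ k.
  have -> : wterm k.+1 p = cterm 1 0 0 k.+1 p *m fm_e M by exact: addr0.
  apply: (le_trans (nm_mulmx _ _)).
  have -> : n%:R * tail p * nm (fm_e M) * (1 / 2) ^+ k
    = n%:R * (tail p * (1 / 2) ^+ k * nm (fm_e M)) by ring.
  rewrite ler_wpM2l // ler_wpM2r ?nm_ge0 //.
  exact: (cterm_tail k (isT : 0 <= 2)%N rp admissible0).
have w0 : wterm 0 p = sigma p *: (r (tau p) *m fm_e M) + phi (tau p).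
  have -> : wterm 0 p = cterm 1 0 0 0 p *m fm_e M + phi (tau p) by [].
  by rewrite cterm_0 Gjet_0 addr0 Pjet_0 scalemxAl.
have t0' : 0 <= n%:R * tail p * nm (fm_e M).
  have /andP[x0 _] := region_ratio rp.
  apply: mulr_ge0 (nm_ge0 _); apply: mulr_ge0 => //.
  by apply: mulr_ge0 => //; apply: growth_ge0; exact: nm_ge0.
have -> : ww p = gsum (fun k => wterm k p) by [].
rewrite (gsum_recl (c := nm (wterm 0 p) + 2 * (n%:R * tail p * nm (fm_e M)))).
  by rewrite w0 addrC addKr; apply: nm_gsum => k; exact: tl.
case=> [|k]; first by rewrite expr0 mulr1 lerDl mulr_ge0.
apply: (le_trans (tl k)).
have -> : (1 / 2 : R) ^+ k = 2 * (1 / 2) ^+ k.+1 by rewrite exprS; field.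
have y0 : 0 <= (1 / 2 : R) ^+ k.+1 by exact: exprn_ge0.
have x0 := nm_ge0 (wterm 0 p).
move: (n%:R * tail p * nm (fm_e M)) ((1 / 2 : R) ^+ k.+1) (nm (wterm 0 p)) y0 x0 => z y x *.
by nra.
Qed.

End RegionBounds.
(** All that is needed of an explicit solution afterwards: its differential system, the two
    components of [chi U = xi V], and error bounds in which [A] is the coefficient of the
    logarithmic growth. *)
Definition cross_estimate (d rho A B : R) t0 W :=
  forall p, nm (tau p - t0) < d -> cRe (sigma p) < rho -> W (tau p) /\
  let X1 := xi1 M V r g tau sigma in let X2 := xi2 M V r g tau sigma in
  let Z1 := chi1 M V r g tau sigma in let Z2 := chi2 M V r g tau sigma in
  let w := ww M V r g phi tau sigma in
  [/\ hasD X1 p (fun v => Z1 p *m Cm M (tau p) (tau v) + sigma v *: Z2 p),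
      hasD X2 p (fun v => Z2 p *m Cm M (tau p) (tau v)
        + sigma v *: (cexp (sigma p) *: Z1 p)),
      hasD w p (fun v => X1 p *m tau v + sigma v *: (X2 p *m fm_e M)),
      Z1 p *m U (tau p) + 2 *: Z2 p = X1 p *m (V - (1 / 2)%:M) /\
      Z2 p *m U (tau p) + (2 * cexp (sigma p)) *: Z1 p = X2 p *m (V + (1 / 2)%:M) &
      let small (x : R) := x <= (A * nm (sigma p) + B) * nm (cexp (sigma p)) in
      [/\ small (nm (X1 p - (sigma p *: Pj 1 (tau p) + g (tau p)))),
        small (nm (X2 p - r (tau p))) &
        small (nm (w p - (sigma p *: (r (tau p) *m fm_e M) + phi (tau p))))]].

Lemma cross_solution (W : set 'cV[C]_n) t0 : open W -> W `<=` star ->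
  (forall t, W t -> hasD r t (fun v => Pj 1 t *m Cm M t v)) ->
  (forall t, W t -> hasD g t (fun v => Gj 2 t *m Cm M t v)) ->
  (forall t, W t -> hasD phi t (fun v => g t *m v)) ->
  W t0 -> exists d rho A B : R, [/\ 0 < d, 0 <= A, 0 <= B,
    (forall t, W t -> r t = 0) -> A = 0 & cross_estimate d rho A B t0 W].
Proof.
move=> oW Ws hr hg hphi Wt0.
have [d [a [b [be [c [reg ha]]]]]] := jet_region_exists oW Ws hr hg Wt0.
have [[a0 b0 be1 c0 d0] hreg] := reg.
have be0 := le_trans ler01 be1.
have q0 : 0 < 192 * be ^+ 2 by rewrite mulr_gt0 // exprn_gt0 // (lt_le_trans ltr01).
(* Chosen so that [96 be^2 exp rho] equals [1 / 2], the ratio built into [gsum]. *)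
pose rho : R := ln (192 * be ^+ 2)^-1.
have hrho : 96 * be ^+ 2 * expR rho <= 1 / 2.
  rewrite /rho lnK ?posrE ?invr_gt0 //.
  have -> : 192 * be ^+ 2 = 2 * (96 * be ^+ 2) by ring.
  rewrite invfM mulrCA divff ?mulr1 ?mul1r //.
  by rewrite mulf_neq0 ?expf_neq0 ?gt_eqF // (lt_le_trans ltr01).
(* The factors come from summing the series, from the prefactor of [growth] and from the first power
   of the ratio; the last one accounts for the pairing with the unit field in the period itself. *)
pose L := 4 * (2 * be ^+ 2) * (96 * be ^+ 2) * (1 + n%:R * nm (fm_e M)).
have L0 : 0 <= L.
  by rewrite !(mulr_ge0, addr_ge0, exprn_ge0) ?nm_ge0.
exists d, rho, (L * (2 * a)), (L * (2 * a + b)); split => //.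
- by apply: mulr_ge0 => //; exact: mulr_ge0.
- by apply: mulr_ge0 => //; apply: addr_ge0 => //; exact: mulr_ge0.
- by move=> /ha ->; rewrite !mulr0.
move=> p p1 p2; have rp : in_region t0 d rho p by [].
split; first exact: (region_W reg rp).
have hb1 := xi1_asym reg hrho rp.
have hb2 := xi2_asym reg hrho rp.
have hb3 := ww_asym reg hrho rp.
have e0 := nm_ge0 (cexp (sigma p)); have ne0 := nm_ge0 (fm_e M).
have gr : growth a b be (nm (sigma p)) = 2 * be ^+ 2 * (2 * a * (nm (sigma p) + 1) + b) by [].
have g0 : 0 <= growth a b be (nm (sigma p)) by exact: (growth_ge0 reg (nm_ge0 _)).
have eL : (L * (2 * a) * nm (sigma p) + L * (2 * a + b)) * nm (cexp (sigma p)) =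
  4 * (growth a b be (nm (sigma p)) * (96 * be ^+ 2 * nm (cexp (sigma p))))
   * (1 + n%:R * nm (fm_e M)) by rewrite gr /L; ring.
have t0' : 0 <= 4 * (growth a b be (nm (sigma p)) * (96 * be ^+ 2 * nm (cexp (sigma p)))).
  by rewrite mulr_ge0 // mulr_ge0 // mulr_ge0 // mulr_ge0 // exprn_ge0.
split.
- exact: (xi1_hasD reg Ws hr hg hrho rp).
- exact: (xi2_hasD reg Ws hr hg hrho rp).
- exact: (ww_hasD reg Ws hr hg hphi hrho rp).
- split; [exact: (cross_euler1 reg Ws hrho rp)
    | exact: (cross_euler2 reg Ws hrho rp)].
- have le1 : 1 <= 1 + n%:R * nm (fm_e M) by rewrite lerDl mulr_ge0.
  split; rewrite /= eL.
  + by apply: (le_trans hb1); rewrite ler_peMr.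
  + by apply: (le_trans hb2); rewrite ler_peMr.
  + apply: (le_trans hb3); rewrite mulrDr mulr1.
    apply: ler_wpDl => //; apply: eq_ler; ring.
Qed.

End CrossSeries.

(** * The tensor product with the quantum cohomology of the projective line *)

Section TensorAlgebra.
Variable R : realType.
Local Notation C := (Cplx R).

Section Bilinear.
Variables m n p q : nat.
Implicit Types (A : 'M[C]_(m, n)) (B : 'M[C]_(p, q)).

Lemma tensmxDl A A' B : (A + A') *t B = A *t B + A' *t B.
Proof. by apply/matrixP => i j; rewrite !mxE mulrDl. Qed.
Lemma tensmxZl (c : C) A B : (c *: A) *t B = c *: (A *t B).
Proof. by apply/matrixP => i j; rewrite !mxE mulrA. Qed.
Lemma tensmxZr (c : C) A B : A *t (c *: B) = c *: (A *t B).
Proof. by apply/matrixP => i j; rewrite !mxE mulrCA. Qed.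
Lemma tensmxNl A B : (- A) *t B = - (A *t B).
Proof. by apply/matrixP => i j; rewrite !mxE mulNr. Qed.
Lemma tensmx_suml (I : Type) (s : seq I) (F : I -> 'M[C]_(m, n)) B :
  (\sum_(i <- s) F i) *t B = \sum_(i <- s) F i *t B.
Proof.
elim: s => [|i s IH]; last by rewrite !big_cons tensmxDl IH.
by rewrite !big_nil; apply/matrixP => i j; rewrite !mxE mul0r.
Qed.
End Bilinear.

Lemma tensmx11 m p : (1%:M : 'M[C]_m) *t (1%:M : 'M[C]_p) = 1%:M.
Proof.
apply/matrixP => i j; case: (mxtens_indexP i) => i1 i2; case: (mxtens_indexP j) => j1 j2.
rewrite tensmxE !mxE -natrM mulnb (can_eq (@mxtens_indexK _ _)) xpair_eqE.
by [].
Qed.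

Lemma tens_del m p (a : 'I_m) (i : 'I_p) : tens (del C a) (del C i) = del C (mxtens_index (a, i)).
Proof.
apply/matrixP => k l; rewrite !mxE; case: (mxtens_indexP k) => k1 k2.
rewrite mxtens_indexK (can_eq (@mxtens_indexK _ _)) xpair_eqE !ord1 !eqxx !andbT.
by rewrite -natrM mulnb.
Qed.

Lemma eq_mulmx_tens k m p (A B : 'M[C]_(k, m * p)) :
  (forall a i, A *m tens (del C a) (del C i) = B *m tens (del C a) (del C i)) -> A = B.
Proof.
move=> h; apply/matrixP => i j; case: (mxtens_indexP j) => a l.
have := h a l; rewrite tens_del !mulmx_del => /colP /(_ i); by rewrite !mxE.
Qed.

Definition rt m p (x : 'rV[C]_m) (b : 'rV[C]_p) : 'rV[C]_(m * p) := x *t b.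

Lemma rt_mul m p m' p' (x : 'rV[C]_m) (b : 'rV[C]_p) (A : 'M[C]_(m, m')) (B : 'M[C]_(p, p')) :
  rt x b *m (A *t B) = rt (x *m A) (b *m B).
Proof. exact (tensmx_mul x b A B). Qed.

Lemma rt_tens m p (x : 'rV[C]_m) (b : 'rV[C]_p) u v :
  rt x b *m tens u v = ((x *m u) 0 0 * (b *m v) 0 0)%:M.
Proof.
have -> : rt x b *m tens u v = (x *m u) *t (b *m v) by exact (tensmx_mul x b u v).
apply/matrixP => i j; rewrite !mxE !ord1 eqxx mulr1n; congr (_ * _); rewrite ?mxE //.
Qed.

Lemma tens_mul m p m' p' (A : 'M[C]_(m', m)) (B : 'M[C]_(p', p)) u v :
  (A *t B) *m tens u v = tens (A *m u) (B *m v).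
Proof. exact (tensmx_mul A B u v). Qed.

Lemma rt_entry m p (x : 'rV[C]_m) (b : 'rV[C]_p) a i :
  rt x b 0 (mxtens_index (a, i)) = x 0 a * b 0 i.
Proof. by rewrite mxE mxtens_indexK !ord1. Qed.

Lemma tens_entry m p (u : 'cV[C]_m) (v : 'cV[C]_p) a i :
  tens u v (mxtens_index (a, i)) 0 = u a 0 * v i 0.
Proof. by rewrite mxE mxtens_indexK !ord1. Qed.

(** Covectors on the tensor product, split into their components along the two basis vectors of the
    second factor. *)
Definition rr m (x y : 'rV[C]_m) : 'rV[C]_(m * 2) :=
  rt x (delta_mx 0 0) + rt y (delta_mx 0 1).

Lemma rr_mul m (x y : 'rV[C]_m) (A : 'M[C]_m) : rr x y *m (A *t 1%:M) = rr (x *m A) (y *m A).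
Proof. by rewrite mulmxDl !rt_mul !mulmx1. Qed.

Lemma rrD m (x y x' y' : 'rV[C]_m) : rr x y + rr x' y' = rr (x + x') (y + y').
Proof. by rewrite /rr /rt !tensmxDl addrACA. Qed.

Lemma rrZ m (c : C) (x y : 'rV[C]_m) : c *: rr x y = rr (c *: x) (c *: y).
Proof. by rewrite /rr /rt !tensmxZl scalerDr. Qed.

Lemma rr_tens0 m (x y : 'rV[C]_m) u : rr x y *m tens u (del C 0) = x *m u.
Proof.
rewrite mulmxDl !rt_tens !mulmx_del; apply/matrixP => i j; rewrite !ord1 !mxE.
by rewrite !eqxx /= !mulr1n mulr1 mulr0 addr0; apply: eq_bigr => k _; rewrite ?mxE.
Qed.

Lemma rr_tens1 m (x y : 'rV[C]_m) u : rr x y *m tens u (del C 1) = y *m u.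
Proof.
rewrite mulmxDl !rt_tens !mulmx_del; apply/matrixP => i j; rewrite !ord1 !mxE.
by rewrite !eqxx /= !mulr1n mulr1 mulr0 add0r; apply: eq_bigr => k _; rewrite ?mxE.
Qed.

Lemma ord2_cases (P : 'I_2 -> Prop) : P 0 -> P 1 -> forall i, P i.
Proof.
move=> h0 h1 [[|[|i]] hi] //.
- by rewrite (_ : Ordinal hi = 0) //; apply: val_inj.
- by rewrite (_ : Ordinal hi = 1) //; apply: val_inj.
Qed.

End TensorAlgebra.

(** * Quantum cohomology of the projective line *)

Section QH.
Variable R : realType.
Local Notation C := (Cplx R).

Lemma hasD_scalarM (T : normedModType C) (f g : T -> C) p L L' :
  hasD f p L -> hasD g p L' ->
  hasD (fun q => f q * g q) p (fun v => L v * g p + f p * L' v).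
Proof.
move=> hf hg.
have toM (h : T -> C) D : hasD h p D ->
    hasD (fun q => (h q)%:M : 'M[C]_1) p (fun v => (D v)%:M : 'M[C]_1).
  move=> hh; apply: hasD_mx => i j; rewrite !ord1.
  apply: (hasD_ext (f := h)); first by near=> q; rewrite mxE eqxx mulr1n.
  by apply: hasD_eqD hh _ => v; rewrite mxE eqxx mulr1n.
have := hasD_entry 0 0 (hasD_mulmx (toM _ _ hf) (toM _ _ hg)).
move=> h; apply: (hasD_ext (f := fun q => ((f q)%:M *m (g q)%:M : 'M[C]_1) 0 0)).
  by near=> q; rewrite -scalar_mxM mxE eqxx mulr1n.
by apply: hasD_eqD h _ => v; rewrite -!scalar_mxM !mxE !eqxx !mulr1n.
Unshelve. all: by end_near. Qed.

Lemma antidiagM k : antidiag C k *m antidiag C k = 1%:M.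
Proof.
apply/matrixP => i j; rewrite !mxE (bigD1 (rev_ord i)) //= big1 => [|l li].
  by rewrite !mxE eqxx mul1r addr0 rev_ordK eq_sym.
by rewrite !mxE (negbTE li) mul0r.
Qed.

Lemma antidiag_unit k : antidiag C k \in unitmx.
Proof. by case: (mulmx1_unit (antidiagM k)). Qed.

Lemma invmx_antidiag k : invmx (antidiag C k) = antidiag C k.
Proof.
rewrite -[LHS]mulmx1 -(antidiagM k) mulmxA mulVmx ?mul1mx //; exact: antidiag_unit.
Qed.

Lemma qh_d1 (v p : 'cV[C]_2) : 'D_v (@qh_potential R) p =
  v 0 0 * p 0 0 * p 1 0 + p 0 0 ^+ 2 * v 1 0 / 2 + v 1 0 * cexp (p 1 0).
Proof.
have b i : blinear (fun q : 'cV[C]_2 => q i 0 : C) by exact: blinear_entry (blinear_id _).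
have h i : hasD (fun q : 'cV[C]_2 => q i 0 : C) p (fun w => w i 0) by exact: hasD_lin.
have hq := hasD_scalarM (hasD_scalarM (h 0) (h 0)) (h 1).
have he := hasD_comp (h 1) (cexp_hasD (p 1 0)).
have h1 : hasD (@qh_potential R) p (fun w =>
   2^-1 *: ((w 0 0 * p 0 0 + p 0 0 * w 0 0) * p 1 0 + (p 0 0 * p 0 0) * w 1 0)
     + w 1 0 * cexp (p 1 0)).
  apply: hasD_ext (hasDD (hasDZ 2^-1 hq) he).
  by near=> q; rewrite /qh_potential expr2 -[_ *: _]/(_ * _) mulrC.
rewrite (hasD_derive h1) -[_ *: _]/(_ * _); field.
Unshelve. all: by end_near. Qed.

Lemma qh_d2 (u v p : 'cV[C]_2) : 'D_u (fun p => 'D_v (@qh_potential R) p) p =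
  v 0 0 * (u 0 0 * p 1 0 + p 0 0 * u 1 0) + p 0 0 * u 0 0 * v 1 0
   + v 1 0 * u 1 0 * cexp (p 1 0).
Proof.
have b i : blinear (fun q : 'cV[C]_2 => q i 0 : C) by exact: blinear_entry (blinear_id _).
have h i : hasD (fun q : 'cV[C]_2 => q i 0 : C) p (fun w => w i 0) by exact: hasD_lin.
have he := hasD_comp (h 1) (cexp_hasD (p 1 0)).
have h1 : hasD (fun p => 'D_v (@qh_potential R) p) p (fun w =>
   v 0 0 *: (w 0 0 * p 1 0 + p 0 0 * w 1 0)
   + (v 1 0 / 2) *: (w 0 0 * p 0 0 + p 0 0 * w 0 0) + v 1 0 *: (w 1 0 * cexp (p 1 0))).
  apply: hasD_ext (hasDD (hasDD (hasDZ (v 0 0) (hasD_scalarM (h 0) (h 1)))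
     (hasDZ (v 1 0 / 2) (hasD_scalarM (h 0) (h 0)))) (hasDZ (v 1 0) he)).
  by near=> q; rewrite qh_d1 -![_ *: _]/(_ * _); field.
rewrite (hasD_derive h1) -![_ *: _]/(_ * _); field.
Unshelve. all: by end_near. Qed.

Lemma qh_d3 (w u v p : 'cV[C]_2) :
  'D_w (fun p => 'D_u (fun p => 'D_v (@qh_potential R) p) p) p =
  v 0 0 * u 0 0 * w 1 0 + v 0 0 * u 1 0 * w 0 0 + u 0 0 * v 1 0 * w 0 0
   + v 1 0 * u 1 0 * w 1 0 * cexp (p 1 0).
Proof.
have b i : blinear (fun q : 'cV[C]_2 => q i 0 : C) by exact: blinear_entry (blinear_id _).
have h i : hasD (fun q : 'cV[C]_2 => q i 0 : C) p (fun w => w i 0) by exact: hasD_lin.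
have he := hasD_comp (h 1) (cexp_hasD (p 1 0)).
have h1 : hasD (fun p => 'D_u (fun p => 'D_v (@qh_potential R) p) p) p (fun w =>
   (v 0 0 * u 0 0) *: w 1 0 + (v 0 0 * u 1 0 + u 0 0 * v 1 0) *: w 0 0
   + (v 1 0 * u 1 0) *: (w 1 0 * cexp (p 1 0))).
  apply: hasD_ext (hasDD (hasDD (hasDZ (v 0 0 * u 0 0) (h 1))
     (hasDZ (v 0 0 * u 1 0 + u 0 0 * v 1 0) (h 0))) (hasDZ (v 1 0 * u 1 0) he)).
  by near=> q; rewrite qh_d2 -![_ *: _]/(_ * _); ring.
rewrite (hasD_derive h1) -![_ *: _]/(_ * _); ring.
Unshelve. all: by end_near. Qed.

Definition Smx (s : C) : 'M[C]_2 := fm_c (qh_cp1 R) (qh_pt s) 1.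

Lemma qh_cE (s : C) a b g : fm_c (qh_cp1 R) (qh_pt s) a b g =
  let u := del C a in let v := del C g in let w := del C (rev_ord b) in
  v 0 0 * u 0 0 * w 1 0 + v 0 0 * u 1 0 * w 0 0 + u 0 0 * v 1 0 * w 0 0
   + v 1 0 * u 1 0 * w 1 0 * cexp s.
Proof.
rewrite /= mxE (bigD1 (rev_ord b)) //= big1 => [|l li].
  rewrite invmx_antidiag !mxE eqxx mul1r addr0 qh_d3.
  by rewrite /qh_pt !mxE eqxx /= mulr1.
by rewrite invmx_antidiag !mxE (negbTE li) mul0r.
Qed.

Lemma qh_c0 s : fm_c (qh_cp1 R) (qh_pt s) 0 = 1%:M.
Proof.
apply/matrixP => b g; rewrite qh_cE /= !mxE.
elim/ord2_cases: b; elim/ord2_cases: g; rewrite /= ?(mulr0, mul0r, addr0, add0r, mulr1) //.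
Qed.

Lemma Smx_row0 s : (delta_mx 0 0 : 'rV[C]_2) *m Smx s = cexp s *: delta_mx 0 1.
Proof.
rewrite -rowE; apply/matrixP => i g; rewrite !ord1 [LHS]mxE /Smx qh_cE /= !mxE.
by elim/ord2_cases: g; rewrite /= ?(mulr0, mul0r, addr0, add0r, mulr1, mul1r).
Qed.

Lemma Smx_row1 s : (delta_mx 0 1 : 'rV[C]_2) *m Smx s = delta_mx 0 0.
Proof.
rewrite -rowE; apply/matrixP => i g; rewrite !ord1 [LHS]mxE /Smx qh_cE /= !mxE.
by elim/ord2_cases: g; rewrite /= ?(mulr0, mul0r, addr0, add0r, mulr1, mul1r).
Qed.

End QH.

#[local] Opaque xi1 xi2 chi1 chi2 ww.

Lemma half_bound (R : realType) (K : R) : 0 < K -> (K - 1) / (2 * K) <= 1 / 2.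
Proof. by move=> K0; rewrite ler_pdivrMr ?mulr_gt0 //; lra. Qed.

Lemma tens_scalar_shift (R : realType) m p (c : Cplx R) :
  (2 * 2) *: ((1%:M : 'M[Cplx R]_m) *t (c%:M : 'M[Cplx R]_p)) = (4 * c)%:M *t 1%:M.
Proof.
rewrite -(scalemx1 _ c) -(scalemx1 _ (4 * c)) tensmxZr tensmxZl scalerA.
by congr (_ *: _); ring.
Qed.

(** * Restriction of the connection to the cross *)

Section Cross.
#[local] Opaque Smx rr.
Variable R : realType.
Local Notation C := (Cplx R).
Local Notation hol := holomorphic_upto.
Variables (n : nat) (M : frob_data C n.+1) (mu : 'I_n.+1 -> C) (N : frob_data C (n.+1 * 2)).
Hypotheses (hM : is_frobenius M) (hmu : normalized_diag M mu) (hN : tensor_qh M mu N).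
Local Notation U := (fm_U M).

Definition Vmu : 'M[C]_n.+1 := diag_mx (\row_a mu a).
Definition VN : 'M[C]_(n.+1 * 2) :=
  (Vmu - (1 / 2)%:M) *t delta_mx 0 0 + (Vmu + (1 / 2)%:M) *t delta_mx 1 1.
(** In flat coordinates the cross is a linear subspace. [tau] and [sigma] extend its coordinates
    linearly to the ambient space and [cproj] is the resulting projection, so functions of [(t, s)]
    are treated as functions on open sets. *)
Definition tau (p : 'cV[C]_(n.+1 * 2)) : 'cV[C]_n.+1 := \col_a p (mxtens_index (a, 0)) 0.
Definition sigma (p : 'cV[C]_(n.+1 * 2)) : C := p (mxtens_index (0, 1)) 0.
Definition cproj p := cross (tau p) (sigma p).

Lemma hV t : fm_dom M t -> fm_V M t = Vmu. Proof. exact: norm_V hmu t. Qed.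

Lemma Vmu_del a : Vmu *m del C a = mu a *: del C a.
Proof.
apply/matrixP => i j; rewrite mul_diag_mx !mxE.
by case: eqP => [->|] //=; rewrite !mulr0.
Qed.

Lemma hVN p : fm_dom N p -> fm_V N p = VN.
Proof.
move=> dp; apply: eq_mulmx_tens => a; have [h0 h1] := tensor_V hN a dp.
have d2 (i j : 'I_2) : (delta_mx i i : 'M[C]_2) *m del C j = (i == j)%:R *: del C j.
  rewrite mul_delta_mx_cond scaler_nat; case: eqP => [->|] //.
have m1 (x : C) : (Vmu + x%:M) *m del C a = (mu a + x) *: del C a.
  by rewrite mulmxDl Vmu_del mul_scalar_mx scalerDl.
have m2 (x : C) : (Vmu - x%:M) *m del C a = (mu a - x) *: del C a.
  by rewrite mulmxBl Vmu_del mul_scalar_mx scalerBl.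
elim/ord2_cases; rewrite ?h0 ?h1 mulmxDl !tens_mul m1 m2 !d2 /= /tens.
  by rewrite !scale1r !scale0r !tensmxZl tensmx0 ?scaler0 addr0.
by rewrite !scale1r !scale0r !tensmxZl tensmx0 ?scaler0 add0r.
Qed.

Lemma tau_linear : linear tau.
Proof. by move=> a u v; apply/matrixP => i j; rewrite !mxE. Qed.
Lemma sigma_linear : linear (sigma : 'cV[C]_(n.+1 * 2) -> C).
Proof. by move=> a u v; rewrite /sigma !mxE. Qed.
Lemma blinear_tau : blinear tau. Proof. exact: blinear_cV tau_linear. Qed.
Lemma blinear_sigma : blinear (sigma : 'cV[C]_(n.+1 * 2) -> C).
Proof. exact: blinear_cV sigma_linear. Qed.

Lemma tau_cross t s : tau (cross t s) = t.
Proof.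
apply/matrixP => i j; rewrite !ord1 mxE mxE tens_entry [in X in _ + X]mxE tens_entry.
by rewrite !mxE eqxx /= mulr1 !mulr0 addr0.
Qed.

Lemma sigma_cross t s : sigma (cross t s) = s.
Proof.
rewrite /sigma mxE tens_entry [in X in _ + X]mxE tens_entry.
by rewrite !mxE !eqxx /= mulr0 add0r !mulr1.
Qed.

Lemma cproj_cross t s : cproj (cross t s) = cross t s.
Proof. by rewrite /cproj tau_cross sigma_cross. Qed.

Lemma crossD t s t' s' : cross t s + cross t' s' = cross (t + t') (s + s') :> 'cV[C]_(n.+1 * 2).
Proof. by rewrite /cross /tens tensmxDl scalerDl addrACA. Qed.
Lemma crossZ c t s : c *: cross t s = cross (c *: t) (c * s) :> 'cV[C]_(n.+1 * 2).
Proof. by rewrite /cross /tens tensmxZl scalerDr scalerA. Qed.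

Lemma cproj_linear : linear cproj.
Proof.
move=> a u v; rewrite /cproj tau_linear (_ : sigma (a *: u + v) = a * sigma u + sigma v).
  by rewrite -crossD -crossZ.
exact: sigma_linear.
Qed.
Lemma blinear_cproj : blinear cproj. Proof. exact: blinear_cV cproj_linear. Qed.

Lemma Cm_cross t s u h : fm_dom M t -> Cm N (cross t s) (cross u h) =
  Cm M t u *t 1%:M + h *: (1%:M *t Smx s).
Proof.
move=> dt.
have c a i : Cm N (cross t s) (tens (del C a) (del C i)) = fm_c M t a *t fm_c (qh_cp1 R) (qh_pt s) i.
  by rewrite tens_del Cm_del (tensor_c hN).
have e1 : Cm N (cross t s) (tens (del C 0) (del C 1)) = 1%:M *t Smx s.
  by rewrite c -(Cm_del M) -(norm_e hmu) (Cm_unit hM).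
have e0 : Cm N (cross t s) (tens u (del C 0)) = Cm M t u *t 1%:M.
  have lu : linear (fun u => Cm N (cross t s) (tens u (del C 0))).
    by move=> x y z; rewrite /tens tensmxDl tensmxZl Cm_linear.
  rewrite (linear_cV u lu) (linear_cV u (Cm_linear M t)) tensmx_suml.
  by apply: eq_bigr => a _; rewrite c qh_c0 tensmxZl Cm_del.
rewrite /cross (linear_add (Cm_linear _ _)) (linear_scale (Cm_linear _ _)).
by rewrite e0 e1.
Qed.

Lemma U_cross t s : fm_dom M t -> fm_U N (cross t s) = U t *t 1%:M + 2 *: (1%:M *t Smx s).
Proof.
move=> dt; rewrite !fm_UE (tensor_E hN) //; exact: Cm_cross.
Qed.

Lemma rr_S (x y : 'rV[C]_n.+1) s : rr x y *m (1%:M *t Smx s) = rr y (cexp s *: x).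
Proof.
have -> : rr x y = rt x (delta_mx 0 0) + rt y (delta_mx 0 1) by [].
rewrite mulmxDl !rt_mul !mulmx1 Smx_row0 Smx_row1 addrC.
have -> : rr y (cexp s *: x) = rt y (delta_mx 0 0) + rt (cexp s *: x) (delta_mx 0 1) by [].
by rewrite /rt tensmxZl tensmxZr.
Qed.

Lemma rr_V (x y : 'rV[C]_n.+1) :
  rr x y *m VN = rr (x *m (Vmu - (1 / 2)%:M)) (y *m (Vmu + (1 / 2)%:M)).
Proof.
have d2 (i j : 'I_2) : (delta_mx 0 i : 'rV[C]_2) *m delta_mx j j = (i == j)%:R *: delta_mx 0 j.
  by rewrite mul_delta_mx_cond scaler_nat.
have -> : rr x y = rt x (delta_mx 0 0) + rt y (delta_mx 0 1) by [].
rewrite /VN mulmxDr !mulmxDl !rt_mul !d2 /= !scale0r !scale1r /rt !tensmx0 addr0 add0r.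
by [].
Qed.

Lemma rr_cross (x y : 'rV[C]_n.+1) u h : rr x y *m cross u h = x *m u + h *: (y *m fm_e M).
Proof. by rewrite /cross mulmxDr -scalemxAr rr_tens0 rr_tens1 (norm_e hmu). Qed.

Lemma rr_Cm (x y : 'rV[C]_n.+1) t s u h : fm_dom M t -> rr x y *m Cm N (cross t s) (cross u h)
  = rr (x *m Cm M t u + h *: y) (y *m Cm M t u + h *: (cexp s *: x)).
Proof. by move=> dt; rewrite Cm_cross // mulmxDr -scalemxAr rr_mul rr_S rrZ rrD. Qed.

Lemma rr_U (x y : 'rV[C]_n.+1) t s : fm_dom M t -> rr x y *m fm_U N (cross t s)
  = rr (x *m U t + 2 *: y) (y *m U t + (2 * cexp s) *: x).
Proof. by move=> dt; rewrite U_cross // mulmxDr -scalemxAr rr_mul rr_S rrZ rrD scalerA. Qed.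

(** The two hypotheses say that [rr y1 y2] is [rr x1 x2] times [V_N U_N^-1]; the connection is thus
    evaluated without computing the inverse of [U_N]. *)
Lemma rr_conn (x1 x2 y1 y2 : 'rV[C]_n.+1) t s u h : fm_dom M t -> fm_star N (cross t s) ->
  y1 *m U t + 2 *: y2 = x1 *m (Vmu - (1 / 2)%:M) ->
  y2 *m U t + (2 * cexp s) *: y1 = x2 *m (Vmu + (1 / 2)%:M) ->
  rr x1 x2 *m conn N VN (cross t s) (cross u h) =
  rr (y1 *m Cm M t u + h *: y2) (y2 *m Cm M t u + h *: (cexp s *: y1)).
Proof.
move=> dt st e1 e2; rewrite /conn !mulmxA rr_V -e1 -e2 -rr_U // -!mulmxA.
rewrite (Cm_invU (tensor_frob hN) _ st) !mulmxA (mulmxK (star_unit (tensor_frob hN) st)).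
exact: rr_Cm.
Qed.

(** The quantum relation [e_2 . e_2 = Q e_1]. *)
Lemma Smx2 s : Smx s *m Smx s = (cexp s)%:M :> 'M[C]_2.
Proof.
apply/row_matrixP; apply: ord2_cases; rewrite !rowE mulmxA ?Smx_row0 ?Smx_row1.
  by rewrite -scalemxAl Smx_row1 mul_mx_scalar.
by rewrite Smx_row0 mul_mx_scalar.
Qed.

(** [U_N = U + 2 S] with commuting [U] and [S] and [S^2 = Q], so multiplication by [U - 2 S] gives
    [U^2 - 4 Q]. *)
Lemma U_cross_unit t s : fm_dom M t -> U t *m U t - (4 * cexp s)%:M \in unitmx ->
  fm_U N (cross t s) \in unitmx.
Proof.
move=> dt u.
have e : fm_U N (cross t s) *m (U t *t 1%:M - 2 *: (1%:M *t Smx s)) =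
    (U t *m U t - (4 * cexp s)%:M) *t 1%:M.
  rewrite U_cross // mulmxBr !mulmxDl -!scalemxAl -!scalemxAr !tensmx_mul !mulmx1 !mul1mx.
  rewrite Smx2 scalerA opprD addrA addrK tensmxDl tensmxNl; congr (_ - _).
  exact: tens_scalar_shift.
have := tensmx_unit (isT : n.+1 != 0%N) (isT : 2%N != 0%N) u (unitmx1 _ 2).
by rewrite -e unitmx_mul => /andP[].
Qed.

(** Off the discriminant of [M] the matrix [U^2] is invertible with locally bounded inverse, so
    [4 Q] is a small perturbation of it and the cross avoids the discriminant of [N]. *)
Lemma cross_star_near t0 : fm_star M t0 -> exists d rho : R, 0 < d /\
  forall t s, nm (t - t0) < d -> cRe s < rho -> fm_star N (cross t s).
Proof.
move=> st; have dt := star_dom hM st; have uU := star_unit hM st.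
have [d1 d10 hd1] := hasD_unit_near (hasD_mulmx (U_hasD' hM hV dt) (U_hasD' hM hV dt))
  (etrans (unitmx_mul _ _) (introT andP (conj uU uU))).
have /nbhs_nmP[d2 d20 hd2] := open_near (frob_open hM) dt.
pose w := nm (invmx (U t0 *m U t0)); pose K : R := n.+1%:R * (n.+1%:R * (2 * w * 4)) + 1.
have w0 : 0 <= w by exact: nm_ge0.
have K0 : 0 < K by rewrite ltr_wpDl // !mulr_ge0.
exists (Num.min d1 d2), (ln (2 * K)^-1); split; first by rewrite lt_min d10.
move=> t s; rewrite lt_min => /andP[/hd1[u1 u2] /hd2 dt'] hs.
apply/(starP (tensor_frob hN)); split; first exact: tensor_dom hN _ _ dt'.
apply: U_cross_unit => //.
have hq : nm (cexp s) <= (2 * K)^-1.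
  rewrite nm_cexp -[leRHS]lnK ?posrE ?invr_gt0 ?mulr_gt0 // ler_expR; exact: ltW.
have [] // := @unitmx_near _ _ (U t *m U t) (U t *m U t - (4 * cexp s)%:M) u1.
rewrite addrC addKr nmN.
have h4 : nm ((4 * cexp s)%:M : 'M[C]_n.+1) <= 4 * (2 * K)^-1.
  by rewrite (le_trans (nm_scalar_mx _ _)) // nmM nm_nat ler_wpM2l.
apply: (@le_trans _ _ (n.+1%:R * (n.+1%:R * (2 * w * (4 * (2 * K)^-1))))).
  apply: ler_wpM2l => //; apply: ler_wpM2l => //.
  exact: (ler_pM (nm_ge0 _) (nm_ge0 _) u2 h4).
have -> : n.+1%:R * (n.+1%:R * (2 * w * (4 * (2 * K)^-1))) = (K - 1) / (2 * K).
  by rewrite /K addrK; ring.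
exact: half_bound.
Qed.

Lemma blinear_rt (T : normedModType C) (L : T -> 'rV[C]_n.+1) (b : 'rV[C]_2) :
  blinear L -> blinear (fun v => rt (L v) b).
Proof.
move=> bL; apply: blinear_mx => i j; rewrite !ord1; case: (mxtens_indexP j) => a l.
have -> : (fun v => rt (L v) b 0 (mxtens_index (a, l))) = (fun v => L v 0 a *: (b 0 l : C)).
  by apply/funext => v; rewrite rt_entry.
exact: blinear_scalel (blinear_entry _ _ bL).
Qed.

Lemma hasD_rr (T : normedModType C) (f g : T -> 'rV[C]_n.+1) p L L' :
  hasD f p L -> hasD g p L' -> hasD (fun q => rr (f q) (g q)) p (fun v => rr (L v) (L' v)).
Proof.
move=> hf hg.
have b (i : 'I_2) := blinear_rt (delta_mx 0 i) (blinear_id ('rV[C]_n.+1)).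
exact: hasDD (hasD_comp hf (hasD_lin _ (b 0))) (hasD_comp hg (hasD_lin _ (b 1))).
Qed.

Section Solution.
Variables (r g : 'cV[C]_n.+1 -> 'rV[C]_n.+1) (phi : 'cV[C]_n.+1 -> 'M[C]_1).

Definition zrow p : 'rV[C]_(n.+1 * 2 + 1) :=
  row_mx (rr (xi1 M Vmu r g tau sigma p) (xi2 M Vmu r g tau sigma p))
   (ww M Vmu r g phi tau sigma p).

Lemma zrow_solution d rho A B t0 W p :
  cross_estimate M Vmu r g phi tau sigma d rho A B t0 W -> W `<=` fm_star M ->
  nm (tau p - t0) < d -> cRe (sigma p) < rho -> fm_star N (cproj p) ->
  restricted_solution (aconn N VN) cproj zrow p.
Proof.
move=> ce Ws h1 h2 st; have [Wp [x1 x2 hw [e1 e2] _]] := ce p h1 h2.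
have dt := star_dom hM (Ws _ Wp).
apply: hasD_eqD (hasD_row_mx (hasD_rr x1 x2) hw) _ => v.
rewrite /zrow mul_aconn row_mxKl (rr_conn _ _ dt st e1 e2) rr_cross.
by [].
Qed.

End Solution.
End Cross.

(** * Linear algebra for flat coordinates *)

Section LinearAlgebra.
Variable R : realType.
Local Notation C := (Cplx R).

Lemma bilinear_ext n (A B : 'M[C]_n) :
  (forall u v : 'cV[C]_n, u^T *m A *m v = u^T *m B *m v) -> A = B.
Proof.
move=> h; apply/matrixP => i j; have := h (del C i) (del C j).
rewrite !mulmx_del trmx_delta -!rowE => /matrixP /(_ 0 0); by rewrite !mxE.
Qed.

(* A tensor symmetric in its first two and skew in its last two arguments vanishes. *)
Lemma sym_skew_eq0 n (P : 'M[C]_n) (S : 'cV[C]_n -> 'M[C]_n) : P \in unitmx ->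
  (forall u v, S u *m v = S v *m u) -> (forall u, P *m S u + (P *m S u)^T = 0) ->
  forall u, S u = 0.
Proof.
move=> uP sym skew u; pose c (u v w : 'cV[C]_n) := (w^T *m (P *m S u) *m v) 0 0.
have c1 x y z : c x y z = c y x z by rewrite /c -!mulmxA sym.
have c2 x y z : c x y z = - c x z y.
  have := skew x => /eqP; rewrite addr_eq0 => /eqP e; rewrite /c {1}e.
  rewrite mulmxN mulNmx mxE; congr (- _).
  have -> : z^T *m (P *m S x)^T *m y = (y^T *m (P *m S x) *m z)^T.
    by rewrite !trmx_mul trmxK !mulmxA.
  by rewrite mxE.
have c0 x y z : c x y z = 0.
  (* Exchanging the first two and the last two arguments alternately, three times each, restores the
     order and produces three signs. *)
  have e : c x y z = - c x y z.
    rewrite {1}c1 c2 c1 c2 opprK c1 c2; by [].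
  have : c x y z + c x y z = 0 by rewrite {1}e addNr.
  by rewrite -mulr2n -mulr_natl => /eqP; rewrite mulf_eq0 pnatr_eq0 => /eqP.
have : P *m S u = 0.
  apply: bilinear_ext => w v; rewrite mulmx0 mul0mx.
  by apply/matrixP => i j; rewrite !ord1 [RHS]mxE; exact: c0.
by move=> e; rewrite -[S u]mul1mx -(mulVmx uP) -mulmxA e mulmx0.
Qed.

Lemma eta_flip n (eta A B : 'M[C]_n) : eta \in unitmx -> A^T *m eta = eta *m B ->
  invmx eta *m A^T = B *m invmx eta.
Proof.
move=> ue e; rewrite -[LHS]mulmx1 -(mulmxV ue) !mulmxA -(mulmxA _ A^T) e.
by rewrite !mulmxA mulVmx // mul1mx.
Qed.

(** [K] is [U eta^-1] and [J K J^T] is the constant Gram matrix. The matrix [X] of the claimed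
    connection already accounts for the derivative of [K], so the discrepancy [J' - J X] satisfies
    the homogeneous skew condition; [h] is [1/2]. *)
Lemma gram_derivative n (J J' K U' V c X : 'M[C]_n) (eti : 'M[C]_n) (h : C) :
  J' *m K *m J^T + J *m (U' *m eti) *m J^T + J *m K *m J'^T = 0 ->
  X *m K = (V - h%:M) *m c *m eti -> K^T = K -> h + h = 1 ->
  (c *m eti)^T = c *m eti -> eti *m V^T = - (V *m eti) ->
  U' = c + c *m V - V *m c ->
  (J' - J *m X) *m K *m J^T + J *m K *m (J' - J *m X)^T = 0.
Proof.
move=> e eX eK hh ec eV eU; rewrite linearB /= !mulmxBl mulmxBr trmx_mul.
have e1 : K *m X^T = (c *m (- V - h%:M)) *m eti.
  have -> : K *m X^T = (X *m K)^T by rewrite trmx_mul eK.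
  rewrite eX -mulmxA trmx_mul ec linearB /= tr_scalar_mx mulmxBr -!mulmxA eV.
  by rewrite mul_mx_scalar mulmxBl mulNmx mul_scalar_mx mulmxBr.
have e2 : J *m (U' *m eti) *m J^T + J *m X *m K *m J^T + J *m K *m (X^T *m J^T) = 0.
  have -> : J *m K *m (X^T *m J^T) = J *m (c *m (- V - h%:M) *m eti) *m J^T.
    by rewrite -e1 !mulmxA.
  have -> : J *m X *m K *m J^T = J *m ((V - h%:M) *m c *m eti) *m J^T by rewrite -eX !mulmxA.
  rewrite -!mulmxDl -!mulmxDr -!mulmxDl eU.
  have -> : c + c *m V - V *m c + (V - h%:M) *m c + c *m (- V - h%:M) = 0; last first.
    by rewrite mul0mx mulmx0 mul0mx.
  rewrite mulmxBl mulmxBr mulmxN mul_scalar_mx mul_mx_scalar.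
  have : c = h *: c + h *: c by rewrite -scalerDl hh scale1r.
  move: (c *m V) (V *m c) (h *: c) => x y z {1}->.
  by apply/matrixP => i j; rewrite !mxE; ring.
rewrite -[RHS]e -[LHS]addr0 -e2.
move: (J' *m K *m J^T) (J *m X *m K *m J^T) (J *m K *m J'^T) (J *m K *m (X^T *m J^T))
  (J *m (U' *m eti) *m J^T) => a b d f q.
by apply/matrixP => i j; rewrite !mxE; ring.
Qed.

Lemma entry_mulmx (Kf : fieldType) m m' n (A : 'M[Kf]_(m, n)) (A' : 'M[Kf]_(m', n)) (B : 'M[Kf]_n) a b :
  (A *m B *m A'^T) a b = (row a A *m B *m (row b A')^T) 0 0.
Proof.
by rewrite -row_mul [LHS]mxE [RHS]mxE; apply: eq_bigr => k _; rewrite !mxE.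
Qed.

Lemma sub_mulmx_sym n (A B J X Y : 'M[C]_n) (u v : 'cV[C]_n) :
  A *m v = B *m u -> X *m v = Y *m u -> (A - J *m X) *m v = (B - J *m Y) *m u.
Proof. by move=> e1 e2; rewrite !mulmxBl e1 -!mulmxA e2. Qed.

Lemma mulmxA5 n (A B X Y Z : 'M[C]_n) : A *m (B *m X *m Y *m Z) = A *m B *m X *m Y *m Z.
Proof. by rewrite !mulmxA. Qed.

Lemma form_transport n (J Ji Bd Bv : 'M[C]_n) (v : 'cV[C]_n) a d : Ji *m J = 1%:M ->
  Bd^T = Bd -> Bd *m v = Bv *m (Ji *m del C d) ->
  ((J *m v)^T *m (Ji^T *m Bd *m Ji) *m del C a) 0 0 = (Ji^T *m Bv *m Ji) a d.
Proof.
move=> e s h.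
have -> : (J *m v)^T *m (Ji^T *m Bd *m Ji) *m del C a =
   ((Ji *m del C a)^T *m (Bv *m (Ji *m del C d)))^T.
  rewrite -h [RHS]trmx_mul trmxK (trmx_mul Bd v) s.
  have -> : v^T *m Bd = v^T *m (J^T *m Ji^T) *m Bd by rewrite -trmx_mul e trmx1 mulmx1.
  by rewrite trmx_mul !mulmxA.
rewrite mxE trmx_mul -!mulmxA (mulmxA Bv) mulmx_del (mulmxA Ji^T) -!mulmxA.
by rewrite /del trmx_delta -rowE colE mulmxA -colE [LHS]mxE [LHS]mxE.
Qed.

Lemma glow_identity n (d : 'rV[C]_n) (H J Gi Ui c V : 'M[C]_n) : J \in unitmx ->
  c *m Ui = Ui *m c ->
  -2 *: ((d *m (Gi *m J *m Ui *m c *m invmx J)) *m J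
     + d *m H *m (J *m ((V - (1 / 2)%:M) *m c *m Ui)))
  = (-2 *: (d *m H *m J) *m (V + (- (1 / 2))%:M) - 2 *: (d *m (Gi *m J))) *m Ui *m c.
Proof.
move=> uJ e; have l1 : d *m (Gi *m J *m Ui *m c *m invmx J) *m J = d *m (Gi *m J) *m (Ui *m c).
  by rewrite !mulmxA mulmxKV.
have l2 : d *m H *m (J *m ((V - (1 / 2)%:M) *m c *m Ui)) =
    d *m H *m J *m (V - (1 / 2)%:M) *m (Ui *m c) by rewrite -e !mulmxA.
have l3 : (- (1 / 2))%:M = - (1 / 2)%:M :> 'M[C]_n.
  by apply/matrixP => i j; rewrite !mxE mulNrn.
rewrite l1 l2 l3 -[RHS]mulmxA; move: (d *m (Gi *m J)) (d *m H *m J) (V - _) (Ui *m c) => q p x y.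
by rewrite [RHS]mulmxBl -!scalemxAl scalerDr addrC !scaleNr.
Qed.

Lemma skew_transport (Kf : fieldType) n (J G K S : 'M[Kf]_n) : J \in unitmx -> G \in unitmx -> G^T = G ->
  K^T = K -> K *m J^T = invmx J *m G -> S *m K *m J^T + J *m K *m S^T = 0 ->
  J^T *m invmx G *m S + (J^T *m invmx G *m S)^T = 0.
Proof.
move=> uJ uG sG sK e h.
have e1 : S *m K *m J^T = S *m invmx J *m G by rewrite -mulmxA e mulmxA.
have e2 : J *m K *m S^T = G *m (invmx J)^T *m S^T.
  by rewrite -{1}sK -{1}[J]trmxK -trmx_mul e trmx_mul sG.
have e3 : (J^T *m invmx G *m S)^T = S^T *m invmx G *m J.
  by rewrite !trmx_mul trmxK trmx_inv sG !mulmxA.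
have e4 : J^T *m (invmx J)^T = 1%:M by rewrite -trmx_mul mulVmx // trmx1.
have : J^T *m invmx G *m (S *m K *m J^T + J *m K *m S^T) *m (invmx G *m J) = 0.
  by rewrite h mulmx0 mul0mx.
rewrite e1 e2 mulmxDr mulmxDl !mulmxA (mulmxK uG) (mulmxKV uJ).
by rewrite (mulmxKV uG (J^T)) e4 mul1mx -e3.
Qed.

End LinearAlgebra.

Section Compose.
Variable R : realType.
Local Notation C := (Cplx R).
Local Notation hol := holomorphic_upto.

Lemma hol_scalarM (V : normedModType C) k (D : set V) (f g : V -> C) : open D ->
  hol k D f -> hol k D g -> hol k D (fun p => f p *: g p).
Proof.
move=> oD hf hg.
have h : hol k D (fun p => f p *: (g p)%:M : 'M[C]_1).
  apply: hol_scalel => //; apply: hol_mx => // i j; rewrite !ord1.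
  by apply: hol_ext hg => // p _; rewrite mxE eqxx mulr1n.
apply: (hol_ext (f := fun p => (f p *: (g p)%:M : 'M[C]_1) 0 0) oD).
  by move=> p _; rewrite !mxE eqxx mulr1n.
exact: hol_entry.
Qed.

Lemma hol_comp m n (W : set 'cV[C]_m) (x : 'cV[C]_m -> 'cV[C]_n) k (f : 'cV[C]_n -> C) :
  open W -> (forall k, hol k W x) -> hol k (x @` W) f -> hol k W (fun t => f (x t)).
Proof.
move=> oW hx; elim: k f => [|k IH] f hf.
  apply: (hol_0 (L := fun t v => 'D_('D_v x t) f (x t))) => t Wt.
  exact: hasD_comp (hol_hasD (hx 0%N) Wt) (hol_hasD hf (imageP x Wt)).
apply: (hol_S (L := fun t v => 'D_('D_v x t) f (x t))) => // [t Wt|v].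
  exact: hasD_comp (hol_hasD (hx 0%N) Wt) (hol_hasD hf (imageP x Wt)).
apply: (hol_ext (f := fun t => \sum_a ('D_v x t) a 0 *: 'D_(del C a) f (x t)) oW).
  move=> t Wt; have [[l _] _] := hol_hasD hf (imageP x Wt).
  by rewrite (linear_cV ('D_v x t) l).
apply: hol_sum => // a.
have h1 : hol k W (fun t => ('D_v x t) a 0 : C) by apply: hol_entry => //; exact: hol_D (hx k.+1).
have h2 := IH _ (hol_D (del C a) hf).
exact: hol_scalarM.
Qed.

End Compose.

(** * Flat coordinates and the dual potential *)

Section FlatData.
Variable R : realType.
Local Notation C := (Cplx R).
Local Notation hol := holomorphic_upto.
Variables (n : nat) (M : frob_data C n.+1) (mu : 'I_n.+1 -> C).
Variables (W : set 'cV[C]_n.+1) (x : 'cV[C]_n.+1 -> 'cV[C]_n.+1) (G : 'M[C]_n.+1).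
Hypotheses (hM : is_frobenius M) (hmu : normalized_diag M mu) (hx : flat_coordinates M W x G).
Local Notation U := (fm_U M).
Local Notation V := (Vmu mu).
Local Notation eta := (fm_eta M).
Let oW : open W := flat_open hx.
Let hv t : fm_dom M t -> fm_V M t = V := @norm_V _ _ _ _ hmu t.

Lemma W_star t : W t -> fm_star M t. Proof. exact: flat_star hx t. Qed.
Lemma W_dom t : W t -> fm_dom M t. Proof. by move=> Wt; exact (star_dom hM (W_star Wt)). Qed.

(** The product axiom for [E] at [e . e = e] gives [[E, e] = - e], so [nabla_e E = e] and the
    eigenvalue is [(2 - d) / 2 - 1]. *)
Lemma V_e : V *m fm_e M = (- (fm_d M / 2)) *: fm_e M.
Proof.
have [t Wt] := flat_nonempty hx; have dt := W_dom Wt.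
have he := hol_constant hM (fm_e M).
have := frob_E_mul hM he he dt.
have l1 := lie_cst (fm_e M) dt.
have l2 : lie_bracket (fm_E M) (fun p => fm_mul M p (fm_e M) (fm_e M)) t = - 'D_(fm_e M) (fm_E M) t.
  have h1 : hasD (fun p => fm_mul M p (fm_e M) (fm_e M)) t (fun=> 0).
    apply: hasD_ext (hasD_cst (fm_e M) t).
    by apply: filterS (open_near (frob_open hM) dt) => p dp; rewrite (frob_mul1 hM).
  have d1 := hasD_derive h1 (fm_E M t).
  have d2 := congr1 (fun v => 'D_v (fm_E M) t) (frob_mul1 hM (fm_e M) dt).
  exact (etrans (f_equal2 (fun a b => a - b) d1 d2) (sub0r _)).
rewrite l2 l1 (frob_mul1 hM _ dt) (frob_mulC hM) // (frob_mul1 hM _ dt) => e.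
have e1 : 'D_(fm_e M) (fm_E M) t = fm_e M.
  have := etrans e (frob_mul1 hM (fm_e M) dt); move: ('D_(fm_e M) _ _) => y <-.
  by apply/matrixP => i j; rewrite !mxE; ring.
have := dE hM (fm_e M) dt; rewrite e1 hv // => e2.
have -> : V *m fm_e M = ((2 - fm_d M) / 2) *: fm_e M - fm_e M by rewrite [X in _ - X]e2 opprB addrC subrK.
rewrite -[X in _ - X]scale1r -scalerBl; congr (_ *: _); by field.
Qed.

(** By the symmetry of the spectrum [- 1/2] is excluded together with [1/2]. *)
Lemma mu_plus_half a : mu a + 1 / 2 != 0.
Proof.
have := norm_mu hmu (rev_ord a); apply: contra => /eqP e.
have := norm_mu_sym hmu a => s; apply/eqP.
have -> : mu (rev_ord a) = - mu a by apply/eqP; rewrite -addr_eq0 addrC s.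
by rewrite -[LHS]add0r -e addrAC subrr add0r.
Qed.

Lemma V_half_unit : V + (1 / 2)%:M \in unitmx.
Proof.
have -> : V + (1 / 2)%:M = diag_mx (\row_a (mu a + 1 / 2)).
  by apply/matrixP => i j; rewrite !mxE -mulrnDl.
rewrite unitmxE det_diag unitfE; apply/prodf_neq0 => a _.
by rewrite mxE mu_plus_half.
Qed.

Lemma one_minus_d : (1 - fm_d M) / 2 != 0.
Proof.
have := V_e; rewrite (norm_e hmu) Vmu_del => /matrixP/(_ 0 0); rewrite !mxE eqxx !mulr1 => e.
have := mu_plus_half 0; rewrite e; apply: contra => /eqP h; apply/eqP; rewrite -h; by field.
Qed.

Lemma V_half_e : invmx (V + (1 / 2)%:M) *m fm_e M = ((1 - fm_d M) / 2)^-1 *: fm_e M.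
Proof.
have e : (V + (1 / 2)%:M) *m fm_e M = ((1 - fm_d M) / 2) *: fm_e M.
  rewrite mulmxDl V_e mul_scalar_mx -scalerDl; congr (_ *: _); by field.
have e1 : fm_e M = ((1 - fm_d M) / 2)^-1 *: ((V + (1 / 2)%:M) *m fm_e M).
  by rewrite e scalerA mulVf ?scale1r // one_minus_d.
by rewrite {1}e1 -scalemxAr (mulKmx V_half_unit).
Qed.

Local Notation J := (jac x).

Lemma x_hol k : hol k W x. Proof. exact: flat_holo hx k. Qed.

Lemma xa_hasD t a : W t -> hasD (fun p => x p a 0 : C) t (fun v => 'D_v x t a 0).
Proof. by move=> Wt; exact: hasD_entry a 0 (hol_hasD (x_hol 0) Wt). Qed.

Lemma jacE t a b : W t -> J t a b = 'D_(del C b) x t a 0.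
Proof. by move=> Wt; rewrite !mxE (hasD_derive (xa_hasD a Wt)). Qed.

Lemma jac_mul t v : W t -> J t *m v = 'D_v x t.
Proof.
move=> Wt; have [[l _] _] := hol_hasD (x_hol 0) Wt.
rewrite (linear_cV v l); apply/matrixP => i j; rewrite ord1 mxE summxE.
by apply: eq_bigr => b _; rewrite jacE // [in RHS]mxE mulrC.
Qed.

Lemma x_hasD t : W t -> hasD x t (fun v => J t *m v).
Proof. by move=> Wt; apply: hasD_eqD (hol_hasD (x_hol 0) Wt) _ => v; rewrite jac_mul. Qed.

Lemma jac_hol k : hol k W J.
Proof.
apply: hol_mx => // a b; apply: (hol_ext (f := fun t => 'D_(del C b) x t a 0 : C) oW).
  by move=> t Wt; rewrite jacE.
by apply: hol_entry => //; exact: hol_D (x_hol k.+1).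
Qed.

Lemma jac_sym t u v : W t -> 'D_u J t *m v = 'D_v J t *m u.
Proof.
move=> Wt; have hJ := hol_hasD (jac_hol 0) Wt.
have e w z : 'D_w (fun p => 'D_z x p) t = 'D_w J t *m z.
  have h : hasD (fun p => 'D_z x p) t (fun w => 'D_w J t *m z + J t *m 0).
    apply: (hasD_ext (f := fun p => J p *m z)).
      by apply: filterS (open_near oW Wt) => p Wp; rewrite jac_mul.
    exact: hasD_mulmx hJ (hasD_cst z t).
  by rewrite (hasD_derive h) mulmx0 addr0.
have sw := schwarz u v oW Wt (x_hol 3).
exact (etrans (esym (e u v)) (etrans sw (e v u))).
Qed.

Lemma gram t : W t -> J t *m (U t *m invmx eta) *m (J t)^T = G.
Proof.
move=> Wt; apply/matrixP => a b; rewrite -(flat_gram hx a b Wt) fm_intE //; last exact: W_dom.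
have gr (c : 'I_n.+1) : grad (fun p => x p c 0) t = row c (J t).
  by apply/matrixP => i j; rewrite !ord1 !mxE.
by rewrite (gr a) (gr b) entry_mulmx !mulmxA.
Qed.

Lemma K_sym t : W t -> (U t *m invmx eta)^T = U t *m invmx eta.
Proof.
move=> Wt; rewrite trmx_mul trmx_inv (frob_eta_sym hM).
exact: eta_flip (frob_eta_unit hM) (U_tr hM (W_dom Wt)).
Qed.

Lemma J_unit t : W t -> J t \in unitmx. Proof. exact: flat_indep hx t. Qed.

Lemma G_unit : G \in unitmx.
Proof.
have [t Wt] := flat_nonempty hx; rewrite -(gram Wt) !unitmx_mul unitmx_tr J_unit //.
by rewrite (star_unit hM (W_star Wt)) unitmx_inv (frob_eta_unit hM).
Qed.

Lemma G_sym : G^T = G.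
Proof.
have [t Wt] := flat_nonempty hx.
by rewrite -(gram Wt) !trmx_mul trmxK -trmx_mul K_sym // !mulmxA.
Qed.

(** The uniqueness argument for the Levi-Civita connection: the discrepancy [S] is symmetric by
    Schwarz and by the symmetry of [conn], and skew because the Gram matrix is constant, hence
    zero. *)
Lemma J_hasD t : W t -> hasD J t (fun u => J t *m conn M (V - (1 / 2)%:M) t u).
Proof.
move=> Wt; have st := W_star Wt; have dt := W_dom Wt.
have hJ := hol_hasD (jac_hol 0) Wt; have ue := frob_eta_unit hM.
pose S u := 'D_u J t - J t *m conn M (V - (1 / 2)%:M) t u.
suff S0 u : S u = 0 by apply: hasD_eqD hJ _ => u; apply/eqP; rewrite -subr_eq0; apply/eqP/S0.
apply: (@sym_skew_eq0 _ _ ((J t)^T *m invmx G) S) => [|a b|a].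
- by rewrite unitmx_mul unitmx_tr J_unit // unitmx_inv G_unit.
- exact (sub_mulmx_sym (J t) (jac_sym a b Wt) (conn_sym hM _ a b st)).
have hK := hasD_mulmx (U_hasD' hM hv dt) (hasD_cst (invmx eta) t).
have hG := hasD_mulmx (hasD_mulmx hJ hK) (hasD_comp hJ (hasD_lin _ (blinear_trmx (blinear_id _)))).
have hG0 : hasD (fun p => J p *m (U p *m invmx eta) *m (J p)^T) t (fun=> 0).
  apply: hasD_ext (hasD_cst G t).
  by apply: filterS (open_near oW Wt) => p Wp; rewrite gram.
have := hasD_unique hG hG0 a; rewrite mulmx0 addr0 mulmxDl => e.
have hX : conn M (V - (1 / 2)%:M) t a *m (U t *m invmx eta) =
    (V - (1 / 2)%:M) *m Cm M t a *m invmx eta.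
  by rewrite /conn !mulmxA mulmxKV // star_unit.
have tr1 : (Cm M t a *m invmx eta)^T = Cm M t a *m invmx eta.
  by rewrite trmx_mul trmx_inv (frob_eta_sym hM); exact: eta_flip ue (Cm_tr hM a dt).
have tr2 : invmx eta *m V^T = - (V *m invmx eta).
  rewrite -mulNmx; apply: eta_flip => //; rewrite mulmxN -(hv dt).
  exact (V_tr hM dt).
have hh : 1 / 2 + 1 / 2 = 1 :> C by field.
have main := gram_derivative e hX (K_sym Wt) hh tr1 tr2 (erefl _).
have JK : U t *m invmx eta *m (J t)^T = invmx (J t) *m G.
  by rewrite -(gram Wt) !mulmxA mulVmx ?J_unit // mul1mx.
exact: skew_transport (J_unit Wt) G_unit G_sym (K_sym Wt) JK main.
Qed.

Lemma Jl_hasD t : W t -> hasD (fun t => invmx G *m J t) t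
  (fun u => invmx G *m J t *m conn M (V - (1 / 2)%:M) t u).
Proof.
move=> Wt; apply: hasD_eqD (hasD_mulmx (hasD_cst (invmx G) t) (J_hasD Wt)) _ => u.
by rewrite mul0mx add0r mulmxA.
Qed.

Definition plow a t : 'rV[C]_n.+1 := row a (invmx G *m J t).
(** The antiderivative [P_0] along the unit of the gradient of [x_a], obtained by solving
    [P_0 (V + 1/2) = P_1 U]. *)
Definition rlow a t : 'rV[C]_n.+1 := plow a t *m U t *m invmx (V + (1 / 2)%:M).

Lemma plow_hasD a t : W t ->
  hasD (plow a) t (fun u => plow a t *m conn M (V - (1 / 2)%:M) t u).
Proof.
move=> Wt; apply: (hasD_ext (f := fun t => delta_mx 0 a *m (invmx G *m J t))).
  by near=> q; rewrite /plow rowE.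
apply: hasD_eqD (hasD_mulmx (hasD_cst (delta_mx 0 a : 'rV[C]_n.+1) t) (Jl_hasD Wt)) _ => u.
by rewrite mul0mx add0r /plow rowE !mulmxA.
Unshelve. all: by end_near. Qed.

Lemma Pjet_rlow a t : W t -> Pjet V U (rlow a) 1 t = plow a t.
Proof.
move=> Wt; rewrite PjetS Pjet_0 subr0 /rlow mulmxKV ?V_half_unit //.
by rewrite mulmxK // (star_unit hM (W_star Wt)).
Qed.

Lemma r_identity (p : 'rV[C]_n.+1) (c Ut A B : 'M[C]_n.+1) : A *m Ut = (V - (1 / 2)%:M) *m c ->
  B = c + c *m V - V *m c ->
  (p *m A *m Ut + p *m B) *m invmx (V + (1 / 2)%:M) = p *m c.
Proof.
move=> e ->; rewrite -mulmxA e -mulmxDr.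
have -> : (V - (1 / 2)%:M) *m c + (c + c *m V - V *m c) = c *m (V + (1 / 2)%:M).
  rewrite mulmxBl mulmxDr mul_scalar_mx mul_mx_scalar.
  have : c = (1 / 2) *: c + (1 / 2) *: c.
    by rewrite -scalerDl (_ : 1 / 2 + 1 / 2 = 1) ?scale1r //; by field.
  move: (c *m V) (V *m c) ((1 / 2) *: c) => y z w {1}->.
  by apply/matrixP => i j; rewrite !mxE; ring.
by rewrite mulmxA mulmxK // V_half_unit.
Qed.

Lemma rlow_hasD a t : W t -> hasD (rlow a) t (fun v => Pjet V U (rlow a) 1 t *m Cm M t v).
Proof.
move=> Wt; have st := W_star Wt; have dt := W_dom Wt.
apply: hasD_eqD (hasD_mulmx (hasD_mulmx (plow_hasD a Wt) (U_hasD' hM hv dt))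
  (hasD_cst (invmx (V + (1 / 2)%:M)) t)) _ => u.
rewrite mulmx0 addr0 Pjet_rlow //; apply: r_identity (erefl _).
by rewrite /conn mulmxKV // star_unit.
Qed.

Lemma Cm_Ee t : W t -> U t *m fm_e M = fm_E M t.
Proof.
move=> Wt; have dt := W_dom Wt.
by rewrite fm_UE (Cm_sym hM) // (Cm_unit hM) // mul1mx.
Qed.

Lemma J_E t : W t -> J t *m fm_E M t = ((1 - fm_d M) / 2) *: x t.
Proof.
move=> Wt; rewrite jac_mul //; apply/matrixP => i j; rewrite !ord1 [RHS]mxE.
by rewrite -(flat_E hx i Wt) (hasD_derive (xa_hasD i Wt)).
Qed.

(** [V + 1/2] has the eigenvalue [(1 - d) / 2] on the unit field and [U e = E], so the homogeneity
    of [x] cancels the eigenvalue. This makes [x_a] the coefficient of [log Q]. *)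
Lemma rlow_e a t : W t -> rlow a t *m fm_e M = (invmx G *m x t) a 0 *: 1%:M.
Proof.
move=> Wt; rewrite /rlow -!mulmxA V_half_e -!scalemxAr Cm_Ee //.
rewrite /plow -row_mul -mulmxA J_E // -scalemxAr.
by apply/matrixP => i j; rewrite !ord1 !mxE eqxx mulr1 mulrA mulVf ?mul1r // one_minus_d.
Qed.

Section Dual.
Variable F : 'cV[C]_n.+1 -> C.
Hypothesis hF : dual_potential M W x G F.

Let F_hol k : hol k (x @` W) F. Proof. by have [h _] := hF; exact: h. Qed.

Definition Hess (y : 'cV[C]_n.+1) : 'M[C]_n.+1 :=
  \matrix_(a, b) 'D_(del C b) (fun z => 'D_(del C a) F z) y.

Lemma Fa_hasD a t : W t -> hasD (fun y => 'D_(del C a) F y) (x t)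
  (fun v => (row a (Hess (x t)) *m v) 0 0).
Proof.
move=> Wt; have h := hol_hasD (hol_D (del C a) (F_hol 1)) (imageP x Wt).
have [[l _] _] := h; apply: hasD_eqD h _ => v.
rewrite (linear_cV v l) mxE; apply: eq_bigr => b _; rewrite !mxE mulrC; by [].
Qed.

Definition glow a t : 'rV[C]_n.+1 := -2 *: (row a (Hess (x t)) *m J t).
Definition philow a t : 'M[C]_1 := (-2 * 'D_(del C a) F (x t))%:M.

Lemma philow_hasD a t : W t -> hasD (philow a) t (fun v => glow a t *m v).
Proof.
move=> Wt; apply: hasD_mx => i j; rewrite !ord1.
have h := hasDZ (-2) (hasD_comp (x_hasD Wt) (Fa_hasD a Wt)).
apply: (hasD_ext (f := fun t => -2 *: 'D_(del C a) F (x t))).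
  by near=> q; rewrite mxE eqxx mulr1n.
by apply: hasD_eqD h _ => v; rewrite -scalemxAl mulmxA [RHS]mxE.
Unshelve. all: by end_near. Qed.

Definition third t a : 'M[C]_n.+1 :=
  \matrix_(d, b) 'D_(del C d) (fun z => 'D_(del C a) (fun y => 'D_(del C b) F y) z) (x t).

(** Multiplication by [E^-1] is [U^-1]; the definition of [F_*] then becomes a matrix identity in
    the frame of the flat coordinates. *)
Lemma dual_third t a : W t -> third t a =
  invmx G *m J t *m invmx (U t) *m Cm M t (invmx (J t) *m del C a) *m invmx (J t).
Proof.
move=> Wt; have dt := W_dom Wt; have st := W_star Wt; have uJ := J_unit Wt.
have uU := star_unit hM st.
have jd c : J t *m dual_del x t c = del C c.
  by rewrite /dual_del -mulmx_del mulKVmx.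
have eI : Cm M t (fm_Einv M t) = invmx (U t).
  have e : U t *m Cm M t (fm_Einv M t) = 1%:M.
    by rewrite {1}fm_UE -(Cm_mul hM) // -fm_UE /fm_Einv mulKVmx // Cm_unit.
  by rewrite -[LHS]mul1mx -(mulVmx uU) -mulmxA e mulmx1.
have main : G *m third t a =
    J t *m invmx (U t) *m Cm M t (invmx (J t) *m del C a) *m invmx (J t).
  apply/matrixP => c b; have [_ hd] := hF; have := congr1 (mulmx (J t)) (hd t a b Wt).
  rewrite /fm_dualmul !Cm_mulE (Cm_mul hM) // eI => e.
  have -> : (J t *m invmx (U t) *m Cm M t (invmx (J t) *m del C a) *m invmx (J t)) c b =
     (J t *m (invmx (U t) *m Cm M t (dual_del x t a) *m dual_del x t b)) c 0.
    by rewrite /dual_del -!mulmx_del !mulmxA mulmx_del [RHS]mxE.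
  rewrite e mulmx_sumr summxE [RHS](bigD1 c) //= [X in _ + X]big1 => [|k kc].
    rewrite addr0 -scalemxAr jd !mxE eqxx mulr1; apply: eq_bigr => d _; by rewrite mxE.
  by rewrite -scalemxAr jd !mxE (negbTE (_ : c != k)) ?mulr0 // eq_sym.
rewrite -(mulKmx G_unit (third t a)) main; exact (mulmxA5 _ _ _ _ _).
Qed.

Lemma lower_jac t : W t -> invmx G *m J t = (invmx (J t))^T *m eta *m invmx (U t).
Proof.
move=> Wt; have uJ := J_unit Wt; have uU := star_unit hM (W_star Wt).
have e : G *m ((invmx (J t))^T *m eta *m invmx (U t)) = J t.
  rewrite -(gram Wt) !mulmxA -(mulmxA _ (J t)^T) -trmx_mul mulVmx // trmx1 mulmx1.
  by rewrite mulmxKV ?(frob_eta_unit hM) // mulmxK.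
by rewrite -{1}e mulKmx // G_unit.
Qed.

Lemma dual_form_sym t u : W t -> let B := eta *m invmx (U t) *m invmx (U t) *m Cm M t u in
  B^T = B.
Proof.
move=> Wt B; have dt := W_dom Wt; have st := W_star Wt; have uU := star_unit hM st.
have e : (invmx (U t))^T *m eta = eta *m invmx (U t).
  rewrite trmx_inv -[RHS](mulKmx (_ : (U t)^T \in unitmx)) ?unitmx_tr //.
  by rewrite (mulmxA (U t)^T) (U_tr hM dt) mulmxK.
rewrite /B !trmx_mul (frob_eta_sym hM) e !mulmxA -(mulmxA _ _ eta) e mulmxA (Cm_tr hM u dt).
by rewrite -!mulmxA (mulmxA (Cm M t u)) (Cm_invU hM u st) -mulmxA (Cm_invU hM u st) !mulmxA.
Qed.

(** A derivative along [v] contracts the third derivatives in one slot, while [dual_third] describes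
    them with another slot fixed. Total symmetry of the form [B] carries [v] to the required
    place. *)
Lemma Hess_hasD t : W t -> hasD (fun t => Hess (x t)) t (fun v =>
  invmx G *m J t *m invmx (U t) *m Cm M t v *m invmx (J t)).
Proof.
move=> Wt; have uJ := J_unit Wt; have dt := W_dom Wt; apply: hasD_mx => a d.
have h := hol_hasD (hol_D (del C d) (hol_D (del C a) (F_hol 2))) (imageP x Wt).
have [[l _] _] := h.
apply: (hasD_ext (f := fun t => 'D_(del C d) (fun z => 'D_(del C a) F z) (x t))).
  by near=> q; rewrite mxE.
apply: hasD_eqD (hasD_comp (x_hasD Wt) h) _ => v.
rewrite (linear_cV _ l).
have -> : \sum_i (J t *m v) i 0 *: 'D_(delta_mx i 0)
   (fun p => 'D_(del C d) (fun z => 'D_(del C a) F z) p) (x t)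
   = ((J t *m v)^T *m third t d *m del C a) 0 0.
  rewrite mulmx_del !mxE; apply: eq_bigr => i _; by rewrite !mxE.
rewrite dual_third // lower_jac //.
set Ji := invmx (J t).
pose B u := eta *m invmx (U t) *m invmx (U t) *m Cm M t u.
have Bs u : (B u)^T = B u by exact: dual_form_sym.
have Bc u w : B u *m w = B w *m u by rewrite /B -!mulmxA (Cm_sym hM u w dt).
have e1 u : Ji^T *m eta *m invmx (U t) *m invmx (U t) *m Cm M t u *m Ji = Ji^T *m B u *m Ji.
  by rewrite /B !mulmxA.
rewrite !e1.
exact (form_transport a (mulVmx uJ) (Bs _) (Bc _ v)).
Unshelve. all: by end_near. Qed.

(** Here the dual potential enters: differentiating its Hessian yields [P_1 U^-1 C_v], and the
    factor [-2] turns this into the inhomogeneity of the recursion for [G]. *)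
Lemma glow_hasD a t : W t -> hasD (glow a) t
  (fun v => Gjet V U (rlow a) (glow a) 2 t *m Cm M t v).
Proof.
move=> Wt; have st := W_star Wt.
have hH := hasD_comp (Hess_hasD Wt) (hasD_lin _ (blinear_mulmxl (delta_mx 0 a : 'rV[C]_n.+1) (blinear_id _))).
have h := hasDZ (-2) (hasD_mulmx hH (J_hasD Wt)).
apply: (hasD_ext (f := fun t => -2 *: (delta_mx 0 a *m Hess (x t) *m J t))).
  by near=> q; rewrite /glow rowE.
apply: hasD_eqD h _ => v.
rewrite GjetSS Gjet_1 Pjet_rlow // subr0 /glow /plow !rowE.
exact (glow_identity _ _ _ _ (J_unit Wt) (Cm_invU hM v st)).
Unshelve. all: by end_near. Qed.

End Dual.

Definition gup a t : 'rV[C]_n.+1 := row a (J t).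
Definition phiup a t : 'M[C]_1 := (x t a 0)%:M.
Definition rup (t : 'cV[C]_n.+1) : 'rV[C]_n.+1 := 0.

Lemma rup_hasD t : W t -> hasD rup t (fun v => Pjet V U rup 1 t *m Cm M t v).
Proof.
move=> Wt; apply: hasD_eqD (hasD_cst 0 t) _ => v.
by rewrite Pjet_eq0 // mul0mx.
Qed.

Lemma gup_hasD a t : W t -> hasD (gup a) t (fun v => Gjet V U rup (gup a) 2 t *m Cm M t v).
Proof.
move=> Wt; have st := W_star Wt; apply: (hasD_ext (f := fun t => delta_mx 0 a *m J t)).
  by near=> q; rewrite /gup rowE.
apply: hasD_eqD (hasD_mulmx (hasD_cst (delta_mx 0 a : 'rV[C]_n.+1) t) (J_hasD Wt)) _ => v.
rewrite mul0mx add0r GjetSS Gjet_1 Pjet_eq0 // scaler0 subr0 subr0 /gup rowE /conn.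
have -> : (- (1 / 2))%:M = - (1 / 2)%:M :> 'M[C]_n.+1.
  by apply/matrixP => i j; rewrite !mxE mulNrn.
by rewrite -!mulmxA (Cm_invU hM v st).
Unshelve. all: by end_near. Qed.

Lemma phiup_hasD a t : W t -> hasD (phiup a) t (fun v => gup a t *m v).
Proof.
move=> Wt; apply: hasD_mx => i j; rewrite !ord1.
apply: (hasD_ext (f := fun t => x t a 0)); first by near=> q; rewrite mxE eqxx mulr1n.
apply: hasD_eqD (hasD_entry a 0 (x_hasD Wt)) _ => v.
by rewrite /gup -row_mul [RHS]mxE.
Unshelve. all: by end_near. Qed.

End FlatData.

(** * Extension off the cross and canonical bases *)

Section Gluing.
Variable R : realType.
Local Notation C := (Cplx R).
Local Notation hol := holomorphic_upto.
Variables (m k : nat) (D0 : set 'cV[C]_m) (A : 'cV[C]_m -> 'cV[C]_m -> 'M[C]_k).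
Hypothesis oD0 : open D0.
Hypothesis linA : forall p, linear (A p).
Hypothesis holA : forall v, hol 2 D0 (fun p => A p v).
Hypothesis flat : forall p u v, D0 p -> 'D_u (fun q => A q v) p - 'D_v (fun q => A q u) p
     + A p u *m A p v - A p v *m A p u = 0.
Variable pi : 'cV[C]_m -> 'cV[C]_m.
Hypothesis bpi : blinear pi.
Hypothesis pi_idem : forall p, pi (pi p) = pi p.

Definition segment_in (D : set 'cV[C]_m) p q :=
  forall t : R, 0 <= t <= 1 -> D (p + creal t *: (q - p)).

Definition solution (z : 'cV[C]_m -> 'rV[C]_k) p := hasD z p (fun u => z p *m A p u).

Lemma fundamental_value p0 r Phi Psi z p q : fundamental D0 A p0 r Phi Psi ->
  nm (p - p0) < r -> nm (q - p0) < r ->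
  (forall t : R, 0 <= t <= 1 -> solution z (p + creal t *: (q - p))) ->
  z q *m Psi q = z p *m Psi p.
Proof.
move=> fu hp hq hz; apply: (restricted_constant (blinear_id _) fu) => t t01.
by split; [exact: segment_ball|exact: hz].
Qed.

Variables (I : Type) (Z : I -> 'cV[C]_m -> 'rV[C]_k) (Gam : set 'cV[C]_m).
Hypotheses (oGam : open Gam) (Gam_pi : forall p, Gam p -> Gam (pi p)).
Hypothesis Gam_D0 : forall p, Gam p -> D0 (pi p).
Hypothesis Z_pi : forall i p, Z i (pi p) = Z i p.
Hypothesis Z_sol : forall i p, Gam p -> restricted_solution A pi (Z i) p.

(** Two radii: a point within [r'] of the centre has its projection within [r], so the fundamental
    matrix is defined at both and on the segment joining them. *)
Definition chart p (c : R * R * ('cV[C]_m -> 'M[C]_k) * ('cV[C]_m -> 'M[C]_k)) :=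
  let: (r', r, Phi, Psi) := c in
  [/\ fundamental D0 A (pi p) r Phi Psi, 0 < r', r' <= r,
     forall q, nm (q - pi p) < r' -> nm (pi q - pi p) < r &
     forall q, nm (q - pi p) < r -> Gam q].

Lemma chart_exists p : Gam p -> exists c, chart p c.
Proof.
move=> gp; have [r [Phi [Psi fu]]] := flat_existence oD0 linA holA flat (Gam_D0 gp).
have [r0 hr h1 h2 h3] := fu.
have /nbhs_nmP[r1 r10 hr1] := open_near oGam (Gam_pi gp).
have [l [c c0 hc]] := bpi.
pose r2 := Num.min r r1; have r20 : 0 < r2 by rewrite lt_min r0.
have sub q : nm (q - pi p) < r2 -> nm (q - pi p) < r /\ nm (q - pi p) < r1.
  by rewrite lt_min => /andP[].
have c1 : 0 < 1 + c by rewrite ltr_pwDl.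
(* [c] is a bound for [pi]; dividing by [1 + c] keeps the projection of the small ball inside the
   large one. *)
exists (r2 / (1 + c), r2, Phi, Psi); split.
- split=> //.
  + by move=> q /sub[/hr].
  + by move=> q /sub[/h2].
  + by move=> q /sub[/h3].
- by rewrite divr_gt0.
- rewrite ler_pdivrMr // ler_peMr //; first exact: ltW.
  by rewrite lerDl.
- move=> q hq; have -> : pi q - pi p = pi (q - pi p).
    have := l (-1) (pi p) q; rewrite scaleN1r scaleN1r pi_idem addrC => e.
    by rewrite -e addrC.
  apply: (le_lt_trans (hc _)).
  move: hq; rewrite ltr_pdivlMr // mulrDr mulr1 mulrC => hq.
  by apply: le_lt_trans hq; rewrite lerDr nm_ge0.
- by move=> q /sub[_ /hr1].
Qed.

Lemma chart_value i p c q : Gam p -> chart p c -> nm (q - pi p) < c.1.1.1 ->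
  Z i (pi p) *m c.1.2 (pi q) = Z i q.
Proof.
case: c => [[[r' r] Phi] Psi] gp [fu r'0 r'r h1 h2] /= hq.
have [r0 hr e1 hinv _] := fu.
have pp : nm (pi p - pi p) < r' by rewrite subrr nm0.
have hc : Z i q *m Psi (pi q) = Z i (pi p) *m Psi (pi (pi p)).
  apply: (restricted_constant bpi fu) => t t01.
  have hs := segment_ball t01 pp hq.
  split; first exact: h1.
  by apply: Z_sol; apply: h2; exact: lt_le_trans hs r'r.
have P1 : Psi (pi p) = 1%:M.
  by have [+ _] := hinv _ (lt_le_trans pp r'r); rewrite e1 mul1mx.
rewrite pi_idem P1 mulmx1 in hc; rewrite -hc -mulmxA.
have [_ ->] := hinv _ (h1 _ hq); exact: mulmx1.
Qed.

(** At the projection of [q] both local extensions equal [Z i]. The segment from there to [q] stays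
    in both large balls, and along it both solve the same system. *)
Lemma chart_compatible i p c p' c' q : Gam p -> chart p c -> Gam p' -> chart p' c' ->
  nm (q - pi p) < c.1.1.1 -> nm (q - pi p') < c'.1.1.1 ->
  Z i (pi p) *m c.1.2 q = Z i (pi p') *m c'.1.2 q.
Proof.
move=> gp hc gp' hc' hq hq'.
have v := chart_value i gp hc hq; have v' := chart_value i gp' hc' hq'.
case: c hc hq v => [[[r r1] Phi] Psi] [fu r0 rr1 h1 h2] /= hq v.
case: c' hc' hq' v' => [[[r' r1'] Phi'] Psi'] [fu' r0' rr1' h1' h2'] /= hq' v'.
pose z q := Z i (pi p') *m Phi' q.
have hz q0 : nm (q0 - pi p') < r1' -> solution z q0.
  have [_ _ _ _ hD] := fu' => /hD[h _].
  apply: hasD_eqD (hasD_mulmx (hasD_cst (Z i (pi p')) q0) h) _ => u.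
  by rewrite mul0mx add0r mulmxA.
have e := fundamental_value fu (h1 _ hq) (lt_le_trans hq rr1)
  (fun t t01 => hz _ (segment_ball t01 (h1' _ hq') (lt_le_trans hq' rr1'))).
have [_ _ _ hinv _] := fu.
have [f1 f2] := hinv _ (lt_le_trans hq rr1); have [f3 f4] := hinv _ (h1 _ hq).
rewrite {2}/z v' -v -mulmxA f3 mulmx1 in e.
by rewrite -e -mulmxA f2 mulmx1.
Qed.

(** The extension uses an arbitrarily chosen chart around each point; compatibility makes the choice
    irrelevant. The domain is a union of balls centred on the cross, so each point is joined to the
    cross by a segment inside it. *)
Lemma gluing : exists (D : set 'cV[C]_m) (ext : I -> 'cV[C]_m -> 'rV[C]_k),
  [/\ open D, D `<=` D0, forall p, Gam p -> D (pi p),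
    forall i q, D q -> solution (ext i) q &
    (forall i p, Gam p -> ext i (pi p) = Z i p) /\
    forall q, D q -> exists2 p, Gam p & segment_in D (pi p) q].
Proof.
have /choice[ch hch] : forall p, exists c, Gam p -> chart p c.
  move=> p; have [gp|ng] := pselect (Gam p); last by exists (0, 0, fun=> 0, fun=> 0).
  by have [c hc] := chart_exists gp; exists c.
pose ball p q := Gam p /\ nm (q - pi p) < (ch p).1.1.1.
pose D q := exists p, ball p q.
have /choice[ctr hctr] : forall q, exists p, D q -> ball p q.
  move=> q; have [[p hp]|nd] := pselect (D q); last by exists q.
  by exists p.
pose ext i q := Z i (pi (ctr q)) *m (ch (ctr q)).1.2 q.
have extE i p q : ball p q -> ext i q = Z i (pi p) *m (ch p).1.2 q.
  move=> bq; have bc : ball (ctr q) q by apply: hctr; exists p.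
  exact (chart_compatible i bc.1 (hch _ bc.1) bq.1 (hch _ bq.1) bc.2 bq.2).
have near_ball p q : ball p q -> exists2 e : R, 0 < e & forall q', nm (q' - q) < e -> ball p q'.
  move=> [gp hq]; exists ((ch p).1.1.1 - nm (q - pi p)); first by rewrite subr_gt0.
  move=> q' h; split => //; apply: (le_lt_trans (nm_trans q _ _)); lra.
exists D, ext; split.
- rewrite openE => q [p bq]; apply/nbhs_nmP; have [e e0 he] := near_ball _ _ bq.
  by exists e => // q' /he; exists p.
- move=> q [p [gp hq]]; have := hch _ gp; case: (ch p) hq => [[[r' r] Phi] Psi] /= hq.
  by move=> [[_ hr _ _ _] _ r'r _ _]; apply: hr; exact: lt_le_trans hq r'r.
- move=> p gp; exists p; split => //; rewrite subrr nm0.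
  by have := hch _ gp; case: (ch p) => [[[r' r] Phi] Psi] [].
- move=> i q [p bq]; have [e e0 he] := near_ball _ _ bq.
  have h : hasD (ch p).1.2 q (fun w => (ch p).1.2 q *m A q w).
    have [gp hq] := bq; have := hch _ gp; case: (ch p) hq => [[[r' r] Phi] Psi] /= hq.
    move=> [[_ _ _ _ hD] _ r'r _ _]; by have [] := hD _ (lt_le_trans hq r'r).
  apply: (hasD_ext (f := fun q => Z i (pi p) *m (ch p).1.2 q)).
    by apply/nbhs_nmP; exists e => // q' /he/extE ->.
  apply: hasD_eqD (hasD_mulmx (hasD_cst (Z i (pi p)) q) h) _ => u.
  by rewrite mul0mx add0r (extE i p q bq) mulmxA.
- split.
    move=> i p gp; have b : ball p (pi p).
      split => //; rewrite subrr nm0.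
      by have := hch _ gp; case: (ch p) => [[[r' r] Phi] Psi] [].
    rewrite (extE i p _ b) -[in (ch p).1.2 _]pi_idem.
    by rewrite (chart_value i gp (hch _ gp) b.2) Z_pi.
  move=> q [p bq]; exists p; first exact: bq.1.
  move=> t t01; exists p; split; first exact: bq.1.
  apply: segment_ball bq.2 => //; rewrite subrr nm0.
  have [gp _] := bq.
  by have := hch _ gp; case: (ch p) => [[[r' r] Phi] Psi] [].
Qed.

End Gluing.

(** * Symplectic bases and brackets of odd periods *)

Section Symplectic.
Variable R : realType.
Local Notation C := (Cplx R).

Lemma sum_scale0 n m (c : 'I_n -> C) (v : 'I_n -> 'rV[C]_m) : (forall a, c a = 0) ->
  \sum_a c a *: v a = 0.
Proof. by move=> h; apply: big1 => a _; rewrite h scale0r. Qed.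

(** The Gram matrix of the [2n] rows is the standard symplectic one, hence invertible, so the rows
    span; pairing an expansion with them identifies its coefficients. *)
Lemma symplectic_span (Kf : fieldType) n (P : 'M[Kf]_(n * 2)) (x y : 'I_n -> 'rV[Kf]_(n * 2)) :
  P^T = - P ->
  (forall a b, [/\ (x a *m P *m (y b)^T) 0 0 = (a == b)%:R,
     (x a *m P *m (x b)^T) 0 0 = 0 & (y a *m P *m (y b)^T) 0 0 = 0]) ->
  forall xi : 'rV[Kf]_(n * 2), xi = \sum_a (xi *m P *m (y a)^T) 0 0 *: x a
     - \sum_a (xi *m P *m (x a)^T) 0 0 *: y a.
Proof.
move=> sP h xi.
pose X := \matrix_a x a; pose Y := \matrix_a y a.
have ent (u v : 'I_n -> 'rV[Kf]_(n * 2)) a b :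
    ((\matrix_a u a) *m P *m (\matrix_a v a)^T) a b = (u a *m P *m (v b)^T) 0 0.
  by rewrite entry_mulmx !rowK.
have eXX : X *m P *m X^T = 0.
  by apply/matrixP => a b; rewrite ent [RHS]mxE; have [] := h a b.
have eYY : Y *m P *m Y^T = 0.
  by apply/matrixP => a b; rewrite ent [RHS]mxE; have [] := h a b.
have eXY : X *m P *m Y^T = 1%:M.
  by apply/matrixP => a b; rewrite ent [RHS]mxE; have [] := h a b.
have eYX : Y *m P *m X^T = - 1%:M.
  have -> : Y *m P *m X^T = - (X *m P *m Y^T)^T.
    by rewrite !trmx_mul trmxK sP mulNmx mulmxN opprK mulmxA.
  by rewrite eXY trmx1.
pose T := col_mx X Y.
have eT : T *m P *m T^T = block_mx 0 1%:M (- 1%:M) 0.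
  by rewrite /T tr_col_mx mul_col_mx mul_col_row eXX eXY eYX eYY.
have rT : \rank T = (n * 2)%N.
  have en : (n * 2)%N = (n + n)%N by rewrite muln2 addnn.
  suff le : (n + n <= \rank T)%N.
    apply/eqP; rewrite eqn_leq rank_leq_col /=; exact: (leq_trans (eq_leq en) le).
  have uB : T *m P *m T^T \in unitmx.
    have e1 : T *m P *m T^T *m block_mx 0 (- 1%:M) 1%:M 0 = 1%:M.
      rewrite eT mulmx_block !(mul0mx, mulmx0, mulNmx, mulmxN, mul1mx, mulmx1, oppr0, opprK,
        addr0, add0r) -scalar_mx_block //.
    by have [] := mulmx1_unit e1.
  have := mxrankM_maxl T (P *m T^T); rewrite mulmxA (mxrank_unit uB) => le; exact le.
have fT : row_full T by rewrite /row_full rT.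
have /submxP[D eD] := submx_full xi fT.
have eD2 : xi = lsubmx D *m X + rsubmx D *m Y by rewrite eD -mul_row_col hsubmxK.
have eL : xi *m P *m Y^T = lsubmx D.
  by rewrite eD2 !mulmxDl -!mulmxA !(mulmxA _ P) eXY eYY mulmx1 mulmx0 addr0.
have eR : xi *m P *m X^T = - rsubmx D.
  by rewrite eD2 !mulmxDl -!mulmxA !(mulmxA _ P) eXX eYX mulmxN mulmx1 mulmx0 add0r.
have sum (z : 'rV[Kf]_n) (u : 'I_n -> 'rV[Kf]_(n * 2)) :
    z *m (\matrix_a u a) = \sum_a z 0 a *: u a.
  by rewrite mulmx_sum_row; apply: eq_bigr => a _; rewrite rowK.
have ent1 (u : 'I_n -> 'rV[Kf]_(n * 2)) a :
    (xi *m P *m (\matrix_a u a)^T) 0 a = (xi *m P *m (u a)^T) 0 0.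
  by rewrite [LHS]mxE [RHS]mxE; apply: eq_bigr => l _; rewrite !mxE.
rewrite {1}eD2 -[rsubmx D]opprK -eR -eL mulNmx !sum.
by congr (_ - _); apply: eq_bigr => a _; rewrite ent1.
Qed.

End Symplectic.

Section OddPeriods.
Variable R : realType.
Local Notation C := (Cplx R).
Local Notation hol := holomorphic_upto.
Variables (n : nat) (N : frob_data C n) (V : 'M[C]_n).
Hypothesis hN : is_frobenius N.
Hypothesis hV : forall t, fm_dom N t -> fm_V N t = V.

Lemma sub_segment (D : set 'cV[C]_n) p q (t : R) : 0 <= t <= 1 -> segment_in D p q ->
  segment_in D p (p + creal t *: (q - p)).
Proof.
move=> /andP[t0 t1] h u /andP[u0 u1].
have -> : p + creal u *: (p + creal t *: (q - p) - p) = p + creal (u * t) *: (q - p).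
  by rewrite [p + creal t *: _]addrC addrK scalerA crealM.
by apply: h; rewrite mulr_ge0 //= mulr_ile1.
Qed.

Lemma odd_period_sub (D D' : set 'cV[C]_n) w : open D' -> D' `<=` D ->
  odd_period N D w -> odd_period N D' w.
Proof.
move=> oD' s [oD Ds hw he]; split => //.
- by move=> p /s/Ds.
- by move=> k; exact: hol_sub s (hw k).
- by move=> t /s; exact: he.
Qed.

Lemma odd_hasD D w p : odd_period N D w -> D p ->
  hasD w p (fun u => (grad w p *m u) 0 0).
Proof. by move=> [_ _ hw _] Dp; apply: grad_hasD; have [h _] := hw 0%N; exact: h. Qed.

Lemma odd_grad_hasD D w p : odd_period N D w -> D p ->
  hasD (grad w) p (fun u => grad w p *m conn N V p u).
Proof.
move=> ow Dp; have h := odd_period_solution hN hV ow Dp.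
apply: (hasD_ext (f := fun q => lsubmx (arow (grad w q) (w q)))).
  by near=> q; rewrite /arow row_mxKl.
apply: hasD_eqD (hasD_comp h (hasD_lin _ (blinear_lsub (blinear_id _)))) _ => u.
by rewrite mul_aconn row_mxKl /arow row_mxKl.
Unshelve. all: by end_near. Qed.

Lemma odd_star D w p : odd_period N D w -> D p -> fm_star N p.
Proof. by move=> [_ h _ _] /h. Qed.

Lemma poisson_segment D f g p q : odd_period N D f -> odd_period N D g ->
  segment_in D p q -> poisson N f g q = poisson N f g p.
Proof.
move=> of_ og hs.
have Dp : D p by have := hs 0; rewrite lexx ler01 creal0 scale0r addr0 => /(_ isT).
have Dq : D q by have := hs 1; rewrite lexx ler01 creal1 scale1r addrC subrK => /(_ isT).
rewrite (poissonE hV f g (star_dom hN (odd_star of_ Dp))).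
rewrite (poissonE hV f g (star_dom hN (odd_star of_ Dq))).
have h := @hasD0_segment R _ _ _ (fun q => bracket N V (grad f q) (grad g q)) p q.
apply: (congr1 (fun B : 'M[C]_1 => B 0 0)); apply: h => t t01; have Dt := hs t t01.
exact (bracket_hasD0 hN hV (odd_star of_ Dt) (odd_grad_hasD of_ Dt) (odd_grad_hasD og Dt)).
Qed.

Lemma cst_const (f : 'cV[C]_n -> C) p q :
  (forall t : R, 0 <= t <= 1 -> hasD f (p + creal t *: (q - p)) (fun=> 0)) -> f q = f p.
Proof.
move=> h; have := @hasD0_segment R _ _ _ (fun q => (f q)%:M : 'M[C]_1) p q.
have e : (forall t : R, 0 <= t <= 1 ->
    hasD (fun q => (f q)%:M : 'M[C]_1) (p + creal t *: (q - p)) (fun=> 0)).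
  move=> t t01; apply: hasD_mx => i j; rewrite !ord1.
  apply: (hasD_ext (f := f)); first by near=> x; rewrite mxE eqxx mulr1n.
  by apply: hasD_eqD (h t t01) _ => v; rewrite mxE.
by move=> /(_ e) /matrixP /(_ 0 0); rewrite !mxE !eqxx !mulr1n.
Unshelve. all: by end_near. Qed.

Lemma solution_hasD_arow D w p : odd_period N D w -> D p ->
  hasD (fun q => arow (grad w q) (w q)) p (fun u => arow (grad w p) (w p) *m aconn N V p u).
Proof. by move=> ow Dp; exact (odd_period_solution hN hV ow Dp). Qed.

Lemma odd_period_comb (D : set 'cV[C]_n) f g (c k : C) : odd_period N D f -> odd_period N D g ->
  odd_period N D (fun p => f p + c * g p + k) /\
  forall p, D p -> grad (fun p => f p + c * g p + k) p = grad f p + c *: grad g p.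
Proof.
move=> of_ og; have [oD Ds _ _] := of_.
pose z q := arow (grad f q) (f q) + c *: arow (grad g q) (g q) + arow 0 k.
have hz p : D p -> hasD z p (fun u => z p *m aconn N V p u).
  move=> Dp; apply: hasD_eqD (hasDD (hasDD (solution_hasD_arow of_ Dp)
    (hasDZ c (solution_hasD_arow og Dp))) (hasD_cst (arow 0 k) p)) _ => u.
  have e0 : arow 0 k *m aconn N V p u = 0 by rewrite arow_aconn !mul0mx row_mx0.
  by rewrite /z !mulmxDl -scalemxAl e0.
have e : (fun q => rsubmx (z q) 0 0) = (fun p => f p + c * g p + k).
  by apply/funext => q; rewrite /z !raddfD /= linearZ /= !row_mxKr !mxE !eqxx !mulr1n.
split; first by rewrite -e; exact (solution_odd_period hN hV oD Ds hz).
move=> p Dp; rewrite -e (solution_grad (hz p Dp)) /z !raddfD /= linearZ /= !row_mxKl.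
exact: addr0.
Qed.

Lemma odd_period_cst (D : set 'cV[C]_n) k : open D -> D `<=` fm_star N ->
  odd_period N D (fun=> k) /\ forall p, grad (fun _ : 'cV[C]_n => k) p = 0.
Proof.
move=> oD Ds.
have gr p : grad (fun _ : 'cV[C]_n => k) p = 0.
  by apply/matrixP => i j; rewrite !mxE (hasD_derive (hasD_cst k p)).
split=> //; split => //.
- by move=> l; exact: hol_cst.
- move=> t Dt a; have -> : grad (fun _ : 'cV[C]_n => k) = fun=> 0 by apply/funext => p; exact: gr.
  by rewrite (hasD_derive (hasD_cst 0 t)) !mul0mx.
Qed.

Lemma odd_period_sum (D : set 'cV[C]_n) (I : Type) (s : seq I) (c : I -> C)
    (f : I -> 'cV[C]_n -> C) k : open D -> D `<=` fm_star N ->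
  (forall i, odd_period N D (f i)) ->
  odd_period N D (fun p => \sum_(i <- s) c i * f i p + k) /\
  forall p, D p -> grad (fun p => \sum_(i <- s) c i * f i p + k) p
     = \sum_(i <- s) c i *: grad (f i) p.
Proof.
move=> oD Ds hf; elim: s => [|i s [IH1 IH2]].
  have -> : (fun p => \sum_(i <- [::]) c i * f i p + k) = (fun=> k).
    by apply/funext => p; rewrite big_nil add0r.
  have [h1 h2] := odd_period_cst k oD Ds; split => // p _; by rewrite h2 big_nil.
have -> : (fun p => \sum_(i <- i :: s) c i * f i p + k) =
    (fun p => (\sum_(i <- s) c i * f i p + k) + c i * f i p + 0).
  by apply/funext => p; rewrite big_cons addr0 -addrA addrC.
have [h1 h2] := odd_period_comb (c i) 0 IH1 (hf i).
by split => // p Dp; rewrite (h2 p Dp) IH2 // big_cons addrC.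
Qed.

End OddPeriods.

Section CanonicalBasis.
Variable R : realType.
Local Notation C := (Cplx R).
Variables (n : nat) (N : frob_data C (n.+1 * 2)) (V : 'M[C]_(n.+1 * 2)).
Hypothesis hN : is_frobenius N.
Hypothesis hV : forall t, fm_dom N t -> fm_V N t = V.
Variables (D0 : set 'cV[C]_(n.+1 * 2)) (X Y : 'I_n.+1 -> 'cV[C]_(n.+1 * 2) -> C).
Hypotheses (oX : forall a, odd_period N D0 (X a)) (oY : forall a, odd_period N D0 (Y a)).
Hypothesis can : canonically_conjugate N D0 X Y.

Lemma bracketE (xi zeta : 'rV[C]_(n.+1 * 2)) :
  bracket N V xi zeta = xi *m (invmx (fm_eta N) *m V^T) *m zeta^T.
Proof. by rewrite /bracket !mulmxA. Qed.

Lemma Pi_skew p : fm_dom N p -> (invmx (fm_eta N) *m V^T)^T = - (invmx (fm_eta N) *m V^T).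
Proof.
move=> dp; have ue := frob_eta_unit hN.
have e : invmx (fm_eta N) *m V^T = (- V) *m invmx (fm_eta N).
  by apply: eta_flip => //; rewrite mulmxN -(hV dp); exact (V_tr hN dp).
by rewrite {2}e trmx_mul trmxK trmx_inv (frob_eta_sym hN) mulNmx opprK.
Qed.

Lemma canonical_expansion p f : D0 p -> grad f p =
  \sum_a poisson N f (Y a) p *: grad (X a) p - \sum_a poisson N f (X a) p *: grad (Y a) p.
Proof.
move=> Dp; have dp := star_dom hN (odd_star (oX ord0) Dp).
have pE g h : poisson N g h p = (grad g p *m (invmx (fm_eta N) *m V^T) *m (grad h p)^T) 0 0.
  by rewrite (poissonE hV g h dp) bracketE.
rewrite {1}(symplectic_span (x := fun a => grad (X a) p) (y := fun a => grad (Y a) p)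
  (Pi_skew dp) _ (grad f p)); last first.
  move=> a b; have [h1 h2 h3] := can a b Dp; split.
  - by rewrite -(pE (X a) (Y b)); exact h1.
  - by rewrite -(pE (X a) (X b)); exact h2.
  - by rewrite -(pE (Y a) (Y b)); exact h3.
exact (f_equal2 (fun A B => A - B)
  (eq_bigr _ (fun a _ => congr1 (fun c => c *: grad (X a) p) (esym (pE f (Y a)))))
  (eq_bigr _ (fun a _ => congr1 (fun c => c *: grad (Y a) p) (esym (pE f (X a)))))).
Qed.

(** The coefficients of the gradient in the canonical basis are brackets, which are constant along
    the segment and vanish at its start. *)
Lemma odd_segment_unique (D : set 'cV[C]_(n.+1 * 2)) w p q : D `<=` D0 -> odd_period N D w ->
  segment_in D p q -> grad w p = 0 -> grad w q = 0 /\ w q = w p.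
Proof.
move=> DD ow hs g0; have [oD _ _ _] := ow.
have dX a := odd_period_sub oD DD (oX a); have dY a := odd_period_sub oD DD (oY a).
have Dt (t : R) : 0 <= t <= 1 -> D (p + creal t *: (q - p)) by exact: hs.
have Dp : D p by have := hs 0; rewrite lexx ler01 creal0 scale0r addr0 => /(_ isT).
have P0 f : poisson N w f p = 0.
  by rewrite /poisson g0 !mul0mx mxE.
have key (t : R) : 0 <= t <= 1 -> grad w (p + creal t *: (q - p)) = 0.
  move=> t01; rewrite (canonical_expansion w (DD _ (Dt t t01))).
  have zX a : poisson N w (X a) (p + creal t *: (q - p)) = 0.
    exact (etrans (poisson_segment hN hV ow (dX a) (sub_segment t01 hs)) (P0 _)).
  have zY a : poisson N w (Y a) (p + creal t *: (q - p)) = 0.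
    exact (etrans (poisson_segment hN hV ow (dY a) (sub_segment t01 hs)) (P0 _)).
  exact (etrans (f_equal2 (fun A B => A - B) (sum_scale0 _ zY) (sum_scale0 _ zX)) (subr0 0)).
split.
  have t1 : 0 <= (1 : R) <= 1 by rewrite lexx ler01.
  have := key 1 t1; rewrite creal1 scale1r addrC subrK => h; exact h.
apply: cst_const => t t01; apply: hasD_eqD (odd_hasD ow (Dt t t01)) _ => u.
by rewrite key // mul0mx mxE.
Qed.

End CanonicalBasis.

(** * Brackets in the limit of small Q *)

Section BracketLimit.
Variable R : realType.
Local Notation C := (Cplx R).

Lemma eq0_halving (x c : R) : 0 <= x -> (forall k, x <= c * (1 / 2) ^+ k) -> x = 0.
Proof.
move=> x0 h; apply/eqP; rewrite eq_le x0 andbT; apply/ler_addgt0Pr => e e0; rewrite add0r.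
have [c0|c0] := lerP c 0.
  by apply: (le_trans (h 0%N)); rewrite expr0 mulr1 (le_trans c0) // ltW.
have [k hk] : exists k, c / e < k.+1%:R.
  exists (Num.truncn (c / e)); exact: truncnS_gt.
apply: (le_trans (h k)); rewrite ltr_pdivrMr // in hk.
have p2 : k.+1%:R <= 2 ^+ k :> R by rewrite -natrX ler_nat; exact: ltn_expl.
rewrite div1r exprVn ler_pdivrMr ?exprn_gt0 // (le_trans (ltW hk)) // mulrC.
by rewrite ler_wpM2l // ltW.
Qed.

Lemma affine_le (A B K y : R) : 0 <= A -> 0 <= B -> A + B <= K -> 0 <= y ->
  A * y + B <= K * (y + 1).
Proof. by move=> *; nra. Qed.

Lemma gram_right n (H J K JT G : 'M[C]_n) : J *m K *m JT = G -> G \in unitmx ->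
  H *m J *m K *m (JT *m invmx G) = H.
Proof.
move=> e u; have -> : H *m J *m K *m (JT *m invmx G) = H *m (J *m K *m JT) *m invmx G.
  by rewrite !mulmxA.
by rewrite e mulmxK.
Qed.

Lemma gram_left n (H J K JT G : 'M[C]_n) : J *m K *m JT = G -> G \in unitmx ->
  invmx G *m J *m K *m (JT *m H) = H.
Proof.
move=> e u; have -> : invmx G *m J *m K *m (JT *m H) = invmx G *m (J *m K *m JT *m H).
  by rewrite !mulmxA.
by rewrite e mulKmx.
Qed.

Lemma cancel_head n (A A' : 'M[C]_n) (u v g : 'cV[C]_n) (B B' : 'M[C]_1) :
  A *m v = A' *m u -> (A *m v)^T *m g + B = (A' *m u)^T *m g + B' -> B = B'.
Proof. by move=> ->; exact: addrI. Qed.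

Lemma sub00 (P Q : 'M[C]_1) : (P - Q) 0 0 = P 0 0 - Q 0 0.
Proof. by rewrite !mxE. Qed.

Lemma bilinear_error n (B : 'M[C]_n) (x l y m : 'rV[C]_n) (S e : R) :
  nm (x - l) <= e -> nm (y - m) <= e -> nm l <= S -> nm m <= S ->
  nm (x *m B *m y^T - l *m B *m m^T) <= n%:R * n%:R * nm B * (e * (2 * S + e)).
Proof.
move=> hx hy hl hm.
have e0 := le_trans (nm_ge0 _) hx; have S0 := le_trans (nm_ge0 _) hl.
have -> : x *m B *m y^T - l *m B *m m^T = (x - l) *m B *m y^T + l *m B *m (y - m)^T.
  by rewrite linearB /= !mulmxBl mulmxBr addrA subrK.
have tri (u v : 'rV[C]_n) a b : nm u <= a -> nm v <= b ->
    nm (u *m B *m v^T) <= n%:R * n%:R * nm B * (a * b).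
  move=> hu hv; have h1 := nm_mulmx_bound hu (lexx (nm B)).
  have h2 : nm v^T <= b by rewrite nm_trmx.
  apply: (le_trans (nm_mulmx_bound h1 h2)); apply: eq_ler; ring.
have hy' : nm y <= S + e.
  by rewrite -[y](subrK m) (le_trans (nmD _ _)) // addrC lerD.
apply: (le_trans (nmD _ _)).
have := lerD (tri _ _ _ _ hx hy') (tri _ _ _ _ hl hy); move=> h; apply: (le_trans h).
by apply: eq_ler; ring.
Qed.

(** The two terms proportional to [s] are [P K P'^T] with opposite signs, so the bracket of the
    leading parts does not depend on [s]. *)
Lemma leading_bracket n (P g r P' g' r' : 'rV[C]_n) (U V eti : 'M[C]_n) (s h : C) :
  P *m U = r *m (V + h%:M) -> P' *m U = r' *m (V + h%:M) ->
  eti *m V^T = - (V *m eti) -> (U *m eti)^T = U *m eti -> eti^T = eti ->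
  (s *: P + g) *m (eti *m (V + h%:M)^T) *m r'^T
   + r *m (eti *m (V - h%:M)^T) *m (s *: P' + g')^T
  = g *m (U *m eti) *m P'^T - P *m (U *m eti) *m g'^T.
Proof.
move=> e1 e2 eV eK et.
have a1 : eti *m (V + h%:M)^T *m r'^T = U *m eti *m P'^T.
  by rewrite -mulmxA -trmx_mul -e2 trmx_mul -eK trmx_mul et mulmxA.
have a2 : r *m (eti *m (V - h%:M)^T) = - (P *m (U *m eti)).
  rewrite linearB /= tr_scalar_mx mulmxBr eV mul_mx_scalar -opprD.
  by rewrite -mul_scalar_mx -mulmxDl mulmxN !mulmxA e1.
rewrite -mulmxA a1 a2 mulNmx linearD linearZ /= !mulmxDl mulmxDr -!scalemxAl -scalemxAr.
have sy : P *m (U *m eti *m P'^T) = P *m (U *m eti) *m P'^T by rewrite !mulmxA.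
by rewrite sy (mulmxA g) opprD addrACA subrr add0r.
Qed.

End BracketLimit.

Section CrossBracket.
Variable R : realType.
Local Notation C := (Cplx R).
Variables (n : nat) (M : frob_data C n.+1) (mu : 'I_n.+1 -> C) (N : frob_data C (n.+1 * 2)).
Hypotheses (hM : is_frobenius M) (hmu : normalized_diag M mu) (hN : tensor_qh M mu N).
Local Notation V := (Vmu mu).
Local Notation eti := (invmx (fm_eta M)).

Lemma invmx_etaN : invmx (fm_eta N) = eti *t antidiag C 2.
Proof.
have e : fm_eta N *m (eti *t antidiag C 2) = 1%:M.
  rewrite (tensor_eta hN) tensmx_mul mulmxV ?(frob_eta_unit hM) // antidiagM.
  exact: tensmx11.
have u := (mulmx1_unit e).1.
by rewrite -[LHS]mulmx1 -e mulmxA mulVmx // mul1mx.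
Qed.

Lemma rr_antidiag (x y : 'rV[C]_n.+1) (A : 'M[C]_n.+1) :
  rr x y *m (A *t antidiag C 2) = rr (y *m A) (x *m A).
Proof.
have d (i : 'I_2) : (delta_mx 0 i : 'rV[C]_2) *m antidiag C 2 = delta_mx 0 (rev_ord i).
  by rewrite -rowE; apply/matrixP => k l; rewrite !mxE ord1 eqxx.
have r0 : rev_ord (0 : 'I_2) = 1 by apply: val_inj.
have r1 : rev_ord (1 : 'I_2) = 0 by apply: val_inj.
by rewrite /rr mulmxDl !rt_mul !d r0 r1 addrC.
Qed.

Lemma rr_diag (x y : 'rV[C]_n.+1) (A B : 'M[C]_n.+1) :
  rr x y *m (A *t delta_mx 0 0 + B *t delta_mx 1 1) = rr (x *m A) (y *m B).
Proof.
have d2 (i j : 'I_2) : (delta_mx 0 i : 'rV[C]_2) *m delta_mx j j = (i == j)%:R *: delta_mx 0 j.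
  by rewrite mul_delta_mx_cond scaler_nat.
by rewrite /rr mulmxDr !mulmxDl !rt_mul !d2 /= !scale0r !scale1r /rt !tensmx0 addr0 add0r.
Qed.

Lemma rr_tr (x y x' y' : 'rV[C]_n.+1) : rr x y *m (rr x' y')^T = x *m x'^T + y *m y'^T.
Proof.
have -> : (rr x' y')^T = tens x'^T (del C 0) + tens y'^T (del C 1).
  have tr (z : 'rV[C]_n.+1) (b : 'rV[C]_2) : (rt z b)^T = tens z^T b^T.
    exact (trmx_tens z b).
  by rewrite /rr linearD /= !tr !trmx_delta.
by rewrite mulmxDr rr_tens0 rr_tens1.
Qed.

Lemma bracket_rr (x y x' y' : 'rV[C]_n.+1) : bracket N (VN mu) (rr x y) (rr x' y') =
  x *m (eti *m (V + (1 / 2)%:M)^T) *m y'^T + y *m (eti *m (V - (1 / 2)%:M)^T) *m x'^T.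
Proof.
rewrite /bracket invmx_etaN rr_antidiag /VN linearD /= !trmx_tens !trmx_delta rr_diag rr_tr.
by rewrite addrC !mulmxA.
Qed.

End CrossBracket.

(** * Explicit solutions attached to the flat coordinates *)

Section LocalData.
Variable R : realType.
Local Notation C := (Cplx R).
Variables (n : nat) (M : frob_data C n.+1) (mu : 'I_n.+1 -> C) (N : frob_data C (n.+1 * 2)).
Variables (W : set 'cV[C]_n.+1) (x : 'cV[C]_n.+1 -> 'cV[C]_n.+1) (G : 'M[C]_n.+1).
Hypotheses (hM : is_frobenius M) (hmu : normalized_diag M mu) (hN : tensor_qh M mu N).
Hypothesis hx : flat_coordinates M W x G.
Variable F : 'cV[C]_n.+1 -> C.
Hypothesis hF : dual_potential M W x G F.
Local Notation V := (Vmu mu).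
Local Notation U := (fm_U M).
Local Notation I := ('I_n.+1 + 'I_n.+1)%type.

(* Explicit solutions are determined by their coefficient row r of s, by the
   s-free part g of the gradient and by the s-free part phi of the period,
   all at Q = 0. *)
Definition dr (i : I) : 'cV[C]_n.+1 -> 'rV[C]_n.+1 :=
  match i with inl _ => @rup R n | inr a => rlow M mu x G a end.
Definition dg (i : I) : 'cV[C]_n.+1 -> 'rV[C]_n.+1 :=
  match i with inl a => gup x a | inr a => glow x F a end.
Definition dphi (i : I) : 'cV[C]_n.+1 -> 'M[C]_1 :=
  match i with inl a => phiup x a | inr a => philow x F a end.
Definition Zs i := zrow M mu (dr i) (dg i) (dphi i).
Definition cyl t0 (d rho : R) (p : 'cV[C]_(n.+1 * 2)) := nm (tau p - t0) < d /\ cRe (sigma p) < rho.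

(** The general error carries the factor [|s| + 1] of a logarithm. The last clause drops it for the
    periods [X^a], for which [O(Q)] is asserted rather than [o(1)]. *)
Definition asymptotics (K : R) p i :=
  let Q := nm (cexp (sigma p)) in let e := K * (nm (sigma p) + 1) * Q in let t := tau p in
  [/\ nm (xi1 M V (dr i) (dg i) (@tau R n) (@sigma R n) p
         - (sigma p *: Pjet V U (dr i) 1 t + dg i t)) <= e,
    nm (xi2 M V (dr i) (dg i) (@tau R n) (@sigma R n) p - dr i t) <= e,
    nm (ww M V (dr i) (dg i) (dphi i) (@tau R n) (@sigma R n) p
      - (sigma p *: (dr i t *m fm_e M) + dphi i t)) <= e &
    forall a, i = inl a -> nm (ww M V (dr i) (dg i) (dphi i) (@tau R n) (@sigma R n) p
      - (sigma p *: (dr i t *m fm_e M) + dphi i t)) <= K * Q].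

Lemma Zs_eq i p q : tau p = tau q -> sigma p = sigma q -> Zs i p = Zs i q.
Proof.
move=> et es; rewrite /Zs /zrow.
by rewrite (xi1_eq _ _ _ _ et es) (xi2_eq _ _ _ _ et es) (ww_eq _ _ _ _ _ et es).
Qed.

Local Notation K t := (U t *m invmx (fm_eta M)).
Definition lead i t := Pjet V U (dr i) 1 t.
Definition lead_bracket i j t := dg i t *m K t *m (lead j t)^T - lead i t *m K t *m (dg j t)^T.

Lemma lead_inl a t : W t -> lead (inl a) t = 0.
Proof. by move=> Wt; rewrite /lead Pjet_eq0. Qed.

Lemma lead_inr a t : W t -> lead (inr a) t = plow x G a t.
Proof. by move=> Wt; exact (Pjet_rlow hM hmu hx a Wt). Qed.

Let F_hol k : holomorphic_upto k (x @` W) F. Proof. by have [h _] := hF; exact: h. Qed.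

Definition gradc (y : 'cV[C]_n.+1) : 'cV[C]_n.+1 := \col_a 'D_(del C a) F y.

Lemma gradc_hasD t : W t ->
  hasD (fun t => gradc (x t)) t (fun u => Hess F (x t) *m (jac x t *m u)).
Proof.
move=> Wt; apply: hasD_comp (x_hasD hx Wt) _; apply: hasD_mx => a j; rewrite ord1.
apply: (hasD_ext (f := fun y => 'D_(del C a) F y)); first by near=> q; rewrite mxE.
apply: hasD_eqD (Fa_hasD hF a Wt) _ => v.
by rewrite -row_mul mxE.
Unshelve. all: by end_near. Qed.

Lemma Fx_hasD t : W t -> hasD (fun t => (F (x t))%:M : 'M[C]_1) t
  (fun v => (jac x t *m v)^T *m gradc (x t)).
Proof.
move=> Wt; have hf := hol_hasD (F_hol 0) (imageP x Wt); have [[l _] _] := hf.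
have h := hasD_comp (x_hasD hx Wt) hf.
apply: hasD_mx => i j; rewrite !ord1.
apply: (hasD_ext (f := fun t => F (x t))); first by near=> q; rewrite mxE eqxx mulr1n.
apply: hasD_eqD h _ => w; rewrite (linear_cV (jac x t *m w) l) mxE.
by apply: eq_bigr => a _; rewrite !mxE.
Unshelve. all: by end_near. Qed.

Lemma Fx_derive t v : W t ->
  'D_v (fun t => (F (x t))%:M : 'M[C]_1) t = (jac x t *m v)^T *m gradc (x t).
Proof. by move=> Wt; exact: hasD_derive (Fx_hasD Wt) v. Qed.

(** Schwarz is applied to [F] composed with [x] on the open set [W], which avoids discussing whether
    the image of [x] is open; the second derivatives of [x] contribute symmetric terms and
    cancel. *)
Lemma Hess_sym t : W t -> (Hess F (x t))^T = Hess F (x t).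
Proof.
move=> Wt; have oW := flat_open hx; have uJ := J_unit hx Wt.
have hJ := hol_hasD (jac_hol hx 0) Wt.
have d2 u v : 'D_u (fun p => 'D_v (fun t => (F (x t))%:M : 'M[C]_1) p) t =
    ('D_u (jac x) t *m v)^T *m gradc (x t) + (jac x t *m v)^T *m (Hess F (x t) *m (jac x t *m u)).
  have h : hasD (fun p => 'D_v (fun t => (F (x t))%:M : 'M[C]_1) p) t (fun u =>
      ('D_u (jac x) t *m v + jac x t *m 0)^T *m gradc (x t)
      + (jac x t *m v)^T *m (Hess F (x t) *m (jac x t *m u))).
    apply: (hasD_ext (f := fun p => (jac x p *m v)^T *m gradc (x p))).
      by apply: filterS (open_near oW Wt) => p Wp; rewrite Fx_derive.
    apply: hasD_mulmx (gradc_hasD Wt).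
    exact: hasD_comp (hasD_mulmx hJ (hasD_cst v t)) (hasD_lin _ (blinear_trmx (blinear_id _))).
  by rewrite (hasD_derive h u) mulmx0 addr0.
have hol3 : holomorphic_upto 3 W (fun t => (F (x t))%:M : 'M[C]_1).
  apply: hol_mx => // i j; rewrite !ord1.
  apply: (hol_ext (f := fun t => F (x t)) oW); first by move=> p _; rewrite mxE eqxx mulr1n.
  exact: hol_comp oW (fun k => x_hol hx k) (F_hol 3).
have sw u v := schwarz u v oW Wt hol3.
have key (u v : 'cV[C]_n.+1) : (jac x t *m v)^T *m (Hess F (x t) *m (jac x t *m u)) =
    (jac x t *m u)^T *m (Hess F (x t) *m (jac x t *m v)).
  have e := etrans (esym (d2 u v)) (etrans (sw u v) (d2 v u)).
  exact (cancel_head (jac_sym hx u v Wt) e).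
apply: bilinear_ext => u v.
have e w : jac x t *m (invmx (jac x t) *m w) = w by rewrite mulKVmx.
have := key (invmx (jac x t) *m u) (invmx (jac x t) *m v).
rewrite !e => k; rewrite -[RHS]mulmxA -k.
have -> : u^T *m (Hess F (x t))^T *m v = (v^T *m (Hess F (x t) *m u))^T.
  by rewrite !trmx_mul trmxK.
by apply/matrixP => i j; rewrite !ord1 mxE.
Qed.

Lemma lead_bracketE t a b : W t ->
  [/\ lead_bracket (inl a) (inr b) t 0 0 = (a == b)%:R,
      lead_bracket (inl a) (inl b) t 0 0 = 0 &
      lead_bracket (inr a) (inr b) t 0 0 = 0].
Proof.
move=> Wt; rewrite /lead_bracket !lead_inl // !lead_inr //.
have gr := gram hM hx Wt; have uG := G_unit hM hx; have sG := G_sym hM hx.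
split.
- rewrite !mul0mx subr0 /gup /plow -entry_mulmx trmx_mul trmx_inv sG (mulmxA (jac x t *m K t)) gr mulmxV //.
  by rewrite mxE.
- by rewrite !mul0mx trmx0 mulmx0 subr0 mxE.
- rewrite /glow /plow linearZ /= -!scalemxAl -!scalemxAr -scalerBr mxE.
  have e1 : (row a (Hess F (x t)) *m jac x t *m K t *m (row b (invmx G *m jac x t))^T) 0 0
     = Hess F (x t) a b.
    rewrite -[row a _ *m jac x t]row_mul -entry_mulmx trmx_mul trmx_inv sG.
    by rewrite (gram_right _ gr uG).
  have e2 : (row a (invmx G *m jac x t) *m K t *m (row b (Hess F (x t)) *m jac x t)^T) 0 0
     = Hess F (x t) b a.
    rewrite -[row b _ *m jac x t]row_mul -entry_mulmx trmx_mul.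
    by rewrite (gram_left _ gr uG) mxE.
  rewrite sub00 e1 e2.
  have := Hess_sym Wt => /matrixP /(_ a b); rewrite mxE => ->.
  by rewrite subrr mulr0.
Qed.

Lemma local_data t0 : W t0 -> exists d rho K : R, [/\ 0 < d, 0 <= K &
  forall p, cyl t0 d rho p -> [/\ W (tau p), fm_star N (cproj p) &
    forall i, restricted_solution (aconn N (VN mu)) (@cproj R n) (Zs i) p /\ asymptotics K p i]].
Proof.
move=> Wt0; have oW := flat_open hx; have Ws : W `<=` fm_star M := @flat_star _ _ _ _ _ _ hx.
have hVM := hV hmu.
have /choice[c hc] : forall i : I, exists c : R * R * R * R, let: (d, rho, A, B) := c in
    [/\ 0 < d, 0 <= A, 0 <= B, (forall t, W t -> dr i t = 0) -> A = 0 &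
      cross_estimate M V (dr i) (dg i) (dphi i) (@tau R n) (@sigma R n) d rho A B t0 W].
  move=> i.
  have [|||d [rho [A [B h]]]] := @cross_solution R n.+1 M V hM hVM (dr i) (dg i) (dphi i) _
      (@tau R n) (@sigma R n) (@blinear_tau R n) (@blinear_sigma R n) W t0 oW Ws _ _ _ Wt0.
  - move=> t Wt; case: i => a; [exact (rup_hasD M mu Wt)|exact (rlow_hasD hM hmu hx a Wt)].
  - move=> t Wt; case: i => a; [exact (gup_hasD hM hmu hx a Wt)|exact (glow_hasD hM hmu hx hF a Wt)].
  - move=> t Wt; case: i => a; [exact (phiup_hasD hx a Wt)|exact (philow_hasD hx hF a Wt)].
  by exists (d, rho, A, B).
have [d1 [rho1 [d10 hd1]]] := cross_star_near hM hmu hN (Ws _ Wt0).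
have hd0 i : 0 < (c i).1.1.1 by have := hc i; case: (c i) => [[[d rho] A] B] [].
have [d [d0 _ hd]] := finite_radius hd0.
(* A lower bound for all the individual thresholds at once; radii and constants are likewise made
   common to the [2n] solutions. *)
pose rho := - (`|rho1| + \sum_i `|(c i).1.1.2|).
pose K := \sum_i ((c i).1.2 + (c i).2).
have A0 i : 0 <= (c i).1.2 by have := hc i; case: (c i) => [[[? ?] A] B] [].
have B0 i : 0 <= (c i).2 by have := hc i; case: (c i) => [[[? ?] A] B] [].
have K0 : 0 <= K by apply: sumr_ge0 => i _; exact: addr_ge0.
have leK i : (c i).1.2 + (c i).2 <= K.
  by rewrite /K (bigD1 i) //= lerDl; apply: sumr_ge0 => j _; exact: addr_ge0.
have S0 : 0 <= \sum_i `|(c i).1.1.2| by exact: sumr_ge0.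
have rle1 : rho <= rho1.
  rewrite /rho; have := ler_norm (- rho1); rewrite normrN; lra.
have rlei i : rho <= (c i).1.1.2.
  rewrite /rho; have := ler_norm (- (c i).1.1.2); rewrite normrN.
  have : `|(c i).1.1.2| <= \sum_i `|(c i).1.1.2|.
    by rewrite (bigD1 i) //= lerDl; exact: sumr_ge0.
  have := normr_ge0 rho1; lra.
exists (Num.min d d1), rho, K; split => //; first by rewrite lt_min d0.
move=> p [+ hs]; rewrite lt_min => /andP[p1 p2].
have st : fm_star N (cproj p) by apply: hd1 => //; exact: lt_le_trans hs rle1.
have Wp : W (tau p).
  have := hc (inl ord0); have := hd (inl ord0); have := rlei (inl ord0).
  case: (c (inl ord0)) => [[[e r0] A] B] /= h1 h2 [_ _ _ _ ce].
  have [] // := ce p (lt_le_trans p1 h2) (lt_le_trans hs h1).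
split => // i; have := hc i; have := hd i; have := rlei i; have := leK i; have := A0 i; have := B0 i.
case: (c i) => [[[e r0] A] B] /= hB hA hK h1 h2 [_ _ _ Az ce].
have q1 := lt_le_trans p1 h2; have q2 := lt_le_trans hs h1.
split; first exact (zrow_solution hM hmu hN ce Ws q1 q2 st).
have [_ [_ _ _ _ [s1 s2 s3]]] := ce p q1 q2.
have Q0 := nm_ge0 (cexp (sigma p)); have sg0 := nm_ge0 (sigma p).
have le1 : (A * nm (sigma p) + B) * nm (cexp (sigma p))
   <= K * (nm (sigma p) + 1) * nm (cexp (sigma p)).
  apply: ler_wpM2r => //.
  exact: affine_le.
split.
- exact: le_trans s1 le1.
- exact: le_trans s2 le1.
- exact: le_trans s3 le1.
- move=> a ia; have A00 : A = 0 by apply: Az; rewrite ia.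
  apply: (le_trans s3); rewrite A00 mul0r add0r; apply: ler_wpM2r => //.
  by apply: le_trans hK; rewrite lerDr.
Qed.

End LocalData.

(** * Exponential decay against logarithmic growth *)

Section ExponentialDecay.
Variable R : realType.
Local Notation C := (Cplx R).

Lemma expR_shift k : expR (- (4 * k%:R) : R) <= (1 / 16) ^+ k.
Proof.
have -> : - (4 * k%:R) = k%:R * (- 4) :> R by ring.
rewrite expRM_natl lerXn2r ?nnegrE ?expR_ge0 //.
have -> : - 4 = 4%:R * (-1) :> R by ring.
rewrite expRM_natl; have -> : (1 / 16 : R) = (1 / 2) ^+ 4 by field.
rewrite lerXn2r ?nnegrE ?expR_ge0 // expRN div1r lef_pV2 ?posrE ?expR_gt0 //.
by have := expR_ge1Dx (1 : R); lra.
Qed.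

(** The logarithms contribute [(k+1)^2 <= 8^k], which lowers [16^-k] to [2^-k]; the shift of [s] by
    [4 k] is made large enough for this. *)
Lemma decay_bound (K m q y S e : R) k : 0 <= K -> 0 <= m -> 0 <= q -> 0 <= S ->
  0 <= y -> y <= S * k.+1%:R -> 0 <= e <= q * (1 / 16) ^+ k ->
  (K * y * e) * (2 * (m * y) + K * y * e) <= K * S ^+ 2 * q * (2 * m + K * q) * (1 / 2) ^+ k.
Proof.
move=> K0 m0 q0 S0 y0 hy /andP[e0 he].
have h16 : (1 / 16 : R) ^+ k <= 1 by rewrite exprn_ile1 //; lra.
have p16 : 0 <= (1 / 16 : R) ^+ k by rewrite exprn_ge0.
have eq : e <= q by rewrite (le_trans he) // ler_piMr.
have k4 : k.+1%:R ^+ 2 * (1 / 16) ^+ k <= (1 / 2 : R) ^+ k.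
  have h2 : k.+1%:R <= 2 ^+ k :> R by rewrite -natrX ler_nat; exact: ltn_expl.
  have -> : (1 / 2 : R) ^+ k = (2 ^+ k) ^+ 3 * (1 / 16) ^+ k.
    by rewrite -exprM mulnC exprM -exprMn; congr (_ ^+ k); field.
  rewrite ler_wpM2r // (@le_trans _ _ ((2 ^+ k) ^+ 2)) //.
    by rewrite lerXn2r ?nnegrE ?exprn_ge0.
  by rewrite ler_weXn2l // exprn_ege1 // ler1n.
have -> : K * y * e * (2 * (m * y) + K * y * e) = K * (y ^+ 2 * e) * (2 * m + K * e) by ring.
have -> : K * S ^+ 2 * q * (2 * m + K * q) * (1 / 2) ^+ k =
   K * (S ^+ 2 * q * (1 / 2) ^+ k) * (2 * m + K * q) by ring.
apply: ler_pM.
- by rewrite !mulr_ge0 ?exprn_ge0.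
- by rewrite addr_ge0 ?mulr_ge0.
- apply: ler_wpM2l => //; apply: (@le_trans _ _ ((S * k.+1%:R) ^+ 2 * (q * (1 / 16) ^+ k))).
    by apply: ler_pM; rewrite ?exprn_ge0 // lerXn2r ?nnegrE // mulr_ge0.
  have -> : (S * k.+1%:R) ^+ 2 * (q * (1 / 16) ^+ k) = S ^+ 2 * q * (k.+1%:R ^+ 2 * (1 / 16) ^+ k).
    by ring.
  by rewrite ler_wpM2l // mulr_ge0 ?exprn_ge0.
- by rewrite lerD2l ler_wpM2l.
Qed.

Lemma two_errors (a b E c q : R) : 0 <= a -> 0 <= b -> E <= c * q ->
  a * E + b * E <= (a + b) * c * q.
Proof. by move=> a0 b0 h; rewrite -mulrDl -mulrA ler_wpM2l // addr_ge0. Qed.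

(** In the sector [|s| + 1] is at most [y + B] with [y = - Re s], and [exp y >= (1 + y/2)^2]
    outgrows this affine bound; [T] is the point beyond which the quotient is below [eps]. *)
Lemma sector_decay (b c eps : R) : 0 <= c -> 0 < eps -> exists rho : R, forall s : C,
  cRe s < rho -> `|cIm s| <= b -> c * (nm s + 1) * nm (cexp s) <= eps.
Proof.
move=> c0 e0; pose B := `|b| + 1; have B1 : 1 <= B by rewrite /B lerDr.
have B0 : 0 <= B by exact: le_trans ler01 B1.
pose T := 2 * c * B / eps; have T0 : 0 <= T by apply: divr_ge0; [apply: mulr_ge0 => //; exact: mulr_ge0|exact: ltW].
exists (- (2 * T)) => s hs hi; pose y := - cRe s.
have yT : 2 * T < y by rewrite /y; move: hs; lra.
have y0 : 0 < y by apply: le_lt_trans yT; rewrite mulr_ge0.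
have ns : nm s + 1 <= y + B.
  rewrite (le_trans (lerD (nm_le_ReIm s) (lexx 1))) // /B.
  have := ler_norm b; have -> : `|cRe s| = y by rewrite ltr0_norm // /y; move: y0; rewrite /y; lra.
  by lra.
have ne : nm (cexp s) <= ((1 + y / 2) ^+ 2)^-1.
  rewrite nm_cexp (_ : cRe s = - y); last by rewrite opprK.
  rewrite expRN lef_pV2 ?posrE ?expR_gt0 ?exprn_gt0 //; last by rewrite addr_gt0 // divr_gt0.
  have -> : expR y = expR (y / 2) ^+ 2 by rewrite -expRM_natl; congr expR; by field.
  rewrite lerXn2r ?nnegrE ?expR_ge0 ?expR_ge1Dx //.
  by rewrite addr_ge0 // divr_ge0 // ltW.
have z0 : 0 < 1 + y / 2 by rewrite addr_gt0 // divr_gt0.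
apply: (@le_trans _ _ (c * (y + B) * ((1 + y / 2) ^+ 2)^-1)).
  apply: ler_pM ne; rewrite ?nm_ge0 ?mulr_ge0 ?addr_ge0 ?nm_ge0 //.
  by rewrite ler_wpM2l.
rewrite ler_pdivrMr ?exprn_gt0 //.
have h1 : y + B <= 2 * B * (1 + y / 2) by have := B1; have := y0; nra.
have h2 : 2 * c * B <= eps * (1 + y / 2).
  have : 2 * c * B = T * eps by rewrite /T divfK // gt_eqF.
  move=> ->; rewrite mulrC ler_wpM2l ?ltW //; move: yT; lra.
apply: (le_trans (ler_wpM2l c0 h1)).
have -> : c * (2 * B * (1 + y / 2)) = (2 * c * B) * (1 + y / 2) by ring.
by rewrite expr2 mulrA ler_wpM2r // ltW.
Qed.

End ExponentialDecay.

Lemma skew_entry (R : realType) m (P : 'M[Cplx R]_m) (u v : 'rV[Cplx R]_m) : P^T = - P ->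
  (u *m P *m v^T) 0 0 = - (v *m P *m u^T) 0 0.
Proof.
move=> e; have -> : u *m P *m v^T = - (v *m P *m u^T)^T.
  by rewrite !trmx_mul trmxK e mulmxA mulmxN mulNmx opprK.
by rewrite [LHS]mxE [in LHS]mxE.
Qed.

Lemma pairing_dual (K : pzRingType) n (c : 'I_n + 'I_n -> K) (P : 'I_n + 'I_n -> 'I_n + 'I_n -> K) :
  (forall a b, [/\ P (inl a) (inr b) = (a == b)%:R, P (inl a) (inl b) = 0,
    P (inr a) (inr b) = 0 & P (inr a) (inl b) = - (a == b)%:R]) ->
  (forall j, \sum_i c i * P i j = 0) -> forall i, c i = 0.
Proof.
move=> h key [] a.
- have := key (inr a); rewrite big_sumType /= (bigD1 a) //= big1 ?addr0; last first.
    by move=> b ba; have [-> _ _ _] := h b a; rewrite (negbTE ba) mulr0.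
  rewrite [X in _ + X]big1 ?addr0; last first.
    by move=> b _; have [_ _ -> _] := h b a; rewrite mulr0.
  by have [-> _ _ _] := h a a; rewrite eqxx mulr1.
- have := key (inl a); rewrite big_sumType /= big1 ?add0r; last first.
    by move=> b _; have [_ -> _ _] := h b a; rewrite mulr0.
  rewrite (bigD1 a) //= big1 ?addr0; last first.
    by move=> b ba; have [_ _ _ ->] := h b a; rewrite (negbTE ba) oppr0 mulr0.
  by have [_ _ _ ->] := h a a; rewrite eqxx mulrN1 => /eqP; rewrite oppr_eq0 => /eqP.
Qed.

Lemma grad_near0 (R : realType) m (w : 'cV[Cplx R]_m -> Cplx R) p :
  (\forall q \near p, w q = 0) -> grad w p = 0.
Proof.
move=> h; apply/matrixP => i j; rewrite !mxE.
apply: (hasD_derive (L := fun=> 0)); apply: (hasD_ext (f := fun=> 0)); last exact: hasD_cst.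
by apply: filterS h => q ->.
Qed.

Lemma pairing_sum (R : realType) m k (I : Type) (r : seq I) (c : I -> Cplx R) (v : I -> 'rV[Cplx R]_m)
    (P : 'M[Cplx R]_(m, k)) (z : 'cV[Cplx R]_k) :
  ((\sum_(i <- r) c i *: v i) *m P *m z) 0 0 = \sum_(i <- r) c i * (v i *m P *m z) 0 0.
Proof.
by rewrite !mulmx_suml summxE; apply: eq_bigr => i _; rewrite -!scalemxAl mxE.
Qed.

Lemma expansion_sub (R : realType) m (I J : Type) (r : seq I) (q : seq J) (a : I -> Cplx R) (b : J -> Cplx R)
    (u : I -> 'rV[Cplx R]_m) (v : J -> 'rV[Cplx R]_m) :
  \sum_(i <- r) a i *: u i - \sum_(j <- q) b j *: v j
   - (\sum_(i <- r) a i *: u i + \sum_(j <- q) - b j *: v j) = 0.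
Proof.
have -> : \sum_(j <- q) - b j *: v j = - \sum_(j <- q) b j *: v j.
  by rewrite -sumrN; apply: eq_bigr => j _; rewrite scaleNr.
exact: subrr.
Qed.

Section Pairing.
Variable R : realType.
Local Notation C := (Cplx R).
Variables (n : nat) (N : frob_data C (n.+1 * 2)) (V : 'M[C]_(n.+1 * 2)).
Hypothesis hN : is_frobenius N.
Hypothesis hV : forall t, fm_dom N t -> fm_V N t = V.

Lemma poisson_pairing p f g : fm_dom N p ->
  poisson N f g p = (grad f p *m (invmx (fm_eta N) *m V^T) *m (grad g p)^T) 0 0.
Proof. by move=> dp; rewrite /poisson (hV dp) -(mulmxA (grad f p)). Qed.

Lemma poisson_skew p f g : fm_dom N p -> poisson N f g p = - poisson N g f p.
Proof.
move=> dp; apply: (etrans (poisson_pairing f g dp)).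
apply: (etrans (skew_entry (grad f p) (grad g p) (Pi_skew hN hV dp))).
exact (congr1 -%R (esym (poisson_pairing g f dp))).
Qed.

End Pairing.

Lemma cross_line (R : realType) n (t t' : 'cV[Cplx R]_n.+1) (s s' u : Cplx R) :
  cross (t + u *: (t' - t)) (s + u * (s' - s)) = cross t s + u *: (cross t' s' - cross t s).
Proof.
have -> : cross t' s' - cross t s = cross (t' - t) (s' - s).
  by apply: (addIr (cross t s)); rewrite subrK crossD !subrK.
by rewrite crossZ crossD.
Qed.

Lemma cRe_realpart (R : realType) (r : R) : cRe (creal r) = r.
Proof. by []. Qed.

Lemma cRe_convex (R : realType) (a b : Cplx R) (u r : R) : 0 <= u <= 1 -> cRe a < r -> cRe b < r ->
  cRe (a + creal u * (b - a)) < r.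
Proof.
move=> /andP[u0 u1] ha hb; rewrite cReD cRe_creal cReD cReN.
have [u00|un] := eqVneq u 0; first by rewrite u00 mul0r addr0.
have up : 0 < u by rewrite lt_neqAle eq_sym un u0.
nra.
Qed.

(** * Construction of the period system *)

Section Existence.
Variable R : realType.
Local Notation C := (Cplx R).
Variables (n : nat) (M : frob_data C n.+1) (mu : 'I_n.+1 -> C) (N : frob_data C (n.+1 * 2)).
Variables (W : set 'cV[C]_n.+1) (x : 'cV[C]_n.+1 -> 'cV[C]_n.+1) (G : 'M[C]_n.+1).
Hypotheses (hM : is_frobenius M) (hmu : normalized_diag M mu) (hN : tensor_qh M mu N).
Hypothesis hx : flat_coordinates M W x G.
Variable F : 'cV[C]_n.+1 -> C.
Hypothesis hF : dual_potential M W x G F.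
Local Notation V := (Vmu mu).
Local Notation VN := (VN mu).
Local Notation I := ('I_n.+1 + 'I_n.+1)%type.
Local Notation Zs := (Zs M mu x G F).
Local Notation asymptotics := (asymptotics M mu x G F).
Local Notation hNf := (tensor_frob hN).
Local Notation hVN := (hVN hN).

Variables (dd rho KK : 'cV[C]_n.+1 -> R).
Hypothesis hloc : forall t0, W t0 -> [/\ 0 < dd t0, 0 <= KK t0 &
  forall p, cyl t0 (dd t0) (rho t0) p -> [/\ W (tau p), fm_star N (cproj p) &
    forall i, restricted_solution (aconn N VN) (@cproj R n) (Zs i) p /\ asymptotics (KK t0) p i]].

(** All points whose projection lies in one of the cylinders over [W]; radius and threshold vary
    with the centre, so no uniform smallness of [Q] over [W] is demanded. *)
Definition Gam p := exists2 t0, W t0 & cyl t0 (dd t0) (rho t0) p.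

Lemma cyl_near t0 d r p : cyl t0 d r p -> exists2 e : R, 0 < e &
  forall q : 'cV[C]_(n.+1 * 2), nm (q - p) < e -> cyl t0 d r q.
Proof.
move=> [h1 h2].
have e10 : 0 < d - nm (tau p - t0) by rewrite subr_gt0.
have [e1 e1p he1] := hasD_cont (hasD_lin p (@blinear_tau R n)) e10.
have e20 : 0 < r - cRe (sigma p) by rewrite subr_gt0.
have [e2 e2p he2] := hasD_cont (hasD_lin p (@blinear_sigma R n)) e20.
exists (Num.min e1 e2); first by rewrite lt_min e1p.
move=> q; rewrite lt_min => /andP[/he1 q1 /he2 q2]; split.
  apply: (le_lt_trans (nm_trans (tau p) _ _)); move: q1; lra.
have := cRe_le_nm (sigma q - sigma p); rewrite cReD cReN ler_norml => /andP[_ h].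
by move: h q2; lra.
Qed.

Lemma Gam_open : open Gam.
Proof.
rewrite openE => p [t0 Wt0 cp]; apply/nbhs_nmP; have [e e0 he] := cyl_near cp.
by exists e => // q /he cq; exists t0.
Qed.

Lemma tau_cproj (p : 'cV[C]_(n.+1 * 2)) : tau (cproj p) = tau p.
Proof. exact: tau_cross. Qed.
Lemma sigma_cproj (p : 'cV[C]_(n.+1 * 2)) : sigma (cproj p) = sigma p.
Proof. exact: sigma_cross. Qed.

Lemma Gam_cproj p : Gam p -> Gam (cproj p).
Proof. by move=> [t0 Wt0 [h1 h2]]; exists t0 => //; split; rewrite ?tau_cproj ?sigma_cproj. Qed.

Lemma Gam_W p : Gam p -> W (tau p).
Proof. by move=> [t0 /hloc[_ _ h] /h[]]. Qed.

Lemma Zs_cproj i p : Zs i (cproj p) = Zs i p.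
Proof. exact (Zs_eq M mu x G F i (tau_cproj p) (sigma_cproj p)). Qed.

Lemma Gam_star p : Gam p -> fm_star N (cproj p).
Proof. by move=> [t0 /hloc[_ _ h] /h[]]. Qed.

Lemma cproj_idem p : cproj (cproj p) = cproj p :> 'cV[C]_(n.+1 * 2).
Proof. exact: cproj_cross. Qed.

Lemma glued : exists (D : set 'cV[C]_(n.+1 * 2)) (ext : I -> 'cV[C]_(n.+1 * 2) -> 'rV[C]_(n.+1 * 2 + 1)),
  [/\ open D, D `<=` fm_star N, forall p, Gam p -> D (cproj p),
    forall i q, D q -> solution (aconn N VN) (ext i) q &
    (forall i p, Gam p -> ext i (cproj p) = Zs i p) /\
    forall q, D q -> exists2 p, Gam p & segment_in D (cproj p) q].
Proof.
apply: gluing.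
- exact (star_open hNf).
- exact (aconn_linear N VN).
- move=> v; exact (aconn_hol VN hNf 2 v).
- move=> p u v sp; exact (aconn_flat hNf hVN u v sp).
- exact: blinear_cproj.
- exact: cproj_idem.
- exact: Gam_open.
- exact: Gam_cproj.
- exact: Gam_star.
- exact: Zs_cproj.
- by move=> i p [t0 /hloc[_ _ h] /h[_ _ /(_ i)[]]].
Qed.

Section Glued.
Variables (D : set 'cV[C]_(n.+1 * 2)) (ext : I -> 'cV[C]_(n.+1 * 2) -> 'rV[C]_(n.+1 * 2 + 1)).
Hypotheses (oD : open D) (Ds : D `<=` fm_star N) (GD : forall p, Gam p -> D (cproj p)).
Hypothesis ext_sol : forall i q, D q -> solution (aconn N VN) (ext i) q.
Hypothesis ext_Z : forall i p, Gam p -> ext i (cproj p) = Zs i p.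
Hypothesis D_seg : forall q, D q -> exists2 p, Gam p & segment_in D (cproj p) q.

Definition per i q : C := rsubmx (ext i q) 0 0.

Lemma per_odd i : odd_period N D (per i).
Proof. exact (solution_odd_period hNf hVN oD Ds (ext_sol i)). Qed.

Lemma per_grad i q : D q -> grad (per i) q = lsubmx (ext i q).
Proof. by move=> Dq; exact (solution_grad (ext_sol i Dq)). Qed.

Lemma per_Gam i p : Gam p -> per i (cproj p) =
  ww M V (dr M mu x G i) (dg x F i) (dphi x F i) (@tau R n) (@sigma R n) p 0 0.
Proof. by move=> gp; rewrite /per ext_Z // /Zs /zrow row_mxKr. Qed.

Lemma cross_segment t s t' s' :
  (forall u : R, 0 <= u <= 1 -> Gam (cross (t + creal u *: (t' - t)) (s + creal u * (s' - s)))) ->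
  segment_in D (cross t s) (cross t' s').
Proof.
move=> h u u01; have := GD (h u u01); rewrite cproj_cross.
by rewrite cross_line.
Qed.

Lemma Gam_cyl t0 t s : W t0 -> nm (t - t0) < dd t0 -> cRe s < rho t0 -> Gam (cross t s).
Proof. by move=> Wt0 h1 h2; exists t0 => //; split; rewrite ?tau_cross ?sigma_cross. Qed.

Lemma cyl_segment t0 t s t' s' : W t0 -> nm (t - t0) < dd t0 -> nm (t' - t0) < dd t0 ->
  cRe s < rho t0 -> cRe s' < rho t0 -> segment_in D (cross t s) (cross t' s').
Proof.
move=> Wt0 h1 h2 h3 h4; apply: cross_segment => u u01; apply: (Gam_cyl Wt0).
  exact: segment_ball.
exact: cRe_convex.
Qed.

(** The two points may belong to different cylinders; the one with the larger threshold contains the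
    whole segment. *)
Lemma fibre_segment t s s' : Gam (cross t s) -> Gam (cross t s') ->
  segment_in D (cross t s) (cross t s').
Proof.
move=> [a Wa [a1 a2]] [b Wb [b1 b2]]; rewrite !tau_cross !sigma_cross in a1 a2 b1 b2.
apply: cross_segment => u u01; rewrite subrr scaler0 addr0.
have [le|lt] := lerP (rho a) (rho b).
  by apply: (Gam_cyl Wb b1); apply: cRe_convex => //; exact: lt_le_trans a2 le.
by apply: (Gam_cyl Wa a1); apply: cRe_convex => //; exact: lt_trans b2 lt.
Qed.

Lemma lead_U i t : W t -> Pjet V (fm_U M) (dr M mu x G i) 1 t *m fm_U M t =
  dr M mu x G i t *m (V + (1 / 2)%:M).
Proof.
move=> Wt; rewrite PjetS Pjet_0 subr0.
exact (mulmxKV (star_unit hM (W_star hx Wt)) _).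
Qed.

Lemma shift_bounds (s : C) k : let s' := s - creal (4 * k%:R) in
  [/\ cRe s' <= cRe s, nm s' + 1 <= 4 * (nm s + 1) * k.+1%:R &
      0 <= nm (cexp s') <= expR (cRe s) * (1 / 16) ^+ k].
Proof.
move=> s'; have k0 : 0 <= k%:R :> R by [].
have e : cRe s' = cRe s - 4 * k%:R.
  by rewrite /s' cReD cReN -[creal _]mulr1 cRe_creal mulr1.
split.
- by rewrite e; lra.
- have h : nm s' <= nm s + 4 * k%:R.
    by rewrite (le_trans (nmB _ _)) // nm_creal ger0_norm // mulr_ge0.
  rewrite -natr1; have := nm_ge0 s; nra.
- rewrite nm_ge0 nm_cexp e expRD ler_wpM2l ?expR_ge0 //; exact: expR_shift.
Qed.

Lemma eti_facts : invmx (fm_eta M) *m V^T = - (V *m invmx (fm_eta M)) /\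
  (invmx (fm_eta M))^T = invmx (fm_eta M).
Proof.
have [t Wt] := flat_nonempty hx; have dt := W_dom hM hx Wt.
split; last by rewrite trmx_inv (frob_eta_sym hM).
rewrite -mulNmx; apply: eta_flip (frob_eta_unit hM) _.
by rewrite mulmxN -(hV hmu dt); exact (V_tr hM dt).
Qed.

(* Along s - 4k the bracket is constant while the corrections to its leading part
   are O(k^2 exp(-4k)). *)
Lemma poisson_Gam i j p : Gam p ->
  poisson N (per i) (per j) (cproj p) = lead_bracket M mu x G F i j (tau p) 0 0.
Proof.
move=> [t0 Wt0 cp]; have gp : Gam p by exists t0.
have [h1 h2] := cp; have [_ K0 hl] := hloc Wt0.
set t := tau p in h1 *; set s := sigma p in h2.
have Wt : W t := Gam_W gp.
pose P i := Pjet V (fm_U M) (dr M mu x G i) 1 t.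
pose m i := nm (P i) + nm (dg x F i t) + nm (dr M mu x G i t).
have m0 l : 0 <= m l by rewrite !addr_ge0 ?nm_ge0.
pose mm := m i + m j; have mm0 : 0 <= mm by exact: addr_ge0.
pose B1 := invmx (fm_eta M) *m (V + (1 / 2)%:M)^T.
pose B2 := invmx (fm_eta M) *m (V - (1 / 2)%:M)^T.
pose S := 4 * (nm s + 1); have S0 : 0 <= S by rewrite mulr_ge0 ?addr_ge0 ?nm_ge0.
pose bound := KK t0 * S ^+ 2 * expR (cRe s) * (2 * mm + KK t0 * expR (cRe s)).
pose cc : R := n.+1%:R * n.+1%:R * nm B1 + n.+1%:R * n.+1%:R * nm B2.
apply/eqP; rewrite -subr_eq0; apply/eqP; apply: nm_eq0.
apply: (eq0_halving (c := cc * bound) (nm_ge0 _)) => k.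
pose sk := s - creal (4 * k%:R); pose pk : 'cV[C]_(n.+1 * 2) := cross t sk.
have [r1 r2 r3] := shift_bounds s k.
have hk : cRe sk < rho t0 by exact: le_lt_trans r1 h2.
have tk : tau pk = t by exact: tau_cross.
have ssk : sigma pk = sk by exact: sigma_cross.
have gk : Gam pk by exact: Gam_cyl Wt0 h1 hk.
have ck : cproj pk = pk by exact: cproj_cross.
have cyk : cyl t0 (dd t0) (rho t0) pk by split; rewrite ?tk ?ssk.
have Dk : D pk by rewrite -ck; exact: GD.
have [_ _ hZ] := hl _ cyk.
have -> : poisson N (per i) (per j) (cproj p) = poisson N (per i) (per j) pk.
  exact (poisson_segment hNf hVN (per_odd i) (per_odd j) (cyl_segment Wt0 h1 h1 hk h2)).
have ex l : lsubmx (ext l pk) = rr (xi1 M V (dr M mu x G l) (dg x F l) (@tau R n) (@sigma R n) pk)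
    (xi2 M V (dr M mu x G l) (dg x F l) (@tau R n) (@sigma R n) pk).
  by have := ext_Z l gk; rewrite ck => ->; rewrite /Zs /zrow row_mxKl.
rewrite (poissonE hVN _ _ (star_dom hNf (Ds Dk))) (per_grad i Dk) (per_grad j Dk) (ex i) (ex j).
rewrite (bracket_rr hM hN) -/B1 -/B2 -sub00.
have [eV et] := eti_facts.
(* Holds exactly for every value of [s], so the quantity compared with the bracket does not move
   with [k]. *)
have LB : lead_bracket M mu x G F i j t =
    (sk *: P i + dg x F i t) *m B1 *m (dr M mu x G j t)^T
    + dr M mu x G i t *m B2 *m (sk *: P j + dg x F j t)^T.
  exact (esym (@leading_bracket R n.+1 (P i) (dg x F i t) (dr M mu x G i t) (P j) (dg x F j t)
    (dr M mu x G j t) (fm_U M t) V (invmx (fm_eta M)) sk (1 / 2) (lead_U i Wt) (lead_U j Wt) eV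
    (K_sym hM hx Wt) et)).
rewrite LB.
have [_ [a1 a2 _ _]] := hZ i; have [_ [b1 b2 _ _]] := hZ j.
rewrite tk ssk in a1 a2 b1 b2; rewrite -/(P i) in a1; rewrite -/(P j) in b1.
set e := KK t0 * (nm sk + 1) * nm (cexp sk) in a1 a2 b1 b2.
pose y := nm sk + 1; have y1 : 1 <= y by rewrite /y lerDr nm_ge0.
have big l : l = i \/ l = j ->
    nm (sk *: P l + dg x F l t) <= mm * y /\ nm (dr M mu x G l t) <= mm * y.
  move=> lij; have lm : m l <= mm by case: lij => ->; rewrite /mm ?lerDl ?lerDr.
  have ml : m l * y <= mm * y by rewrite ler_wpM2r // (le_trans ler01).
  have [x1 x2 x3] : [/\ 0 <= nm (P l), 0 <= nm (dg x F l t) & 0 <= nm (dr M mu x G l t)].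
    by split; exact: nm_ge0.
  split; apply: le_trans ml.
    apply: (le_trans (nmD _ _)); rewrite nmZ /m /y.
    have := nm_ge0 sk; move: x1 x2 x3; move: (nm (P l)) (nm (dg x F l t))
      (nm (dr M mu x G l t)) (nm sk) => *; nra.
  rewrite /m; move: x1 x2 x3 y1; move: (nm (P l)) (nm (dg x F l t)) (nm (dr M mu x G l t)) y => *; nra.
have [l1 m1] := big i (or_introl erefl); have [l2 m2] := big j (or_intror erefl).
have E1 := bilinear_error B1 a1 b2 l1 m2.
have E2 := bilinear_error B2 a2 b1 m1 l2.
have dec : e * (2 * (mm * y) + e) <= bound * (1 / 2) ^+ k.
  apply: (decay_bound K0 mm0 (expR_ge0 _) S0); last exact: r3.
  - by rewrite addr_ge0 ?nm_ge0.
  - exact: r2.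
have n2 (B : 'M[C]_n.+1) : 0 <= n.+1%:R * n.+1%:R * nm B by rewrite !mulr_ge0 ?nm_ge0.
apply: (le_trans (nm_entry _ _ _)).
rewrite opprD addrACA (le_trans (nmD _ _)) // (le_trans (lerD E1 E2)) //.
exact: two_errors (n2 B1) (n2 B2) dec.
Qed.

Lemma D_poisson i j q : D q -> exists2 t, W t &
  poisson N (per i) (per j) q = lead_bracket M mu x G F i j t 0 0.
Proof.
move=> /D_seg[p gp hs]; exists (tau p); first exact: Gam_W.
by rewrite (poisson_segment hNf hVN (per_odd i) (per_odd j) hs) poisson_Gam.
Qed.

Lemma per_canonical : canonically_conjugate N D (fun a => per (inl a)) (fun a => per (inr a)).
Proof.
move=> q a b Dq; split.
- have [t Wt e] := D_poisson (inl a) (inr b) Dq.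
  have [h1 h2 h3] := lead_bracketE hM hmu hx hF a b Wt; exact (etrans e h1).
- have [t Wt e] := D_poisson (inl a) (inl b) Dq.
  have [h1 h2 h3] := lead_bracketE hM hmu hx hF a b Wt; exact (etrans e h2).
- have [t Wt e] := D_poisson (inr a) (inr b) Dq.
  have [h1 h2 h3] := lead_bracketE hM hmu hx hF a b Wt; exact (etrans e h3).
Qed.

(** The vanishing of the gradient propagates along a fibre, then over [W] by connectedness, and
    finally off the cross along the segments contained in [D]. *)
Lemma odd_vanish w t0 s0 : odd_period N D w -> Gam (cross t0 s0) ->
  grad w (cross t0 s0) = 0 -> forall q, D q -> w q = w (cross t0 s0).
Proof.
move=> ow g0 gw.
have step p q : segment_in D p q -> grad w p = 0 -> grad w q = 0 /\ w q = w p.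
  move=> hs; exact (odd_segment_unique hNf hVN (fun a => per_odd (inl a)) (fun a => per_odd (inr a))
    per_canonical (fun _ h => h) ow hs).
pose P t := forall s, Gam (cross t s) -> grad w (cross t s) = 0 /\ w (cross t s) = w (cross t0 s0).
have from t s : Gam (cross t s) -> grad w (cross t s) = 0 -> w (cross t s) = w (cross t0 s0) -> P t.
  move=> gs h1 h2 s' gs'; have [e1 e2] := step _ _ (fibre_segment gs gs') h1.
  exact (conj e1 (etrans e2 h2)).
have allP t : W t -> P t.
  apply: (connected_ind (flat_connected hx) (x0 := t0)).
  - by have := Gam_W g0; rewrite tau_cross.
  - exact (from _ _ g0 gw erefl).
  - move=> a Wa; have [da _ _] := hloc Wa; apply/nbhs_nmP; exists (dd a); first exact da.
    move=> b hb Wb.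
    pose s := creal (rho a - 1) : C.
    have hs : cRe s < rho a by rewrite cRe_realpart ltrBlDr ltrDl.
    have aa : nm (a - a) < dd a by rewrite subrr nm0.
    have ga := Gam_cyl Wa aa hs; have gb := Gam_cyl Wa hb hs.
    split => h.
      have [h1 h2] := h s gb.
      have [e1 e2] := step _ _ (cyl_segment Wa hb aa hs hs) h1.
      exact (from _ _ ga e1 (etrans e2 h2)).
    have [h1 h2] := h s ga.
    have [e1 e2] := step _ _ (cyl_segment Wa aa hb hs hs) h1.
    exact (from _ _ gb e1 (etrans e2 h2)).
move=> q /D_seg[p gp hs]; have gc := Gam_cproj gp.
have [h1 h2] := allP _ (Gam_W gp) (sigma p) gc.
have [_ h3] := step _ _ hs h1; exact (etrans h3 h2).
Qed.

Lemma Gam_nonempty : exists t0 s0, Gam (cross t0 s0).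
Proof.
have [a Wa] := flat_nonempty hx; have [da _ _] := hloc Wa.
exists a, (creal (rho a - 1)); apply: (Gam_cyl Wa); first by rewrite subrr nm0.
by rewrite cRe_realpart ltrBlDr ltrDl.
Qed.

Lemma per_independent (c : I -> C) p : D p -> \sum_i c i *: grad (per i) p = 0 -> forall i, c i = 0.
Proof.
move=> Dp h0; have dp := star_dom hNf (Ds Dp).
have key j : \sum_i c i * poisson N (per i) (per j) p = 0.
  have e := congr1 (fun v : 'rV[C]_(n.+1 * 2) =>
    (v *m (invmx (fm_eta N) *m VN^T) *m (grad (per j) p)^T) 0 0) h0.
  rewrite /= pairing_sum in e; apply: etrans (etrans e _).
    by apply: eq_bigr => i _; rewrite (poisson_pairing hVN (per i) (per j) dp).
  by rewrite !mul0mx mxE.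
apply: (pairing_dual (P := fun i j => poisson N (per i) (per j) p)) key => a b.
have [h1 h2 h3] := per_canonical a b Dp; have [h4 _ _] := per_canonical b a Dp.
split; [exact h1|exact h2|exact h3|].
by rewrite (poisson_skew hNf hVN (per (inr a)) (per (inl b)) dp) h4 eq_sym.
Qed.

(** The brackets at one point of the cross give the coefficients, and the difference has zero
    gradient there, hence is constant on [D]. Two expansions of the same period differ by a relation
    among gradients, excluded by the pairing. *)
Lemma per_basis : odd_period_basis N D
  (XY_family (fun a => per (inl a)) (fun a => per (inr a))).
Proof.
have fE i : XY_family (fun a => per (inl a)) (fun a => per (inr a)) i = per i by case: i.
split; first by move=> i; rewrite fE; exact: per_odd.
move=> w ow; have [t0 [s0 g0]] := Gam_nonempty.
have D0 : D (cross t0 s0) by have := GD g0; rewrite cproj_cross.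
pose c0 : 'cV[C]_(n.+1 * 2) := cross t0 s0.
pose c (i : I) := match i with inl a => poisson N w (per (inr a)) c0
  | inr a => - poisson N w (per (inl a)) c0 end.
have [ow1 gr1] := odd_period_sum hNf hVN (index_enum I) c 0 oD Ds per_odd.
have [ow2 gr2] := odd_period_comb hNf hVN (-1) 0 ow ow1.
have z : grad (fun p => w p + -1 * (\sum_i c i * per i p + 0) + 0) c0 = 0.
  rewrite gr2 // gr1 // scaleN1r big_sumType /=.
  rewrite (canonical_expansion hNf hVN (fun a => per_odd (inl a)) per_canonical w D0).
  exact (expansion_sub _ _ _ _ _ _).
exists ([ffun i => c i], w c0 - \sum_i c i * per i c0); split => /=.
  move=> p Dp; have := odd_vanish ow2 g0 z Dp; rewrite !addr0 !mulN1r.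
  have e q : \sum_i [ffun i => c i] i * XY_family (fun a => per (inl a)) (fun a => per (inr a)) i q
     = \sum_i c i * per i q by apply: eq_bigr => i _; rewrite ffunE fE.
  by rewrite e => /eqP; rewrite subr_eq => /eqP ->; rewrite addrC.
move=> [k1 k2] /= hk.
pose d i := k1 i - c i; pose dk := k2 - (w c0 - \sum_i c i * per i c0).
have hz p : D p -> \sum_i d i * per i p + dk = 0.
  move=> Dp; have := odd_vanish ow2 g0 z Dp; rewrite !addr0 !mulN1r => e1.
  have -> : \sum_i d i * per i p = \sum_i k1 i * per i p - \sum_i c i * per i p.
    by rewrite -sumrB; apply: eq_bigr => i _; rewrite mulrBl.
  have e2 := hk p Dp; rewrite (eq_bigr (fun i => k1 i * per i p)) in e2; last by move=> i _; rewrite fE.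
  by rewrite /dk -e1 e2; ring.
have [od gd] := odd_period_sum hNf hVN (index_enum I) d dk oD Ds per_odd.
have gd0 : \sum_i d i *: grad (per i) c0 = 0.
  apply: (etrans (esym (gd _ D0))); apply: grad_near0.
  by apply: filterS (open_near oD D0) => p Dp; rewrite hz.
have d0 := per_independent D0 gd0.
congr pair.
  by apply/ffunP => i; rewrite ffunE; apply/esym/eqP; rewrite -subr_eq0; apply/eqP; exact: d0.
apply/esym/eqP; rewrite -subr_eq0; apply/eqP.
by have := hz _ D0; rewrite big1 ?add0r // => i _; rewrite d0 mul0r.
Qed.

Lemma per_estimate i t0 t s : W t0 -> nm (t - t0) < dd t0 -> cRe s < rho t0 ->
  nm (per i (cross t s) - (s * (dr M mu x G i t *m fm_e M) 0 0 + dphi x F i t 0 0))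
    <= KK t0 * (nm s + 1) * nm (cexp s) /\
  forall a, i = inl a ->
  nm (per i (cross t s) - (s * (dr M mu x G i t *m fm_e M) 0 0 + dphi x F i t 0 0))
    <= KK t0 * nm (cexp s).
Proof.
move=> Wt0 h1 h2; have g := Gam_cyl Wt0 h1 h2.
have [_ _ hl] := hloc Wt0.
have cp : cyl t0 (dd t0) (rho t0) (cross t s) by split; rewrite ?tau_cross ?sigma_cross.
have [_ _ /(_ i)[_ [_ _ e3 e4]]] := hl _ cp.
rewrite tau_cross sigma_cross in e3 e4.
have pe := per_Gam i g; rewrite cproj_cross in pe.
set w := ww _ _ _ _ _ _ _ _ in e3 e4 pe.
set v := s *: _ + _ in e3 e4.
have vE : s * (dr M mu x G i t *m fm_e M) 0 0 + dphi x F i t 0 0 = v 0 0.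
  by rewrite /v [RHS]mxE [X in _ = X + _]mxE.
rewrite vE pe -(sub00 w v); split; first exact: le_trans (nm_entry _ _ _) e3.
by move=> a /e4; exact: le_trans (nm_entry _ _ _).
Qed.

Lemma near_dd t0 : W t0 -> \forall t \near t0, nm (t - t0) < dd t0.
Proof. by move=> /hloc[d0 _ _]; apply/nbhs_nmP; exists (dd t0). Qed.

Lemma per_dom : near_Q0 W (fun t s => D (cross t s)).
Proof.
move=> t0 Wt0; exists (rho t0); apply: filterS (near_dd Wt0) => t h1 s h2.
by have := GD (Gam_cyl Wt0 h1 h2); rewrite cproj_cross.
Qed.

Lemma per_bigO a : cross_bigO W (per (inl a)) (fun t => x t a 0).
Proof.
move=> t0 Wt0; exists (creal (KK t0)), (rho t0); apply: filterS (near_dd Wt0) => t h1 s h2.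
have [_ /(_ a erefl)] := per_estimate (inl a) Wt0 h1 h2.
have -> : (dr M mu x G (inl a) t *m fm_e M) 0 0 = 0 by rewrite /= /rup mul0mx mxE.
have -> : dphi x F (inl a) t 0 0 = x t a 0 by rewrite /= /phiup mxE eqxx mulr1n.
rewrite mulr0 add0r.
by rewrite !nmE -crealM creal_le.
Qed.

Lemma per_littleo a : cross_littleo1 W (per (inr a))
  (fun t s => (invmx G *m x t) a 0 * s - 2 * 'D_(del C a) F (x t)).
Proof.
move=> t0 Wt0 b eps eps0; have [_ K0 _] := hloc Wt0.
have [r hr] := sector_decay b K0 eps0.
exists (Num.min r (rho t0)); near=> t.
have h1 : nm (t - t0) < dd t0 by near: t; exact: near_dd.
have Wt : W t by near: t; exact: open_near (flat_open hx) Wt0.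
move=> s; rewrite lt_min => /andP[s1 s2] sb.
have [e _] := per_estimate (inr a) Wt0 h1 s2.
have e1 : (dr M mu x G (inr a) t *m fm_e M) 0 0 = (invmx G *m x t) a 0.
  by rewrite /= (rlow_e hM hmu hx a Wt) mxE [X in _ * X]mxE eqxx mulr1n mulr1.
have e2 : dphi x F (inr a) t 0 0 = (-2) * 'D_(del C a) F (x t).
  by rewrite /= /philow mxE eqxx mulr1n.
rewrite e1 e2 in e.
rewrite nmE creal_le; apply: le_trans (hr s s1 sb).
by rewrite [_ 0 * s]mulrC -mulNr.
Unshelve. all: by end_near. Qed.

Lemma per_system : period_system N W x G F D (fun a => per (inl a)) (fun a => per (inr a)).
Proof. by split; [exact: per_dom|exact: per_basis|exact: per_bigO|exact: per_littleo]. Qed.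

End Glued.
End Existence.

Section PeriodSystems.
Variable R : realType.
Local Notation C := (Cplx R).
Variables (n : nat) (M : frob_data C n.+1) (mu : 'I_n.+1 -> C) (N : frob_data C (n.+1 * 2)).
Variables (W : set 'cV[C]_n.+1) (x : 'cV[C]_n.+1 -> 'cV[C]_n.+1) (G : 'M[C]_n.+1).
Hypotheses (hM : is_frobenius M) (hmu : normalized_diag M mu) (hN : tensor_qh M mu N).
Hypothesis hx : flat_coordinates M W x G.

Theorem period_system_exists F : dual_potential M W x G F ->
  exists (D : set 'cV[C]_(n.+1 * 2)) (X Y : 'I_n.+1 -> 'cV[C]_(n.+1 * 2) -> C),
    period_system N W x G F D X Y /\ canonically_conjugate N D X Y.
Proof.
move=> hF.
have /choice[c hc] : forall t0, exists c : R * R * R, W t0 -> [/\ 0 < c.1.1, 0 <= c.2 &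
    forall p, cyl t0 c.1.1 c.1.2 p -> [/\ W (tau p), fm_star N (cproj p) &
    forall i, restricted_solution (aconn N (VN mu)) (@cproj R n) (Zs M mu x G F i) p /\
      asymptotics M mu x G F c.2 p i]].
  move=> t0; have [Wt0|nW] := pselect (W t0); last by exists (0, 0, 0).
  by have [d [rho [K h]]] := local_data hM hmu hN hx hF Wt0; exists (d, rho, K).
pose dd t := (c t).1.1; pose rho t := (c t).1.2; pose KK t := (c t).2.
have hloc : forall t0, W t0 -> [/\ 0 < dd t0, 0 <= KK t0 &
  forall p, cyl t0 (dd t0) (rho t0) p -> [/\ W (tau p), fm_star N (cproj p) &
    forall i, restricted_solution (aconn N (VN mu)) (@cproj R n) (Zs M mu x G F i) p /\
      asymptotics M mu x G F (KK t0) p i]] by exact hc.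
have [D [ext [oD Ds GD es [eZ Dseg]]]] := glued hN hloc.

exists D, (fun a => per ext (inl a)), (fun a => per ext (inr a)); split.
  exact (per_system hM hmu hN hx hF hloc oD Ds GD es eZ Dseg).
exact (per_canonical hM hmu hN hx hF hloc oD Ds GD es eZ Dseg).
Qed.

End PeriodSystems.

(** * Uniqueness *)

Section PotentialAmbiguity.
Variable R : realType.
Local Notation C := (Cplx R).

Lemma connected_hasD0 (V : normedModType C) m k (A : set V) (f : V -> 'M[C]_(m, k)) :
  open A -> connected A -> (forall p, A p -> hasD f p (fun=> 0)) ->
  forall p q, A p -> A q -> f q = f p.
Proof.
move=> oA cA h p q Ap.
apply: (connected_ind (P := fun q => f q = f p) cA Ap (erefl _)) => a Aa.
have /nbhs_nmP[d d0 hd] := open_near oA Aa.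
have e b : nm (b - a) < d -> f b = f a.
  move=> hb; apply: hasD0_segment => r r01; apply: h; apply: hd.
  by apply: segment_ball => //; rewrite subrr nm0.
by apply/nbhs_nmP; exists d => // b /e -> _.
Qed.

Lemma trmxB_sym n (A B : 'M[C]_n) : A^T = A -> B^T = B -> (A - B)^T = A - B.
Proof. by move=> eA eB; rewrite linearB /= eA eB. Qed.

Lemma mulmx_cancel m n k (u : 'M[C]_(m, n)) (a b : 'M[C]_(n, k)) : u *m (a + b) - u *m a - u *m b = 0.
Proof. by rewrite mulmxDr [u *m a + _]addrC addrK subrr. Qed.

(** The factor [1 / 2] makes [H] the Hessian and [H y + l] the gradient. *)
Definition quad (n : nat) (H : 'M[C]_n) (l : 'cV[C]_n) (c : C) (y : 'cV[C]_n) : C :=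
  (y^T *m ((1 / 2) *: H) *m y) 0 0 + (l^T *m y) 0 0 + c.

Lemma quad_quadratic n (H : 'M[C]_n.+1) l c : is_quadratic (quad H l c).
Proof. by exists ((1 / 2) *: H), l^T, c. Qed.

Lemma quad_form_hasD (V : normedModType C) n (H : 'M[C]_n) (l : 'cV[C]_n) (y : V -> 'cV[C]_n) p L :
  H^T = H -> hasD y p L ->
  hasD (fun p => (y p)^T *m ((1 / 2) *: H) *m y p + l^T *m y p) p
    (fun v => (L v)^T *m (H *m y p + l)).
Proof.
move=> sH hy.
have hT := hasD_comp hy (hasD_lin _ (blinear_trmx (blinear_id _))).
have h1 := hasD_mulmx (hasD_mulmx hT (hasD_cst ((1 / 2) *: H) p)) hy.
have h2 := hasD_mulmx (hasD_cst l^T p) hy.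
apply: hasD_eqD (hasDD h1 h2) _ => v.
have tr (u w : 'cV[C]_n) : u^T *m w = w^T *m u.
  by rewrite -[LHS]trmxK trmx_mul trmxK; apply/matrixP => i j; rewrite !ord1 mxE.
have e1 : (L v)^T *m ((1 / 2) *: H) *m y p = (1 / 2) *: ((L v)^T *m (H *m y p)).
  by rewrite -scalemxAr -scalemxAl mulmxA.
have e2 : (y p)^T *m ((1 / 2) *: H) *m L v = (1 / 2) *: ((L v)^T *m (H *m y p)).
  rewrite -scalemxAr -scalemxAl; congr (_ *: _).
  by rewrite (tr (L v)) trmx_mul sH.
rewrite mul0mx add0r mulmx0 addr0 e1 e2 -scalerDl (tr l) mulmxDr.
have -> : 1 / 2 + 1 / 2 = 1 :> C by field.
by rewrite scale1r.
Qed.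

Lemma quad_hasD n (H : 'M[C]_n) (l : 'cV[C]_n) c y : H^T = H ->
  hasD (quad H l c) y (fun v => (v^T *m (H *m y + l)) 0 0).
Proof.
move=> sH.
have h := quad_form_hasD l sH (hasD_lin y (blinear_id _)).
have h1 := hasDD (hasD_entry 0 0 h) (hasD_cst c y).
apply: (hasD_ext (f := fun y => (y^T *m ((1 / 2) *: H) *m y + l^T *m y) 0 0 + c)).
  by near=> q; rewrite /quad mxE.
by apply: hasD_eqD h1 _ => v; rewrite addr0.
Unshelve. all: by end_near. Qed.

Lemma quad_derive n (H : 'M[C]_n) (l : 'cV[C]_n) c y a : H^T = H ->
  'D_(del C a) (quad H l c) y = \sum_b H a b * y b 0 + l a 0.
Proof.
move=> sH; rewrite (hasD_derive (quad_hasD l c y sH)) trmx_delta -rowE !mxE.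
by [].
Qed.

Variables (n : nat) (M : frob_data C n.+1).
Variables (W : set 'cV[C]_n.+1) (x : 'cV[C]_n.+1 -> 'cV[C]_n.+1) (G : 'M[C]_n.+1).
Hypotheses (hM : is_frobenius M) (hx : flat_coordinates M W x G).
Variables F F' : 'cV[C]_n.+1 -> C.
Hypotheses (hF : dual_potential M W x G F) (hF' : dual_potential M W x G F').

(* The third derivatives of a dual potential are prescribed by the product. *)
Lemma dual_potential_unique : exists (H : 'M[C]_n.+1) (l : 'cV[C]_n.+1) (c : C),
  [/\ H^T = H, forall t, W t -> F' (x t) = F (x t) + quad H l c (x t) &
    forall t, W t -> gradc F' (x t) = gradc F (x t) + (H *m x t + l)].
Proof.
have [t1 Wt1] := flat_nonempty hx; have oW := flat_open hx; have cW := flat_connected hx.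
pose H := Hess F' (x t1) - Hess F (x t1).
(* Three integrations over the connected set [W]: the differences of Hessians, then of gradients,
   then of values are each reduced to a constant. *)
have HE t : W t -> Hess F' (x t) - Hess F (x t) = H.
  move=> Wt; apply: (connected_hasD0 (f := fun t => Hess F' (x t) - Hess F (x t)) oW cW) Wt1 Wt => p Wp.
  exact: hasD_eqD (hasDB (Hess_hasD hM hx hF' Wp) (Hess_hasD hM hx hF Wp)) (fun v => subrr _).
have sH : H^T = H.
  exact (trmxB_sym (Hess_sym hx hF' Wt1) (Hess_sym hx hF Wt1)).
pose l := gradc F' (x t1) - gradc F (x t1) - H *m x t1.
have lE t : W t -> gradc F' (x t) - gradc F (x t) - H *m x t = l.
  move=> Wt; apply: (connected_hasD0 (f := fun t => gradc F' (x t) - gradc F (x t) - H *m x t) oW cW) Wt1 Wt => p Wp.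
  apply: hasD_eqD (hasDB (hasDB (gradc_hasD hx hF' Wp) (gradc_hasD hx hF Wp))
    (hasD_mulmx (hasD_cst H p) (x_hasD hx Wp))) _ => v.
  by rewrite mul0mx add0r -(HE _ Wp) !mulmxBl subrr.
have gE t : W t -> gradc F' (x t) = gradc F (x t) + (H *m x t + l).
  by move=> Wt; rewrite -(lE _ Wt) [H *m _ + _]addrC subrK addrC subrK.
pose f t : 'M[C]_1 := (F' (x t))%:M - (F (x t))%:M
  - ((x t)^T *m ((1 / 2) *: H) *m x t + l^T *m x t).
have fE t : W t -> f t = f t1.
  move=> Wt; apply: (connected_hasD0 (f := f) oW cW) Wt1 Wt => p Wp.
  apply: hasD_eqD (hasDB (hasDB (Fx_hasD hx hF' Wp) (Fx_hasD hx hF Wp))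
    (quad_form_hasD l sH (x_hasD hx Wp))) _ => v.
  rewrite (gE _ Wp); exact (mulmx_cancel _ _ _).
exists H, l, (f t1 0 0); split=> // t Wt.
by rewrite -(fE _ Wt) /quad /f !mxE eqxx !mulr1n; ring.
Qed.

End PotentialAmbiguity.

(** * Asymptotic expansions along the cross *)

Section Asymptotics.
Variable R : realType.
Local Notation C := (Cplx R).
Variables (n : nat) (W : set 'cV[C]_n.+1).
Implicit Types (f : 'cV[C]_(n.+1 * 2) -> C) (g : 'cV[C]_n.+1 -> C -> C).

Lemma near_Q0_and (P Q : 'cV[C]_n.+1 -> C -> Prop) : near_Q0 W P -> near_Q0 W Q ->
  near_Q0 W (fun t s => P t s /\ Q t s).
Proof.
move=> hP hQ t0 Wt0; have [r1 h1] := hP _ Wt0; have [r2 h2] := hQ _ Wt0.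
exists (Num.min r1 r2); apply: filterS2 h1 h2 => t h1 h2 s; rewrite lt_min => /andP[s1 s2].
by split; [exact: h1|exact: h2].
Qed.

Lemma near_Q0_sub (P Q : 'cV[C]_n.+1 -> C -> Prop) : (forall t s, P t s -> Q t s) ->
  near_Q0 W P -> near_Q0 W Q.
Proof.
move=> PQ hP t0 Wt0; have [r h] := hP _ Wt0; exists r; apply: filterS h => t h s hs.
exact: PQ (h s hs).
Qed.

Lemma littleo_ext f g g' : open W -> (forall t s, W t -> g t s = g' t s) ->
  cross_littleo1 W f g -> cross_littleo1 W f g'.
Proof.
move=> oW e h t0 Wt0 b eps e0; have [r hr] := h _ Wt0 b eps e0; exists r.
by apply: filterS2 hr (open_near oW Wt0) => t ht Wt s s1 s2; rewrite -e //; exact: ht.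
Qed.

Lemma littleo_comb f f' g g' (c k : C) : cross_littleo1 W f g -> cross_littleo1 W f' g' ->
  cross_littleo1 W (fun p => f p + c * f' p + k) (fun t s => g t s + c * g' t s + k).
Proof.
move=> h h' t0 Wt0 b eps e0.
have c1 : 0 < nm c + 1 by rewrite (lt_le_trans ltr01) // lerDr nm_ge0.
have [r1 h1] := h t0 Wt0 b _ (divr_gt0 e0 (ltr0n _ 2)).
have [r2 h2] := h' t0 Wt0 b _ (divr_gt0 (divr_gt0 e0 (ltr0n _ 2)) c1).
exists (Num.min r1 r2); apply: filterS2 h1 h2 => t h1 h2 s; rewrite lt_min => /andP[s1 s2] sb.
have := h1 s s1 sb; have := h2 s s2 sb; rewrite !nmE !creal_le => k2 k1.
have -> : f (cross t s) + c * f' (cross t s) + k - (g t s + c * g' t s + k) =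
  (f (cross t s) - g t s) + c * (f' (cross t s) - g' t s) by ring.
apply: (le_trans (nmD _ _)); rewrite [nm (c * _)](nmZ c).
have k3 : nm c * nm (f' (cross t s) - g' t s) <= eps / 2.
  apply: (@le_trans _ _ ((nm c + 1) * (eps / 2 / (nm c + 1)))).
    by apply: ler_pM; rewrite ?nm_ge0 // lerDl.
  by rewrite mulrC divfK // gt_eqF.
by rewrite [leRHS]splitr lerD.
Qed.

Lemma littleo_cst (k : C) : cross_littleo1 W (fun=> k) (fun _ _ => k).
Proof.
move=> t0 Wt0 b eps e0; exists 0; near=> t => s _ _.
by rewrite subrr normr0 -[0]/(creal 0) creal_le ltW.
Unshelve. all: by end_near. Qed.

Lemma littleo_sum (I : Type) (r : seq I) (c : I -> C) (f : I -> 'cV[C]_(n.+1 * 2) -> C)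
    (g : I -> 'cV[C]_n.+1 -> C -> C) k : (forall i, cross_littleo1 W (f i) (g i)) ->
  cross_littleo1 W (fun p => \sum_(i <- r) c i * f i p + k) (fun t s => \sum_(i <- r) c i * g i t s + k).
Proof.
move=> h; elim: r => [|i r IH].
  have -> : (fun p => \sum_(i <- [::]) c i * f i p + k) = (fun=> k).
    by apply/funext => p; rewrite big_nil add0r.
  have -> : (fun t s => \sum_(i <- [::]) c i * g i t s + k) = (fun _ _ => k).
    by apply/funext => t; apply/funext => s; rewrite big_nil add0r.
  exact: littleo_cst.
have -> : (fun p => \sum_(j <- i :: r) c j * f j p + k) =
    (fun p => (\sum_(j <- r) c j * f j p + k) + c i * f i p + 0).
  by apply/funext => p; rewrite big_cons; ring.
have -> : (fun t s => \sum_(j <- i :: r) c j * g j t s + k) =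
    (fun t s => (\sum_(j <- r) c j * g j t s + k) + c i * g i t s + 0).
  by apply/funext => t; apply/funext => s; rewrite big_cons; ring.
exact: littleo_comb.
Qed.

(** The constant [k] is an arbitrary complex number, so the inequality in [C] is first weakened to
    one with its modulus; [sector_decay] then applies, with room for an additional logarithm. *)
Lemma bigO_littleo f (g : 'cV[C]_n.+1 -> C) : cross_bigO W f g -> cross_littleo1 W f (fun t _ => g t).
Proof.
move=> h t0 Wt0 b eps e0; have [k [r1 h1]] := h _ Wt0.
have [r2 h2] := sector_decay b (nm_ge0 k) e0.
exists (Num.min r1 r2); apply: filterS h1 => t h1 s; rewrite lt_min => /andP[s1 s2] sb.
have := h1 s s1; rewrite !nmE creal_le lecE => /andP[_ h3].
have h4 : nm (f (cross t s) - g t) <= nm k * nm (cexp s).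
  rewrite (le_trans h3) // (le_trans (le_trans (ler_norm _) (cRe_le_nm (k * creal (nm (cexp s)))))) //.
  by rewrite (nmZ k) nm_creal ger0_norm ?nm_ge0.
apply: (le_trans h4); apply: le_trans (h2 s s2 sb); rewrite -mulrA ler_wpM2l ?nm_ge0 //.
by rewrite ler_peMl ?nm_ge0 // lerDr nm_ge0.
Qed.

Lemma littleo_at f g t : W t -> cross_littleo1 W f g -> forall eps : R, 0 < eps -> exists rho : R,
  forall s, cRe s < rho -> cIm s = 0 -> nm (f (cross t s) - g t s) <= eps.
Proof.
move=> Wt h eps e0; have [r hr] := h t Wt 0 eps e0; exists r => s hs si.
have := nbhs_singleton hr s hs; rewrite si normr0 lexx => /(_ isT).
by rewrite nmE creal_le.
Qed.

(** Subtracting the values at two real points one unit apart isolates [B]; then [A] is itself a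
    value of the small quantity. *)
Lemma affine_limit0 (A B : C) (rho0 : R) : (forall eps : R, 0 < eps -> exists rho : R,
  forall s : C, cRe s < rho -> cRe s < rho0 -> cIm s = 0 -> nm (A + B * s) <= eps) -> A = 0 /\ B = 0.
Proof.
move=> h.
have key (v : C) : (forall eps : R, 0 < eps -> nm v <= eps) -> v = 0.
  move=> hv; apply: nm_eq0; apply/eqP; rewrite eq_le nm_ge0 andbT; apply/ler_addgt0Pr => e e0.
  by rewrite add0r; exact: hv.
have B0 : B = 0.
  apply: key => eps e0; have [r hr] := h _ (divr_gt0 e0 (ltr0n _ 2)).
  pose m := Num.min r rho0 - 1.
  have m1 : m < r by rewrite /m ltrBlDr (@le_lt_trans _ _ r) ?ltrDl // ge_min lexx.
  have m2 : m < rho0 by rewrite /m ltrBlDr (@le_lt_trans _ _ rho0) ?ltrDl // ge_min lexx orbT.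
  have k1 := hr (creal m) m1 m2 (erefl _).
  have k2 : nm (A + B * creal (m - 1)) <= eps / 2.
    by apply: hr => //; rewrite cRe_realpart; move: m1 m2; lra.
  have -> : B = (A + B * creal m) - (A + B * creal (m - 1)).
    rewrite (_ : creal m = creal (m - 1) + 1); first by ring.
    by rewrite -creal1 -crealD subrK.
  by apply: (le_trans (nmB _ _)); rewrite [leRHS]splitr lerD.
split=> //; apply: key => eps e0; have [r hr] := h _ e0.
pose m := Num.min r rho0 - 1.
have m1 : m < r by rewrite /m ltrBlDr (@le_lt_trans _ _ r) ?ltrDl // ge_min lexx.
have m2 : m < rho0 by rewrite /m ltrBlDr (@le_lt_trans _ _ rho0) ?ltrDl // ge_min lexx orbT.
by have := hr (creal m) m1 m2 (erefl _); rewrite B0 mul0r addr0.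
Qed.

End Asymptotics.

Lemma expansion_remainder (R : realType) m n (w : 'rV[Cplx R]_m) (a b : 'I_n -> Cplx R)
    (u v : 'I_n -> 'rV[Cplx R]_m) (al be : 'rV[Cplx R]_n) :
  w = \sum_i a i *: u i - \sum_i b i *: v i ->
  (forall i, al 0 i = a i) -> (forall i, be 0 i = - b i) ->
  w + -1 *: (\sum_i al 0 i *: u i) + -1 *: (\sum_i be 0 i *: v i) = 0.
Proof.
move=> -> ea eb; rewrite !scaleN1r -addrA -opprD.
have -> : \sum_i al 0 i *: u i = \sum_i a i *: u i by apply: eq_bigr => i _; rewrite ea.
have -> : \sum_i be 0 i *: v i = \sum_i - b i *: v i by apply: eq_bigr => i _; rewrite eb.
exact: expansion_sub.
Qed.

Section Vanishing.
Variable R : realType.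
Local Notation C := (Cplx R).
Variables (n : nat) (N : frob_data C (n.+1 * 2)) (V : 'M[C]_(n.+1 * 2)).
Hypothesis hN : is_frobenius N.
Hypothesis hV : forall t, fm_dom N t -> fm_V N t = V.
Variables (D0 : set 'cV[C]_(n.+1 * 2)) (X Y : 'I_n.+1 -> 'cV[C]_(n.+1 * 2) -> C).
Hypotheses (oX : forall a, odd_period N D0 (X a)) (oY : forall a, odd_period N D0 (Y a)).
Hypothesis can : canonically_conjugate N D0 X Y.

Lemma canonical_remainder D w c : open D -> D `<=` D0 -> odd_period N D w -> D c ->
  exists al be : 'rV[C]_n.+1,
  let f p := w p + -1 * (\sum_a al 0 a * X a p + 0) + 0 in
  let g p := f p + -1 * (\sum_a be 0 a * Y a p + 0) + 0 in
  odd_period N D g /\ grad g c = 0.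
Proof.
move=> oD DD ow Dc; have Ds : D `<=` fm_star N by have [_ ? _ _] := ow.
pose al := \row_a poisson N w (Y a) c; pose be := \row_a - poisson N w (X a) c.
have [p1 q1] := odd_period_sum hN hV (index_enum 'I_n.+1) (fun a => al 0 a) 0 oD Ds (fun a => odd_period_sub oD DD (oX a)).
have [p2 q2] := odd_period_comb hN hV (-1) 0 ow p1.
have [p3 q3] := odd_period_sum hN hV (index_enum 'I_n.+1) (fun a => be 0 a) 0 oD Ds (fun a => odd_period_sub oD DD (oY a)).
have [p4 q4] := odd_period_comb hN hV (-1) 0 p2 p3.
exists al, be; split; first exact p4.
apply: (etrans (q4 _ Dc)); rewrite (q2 _ Dc) (q1 _ Dc) (q3 _ Dc).
apply: expansion_remainder (canonical_expansion hN hV oX can w (DD _ Dc)) _ _ => a.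
  by rewrite mxE.
by rewrite mxE.
Qed.

End Vanishing.

Section Uniqueness.
Variable R : realType.
Local Notation C := (Cplx R).
Variables (n : nat) (M : frob_data C n.+1) (mu : 'I_n.+1 -> C) (N : frob_data C (n.+1 * 2)).
Variables (W : set 'cV[C]_n.+1) (x : 'cV[C]_n.+1 -> 'cV[C]_n.+1) (G : 'M[C]_n.+1).
Hypotheses (hM : is_frobenius M) (hmu : normalized_diag M mu) (hN : tensor_qh M mu N).
Hypothesis hx : flat_coordinates M W x G.
Local Notation hNf := (tensor_frob hN).
Local Notation hVN := (hVN hN).

(** Differentiation removes the constant, and the Jacobian of [x] is invertible. *)
Lemma row_x_eq0 (r : 'rV[C]_n.+1) (k : 'M[C]_1) t : W t ->
  (\forall p \near t, r *m x p + k = 0) -> r = 0.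
Proof.
move=> Wt h0; have uJ := J_unit hx Wt.
have h1 := hasDD (hasD_mulmx (hasD_cst r t) (x_hasD hx Wt)) (hasD_cst k t).
have h2 : hasD (fun p => r *m x p + k) t (fun=> 0).
  by apply: (hasD_ext (f := fun=> 0)); [apply: filterS h0 => p ->|exact: hasD_cst].
have e (u : 'cV[C]_n.+1) : r *m (jac x t *m u) = 0.
  by have := hasD_derive h1 u; rewrite (hasD_derive h2 u) mul0mx add0r addr0.
apply/matrixP => i j; rewrite ord1.
have := e (invmx (jac x t) *m del C j); rewrite mulKVmx // /del -colE => /matrixP /(_ 0 0).
by rewrite !mxE.
Qed.

Variable F : 'cV[C]_n.+1 -> C.
Hypothesis hF : dual_potential M W x G F.

(* Expanding w in the canonical basis gives w = A(t) + B(t) s + o(1) with A and B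
   affine in x(t) and in the gradient of F, and s is unbounded. *)
Lemma odd_vanishing D w : odd_period N D w -> near_Q0 W (fun t s => D (cross t s)) ->
  cross_littleo1 W w (fun _ _ => 0) ->
  near_Q0 W (fun t s => \forall p \near cross t s, w p = 0).
Proof.
move=> ow hD w0; have oW := flat_open hx.
have [D0 [X [Y [ps can]]]] := period_system_exists hM hmu hN hx hF.
have oX a : odd_period N D0 (X a) := (ps_basis ps).1 (inl a).
have oY a : odd_period N D0 (Y a) := (ps_basis ps).1 (inr a).
move=> t1 Wt1; have [r1 h1] := near_Q0_and hD (ps_dom ps) Wt1.
have [d d0 hd] := (nbhs_nmP t1 _).1 (filterI h1 (open_near oW Wt1)).
pose D' := D `&` D0; have oD' : open D'.
  by apply: openI; [have [] := ow|have [] := oX ord0].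
have DD : D' `<=` D by move=> p [].
have DD0 : D' `<=` D0 by move=> p [].
have reg t s : nm (t - t1) < d -> cRe s < r1 -> D' (cross t s) by move=> /hd[h _] /h[].
have Wd t : nm (t - t1) < d -> W t by move=> /hd[].
have t1d : nm (t1 - t1) < d by rewrite subrr nm0.
pose s1 : C := creal (r1 - 1); have hs1 : cRe s1 < r1 by rewrite cRe_realpart ltrBlDr ltrDl.
have Dc := reg _ _ t1d hs1.
have ow' := odd_period_sub oD' DD ow.
have [al [be [og gc]]] := canonical_remainder hNf hVN oX oY can oD' DD0 ow' Dc.
set g := (fun p => _) in og gc.
have gE t s : nm (t - t1) < d -> cRe s < r1 ->
    grad g (cross t s) = 0 /\ g (cross t s) = g (cross t1 s1).
  move=> ht hs; have sg : segment_in D' (cross t1 s1) (cross t s).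
    by move=> u u01; rewrite -cross_line; apply: reg; [exact: segment_ball|exact: cRe_convex].
  exact (odd_segment_unique hNf hVN oX oY can DD0 og sg gc).
set gam := g (cross t1 s1) in gE.
have lg := littleo_comb (-1) 0 (littleo_comb (-1) 0 w0
    (littleo_sum (index_enum 'I_n.+1) (fun a => al 0 a) 0 (fun a => bigO_littleo (ps_X ps a))))
    (littleo_sum (index_enum 'I_n.+1) (fun a => be 0 a) 0 (ps_Y ps)).
have lim t : nm (t - t1) < d -> gam + (\sum_a al 0 a * x t a 0 -
    2 * \sum_a be 0 a * 'D_(del C a) F (x t)) = 0 /\ \sum_a be 0 a * (invmx G *m x t) a 0 = 0.
  move=> ht; apply: (affine_limit0 (rho0 := r1)) => eps e0.
  have [r hr] := littleo_at (Wd _ ht) lg e0; exists r => s ss sr si.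
  apply: le_trans (hr s ss si); rewrite -/(g (cross t s)) (gE t s ht sr).2.
  rewrite le_eqVlt; apply/orP; left; apply/eqP; congr nm.
  have -> : \sum_a be 0 a * ((invmx G *m x t) a 0 * s - 2 * 'D_(del C a) F (x t)) =
      (\sum_a be 0 a * (invmx G *m x t) a 0) * s - 2 * \sum_a be 0 a * 'D_(del C a) F (x t).
    by rewrite mulr_suml mulr_sumr -sumrB; apply: eq_bigr => a _; ring.
  ring.
have ball : \forall t \near t1, nm (t - t1) < d by apply/nbhs_nmP; exists d.
have mulE (rv : 'rV[C]_n.+1) (yv : 'cV[C]_n.+1) :
    rv *m yv = (\sum_a rv 0 a * yv a 0)%:M.
  by apply/matrixP => i j; rewrite !ord1 !mxE eqxx mulr1n.
(* The order matters: the coefficient of [s] kills [be]; only then do the derivatives of [F] drop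
   out of the constant term, which gives [al = 0] and finally [gam = 0]. *)
have be0 : be = 0.
  have uG := G_unit hM hx.
  have e : be *m invmx G = 0.
    apply: (row_x_eq0 (k := 0) Wt1); apply: filterS ball => t /lim[_ e].
    by rewrite -mulmxA mulE e addr0 raddf0.
  by rewrite -[be](mulmxKV uG) e mul0mx.
have sb t : \sum_a be 0 a * 'D_(del C a) F (x t) = 0.
  by rewrite big1 // => a _; rewrite be0 mxE mul0r.
have al0 : al = 0.
  apply: (row_x_eq0 (k := gam%:M) Wt1); apply: filterS ball => t /lim[e _].
  rewrite mulE -raddfD /= addrC; move: e; rewrite sb mulr0 subr0 => ->.
  by rewrite raddf0.
have gam0 : gam = 0.
  have [e _] := lim _ t1d; move: e; rewrite sb mulr0 subr0 big1 ?addr0 //.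
  by move=> a _; rewrite al0 mxE mul0r.
have gw : g = w.
  apply/funext => p; rewrite /g !big1 ?addr0 ?mulr0 ?addr0 //.
  - by move=> a _; rewrite be0 mxE mul0r.
  - by move=> a _; rewrite al0 mxE mul0r.
exists r1; apply: filterS ball => t ht s hs.
have [gr ge] := gE t s ht hs; rewrite gw in gr; rewrite gw gam0 in ge.
have /nbhs_nmP[e e0 he] := open_near oD' (reg _ _ ht hs).
apply/nbhs_nmP; exists e; first exact e0.
move=> q hq; have sg : segment_in D' (cross t s) q.
  by move=> u u01; apply: he; apply: segment_ball => //; rewrite subrr nm0.
exact (etrans (odd_segment_unique hNf hVN oX oY can DD0 ow' sg gr).2 ge).
Qed.

Theorem period_system_unique F' (D D' : set 'cV[C]_(n.+1 * 2))
    (X Y X' Y' : 'I_n.+1 -> 'cV[C]_(n.+1 * 2) -> C) :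
  dual_potential M W x G F' ->
  period_system N W x G F D X Y -> period_system N W x G F' D' X' Y' ->
  (forall a, eq_near_cross W (X' a) (X a)) /\
  exists q : 'cV[C]_n.+1 -> C, [/\ is_quadratic q,
    (forall y, (x @` W) y -> F' y = F y + q y) &
    forall a, eq_near_cross W (Y' a)
      (fun p => Y a p - 2 * 'D_(del C a) q (\col_b X b p))].
Proof.
move=> hF' ps ps'; have oW := flat_open hx.
have oX a : odd_period N D (X a) := (ps_basis ps).1 (inl a).
have oY a : odd_period N D (Y a) := (ps_basis ps).1 (inr a).
have oX' a : odd_period N D' (X' a) := (ps_basis ps').1 (inl a).
have oY' a : odd_period N D' (Y' a) := (ps_basis ps').1 (inr a).
(* The two systems live on different domains; the intersection still contains the points of the
   cross with [Q] small. *)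
pose E := D' `&` D; have oE : open E.
  by apply: openI; [have [] := oX' ord0|have [] := oX ord0].
have ED : E `<=` D by move=> p [].
have ED' : E `<=` D' by move=> p [].
have hE : near_Q0 W (fun t s => E (cross t s)) := near_Q0_and (ps_dom ps') (ps_dom ps).
have Es : E `<=` fm_star N by move=> p /ED; have [_ h _ _] := oX ord0; exact: h.
split=> [a|].
  have [ow _] := odd_period_comb hNf hVN (-1) 0 (odd_period_sub oE ED' (oX' a)) (odd_period_sub oE ED (oX a)).
  have := littleo_comb (-1) 0 (bigO_littleo (ps_X ps' a)) (bigO_littleo (ps_X ps a)).
  move=> /(littleo_ext oW (g' := fun _ _ => 0)) lw.
  apply: (near_Q0_sub _ (odd_vanishing ow hE (lw _))) => [t s|t s _]; last by ring.
  apply: filterS => p; rewrite addr0 mulN1r => /eqP; rewrite subr_eq0 => /eqP; exact: id.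
have [H [l [c [sH FE gE]]]] := dual_potential_unique hM hx hF hF'.
exists (quad H l c); split; first exact: quad_quadratic.
  by move=> y [t Wt <-]; exact: FE.
move=> a.
have [ow1 _] := odd_period_comb hNf hVN (-1) 0 (odd_period_sub oE ED' (oY' a)) (odd_period_sub oE ED (oY a)).
(* The gradient of a quadratic polynomial is affine, so substituting [X] for [x] in it gives a
   constant combination of odd periods plus a constant, again an odd period. *)
have [ow2 _] := odd_period_sum hNf hVN (index_enum 'I_n.+1) (fun b => H a b) (l a 0) oE Es
  (fun b => odd_period_sub oE ED (oX b)).
have [ow _] := odd_period_comb hNf hVN 2 0 ow1 ow2.
have := littleo_comb 2 0 (littleo_comb (-1) 0 (ps_Y ps' a) (ps_Y ps a))
  (littleo_sum (index_enum 'I_n.+1) (fun b => H a b) (l a 0) (fun b => bigO_littleo (ps_X ps b))).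
move=> /(littleo_ext oW (g' := fun _ _ => 0)) lw.
apply: (near_Q0_sub _ (odd_vanishing ow hE (lw _))) => [t s|t s Wt].
  apply: filterS => p; rewrite quad_derive //.
  have -> : \sum_b H a b * (\col_b0 X b0 p) b 0 = \sum_b H a b * X b p.
    by apply: eq_bigr => b _; rewrite mxE.
  move=> /eqP; rewrite !addr0 mulN1r -addrA addr_eq0 => /eqP ->; ring.
have := congr1 (fun v : 'cV[C]_n.+1 => v a 0) (gE t Wt); rewrite /= !mxE => ->.
ring.
Qed.

End Uniqueness.

Theorem theorem16 (R : realType) (n : nat)
    (M : frob_data (Cplx R) n.+1) (mu : 'I_n.+1 -> Cplx R)
    (N : frob_data (Cplx R) (n.+1 * 2))
    (W : set 'cV[Cplx R]_n.+1) (x : 'cV[Cplx R]_n.+1 -> 'cV[Cplx R]_n.+1)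
    (G : 'M[Cplx R]_n.+1)
    (hM : is_frobenius M) (hmu : normalized_diag M mu)
    (hN : tensor_qh M mu N) (hx : flat_coordinates M W x G) :
  (forall F : 'cV[Cplx R]_n.+1 -> Cplx R, dual_potential M W x G F ->
     exists (D : set 'cV[Cplx R]_(n.+1 * 2))
            (X Y : 'I_n.+1 -> 'cV[Cplx R]_(n.+1 * 2) -> Cplx R),
       period_system N W x G F D X Y /\ canonically_conjugate N D X Y) /\
  (forall (F F' : 'cV[Cplx R]_n.+1 -> Cplx R)
     (D D' : set 'cV[Cplx R]_(n.+1 * 2))
     (X Y X' Y' : 'I_n.+1 -> 'cV[Cplx R]_(n.+1 * 2) -> Cplx R),
     dual_potential M W x G F -> dual_potential M W x G F' ->
     period_system N W x G F D X Y -> period_system N W x G F' D' X' Y' ->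
     (forall a, eq_near_cross W (X' a) (X a)) /\
     exists q : 'cV[Cplx R]_n.+1 -> Cplx R,
       [/\ is_quadratic q,
           (forall y, (x @` W) y -> F' y = F y + q y)
         & forall a, eq_near_cross W (Y' a)
             (fun p => Y a p - 2 * 'D_(del (Cplx R) a) q (\col_b X b p))]).
Proof.
split=> [F hF|F F' D D' X Y X' Y' hF hF' ps ps'].
  exact (period_system_exists hM hmu hN hx hF).
exact (period_system_unique hM hmu hN hx hF hF' ps ps').
Qed.
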